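(* Let $N\ge 3$, let $\Omega\subset\mathbb{R}^N$ be a bounded open set, let $B>0$, $p>0$, and let $b:\Omega\to\mathbb{R}$ be measurable with $\alpha\le b(x)\le\beta$ for a.e. $x\in\Omega$, for some constants $\alpha,\beta>0$. Let $0<\theta<1$. Assume that $f$ is a positive function belonging to $L^m(\Omega)$, where $m\ge 1$ and $\frac{N}{2N-\theta(N-1)}<m<\frac{2N}{2N-\theta(N-2)}$, and set $\sigma=\frac{mN(2-\theta)}{N-\theta m}$. Then there exists a function $u\in W^{1,\sigma}_0(\Omega)$, strictly positive on $\Omega$, such that $\frac{|\nabla u|^2}{u^\theta}\in L^1(\Omega)$ and $$\int_\Omega \frac{b(x)}{(1+u)^p}\nabla u\cdot\nabla\varphi + B\int_\Omega \frac{|\nabla u|^2}{u^\theta}\varphi=\int_\Omega f\varphi$$ for every $\varphi\in C^1_0(\Omega)$.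
   Context: ''$f$ positive'' means $f>0$ a.e. in $\Omega$; ''$u$ strictly positive on $\Omega$'' means $u>0$ a.e. in $\Omega$. $C^1_0(\Omega)$ denotes the $C^1$ functions with compact support in $\Omega$. *)

(* Defs.v *)
From HB Require Import structures.
From mathcomp Require Import all_boot all_order all_algebra.
From mathcomp Require Import all_classical all_reals all_analysis.
Import Order.TTheory GRing.Theory Num.Theory.
Import numFieldNormedType.Exports.

Set Implicit Arguments.
Unset Strict Implicit.
Unset Printing Implicit Defensive.

Local Open Scope classical_set_scope.
Local Open Scope ring_scope.

Section product_measure_tuple.
Context {R : realType}.
Local Notation mR := (measurableTypeR R).

Definition tuple_cons n (p : mR * n.-tuple mR) : n.+1.-tuple mR :=
  [tuple of p.1 :: p.2].

Definition tuple_uncons n (t : n.+1.-tuple mR) : mR * n.-tuple mR :=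
  (thead t, [tuple of behead t]).

Lemma measurable_tuple_cons n : measurable_fun setT (@tuple_cons n).
Proof. exact: measurable_cons. Qed.

Lemma measurable_tuple_uncons n : measurable_fun setT (@tuple_uncons n).
Proof.
apply/measurable_fun_pair => /=; first exact: measurable_tnth.
exact: measurable_behead.
Qed.

Lemma tuple_consK n : cancel (@tuple_cons n) (@tuple_uncons n).
Proof. by case=> x t; congr pair; apply/val_inj. Qed.

Section cons_measure.
Variables (n : nat) (m : {sigma_finite_measure set (n.-tuple mR) -> \bar R}).

Definition cons_measure : set (n.+1.-tuple mR) -> \bar R :=
  pushforward (@lebesgue_measure R \x m)%E (@tuple_cons n).

Let cons_measure0 : cons_measure set0 = 0%E.
Proof. by rewrite /cons_measure /pushforward preimage_set0 measure0. Qed.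

Let cons_measure_ge0 A : (0 <= cons_measure A)%E.
Proof. exact: (@measure_ge0 _ _ _ (@lebesgue_measure R \x m)%E). Qed.

Let cons_measure_sigma_additive : semi_sigma_additive cons_measure.
Proof.
have mc := @measurable_tuple_cons n.
exact: measure_semi_sigma_additive.
Qed.

HB.instance Definition _ := isMeasure.Build _ _ _ cons_measure
  cons_measure0 cons_measure_ge0 cons_measure_sigma_additive.

Let cons_measure_sigma_finite : sigma_finite setT cons_measure.
Proof.
have /sigma_finiteP[F [FT ndF Foo]] := sigma_finiteT (@lebesgue_measure R).
have /sigma_finiteP[G [GT ndG Goo]] := sigma_finiteT m.
exists (fun k => @tuple_uncons n @^-1` (F k `*` G k)).
  rewrite -preimage_bigcup (_ : \bigcup_k _ = setT) ?preimage_setT//.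
  apply/seteqP; split=> // -[x t] _.
  have [i _ Fix] : (\bigcup_k F k) x by rewrite -FT.
  have [j _ Gjt] : (\bigcup_k G k) t by rewrite -GT.
  exists (maxn i j) => //; split.
    by move: x Fix; exact/subsetPset/ndF/leq_maxl.
  by move: t Gjt; exact/subsetPset/ndG/leq_maxr.
move=> k; have [mFk Fkoo] := Foo k; have [mGk Gkoo] := Goo k; split.
  rewrite -[X in measurable X]setTI; apply: measurable_tuple_uncons => //.
  exact: measurableX.
rewrite /cons_measure /pushforward -comp_preimage.
rewrite (_ : _ \o _ = id); last by apply/funext => p; exact: tuple_consK.
by rewrite preimage_id product_measure1E// lte_mul_pinfty// ge0_fin_numE.
Qed.

HB.instance Definition _ :=
  Measure_isSigmaFinite.Build _ _ _ cons_measure cons_measure_sigma_finite.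

End cons_measure.

Fixpoint tuple_lebesgue n : {sigma_finite_measure set (n.-tuple mR) -> \bar R} :=
  match n with
  | 0 => \d_([tuple] : 0.-tuple mR)
  | n'.+1 => cons_measure (tuple_lebesgue n')
  end.

Lemma tuple_lebesgue_box n (A : 'I_n -> set mR) :
  (forall i, measurable (A i)) ->
  tuple_lebesgue n [set t | forall i, A i (tnth t i)] =
  (\prod_(i < n) lebesgue_measure (A i))%E.
Proof.
elim: n A => [|n IH] A mA /=.
  rewrite big_ord0 /dirac indicE (_ : _ \in _) //.
  by rewrite inE => -[].
rewrite big_ord_recl -(IH (fun i => A (lift ord0 i))) // -product_measure1E //.
  rewrite /cons_measure /pushforward; congr product_measure1.
  apply/seteqP; split => -[x t] /=.
    move=> h; split; first by have := h ord0.
    by move=> i; have := h (lift ord0 i); rewrite tnthS.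
  move=> [Ax At] i; case: (unliftP ord0 i) => [j ->|->] //.
  by rewrite tnthS; exact: At.
rewrite (_ : mkset _ = \bigcap_(i in [set: 'I_n])
    ((fun t => tnth t i) @^-1` A (lift ord0 i))).
  apply: fin_bigcap_measurable => // i _.
  by rewrite -[X in measurable X]setTI; exact: measurable_tnth.
by apply/seteqP; split => t h; [move=> i _; exact: h|move=> i; exact: h].
Qed.

End product_measure_tuple.

Definition rV_display : measure_display. Proof. exact. Qed.

(* 'rV[R]_N with the sigma-algebra generated by the coordinates, i.e., the
   Borel sigma-algebra. *)
Definition borel_rV (R : realType) (N : nat) : Type := 'rV[R]_N.

Section borel_rV.
Context {R : realType} {N : nat}.
Local Notation mR := (measurableTypeR R).

HB.instance Definition _ := Pointed.on (borel_rV R N).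

Let coords (i : 'I_N) (x : borel_rV R N) : mR := x ord0 i.

Let coords_set0 : g_sigma_preimage coords set0.
Proof. exact: sigma_algebra0. Qed.

Let coords_setC A : g_sigma_preimage coords A -> g_sigma_preimage coords (~` A).
Proof. exact: sigma_algebraC. Qed.

Let coords_bigcup (F : _^nat) : (forall i, g_sigma_preimage coords (F i)) ->
  g_sigma_preimage coords (\bigcup_i (F i)).
Proof. exact: sigma_algebra_bigcup. Qed.

HB.instance Definition _ := @isMeasurable.Build rV_display (borel_rV R N)
  (g_sigma_preimage coords) coords_set0 coords_setC coords_bigcup.

Definition row_of_tuple (t : N.-tuple mR) : borel_rV R N :=
  \row_i tnth t i.

Lemma measurable_row_of_tuple : measurable_fun setT row_of_tuple.
Proof.
move=> _ A mA; rewrite setTI.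
have : preimage_set_system setT row_of_tuple (g_sigma_preimage coords)
    (row_of_tuple @^-1` A).
  by exists A => //; rewrite setTI.
rewrite -g_sigma_preimage_comp.
suff -> : (fun i => coords i \o row_of_tuple) = fun i t => tnth t i by [].
by apply/funext => i; apply/funext => t; rewrite /coords/= mxE.
Qed.

Definition borel_lebesgue : set (borel_rV R N) -> \bar R :=
  pushforward (tuple_lebesgue N) row_of_tuple.

Let borel_lebesgue0 : borel_lebesgue set0 = 0%E.
Proof. by rewrite /borel_lebesgue /pushforward preimage_set0 measure0. Qed.

Let borel_lebesgue_ge0 A : (0 <= borel_lebesgue A)%E.
Proof. exact: (@measure_ge0 _ _ _ (tuple_lebesgue N)). Qed.

Let borel_lebesgue_sigma_additive : semi_sigma_additive borel_lebesgue.
Proof.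
have mr := measurable_row_of_tuple.
exact: measure_semi_sigma_additive.
Qed.

HB.instance Definition _ := isMeasure.Build _ _ _ borel_lebesgue
  borel_lebesgue0 borel_lebesgue_ge0 borel_lebesgue_sigma_additive.
End borel_rV.

(* 'rV[R]_N with the sigma-algebra of Lebesgue-measurable sets, which is the
   one carried by the completion [lebesgueN] of [borel_lebesgue]. *)
Definition lebesgue_rV (R : realType) (N : nat) : measurableType _ :=
  caratheodory_type ((@borel_lebesgue R N)^*)%mu.

Definition lebesgueN {R : realType} {N : nat} : set (lebesgue_rV R N) -> \bar R :=
  @completed_measure_extension _ (borel_rV R N) R borel_lebesgue.
HB.instance Definition _ R N := Measure.on (@lebesgueN R N).

Lemma lebesgueN_box (R : realType) (N : nat)
    (A : 'I_N -> set (measurableTypeR R)) :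
  (forall i, measurable (A i)) ->
  @lebesgueN R N [set x : 'rV[R]_N | forall i, A i (x ord0 i)] =
  (\prod_(i < N) lebesgue_measure (A i))%E.
Proof.
move=> mA; rewrite -tuple_lebesgue_box // /lebesgueN.
have mbox : measurable
    ([set x : 'rV[R]_N | forall i, A i (x ord0 i)] : set (borel_rV R N)).
  rewrite (_ : mkset _ = \bigcap_(i in [set: 'I_N])
      ((fun x : borel_rV R N => x ord0 i) @^-1` A i)); last first.
    by apply/seteqP; split => t h; [move=> i _; exact: h|move=> i; exact: h].
  apply: fin_bigcap_measurable => // i _.
  apply: sub_sigma_algebra; rewrite -bigcup_seq/=; exists i => /=.
    by rewrite mem_index_enum.
  by exists (A i) => //; rewrite setTI.
transitivity (@borel_lebesgue R N [set x : 'rV[R]_N | forall i, A i (x ord0 i)]).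
  exact: measurable_mu_extE.
rewrite /borel_lebesgue /pushforward; congr (tuple_lebesgue _ _).
by apply/seteqP; split => t h i; have := h i; rewrite /row_of_tuple mxE.
Qed.

Section sobolev.
Context {R : realType} {N : nat}.
Local Notation mu := (@lebesgueN R N).
Implicit Types (Omega : set 'rV[R]_N) (p : R) (u phi : 'rV[R]_N -> R)
  (g : 'rV[R]_N -> 'rV[R]_N).

Definition measurable_on Omega u : Prop :=
  measurable_fun (Omega : set (lebesgue_rV R N)) (u : lebesgue_rV R N -> R).

(* The norm of ['rV[R]_N] in the library is the sup norm, so the Euclidean one
   goes through this inner product. *)
Definition dotr (x y : 'rV[R]_N) : R := \sum_i x ord0 i * y ord0 i.

Definition partial (i : 'I_N) phi (x : 'rV[R]_N) : R :=
  'D_(delta_mx ord0 i) phi x.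

Definition grad phi (x : 'rV[R]_N) : 'rV[R]_N := \row_i partial i phi x.

(* Functions on Omega with compact support in Omega are represented by their
   extension by zero. *)
Definition C1c Omega phi : Prop :=
  [/\ forall x, differentiable phi x,
      forall i, continuous (partial i phi),
      compact (closure [set x | phi x != 0]) &
      closure [set x | phi x != 0] `<=` Omega].

Definition Lp_norm Omega p u : \bar R :=
  Lnorm mu p%:E (EFin \o (u \_ Omega : lebesgue_rV R N -> R)).

Definition in_Lp Omega p u : Prop :=
  (u \_ Omega : lebesgue_rV R N -> R) \in Lfun mu p%:E.

Definition weak_gradient Omega u g : Prop :=
  forall phi, C1c Omega phi -> forall i,
    \int[mu]_(x in Omega) (u x * partial i phi x) =
    - \int[mu]_(x in Omega) (g x ord0 i * phi x).

(* [W1p Omega p u g]: u is in W^{1,p}(Omega) and g is its weak gradient. *)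
Definition W1p Omega p u g : Prop :=
  [/\ in_Lp Omega p u, forall i, in_Lp Omega p (fun x => g x ord0 i) &
      weak_gradient Omega u g].

Definition W1p_norm Omega p u g : \bar R :=
  (Lp_norm Omega p u + \sum_i Lp_norm Omega p (fun x => g x ord0 i))%E.

(* W^{1,p}_0(Omega) is the closure of C^1_0(Omega) in W^{1,p}(Omega). *)
Definition W1p0 Omega p u g : Prop :=
  W1p Omega p u g /\
  forall e : R, 0 < e -> exists2 phi, C1c Omega phi &
    (W1p_norm Omega p (fun x => u x - phi x)%R
                      (fun x => g x - grad phi x)%R < e%:E)%E.

End sobolev.

(* Main.v *)
From HB Require Import structures.
Require Import Defs.
From mathcomp Require Import all_boot all_order all_algebra.
From mathcomp Require Import all_classical all_reals all_analysis measurable_realfun.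
From mathcomp Require Import ring lra.
Import Order.TTheory GRing.Theory Num.Theory.
Import numFieldNormedType.Exports.

(** With H(s) the primitive of (1 + s)^-p and v = H(u) the equation becomes
    - div(b grad v) + B G(v) |grad v|^2 = f, where G(H(s)) = (1 + s)^(2p) s^-theta
    is singular at 0.  Replace G by bounded Lipschitz functions G_n increasing to G,
    |grad v| by min(|grad v|, n) and f by min(f, k).  Adding lambda v with lambda
    large makes the problem a contraction in the closure of the test functions; a
    comparison principle, obtained with the test sqrt(1 + (t^+)^2) - 1 of the
    difference of two solutions, allows to remove lambda by a monotone iteration.
    The minimal solutions are monotone in n and in k, hence a diagonal sequence v_n
    converges a.e. to some v, and the test eta atan((v_n - v_m) / eta) shows that
    the gradients converge in measure.

    In the limit, Fatou's lemma with the test function phi cut off where u is large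
    gives one inequality; with the additional weight exp(- primitive of C t^-theta)
    evaluated at v_n, which makes the quadratic term nonnegative on the other side,
    it gives the converse one and, f being positive, v > 0.  Testing with
    (1 + u)^gamma and Sobolev's inequality for (1 + u)^((2 - theta + gamma) / 2)
    bound u in L^s and |grad u|^2 u^-theta (1 + u)^gamma in L^1, hence grad u in
    L^sigma by Young's inequality.  Sobolev's inequality comes from Gagliardo's
    induction on the dimension. *)

Set Implicit Arguments.
Unset Strict Implicit.
Unset Printing Implicit Defensive.

Local Open Scope classical_set_scope.
Local Open Scope ring_scope.

(** * Integration *)

(** The coefficient (1 + u)^-p loses its coercivity where u is large; after the change of unknown
    the principal part is uniformly elliptic. The price is that v must stay below H(+oo), which is
    finite when p > 1. Until u is known to be finite almost everywhere, each passage to the limit is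
    therefore cut off where u is large, and the derivative of the cut-off has to be controlled.

    The finiteness of u and the bounds on its gradient rest on the lower order term: its weight
    u^-theta controls the gradients of powers of 1 + u.

    The datum is only in L^m, possibly with m = 1, so v is not known to have finite energy. The
    first bounds, which use nothing but the mass of f, concern log(1 + v), and only truncations are
    shown to lie in the energy space.

    As theta < 1, t^-theta is integrable at 0; the exponential weight is thus positive, and equal to
    1 where v = 0.

    The number gamma is such that Hoelder's inequality for f (1 + u)^gamma brings back exactly the
    norm of u that Sobolev's inequality bounds, to a power less than 1. *)

Lemma cvg_epsP (R : realType) (u : nat -> R) (l : R) :
  u n @[n --> \oo] --> l <->
  forall e : R, 0 < e -> exists N, forall n, (N <= n)%N -> `|u n - l| <= e.
Proof.
split=> [/cvgrPdist_le h e e0|h].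
  by have [N _ hN] := h e e0; exists N => n Nn; rewrite distrC; exact: hN.
apply/cvgrPdist_le => e e0; have [N hN] := h e e0.
by exists N => // n /= Nn; rewrite distrC; exact: hN.
Qed.

Lemma cvg_bigsum (R : realType) (J : Type) (s : seq J) (u : J -> nat -> R) (l : J -> R) :
  (forall j, u j n @[n --> \oo] --> l j) ->
  \sum_(j <- s) u j n @[n --> \oo] --> \sum_(j <- s) l j.
Proof.
move=> h; elim: s => [|j s ih].
  by rewrite big_nil; under eq_cvg do rewrite big_nil; exact: cvg_cst.
by rewrite big_cons; under eq_cvg do rewrite big_cons; exact: cvgD.
Qed.

Section integrals.
Context {d : measure_display} {T : measurableType d} {R : realType}.
Variable nu : {measure set T -> \bar R}.
Implicit Types f g h : T -> R.

Definition measf f := measurable_fun setT f.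
Definition L1 f := nu.-integrable setT (EFin \o f).
Fact I_key : unit. Proof. exact: tt. Qed.
(** The integral is locked so that comparing two integrands never unfolds the Lebesgue integral. *)
Definition I f : R := locked_with I_key (\int[nu]_x f x).
Definition aE (P : T -> Prop) := {ae nu, forall x, P x}.

Lemma IE f : I f = \int[nu]_x f x.
Proof. by rewrite /I unlock. Qed.

Lemma aE_all (P : T -> Prop) : (forall x, P x) -> aE P.
Proof. by move=> h; apply: aeW. Qed.

Lemma aE_mp (P Q : T -> Prop) : aE P -> (forall x, P x -> Q x) -> aE Q.
Proof. by rewrite /aE => h hPQ; apply: filterS h => x; exact: hPQ. Qed.

Lemma aE_mp2 (P Q S : T -> Prop) :
  aE P -> aE Q -> (forall x, P x -> Q x -> S x) -> aE S.
Proof. by rewrite /aE => h k hPQ; apply: filterS2 h k => x; exact: hPQ. Qed.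

Lemma aE_mp3 (P Q S U : T -> Prop) :
  aE P -> aE Q -> aE S -> (forall x, P x -> Q x -> S x -> U x) -> aE U.
Proof. by rewrite /aE => h k l hPQ; apply: filterS3 h k l => x; exact: hPQ. Qed.

Lemma aE_nat (P : nat -> T -> Prop) :
  (forall n, aE (P n)) -> aE (fun x => forall n, P n x).
Proof. by move=> h; exact: ae_foralln. Qed.

Lemma aE_fin (J : finType) (P : J -> T -> Prop) :
  (forall n, aE (P n)) -> aE (fun x => forall n, P n x).
Proof.
move=> h.
have : aE (fun x => forall n, n \in enum J -> P n x).
  elim: (enum J) => [|j s ih]; first exact: aE_all.
  apply: (aE_mp2 (h j) ih) => x hj hs n; rewrite inE => /orP[/eqP->//|]; exact: hs.
by move=> k; apply: (aE_mp k) => x hx n; apply: hx; rewrite mem_enum.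
Qed.

Lemma L1_mf f : L1 f -> measf f.
Proof. by move=> /measurable_int/measurable_EFinP. Qed.

Lemma mfD f g : measf f -> measf g -> measf (fun x => f x + g x).
Proof. exact: measurable_funD. Qed.

Lemma mfB f g : measf f -> measf g -> measf (fun x => f x - g x).
Proof. exact: measurable_funB. Qed.

Lemma mfM f g : measf f -> measf g -> measf (fun x => f x * g x).
Proof. exact: measurable_funM. Qed.

Lemma mf_cst (c : R) : measf (fun=> c).
Proof. exact: measurable_cst. Qed.

Lemma mfX f n : measf f -> measf (fun x => f x ^+ n).
Proof. exact: measurable_funX. Qed.

Lemma mf_norm f : measf f -> measf (fun x => `|f x|).
Proof. by move=> mf; apply: measurableT_comp => //; exact: normr_measurable. Qed.

Lemma mf_cont (k : R -> R) f : continuous k -> measf f -> measf (fun x => k (f x)).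
Proof.
by move=> ck mf; apply: measurableT_comp => //; exact: continuous_measurable_fun.
Qed.

Lemma mf_min f g : measf f -> measf g -> measf (fun x => Num.min (f x) (g x)).
Proof. exact: measurable_minr. Qed.

Lemma mf_max f g : measf f -> measf g -> measf (fun x => Num.max (f x) (g x)).
Proof. exact: measurable_maxr. Qed.

Lemma mf_sum (J : Type) (s : seq J) (F : J -> T -> R) :
  (forall j, measf (F j)) -> measf (fun x => \sum_(j <- s) F j x).
Proof.
move=> h; elim: s => [|j s ih].
  by under [X in measf X]eq_fun do rewrite big_nil; exact: mf_cst.
by under [X in measf X]eq_fun do rewrite big_cons; exact: mfD.
Qed.

Lemma mf_ind (A : set T) : measurable A -> measf (\1_A : T -> R).
Proof. exact: measurable_indic. Qed.

Lemma mf_cvg (h : nat -> T -> R) f : (forall n, measf (h n)) ->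
  (forall x, h n x @[n --> \oo] --> f x) -> measf f.
Proof. by move=> mh hf; apply: (measurable_fun_cvg mh) => x _; exact: hf. Qed.

Lemma L1_dom f g : measf f -> L1 g -> (forall x, `|f x| <= g x) -> L1 f.
Proof.
move=> mf ig h; apply: (le_integrable measurableT _ _ ig).
  exact/measurable_EFinP.
by move=> x _ /=; rewrite lee_fin (le_trans (h x))// ler_norm.
Qed.

Lemma L1D f g : L1 f -> L1 g -> L1 (fun x => f x + g x).
Proof. by move=> hf hg; have := integrableD measurableT hf hg. Qed.

Lemma L1N f : L1 f -> L1 (fun x => - f x).
Proof. by move=> hf; have := integrableN hf. Qed.

Lemma L1B f g : L1 f -> L1 g -> L1 (fun x => f x - g x).
Proof. by move=> hf hg; have := integrableB measurableT hf hg. Qed.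

Lemma L1Z (c : R) f : L1 f -> L1 (fun x => c * f x).
Proof. by move=> hf; have := integrableZl measurableT c hf. Qed.

Lemma L1_norm f : L1 f -> L1 (fun x => `|f x|).
Proof. by move=> h; exact: integrable_norm. Qed.

Lemma L1_0 : L1 (fun=> 0).
Proof. exact: integrable0. Qed.

Lemma L1_sum (J : Type) (s : seq J) (F : J -> T -> R) :
  (forall j, L1 (F j)) -> L1 (fun x => \sum_(j <- s) F j x).
Proof.
move=> h; elim: s => [|j s ih].
  by under [X in L1 X]eq_fun do rewrite big_nil; exact: L1_0.
by under [X in L1 X]eq_fun do rewrite big_cons; exact: L1D.
Qed.

Lemma ID f g : L1 f -> L1 g -> I (fun x => f x + g x) = I f + I g.
Proof. by move=> *; rewrite !IE RintegralD. Qed.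

Lemma IB f g : L1 f -> L1 g -> I (fun x => f x - g x) = I f - I g.
Proof. by move=> *; rewrite !IE RintegralB. Qed.

Lemma IZ c f : L1 f -> I (fun x => c * f x) = c * I f.
Proof. by move=> *; rewrite !IE RintegralZl. Qed.

Lemma IN f : L1 f -> I (fun x => - f x) = - I f.
Proof.
move=> hf; have := IZ (-1) hf; rewrite mulN1r => <-.
by congr I; apply/funext => x; rewrite mulN1r.
Qed.

Lemma I_0 : I (fun=> 0) = 0.
Proof. by rewrite !IE Rintegral_cst// mul0r. Qed.

Lemma I_sum (J : Type) (s : seq J) (F : J -> T -> R) :
  (forall j, L1 (F j)) -> I (fun x => \sum_(j <- s) F j x) = \sum_(j <- s) I (F j).
Proof.
move=> h; elim: s => [|j s ih].
  by under [X in I X]eq_fun do rewrite big_nil; rewrite big_nil I_0.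
by under [X in I X]eq_fun do rewrite big_cons; rewrite ID ?ih ?big_cons//; exact: L1_sum.
Qed.

Lemma EI f : L1 f -> (\int[nu]_x (f x)%:E)%E = (I f)%:E.
Proof. by move=> hf; rewrite IE /Rintegral fineK//; exact: integrable_fin_num. Qed.

Lemma I_eq_ae f g : measf f -> measf g -> aE (fun x => f x = g x) -> I f = I g.
Proof.
move=> mf mg h; rewrite !IE /Rintegral; congr fine.
apply: ae_eq_integral => //; [exact/measurable_EFinP|exact/measurable_EFinP|].
by apply: (aE_mp h) => x /= -> .
Qed.

Lemma L1_eq_ae f g : measf g -> aE (fun x => f x = g x) -> L1 f -> L1 g.
Proof.
move=> mg h hf; have mf := L1_mf hf.
move/integrableP : (hf) => [_ fo]; apply/integrableP; split.
  exact/measurable_EFinP.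
rewrite (_ : integral _ _ _ = (\int[nu]_x `|(f x)%:E|)%E)//.
apply: ae_eq_integral => //.
- by apply: measurableT_comp => //; exact/measurable_EFinP.
- by apply: measurableT_comp => //; exact/measurable_EFinP.
- by apply: (aE_mp h) => x /= -> .
Qed.

Lemma I_le f g : L1 f -> L1 g -> (forall x, f x <= g x) -> I f <= I g.
Proof. by move=> hf hg h; rewrite !IE; apply: le_Rintegral. Qed.

Lemma I_le_ae f g : L1 f -> L1 g -> aE (fun x => f x <= g x) -> I f <= I g.
Proof.
move=> hf hg h.
have mm : measf (fun x => Num.min (f x) (g x)).
  by apply: mf_min; exact: L1_mf.
have e : aE (fun x => f x = Num.min (f x) (g x)).
  by apply: (aE_mp h) => x ?; rewrite min_l.
rewrite (I_eq_ae (L1_mf hf) mm e); apply: I_le => //.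
  exact: (L1_eq_ae mm e hf).
by move=> x; rewrite ge_min lexx orbT.
Qed.

Lemma I_ge0 f : (forall x, 0 <= f x) -> 0 <= I f.
Proof. by move=> h; rewrite IE; apply: Rintegral_ge0. Qed.

Lemma I_eq0 f : L1 f -> (forall x, 0 <= f x) -> I f <= 0 -> aE (fun x => f x = 0).
Proof.
move=> hf h0 hI.
have hI0 : I f = 0 by apply/eqP; rewrite eq_le hI I_ge0.
have := @ae_eq_integral_abs _ _ _ nu setT measurableT (EFin \o f) (measurable_int _ hf).
move=> [+ _].
have -> : (\int[nu]_x `|(EFin \o f) x| = 0)%E.
  under eq_integral => x _ do rewrite /= ger0_norm//.
  by rewrite EI// hI0.
by move=> /(_ erefl) h; apply: (aE_mp h) => x /= /(_ Logic.I)[].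
Qed.

Lemma norm_I f : L1 f -> `|I f| <= I (fun x => `|f x|).
Proof. by move=> h; rewrite !IE; exact: le_normr_Rintegral. Qed.

Lemma I_dct (fn : nat -> T -> R) f g : (forall n, measf (fn n)) -> measf f -> L1 g ->
  aE (fun x => fn n x @[n --> \oo] --> f x) ->
  (forall n, aE (fun x => `|fn n x| <= g x)) ->
  L1 f /\ I (fn n) @[n --> \oo] --> I f.
Proof.
move=> mfn mf hg hcv hb.
have [|||||h1 _ h2] := @dominated_convergence _ _ _ nu setT measurableT
   (fun n => EFin \o fn n) (EFin \o f) (EFin \o g).
- by move=> n; exact/measurable_EFinP/mfn.
- exact/measurable_EFinP.
- by apply: (aE_mp hcv) => x hx _; apply: cvg_EFin => //; exact: nearW.
- exact: hg.
- have /aE_nat h := hb; by apply: (aE_mp h) => x hx n _ /=; rewrite lee_fin; exact: hx.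
split => //.
have hn n : L1 (fn n).
  apply/integrableP; split; first exact/measurable_EFinP/mfn.
  have [_ gf] := integrableP _ _ _ hg.
  apply: le_lt_trans gf; apply: ae_ge0_le_integral => //.
  - by apply: measurableT_comp => //; exact/measurable_EFinP/mfn.
  - by apply: measurableT_comp => //; exact/measurable_EFinP/L1_mf.
  - by apply: (aE_mp (hb n)) => x h _ /=; rewrite lee_fin (le_trans h)// ler_norm.
rewrite IE; under eq_cvg do rewrite IE.
rewrite /Rintegral.
apply: (@fine_cvg _ _ _ _ (fun n => (\int[nu]_x (fn n x)%:E)%E)).
by rewrite fineK//; exact: integrable_fin_num.
Qed.

(** The bound on the right is a convergent sequence rather than a constant: in the applications a
    nonnegative term of a tested equation is bounded by terms that converge themselves. *)
Lemma I_fatou (fn : nat -> T -> R) f (c : nat -> R) C : (forall n, L1 (fn n)) -> measf f ->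
  (forall n x, 0 <= fn n x) -> (forall x, 0 <= f x) ->
  aE (fun x => fn n x @[n --> \oo] --> f x) ->
  (forall n, I (fn n) <= c n) -> c n @[n --> \oo] --> C ->
  L1 f /\ I f <= C.
Proof.
move=> hfn mf fn0 f0 hcv hI hC.
have hle : (\int[nu]_x (f x)%:E <= C%:E)%E.
  have -> : (\int[nu]_x (f x)%:E = \int[nu]_x limn_einf (fun n => (fn n x)%:E))%E.
    apply: ae_eq_integral => //; first exact/measurable_EFinP.
      rewrite (_ : (fun x => _) = (fun x => - limn_esup (fun n => - (fn n x)%:E)%E)%E).
        apply: measurableT_comp => //; apply: measurable_fun_limn_esup => n.
        by apply: measurableT_comp => //; exact/measurable_EFinP/L1_mf.
      by apply/funext => x; have := limn_esupN (fun n => (fn n x)%:E); rewrite /comp => ->; rewrite oppeK.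
    apply: (aE_mp hcv) => x hx _ /=.
    have e : (EFin \o fn ^~ x) n @[n --> \oo] --> (f x)%:E.
      by apply: cvg_EFin => //; exact: nearW.
    by rewrite is_cvg_limn_einfE; [exact/esym/cvg_lim|apply/cvg_ex; eexists; exact: e].
  apply: (le_trans (@fatou _ _ _ nu setT measurableT (fun n x => (fn n x)%:E) _ _)) => //.
  - move=> n; exact/measurable_EFinP/L1_mf.
  - by move=> n x _; rewrite lee_fin.
  have e : (c n)%:E @[n --> \oo] --> C%:E by apply: cvg_EFin => //; exact: nearW.
  rewrite limn_einf_lim -(cvg_lim _ e)//; apply: lee_lim.
  - exact: is_cvg_einfs.
  - by apply/cvg_ex; eexists; exact: e.
  - apply: nearW => n; apply: (@le_trans _ _ (\int[nu]_x (fn n x)%:E)%E).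
      by apply: ereal_inf_lbound; exists n => //=.
    by rewrite EI// lee_fin.
have hf : L1 f.
  apply/integrableP; split; first exact/measurable_EFinP.
  rewrite (_ : integral _ _ _ = (\int[nu]_x (f x)%:E)%E).
    by apply: le_lt_trans hle _; exact: ltry.
  by apply: eq_integral => x _ /=; rewrite ger0_norm.
by split=> //; rewrite -lee_fin -EI.
Qed.

Lemma aE_mf f g : (forall x, f x = g x) -> measf f -> measf g.
Proof. by move=> /funext ->. Qed.

Lemma L1_eq f g : (forall x, f x = g x) -> L1 f -> L1 g.
Proof. by move=> /funext ->. Qed.

Lemma I_eq f g : (forall x, f x = g x) -> I f = I g.
Proof. by move=> /funext ->. Qed.

Lemma L1_dom_ae f g : measf f -> L1 g -> aE (fun x => `|f x| <= g x) -> L1 f.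
Proof.
move=> mf ig h.
(* Dominated convergence for the constant sequence [f] yields integrability from a bound that holds
   only almost everywhere. *)
suff /I_dct : aE (fun x => (fun=> f x) n @[n --> \oo] --> f x) by move=> /(_ g (fun=> mf) mf ig (fun=> h))[].
by apply: aE_all => x; exact: cvg_cst.
Qed.

Definition L2 f := measf f /\ L1 (fun x => f x ^+ 2).

Lemma L2M f g : L2 f -> L2 g -> L1 (fun x => f x * g x).
Proof.
move=> [mf f2] [mg g2]; apply: (L1_dom _ (L1D f2 g2)); first exact: mfM.
by move=> x; rewrite normrM; have := sqr_ge0 (`|f x| - `|g x|);
  have := real_normK (num_real (f x)); have := real_normK (num_real (g x)); nra.
Qed.

Lemma L2Z c f : L2 f -> L2 (fun x => c * f x).
Proof.
move=> [mf f2]; split; first by apply: mfM => //; exact: mf_cst.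
by apply: L1_eq (L1Z (c ^+ 2) f2) => x; rewrite exprMn.
Qed.

Lemma L2D f g : L2 f -> L2 g -> L2 (fun x => f x + g x).
Proof.
move=> hf hg; split; first exact: mfD hf.1 hg.1.
apply: L1_eq (L1D (L1D hf.2 (L1Z 2 (L2M hf hg))) hg.2) => x.
by rewrite sqrrD mulr_natl.
Qed.

Lemma L2N f : L2 f -> L2 (fun x => - f x).
Proof. by move=> h; have := L2Z (-1) h; under [X in L2 X -> _]eq_fun do rewrite mulN1r. Qed.

Lemma L2B f g : L2 f -> L2 g -> L2 (fun x => f x - g x).
Proof. by move=> hf hg; apply: L2D => //; exact: L2N. Qed.

Lemma L2_dom f g : measf f -> L2 g -> (forall x, `|f x| <= `|g x|) -> L2 f.
Proof.
move=> mf [mg g2] h; split => //; apply: (L1_dom _ g2); first exact: mfX.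
move=> x; rewrite ger0_norm ?sqr_ge0//.
by rewrite -(real_normK (num_real (f x))) -(real_normK (num_real (g x))) lerXn2r// nnegrE.
Qed.

Lemma L2_bM (M : R) b f : measf b -> (forall x, `|b x| <= M) -> L2 f ->
  L2 (fun x => b x * f x).
Proof.
move=> mb hb hf; apply: (L2_dom _ (L2Z M hf)); first exact: mfM mb hf.1.
move=> x; rewrite !normrM ler_wpM2r// (le_trans (hb x))// ler_norm//.
Qed.

Lemma L1_bM (M : R) b f : measf b -> (forall x, `|b x| <= M) -> L1 f ->
  L1 (fun x => b x * f x).
Proof.
move=> mb hb hf; apply: (L1_dom _ (L1Z M (L1_norm hf))); first exact: mfM mb (L1_mf hf).
by move=> x; rewrite normrM ler_wpM2r// (le_trans (hb x))// ler_norm.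
Qed.

Lemma L2_0 : L2 (fun=> 0).
Proof.
by split; [exact: mf_cst|apply: L1_eq L1_0 => x; rewrite expr0n].
Qed.

Lemma L2_eq_ae f g : measf g -> aE (fun x => f x = g x) -> L2 f -> L2 g.
Proof.
move=> mg h [mf f2]; split => //; apply: (L1_eq_ae _ _ f2); first exact: mfX.
by apply: (aE_mp h) => x ->.
Qed.

Lemma I_young (t : R) f g : 0 < t -> L2 f -> L2 g ->
  I (fun x => f x * g x) <= t * I (fun x => f x ^+ 2) + t^-1 * I (fun x => g x ^+ 2).
Proof.
move=> t0 hf hg.
rewrite -(IZ _ hf.2) -(IZ _ hg.2) -ID ?(L1Z _ hf.2) ?(L1Z _ hg.2)//.
apply: I_le; first exact: L2M.
  by apply: L1D; apply: L1Z; [exact: hf.2|exact: hg.2].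
move=> x; set a := f x; set b := g x.
have ti0 : 0 < t^-1 by rewrite invr_gt0.
have e : t * t^-1 = 1 by rewrite divff ?gt_eqF.
have : 0 <= t^-1 * (t * a - b / 2) ^+ 2 by rewrite mulr_ge0 ?sqr_ge0 ?ltW.
have -> : t^-1 * (t * a - b / 2) ^+ 2 =
  (t * t^-1) * t * a ^+ 2 - (t * t^-1) * a * b + t^-1 * b ^+ 2 / 4 by field; rewrite gt_eqF.
rewrite e !mul1r => h; have := mulr_ge0 (ltW ti0) (sqr_ge0 b); nra.
Qed.

Lemma norm_I_young (t : R) f g : 0 < t -> L2 f -> L2 g ->
  `|I (fun x => f x * g x)| <= t * I (fun x => f x ^+ 2) + t^-1 * I (fun x => g x ^+ 2).
Proof.
move=> t0 hf hg; rewrite ler_norml I_young// andbT lerNl -IN; last exact: L2M.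
have := I_young t0 (L2N hf) hg.
by under [X in I X <= _ -> _]eq_fun do rewrite mulNr; under [X in _ * I X + _]eq_fun do rewrite sqrrN.
Qed.

Lemma I_sq_ge0 f : 0 <= I (fun x => f x ^+ 2).
Proof. by apply: I_ge0 => x; rewrite sqr_ge0. Qed.

Lemma cvg_L2M (h : nat -> T -> R) k : (forall n, L2 (h n)) -> L2 k ->
  I (fun x => h n x ^+ 2) @[n --> \oo] --> (0 : R) ->
  I (fun x => h n x * k x) @[n --> \oo] --> (0 : R).
Proof.
move=> hh hk hc; apply/cvg_epsP => e e0.
set K := I (fun x => k x ^+ 2); have K0 : 0 <= K by exact: I_sq_ge0.
(* With this [t] the fixed term of Young's inequality, t^-1 K, is at most e / 2; the other one tends
   to 0. *)
pose t := (2 * (K + 1)) / e.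
have t0 : 0 < t by rewrite divr_gt0// mulr_gt0//; lra.
have d0 : 0 < e / (2 * t) by rewrite divr_gt0// mulr_gt0.
have /cvg_epsP/(_ _ d0)[M hM] := hc; exists M => n /hM.
rewrite !subr0 ger0_norm ?I_sq_ge0// => hn.
apply: (le_trans (norm_I_young t0 (hh n) hk)).
have : t * I (fun x => h n x ^+ 2) <= e / 2.
  apply: (le_trans (ler_wpM2l (ltW t0) hn)).
  by rewrite le_eqVlt; apply/orP; left; apply/eqP; field; rewrite gt_eqF.
have : t^-1 * K <= e / 2.
  rewrite /t invf_div mulrAC ler_pdivrMr ?mulr_gt0//; last lra.
  by have -> : e / 2 * (2 * (K + 1)) = e * K + e; [by field|rewrite lerDl ltW].
rewrite -/K; lra.
Qed.

(* |h k| <= min(|h k|, k^2 / t) + t h^2; dominated convergence applies to the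
   minimum. *)
Lemma cvg_weak (h : nat -> T -> R) k C : (forall n, L2 (h n)) -> L2 k ->
  (forall n, I (fun x => h n x ^+ 2) <= C) ->
  aE (fun x => h n x @[n --> \oo] --> (0 : R)) ->
  I (fun x => h n x * k x) @[n --> \oo] --> (0 : R).
Proof.
move=> hh hk hC hc; apply/cvg_epsP => e e0.
pose t := e / (2 * (`|C| + 1)).
have C0 : 0 < `|C| + 1 by have := normr_ge0 C; lra.
have t0 : 0 < t by rewrite divr_gt0// mulr_gt0.
pose m n x := Num.min `|h n x * k x| (t^-1 * k x ^+ 2).
have mm n : measf (m n).
  apply: mf_min; first exact: mf_norm (mfM (hh n).1 hk.1).
  by apply: mfM; [exact: mf_cst|exact: mfX hk.1].
have m0 n x : 0 <= m n x by rewrite le_min normr_ge0 mulr_ge0 ?sqr_ge0// invr_ge0 ltW.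
have mk n x : `|m n x| <= t^-1 * k x ^+ 2 by rewrite ger0_norm// ge_min lexx orbT.
have Lk := L1Z t^-1 hk.2.
have mL n : L1 (m n) by exact: L1_dom (mm n) Lk (mk n).
have [_ cm] : L1 (fun=> 0 : R) /\ I (m n) @[n --> \oo] --> I (fun=> 0 : R).
  apply: (I_dct mm (mf_cst 0) Lk _ (fun n => aE_all (mk n))).
  apply: (aE_mp hc) => x hx.
  have h1 : `|h n x * k x| @[n --> \oo] --> (0 : R).
    rewrite -[X in _ --> X](normr0 R); apply: cvg_norm.
    by rewrite -(mul0r (k x)); apply: cvgM => //; exact: cvg_cst.
  by apply: (squeeze_cvgr _ (cvg_cst 0) h1); apply: nearW => n; rewrite m0 /m ge_min lexx.
rewrite I_0 in cm.
have e2 : 0 < e / 2 by lra.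
have /cvg_epsP/(_ _ e2)[M hM] := cm; exists M => n /hM.
rewrite !subr0 ger0_norm; last by apply: I_ge0 => x.
move=> hn.
apply: (le_trans (norm_I (L2M (hh n) hk))).
apply: (@le_trans _ _ (I (m n) + t * I (fun x => h n x ^+ 2))).
  rewrite -(IZ _ (hh n).2) -ID//; last exact: L1Z (hh n).2.
  apply: I_le; first exact: L1_norm (L2M (hh n) hk).
    by apply: L1D => //; exact: L1Z (hh n).2.
  move=> x; rewrite /m; case: (leP `|h n x * k x| (t^-1 * k x ^+ 2)) => hx.
    by have := mulr_ge0 (ltW t0) (sqr_ge0 (h n x)); lra.
  have k2 := sqr_ge0 (k x).
  have hk2 : `|h n x * k x| ^+ 2 = h n x ^+ 2 * k x ^+ 2.
    by rewrite real_normK ?num_real// exprMn.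
  set A := `|h n x * k x| in hx hk2 *.
  have A0 : 0 < A.
    by apply: le_lt_trans hx; rewrite mulr_ge0// invr_ge0 ltW.
  have : k x ^+ 2 < t * A.
    by rewrite -[ltRHS]mulrC -ltr_pdivrMr// mulrC.
  have h2 := sqr_ge0 (h n x).
  move=> kx.
  have : A * A <= h n x ^+ 2 * (t * A).
    by rewrite -expr2 hk2 ler_wpM2l// ltW.
  rewrite mulrA ler_pM2r// => ?.
  have : 0 <= t^-1 * k x ^+ 2 by rewrite mulr_ge0// invr_ge0 ltW.
  by rewrite mulrC; lra.
have : t * I (fun x => h n x ^+ 2) <= e / 2.
  apply: (@le_trans _ _ (t * (`|C| + 1))).
    apply: ler_wpM2l; first exact: ltW.
    by apply: (le_trans (hC n)); have := ler_norm C; lra.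
  by rewrite le_eqVlt; apply/orP; left; apply/eqP; rewrite /t; field; rewrite gt_eqF.
lra.
Qed.

(** [P] itself need not be measurable. A measurable set of full measure inside it can be used to
    multiply functions by its indicator, so that a limit holding almost everywhere becomes one
    holding everywhere and is measurable. *)
Lemma aE_set (P : T -> Prop) : aE P ->
  exists A : set T, [/\ measurable A, aE (fun x => A x) & forall x, A x -> P x].
Proof.
rewrite /aE => -[A [mA A0 hA]]; exists (~` A); split.
- exact: measurableC.
- by exists A; split => // x /=; rewrite notK.
- by move=> x Ax; apply: contrapT => nP; apply: Ax; exact: hA.
Qed.

(** By monotone convergence the supremum has integral at most [C], hence is finite almost
    everywhere. Applied to partial sums, this does the work of the Borel-Cantelli lemma; it also
    bounds monotone families of solutions. *)
Lemma mono_ae_bounded (g : nat -> T -> R) C : (forall n, L1 (g n)) ->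
  (forall n x, 0 <= g n x) -> (forall n x, g n x <= g n.+1 x) ->
  (forall n, I (g n) <= C) -> aE (fun x => exists b, forall n, g n x <= b).
Proof.
move=> hg g0 gnd gC.
have nd x : nondecreasing_seq (fun n => (g n x)%:E).
  by apply/nondecreasing_seqP => n; rewrite lee_fin.
have mg n : measurable_fun setT (EFin \o g n) by exact/measurable_EFinP/L1_mf.
pose E x := limn (fun n => (g n x)%:E).
have mE : measurable_fun setT E.
  apply: (@emeasurable_fun_cvg _ _ _ setT (fun n => EFin \o g n)) => // x _ /=.
  by apply: ereal_nondecreasing_is_cvgn; exact: nd.
have E0 x : (0 <= E x)%E.
  apply: lime_ge; first by apply: ereal_nondecreasing_is_cvgn; exact: nd.
  by apply: nearW => n; rewrite lee_fin.
have iE : (\int[nu]_x E x <= C%:E)%E.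
  rewrite /E (@monotone_convergence _ _ _ nu setT measurableT (fun n => EFin \o g n))//.
  - apply: lime_le.
      apply: ereal_nondecreasing_is_cvgn => m n mn; apply: ge0_le_integral => //.
      + by move=> x _; rewrite lee_fin.
      + by move=> x _; rewrite lee_fin -lee_fin; exact: nd.
    by apply: nearW => n; rewrite /comp EI// lee_fin.
  - by move=> n x _; rewrite lee_fin.
  - by move=> x _; exact: nd.
have /integrable_ae : nu.-integrable setT E.
  apply/integrableP; split => //.
  rewrite (_ : integral _ _ _ = (\int[nu]_x E x)%E).
    by apply: le_lt_trans iE _; exact: ltry.
  by apply: eq_integral => x _; rewrite gee0_abs.
move=> /(_ measurableT) h; apply: (aE_mp h) => x /(_ Logic.I) fx.
exists (fine (E x)) => n; rewrite -lee_fin fineK//.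
rewrite /E (cvg_lim _ (ereal_nondecreasing_cvgn (nd x)))//.
by apply: ereal_sup_ubound; exists n.
Qed.

End integrals.

Lemma cvg_geometric_increments (R : realType) (a : nat -> R) (C : R) :
  (forall n, `|a n.+1 - a n| <= C * 2^-1 ^+ n) -> exists l : R, a n @[n --> \oo] --> l.
Proof.
move=> ha.
have h1 : cvgn (series (telescope a)).
  apply: normed_cvg.
  apply: (@series_le_cvg _ _ (geometric C 2^-1)) => //.
  - by move=> n; rewrite /=.
  - by move=> n; rewrite /geometric /=; exact: le_trans (normr_ge0 _) (ha n).
  - apply: is_cvg_geometric_series; rewrite ger0_norm ?invr_ge0//.
    by rewrite invf_lt1// ltr1n.
exists (a 0%N + limn (series (telescope a))).
under eq_cvg do rewrite (eq_sum_telescope a).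
by apply: cvgD; [exact: cvg_cst|exact: h1].
Qed.

Lemma subseq_rate (N : nat -> nat) :
  exists s : nat -> nat, (forall n, (s n < s n.+1)%N) /\ (forall n, (N n <= s n)%N).
Proof.
pose s := fix s n := if n is m.+1 then maxn (s m).+1 (N m.+1) else N 0%N.
by exists s; split=> [n|[|n]] //=; [rewrite leq_maxl|rewrite leq_maxr].
Qed.

Lemma subseq_ge (s : nat -> nat) : (forall n, (s n < s n.+1)%N) -> forall n, (n <= s n)%N.
Proof. by move=> h; elim=> // n ih; exact: leq_ltn_trans (h n). Qed.

Lemma cvg_subseq (R : realType) (u : nat -> R) (l : R) (s : nat -> nat) :
  (forall n, (s n < s n.+1)%N) -> u n @[n --> \oo] --> l -> u (s n) @[n --> \oo] --> l.
Proof.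
move=> hs /cvg_epsP h; apply/cvg_epsP => e e0; have [N hN] := h e e0.
by exists N => n Nn; apply: hN; rewrite (leq_trans Nn)// subseq_ge.
Qed.

(** * Convergence in measure and completeness of L2 for a finite measure *)

Section completeness.
Context {d : measure_display} {T : measurableType d} {R : realType}.
Variable nu : {measure set T -> \bar R}.
Hypothesis nufin : (nu setT < +oo)%E.
Notation L1 := (L1 nu).
Notation L2 := (L2 nu).
Notation I := (I nu).
Notation aE := (aE nu).

Lemma L1_bdd (f : T -> R) M : measf f -> (forall x, `|f x| <= M) -> L1 f.
Proof.
move=> mf hM; apply: measurable_bounded_integrable => //.
exists M; split; first exact: num_real.
by move=> N MN x _; exact: le_trans (hM x) (ltW MN).
Qed.

Lemma L1_cst (c : R) : L1 (fun=> c).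
Proof. by apply: (@L1_bdd _ `|c|) => //; exact: mf_cst. Qed.

Lemma L2_bdd (f : T -> R) M : measf f -> (forall x, `|f x| <= M) -> L2 f.
Proof.
move=> mf hM; split => //; apply: (@L1_bdd _ (M ^+ 2)); first exact: mfX.
move=> x; rewrite normrX lerXn2r// nnegrE// (le_trans _ (hM x))//.
Qed.

Lemma L2_cst (c : R) : L2 (fun=> c).
Proof. by apply: (@L2_bdd _ `|c|) => //; exact: mf_cst. Qed.

Lemma L2_L1 (f : T -> R) : L2 f -> L1 f.
Proof.
by move=> hf; apply: L1_eq (L2M hf (L2_cst 1)) => x; rewrite mulr1.
Qed.

Section sub.
Context {J : finType}.
Variable h : nat -> J -> T -> R.
Hypothesis mh : forall n j, measf (h n j).
Let D n m x := \sum_j (h n j x - h m j x) ^+ 2.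

Let mD n m : measf (D n m).
Proof. by apply: mf_sum => j; apply: mfX; exact: mfB. Qed.

Let D0 n m x : 0 <= D n m x.
Proof. by apply: sumr_ge0 => j _; rewrite sqr_ge0. Qed.

(** Along the subsequence the truncated distances [w n] have integral at most 16^-n, so the sum of
    the 4^n w_n is integrable and w_n <= b 4^-n almost everywhere. As [w n] is a squared distance,
    the increments are of order 2^-n, which is summable. *)
Lemma cauchy_measure_subseq :
  (forall e : R, 0 < e -> exists N, forall n m, (N <= n)%N -> (N <= m)%N ->
     I (fun x => Num.min 1 (D n m x)) <= e) ->
  exists s : nat -> nat, (forall n, (s n < s n.+1)%N) /\
  exists l : J -> T -> R, (forall j, measf (l j)) /\
    aE (fun x => forall j, h (s n) j x @[n --> \oo] --> l j x).
Proof.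
move=> hc.
have e0 n : 0 < (16^-1 : R) ^+ n by rewrite exprn_gt0.
pose N n := projT1 (cid (hc _ (e0 n))).
have hN n := projT2 (cid (hc _ (e0 n))).
have [s [s1 s2]] := subseq_rate N; exists s; split => //.
pose w n x := Num.min 1 (D (s n.+1) (s n) x).
have mw n : measf (w n) by apply: mf_min => //; exact: mf_cst.
have w0 n x : 0 <= w n x by rewrite le_min ler01 D0.
have Lw n : L1 (w n).
  by apply: (@L1_bdd _ 1) => // x; rewrite ger0_norm// ge_min lexx.
have hw n : I (w n) <= 16^-1 ^+ n.
  by apply: (hN n); rewrite ?s2// (leq_trans (s2 n))// ltnW.
have iE M : iota 0 M.+1 = iota 0 M ++ [:: M] by rewrite -addn1 iotaD.
pose g M x := \sum_(n <- iota 0 M) 4 ^+ n * w n x.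
have bnd : aE (fun x => exists b, forall M, g M x <= b).
  apply: (@mono_ae_bounded _ _ _ _ g 2).
  - by move=> M; apply: L1_sum => n; exact: L1Z.
  - by move=> M x; apply: sumr_ge0 => n _; rewrite mulr_ge0// exprn_ge0.
  - by move=> M x; rewrite /g iE big_cat/= big_seq1 lerDl mulr_ge0// exprn_ge0.
  - move=> M; rewrite /g I_sum; last by move=> n; exact: L1Z.
    have key : \sum_(n <- iota 0 M) (4^-1 : R) ^+ n <= 2 - 4 / 3 * 4^-1 ^+ M.
      elim: M => [|M ih]; first by rewrite big_nil expr0; lra.
      rewrite iE big_cat/= big_seq1 exprS.
      have : 0 <= (4^-1 : R) ^+ M by rewrite exprn_ge0// invr_ge0.
      by move: ih; set A := (4^-1 : R) ^+ M; set B := \sum_(_ <- _) _; lra.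
    apply: (@le_trans _ _ (\sum_(n <- iota 0 M) (4^-1 : R) ^+ n)).
      apply: ler_sum => n _; rewrite IZ//.
      apply: (le_trans (ler_wpM2l _ (hw n))); first by rewrite exprn_ge0.
      by rewrite -exprMn lerXn2r ?nnegrE ?mulr_ge0 ?invr_ge0//; lra.
    by apply: (le_trans key); rewrite gerBl mulr_ge0// exprn_ge0// invr_ge0.
have cv : aE (fun x => forall j, exists l : R, h (s n) j x @[n --> \oo] --> l).
  apply: (aE_mp bnd) => x [b hb] j.
  have b0 : 0 <= b by apply: le_trans (hb 0%N); rewrite /g big_nil.
  have hw4 n : 4 ^+ n * w n x <= b.
    apply: le_trans (hb n.+1); rewrite /g iE big_cat/= big_seq1 lerDr.
    by apply: sumr_ge0 => m _; rewrite mulr_ge0// exprn_ge0.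
  (* Beyond [m0] the minimum with 1 is not attained at 1, so that [w n] is the squared distance
     itself. *)
  have [m0 hm0] : exists m0, forall n, (m0 <= n)%N -> w n x < 1.
    have [m0 hm0] : exists m0, b < 4 ^+ m0.
      exists (Num.bound b).
      have := archi_boundP b0; move/lt_le_trans; apply.
      by rewrite -natrX ler_nat; apply: ltnW; apply: ltn_expl.
    exists m0 => n m0n.
    have p4 : (0 : R) < 4 ^+ n by rewrite exprn_gt0.
    rewrite -(ltr_pM2l p4) mulr1; apply: le_lt_trans (hw4 n) _.
    by apply: (lt_le_trans hm0); rewrite ler_weXn2l// ler1n.
  have [l hl] : exists l : R, h (s (n + m0)%N) j x @[n --> \oo] --> l.
    apply: (@cvg_geometric_increments _ _ (b + 1)) => n.
    have wlt := hm0 (n + m0)%N (leq_addl _ _).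
    have wE : w (n + m0)%N x = D (s (n + m0).+1) (s (n + m0)%N) x.
      rewrite /w min_r// leNgt; apply/negP => h1.
      by move: wlt; rewrite /w min_l ?ltxx// ltW.
    have : (h (s (n + m0).+1) j x - h (s (n + m0)%N) j x) ^+ 2 <= w (n + m0)%N x.
      by rewrite wE /D (bigD1 j)//= lerDl sumr_ge0// => i _; rewrite sqr_ge0.
    rewrite addSn; set z := _ - _ => hz.
    have p2 : (0 : R) < 2^-1 ^+ n by rewrite exprn_gt0// invr_gt0.
    have hz2 : z ^+ 2 <= ((b + 1) * 2^-1 ^+ n) ^+ 2.
      apply: (le_trans hz).
      have p4 : (0 : R) < 4 ^+ (n + m0) by rewrite exprn_gt0.
      have : w (n + m0)%N x <= b / 4 ^+ (n + m0) by rewrite ler_pdivlMr// mulrC.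
      move/le_trans; apply.
      rewrite exprMn -exprM mulnC exprM exprVn.
      have -> : (2 ^+ 2 : R) = 4 by rewrite -natrX.
      rewrite -exprVn; apply: ler_pM => //.
      - by nra.
      - rewrite !exprVn lef_pV2 ?posrE ?exprn_gt0//.
        by rewrite ler_weXn2l ?ler1n// leq_addr.
    rewrite -(@ler_pXn2r _ 2)// ?nnegrE//; last by rewrite mulr_ge0 ?(ltW p2)//; lra.
    by rewrite real_normK ?num_real.
  by exists l; rewrite -(cvg_shiftn m0).
have [A [mA aA hA]] := aE_set cv.
(* Cut to [A], the sequence converges at every point, so the limit [l] is measurable as a pointwise
   limit. *)
pose hh n j x := \1_A x * h (s n) j x.
pose l j x := limn (fun n => hh n j x).
have hl j x : hh n j x @[n --> \oo] --> l j x.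
  have [Ax|nAx] := pselect (A x).
    have [y hy] := hA x Ax j.
    have c : hh n j x @[n --> \oo] --> y.
      rewrite (_ : (fun n => hh n j x) = (fun n => h (s n) j x))//.
      by apply/funext => n; rewrite /hh indicE mem_set// mul1r.
    by rewrite /l (cvg_lim _ c).
  have e : (fun n => hh n j x) = fun=> 0.
    by apply/funext => n; rewrite /hh indicE memNset// mul0r.
  by rewrite /l e lim_cst//; exact: cvg_cst.
exists l; split=> [j|].
  apply: (@mf_cvg _ _ _ (fun n => hh n j)) => // n.
  by apply: mfM => //; exact: mf_ind.
apply: (aE_mp aA) => x Ax j; have := hl j x.
rewrite (_ : (fun n => hh n j x) = (fun n => h (s n) j x))//.
by apply/funext => n; rewrite /hh indicE mem_set// mul1r.
Qed.

End sub.

(** The limit is taken along a subsequence converging almost everywhere; Fatou's lemma in the second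
    index of the Cauchy bound shows that the whole sequence converges to it in L2. *)
Lemma L2_complete (J : finType) (h : nat -> J -> T -> R) :
  (forall n j, L2 (h n j)) ->
  (forall e : R, 0 < e -> exists N, forall n m, (N <= n)%N -> (N <= m)%N ->
     I (fun x => \sum_j (h n j x - h m j x) ^+ 2) <= e) ->
  exists l : J -> T -> R, (forall j, L2 (l j)) /\
    I (fun x => \sum_j (h n j x - l j x) ^+ 2) @[n --> \oo] --> (0 : R).
Proof.
move=> hh hc.
have LD n m : L1 (fun x => \sum_j (h n j x - h m j x) ^+ 2).
  by apply: L1_sum => j; exact: (L2B (hh n j) (hh m j)).2.
have D0 n m x : 0 <= \sum_j (h n j x - h m j x) ^+ 2.
  by apply: sumr_ge0 => j _; rewrite sqr_ge0.
have [|s [hs [l [ml hl]]]] := @cauchy_measure_subseq J h (fun n j => (hh n j).1) _.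
  move=> e e0; have [N hN] := hc e e0; exists N => n m Nn Nm.
  apply: le_trans (hN n m Nn Nm); apply: I_le => //.
    apply: (@L1_bdd _ 1); first by apply: mf_min; [exact: mf_cst|exact: L1_mf (LD n m)].
    by move=> x; rewrite ger0_norm ?ge_min ?lexx// le_min ler01 D0.
  by move=> x; rewrite ge_min lexx orbT.
have key e : 0 < e -> exists N, forall n, (N <= n)%N ->
    L1 (fun x => \sum_j (h n j x - l j x) ^+ 2) /\
    I (fun x => \sum_j (h n j x - l j x) ^+ 2) <= e.
  move=> e0; have [N hN] := hc e e0; exists N => n Nn.
  apply: (@I_fatou _ _ _ nu (fun m x => \sum_j (h n j x - h (s (m + N)%N) j x) ^+ 2) _ (fun=> e)) => //.
  - apply: mf_sum => j; apply: mfX; apply: mfB => //; exact: (hh n j).1.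
  - by move=> x; apply: sumr_ge0 => j _; rewrite sqr_ge0.
  - apply: (aE_mp hl) => x hx.
    apply: (cvg_bigsum (u := fun j m => (h n j x - h (s (m + N)%N) j x) ^+ 2)) => j.
    apply: (@cvg_comp _ _ _ (fun m => h n j x - h (s (m + N)%N) j x) (fun z => z ^+ 2) _ (nbhs (h n j x - l j x))).
      apply: cvgB; first exact: cvg_cst.
      by rewrite (cvg_shiftn N (fun m => h (s m) j x)); exact: hx.
    exact: exprn_continuous.
  - by move=> m; apply: hN => //; rewrite (leq_trans _ (subseq_ge hs _))// leq_addl.
  - exact: cvg_cst.
exists l; split=> [j|].
  have [N hN] := key 1 ltr01.
  have [L _] := hN N (leqnn _).
  have hd : L2 (fun x => h N j x - l j x).
    split; first by apply: mfB => //; exact: (hh N j).1.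
    apply: (L1_dom _ L); first by apply: mfX; apply: mfB => //; exact: (hh N j).1.
    move=> x; rewrite ger0_norm ?sqr_ge0// (bigD1 j)//= lerDl sumr_ge0// => i _; exact: sqr_ge0.
  by have := L2B (hh N j) hd; under [X in L2 X -> _]eq_fun do rewrite opprB addrC subrK.
apply/cvg_epsP => e e0; have [N hN] := key e e0; exists N => n Nn.
rewrite subr0 ger0_norm; first exact: (hN n Nn).2.
by apply: I_ge0 => x; apply: sumr_ge0 => j _; rewrite sqr_ge0.
Qed.

End completeness.

(** * Semi-Hilbert spaces *)

(** The first order condition at a minimum. For t = - a / (b + 1) the expression equals - (a / (b +
    1))^2; taking b + 1 rather than b avoids the case b = 0. *)
Lemma linear_quadratic_ge0 (R : realType) (a b : R) :
  (forall t : R, 0 <= t * a + t ^+ 2 * b) -> a = 0.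
Proof.
move=> h; have b0 : 0 <= b by have := h 1; have := h (-1); lra.
pose t := - a / (b + 1).
have := h t; have -> : t * a + t ^+ 2 * b = - (a ^+ 2) / (b + 1) ^+ 2.
  by rewrite /t; field; rewrite gt_eqF//; lra.
rewrite mulNr oppr_ge0 pmulr_lle0; last by rewrite invr_gt0 exprn_gt0//; lra.
by move=> a2; apply/eqP; rewrite -sqrf_eq0 eq_le a2 sqr_ge0.
Qed.

Section semi_hilbert.
Context {R : realType} {V : lmodType R}.
Variables (H : set V) (ip : V -> V -> R).
Hypothesis H0 : H 0.
Hypothesis HP : forall a x y, H x -> H y -> H (a *: x + y).
Hypothesis ipC : forall x y, ip x y = ip y x.
Hypothesis ipP : forall a x y z, H x -> H y -> H z ->
  ip (a *: x + y) z = a * ip x z + ip y z.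
Local Notation Q x := (ip x x).
Hypothesis Q0 : forall x, H x -> 0 <= Q x.
Hypothesis complete : forall x : nat -> V, (forall n, H (x n)) ->
  (forall e : R, 0 < e -> exists N, forall n m, (N <= n)%N -> (N <= m)%N ->
     Q (x n - x m) <= e) ->
  exists2 y, H y & Q (x n - y) @[n --> \oo] --> (0 : R).

Let HZ a x : H x -> H (a *: x).
Proof. by move=> hx; rewrite -[_ *: _]addr0; exact: HP. Qed.

Let HD x y : H x -> H y -> H (x + y).
Proof. by move=> hx hy; rewrite -[x]scale1r; exact: HP. Qed.

Let HB x y : H x -> H y -> H (x - y).
Proof. by move=> hx hy; rewrite addrC -scaleN1r; exact: HP. Qed.

Let ipD x y z : H x -> H y -> H z -> ip (x + y) z = ip x z + ip y z.
Proof. by move=> hx hy hz; rewrite -{1}[x]scale1r ipP// mul1r. Qed.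

Let ip0 z : H z -> ip 0 z = 0.
Proof.
by move=> hz; have := ipD H0 H0 hz; rewrite addr0 => h; lra.
Qed.

Let ipZ a x z : H x -> H z -> ip (a *: x) z = a * ip x z.
Proof. by move=> hx hz; rewrite -[_ *: _]addr0 ipP// ip0// addr0. Qed.

Let ipB x y z : H x -> H y -> H z -> ip (x - y) z = ip x z - ip y z.
Proof.
by move=> hx hy hz; rewrite -scaleN1r ipD ?ipZ ?mulN1r//; exact: HZ.
Qed.

Let ipDr x y z : H x -> H y -> H z -> ip z (x + y) = ip z x + ip z y.
Proof. by move=> *; rewrite ipC ipD// !(ipC _ z). Qed.

Let ipZr a x z : H x -> H z -> ip z (a *: x) = a * ip z x.
Proof. by move=> *; rewrite ipC ipZ// ipC. Qed.

Let QZ a x : H x -> Q (a *: x) = a ^+ 2 * Q x.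
Proof. by move=> hx; have h := HZ a hx; rewrite ipZ// ipZr// mulrA expr2. Qed.

Let QBC x y : H x -> H y -> Q (x - y) = Q (y - x).
Proof.
move=> hx hy; have -> : x - y = -1 *: (y - x) by rewrite scaleN1r opprB.
by rewrite QZ ?sqrrN ?expr1n ?mul1r//; exact: HB.
Qed.

Lemma QD a x y : H x -> H y -> Q (x + a *: y) = Q x + 2 * a * ip x y + a ^+ 2 * Q y.
Proof.
move=> hx hy; have hay := HZ a hy; have hxy := HD hx hay.
by rewrite ipD// !ipDr// !ipZ// !ipZr// (ipC y x); ring.
Qed.

Lemma ip_young t x y : 0 < t -> H x -> H y -> 2 * ip x y <= t * Q x + t^-1 * Q y.
Proof.
move=> t0 hx hy; have := Q0 (HD hx (HZ (- t^-1) hy)).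
rewrite QD// => h; have : 0 <= t * (Q x + 2 * - t^-1 * ip x y + (- t^-1) ^+ 2 * Q y).
  by apply: mulr_ge0 => //; exact: ltW.
have -> : t * (Q x + 2 * - t^-1 * ip x y + (- t^-1) ^+ 2 * Q y) =
   t * Q x - 2 * ip x y + t^-1 * Q y by field; rewrite gt_eqF.
lra.
Qed.

(** Functions equal almost everywhere are not identified, so the form is only positive semidefinite.
    Vectors of zero norm do no harm, being orthogonal to all of [H]. *)
Lemma Q_eq0 x y : H x -> H y -> Q x = 0 -> ip x y = 0.
Proof.
move=> hx hy q0; suff : 2 * ip x y = 0 by lra.
apply: (@linear_quadratic_ge0 _ _ (Q y)) => t.
by have := Q0 (HD hx (HZ t hy)); rewrite QD// q0; lra.
Qed.

Lemma cvg_ip x y z : (forall n, H (x n)) -> H y -> H z ->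
  Q (x n - y) @[n --> \oo] --> (0 : R) -> ip (x n) z @[n --> \oo] --> ip y z.
Proof.
move=> hx hy hz /cvg_epsP hc; apply/cvg_epsP => e e0.
pose t := (Q z + 1) / e.
have z0 := Q0 hz.
have t0 : 0 < t by rewrite divr_gt0//; lra.
have d0 : 0 < e / t by rewrite divr_gt0.
have [N hN] := hc _ d0; exists N => n Nn.
have hxy := HB (hx n) hy.
have := hN n Nn; rewrite subr0 ger0_norm ?Q0// => q.
have b1 : t * Q (x n - y) <= e by rewrite mulrC -ler_pdivlMr.
have b2 : t^-1 * Q z <= e.
  rewrite /t invf_div mulrAC ler_pdivrMr; last lra.
  by rewrite ler_pM2l//; lra.
rewrite -ipB// ler_norml; apply/andP; split; last by have := ip_young t0 hxy hz; lra.
have := ip_young t0 hxy (HZ (-1) hz).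
by rewrite ipZr// QZ// sqrrN expr1n; lra.
Qed.

Definition linear_on (l : V -> R) :=
  forall a x y, H x -> H y -> l (a *: x + y) = a * l x + l y.

(** The solution minimises Q / 2 - l. The growth condition takes the place of the continuity of [l]:
    it bounds this functional from below by - C. *)
Lemma riesz_min (l : V -> R) C : linear_on l ->
  (forall x, H x -> l x <= C + 4^-1 * Q x) ->
  exists2 y, H y & forall z, H z -> ip y z = l z.
Proof.
move=> ll lC.
pose J x := 2^-1 * Q x - l x.
have l0 : l 0 = 0 by have := ll 1 0 0 H0 H0; rewrite scale1r addr0; lra.
have lZ a x : H x -> l (a *: x) = a * l x.
  by move=> hx; rewrite -[_ *: _]addr0 ll// l0 addr0.
pose S := [set J x | x in H].
have Slb : has_lbound S.
  exists (- C) => _ [x hx <-]; have := lC x hx; have := Q0 hx; rewrite /J; lra.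
have Sinf : has_inf S by split => //; exists (J 0); exists 0.
set m := inf S.
have mJ x : H x -> m <= J x by move=> hx; apply: ge_inf => //; exists x.
have ex n : exists x, H x /\ J x <= m + n.+1%:R^-1.
  have n0 : (0 : R) < n.+1%:R^-1 by rewrite invr_gt0.
  have [_ [x hx <-] hlt] := inf_adherent n0 Sinf.
  by exists x; split => //; exact: ltW.
pose x n := projT1 (cid (ex n)).
have hx n : H (x n) by exact: (projT2 (cid (ex n))).1.
have Jx n : J (x n) <= m + n.+1%:R^-1 by exact: (projT2 (cid (ex n))).2.
have inv_small (e : R) : 0 < e -> exists N, forall n, (N <= n)%N -> n.+1%:R^-1 <= e.
  move=> e0; exists (Num.bound e^-1) => n Nn.
  rewrite invf_ple ?posrE//; apply: (@le_trans _ _ (Num.bound e^-1)%:R).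
    by apply/ltW/archi_boundP; rewrite invr_ge0 ltW.
  by rewrite ler_nat (leq_trans Nn).
have [e e0|y hy hc] := complete hx.
  have [N hN] := inv_small (e / 8) (divr_gt0 e0 (ltr0n _ 8)).
  exists N => n k Nn Nk.
  (* Parallelogram law: the midpoint is no better than the infimum, hence Q (x n - x k) <= 4 (1 / (n
     + 1) + 1 / (k + 1)). *)
  have hz : H (2^-1 *: (x n + x k)) by apply: HZ; exact: HD.
  have := mJ _ hz; rewrite /J lZ; last exact: HD.
  have -> : l (x n + x k) = l (x n) + l (x k).
    by rewrite -{1}[x n]scale1r ll// mul1r.
  have -> : Q (2^-1 *: (x n + x k)) = 4^-1 * (Q (x n) + 2 * ip (x n) (x k) + Q (x k)).
    have h := HD (hx n) (hx k).
    by rewrite QZ// ipD// !ipDr// (ipC (x k)); field.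
  have -> : Q (x n - x k) = Q (x n) - 2 * ip (x n) (x k) + Q (x k).
    by rewrite -scaleN1r QD//; ring.
  move: (Jx n) (Jx k) (hN n Nn) (hN k Nk); rewrite /J.
  move: (n.+1%:R^-1) (k.+1%:R^-1) (l (x n)) (l (x k)) (Q (x n)) (Q (x k)) (ip (x n) (x k)).
  by move=> r1 r2 l1 l2 q1 q2 q3; lra.
exists y => // z hz.
suff : ip y z - l z = 0 by lra.
apply: (@linear_quadratic_ge0 _ _ (2^-1 * Q z)) => t.
have cv := cvg_ip hx hy hz hc.
have cv2 : t * (ip (x n) z - l z) + t ^+ 2 * (2^-1 * Q z) + n.+1%:R^-1 @[n --> \oo] -->
    t * (ip y z - l z) + t ^+ 2 * (2^-1 * Q z) + 0.
  apply: cvgD; last first.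
    apply/cvg_epsP => e e0; have [N hN] := inv_small e e0; exists N => n Nn.
    by rewrite subr0 ger0_norm ?invr_ge0// hN.
  apply: cvgD; last exact: cvg_cst.
  apply: cvgM; first exact: cvg_cst.
  by apply: cvgB => //; exact: cvg_cst.
rewrite -[leRHS]addr0 -(cvg_lim _ cv2)//; apply: limr_ge.
  by apply/cvg_ex; eexists; exact: cv2.
apply: nearW => n.
have := mJ _ (HD (hx n) (HZ t hz)); rewrite /J QD//.
have -> : l (x n + t *: z) = l (x n) + t * l z by rewrite addrC ll// addrC.
move: (Jx n); rewrite /J; move: (n.+1%:R^-1) => r; lra.
Qed.

(** [F x] represents the functional [l x]. Testing the difference of two representations with F x -
    F y and absorbing a quarter gives the contraction factor 1/3 for [Q]; a fixed point solves the
    equation. *)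
Lemma contraction_solvable (l : V -> V -> R) (C : V -> R) :
  (forall x, H x -> linear_on (l x)) ->
  (forall x z, H x -> H z -> l x z <= C x + 4^-1 * Q z) ->
  (forall x y z, H x -> H y -> H z -> l x z - l y z <= 4^-1 * (Q (x - y) + Q z)) ->
  exists2 x, H x & forall z, H z -> ip x z = l x z.
Proof.
move=> ll lC lip.
have ex x : exists y, H x -> H y /\ forall z, H z -> ip y z = l x z.
  have [hx|nx] := pselect (H x); last by exists 0.
  have [y hy yz] := riesz_min (ll x hx) (fun z hz => lC x z hx hz).
  by exists y.
pose F x := projT1 (cid (ex x)).
have HF x : H x -> H (F x) by move=> hx; exact: (projT2 (cid (ex x)) hx).1.
have FE x z : H x -> H z -> ip (F x) z = l x z.
  by move=> hx; exact: (projT2 (cid (ex x)) hx).2.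
have con x y : H x -> H y -> Q (F x - F y) <= 3^-1 * Q (x - y).
  move=> hx hy; have hd := HB (HF x hx) (HF y hy).
  have := lip x y _ hx hy hd; rewrite -!FE// -ipB//; [lra|exact: HF|exact: HF].
pose x n := iter n F 0.
have hx n : H (x n) by elim: n => //= n ih; exact: HF.
(* The weights 3/2 and 3 are such that 3/2 times the contraction factor 1/3 stays below 1. *)
have tri a b : H a -> H b -> Q (a + b) <= (3 / 2) * Q a + 3 * Q b.
  move=> ha hb; rewrite -{1 2}[b]scale1r QD//.
  have h2 : (0 : R) < 2^-1 by rewrite invr_gt0.
  by have := ip_young h2 ha hb; rewrite invrK; lra.
have c1 n k : Q (x (k + n)%N - x n) <= 6 * Q (x n.+1 - x n).
  elim: k => [|k ih].
    by rewrite add0n subrr ip0// mulr_ge0// Q0//; exact: HB.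
  rewrite (_ : x (k.+1 + n)%N - x n = (F (x (k + n)%N) - F (x n)) + (x n.+1 - x n)).
    apply: (le_trans (tri _ _ (HB (HF _ (hx _)) (HF _ (hx _))) (HB (hx _) (hx _)))).
    by have := con _ _ (hx (k + n)%N) (hx n); lra.
  by rewrite -[F (x (k + n)%N)]/(x (k.+1 + n)%N) -[F (x n)]/(x n.+1) addrA subrK.
have c2 n : Q (x n.+1 - x n) <= 3^-1 ^+ n * Q (x 1%N - x 0%N).
  elim: n => [|n ih]; first by rewrite expr0 mul1r.
  apply: (le_trans (con _ _ (hx n.+1) (hx n))); rewrite exprS -mulrA ler_pM2l//.
have K0 : 0 <= Q (x 1%N - x 0%N) by apply: Q0; exact: HB.
set K := Q (x 1%N - x 0%N) in c2 K0.
have [e e0|y hy hc] := complete hx.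
  have cv : (6 * K) * 3^-1 ^+ n @[n --> \oo] --> (6 * K) * (0 : R).
    apply: cvgM; first exact: cvg_cst.
    by apply: cvg_expr; rewrite ger0_norm ?invr_ge0// invf_lt1// ltr1n.
  move/cvg_epsP : cv => /(_ e e0) [N hN]; exists N.
  have half n m : (N <= n)%N -> (n <= m)%N -> Q (x m - x n) <= e.
    move=> Nn nm; have := hN n Nn; rewrite mulr0 subr0 ger0_norm; last first.
      by rewrite !mulr_ge0// exprn_ge0// invr_ge0.
    apply: le_trans; rewrite -(subnK nm); apply: (le_trans (c1 n _)).
    by rewrite -mulrA ler_pM2l// mulrC; have := c2 n; rewrite mulrC.
  move=> n m Nn Nm; have [nm|/ltnW mn] := leqP n m; last exact: half.
  by rewrite QBC//; exact: half.
have hF := HF y hy; have hd := HB hF hy.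
have q0 : Q (F y - y) = 0.
  apply/eqP; rewrite eq_le Q0// andbT.
  have cv : Q (x n - y) + 3 * Q (x n.+1 - y) @[n --> \oo] --> (0 + 3 * 0 : R).
    apply: cvgD => //; apply: cvgM; first exact: cvg_cst.
    exact: (@cvg_subseq _ (fun n => Q (x n - y)) 0 S).
  rewrite -[leRHS](_ : 0 + 3 * 0 = 0 :> R); last by rewrite mulr0 addr0.
  rewrite -(cvg_lim _ cv)//; apply: limr_ge; first by apply/cvg_ex; eexists; exact: cv.
  apply: nearW => n.
  rewrite (_ : F y - y = (F y - F (x n)) + (x n.+1 - y)); last by rewrite addrA subrK.
  apply: (le_trans (tri _ _ (HB hF (HF _ (hx n))) (HB (hx n.+1) hy))).
  have := con _ _ hy (hx n).
  rewrite (QBC hy (hx n)).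
  have := Q0 (HB (hx n) hy); lra.
exists y => // z hz; rewrite -FE//.
by have := Q_eq0 hd hz q0; rewrite ipB//; lra.
Qed.

End semi_hilbert.

(** * C^1 functions of one variable *)

Section C1.
Context {R : realType}.
Implicit Types f g : R -> R.

Definition C1fun f f' := (forall t : R, is_derive t 1 f (f' t)) /\ continuous f'.

Lemma C1_cont f f' : C1fun f f' -> continuous f.
Proof.
by move=> [h _] t; apply/differentiable_continuous/derivable1_diffP; have [] := h t.
Qed.

Lemma C1_mvt f f' a b : C1fun f f' -> a <= b ->
  exists c, [/\ a <= c, c <= b & f b - f a = f' c * (b - a)].
Proof.
move=> hf ab; have [c] := @MVT_segment R f f' a b ab (fun x _ => hf.1 x)
  (continuous_subspaceT (C1_cont hf)).
by rewrite in_itv/= => /andP[h1 h2] h3; exists c.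
Qed.

Lemma C1_lip f f' M : C1fun f f' -> (forall t, `|f' t| <= M) ->
  forall a b, `|f a - f b| <= M * `|a - b|.
Proof.
move=> hf hM; have key a b : a <= b -> `|f b - f a| <= M * `|b - a|.
  by move=> ab; have [c [_ _ ->]] := C1_mvt hf ab; rewrite normrM ler_wpM2r.
move=> a b; have [ab|/ltW ba] := leP b a; first exact: key.
by rewrite distrC (distrC a); exact: key.
Qed.

Lemma C1_nd f f' : C1fun f f' -> (forall t, 0 <= f' t) ->
  forall a b, a <= b -> f a <= f b.
Proof.
move=> hf h0 a b ab; have [c [_ _ e]] := C1_mvt hf ab.
by rewrite -subr_ge0 e mulr_ge0// subr_ge0.
Qed.

Lemma C1_eq f g f' g' : (forall t, f t = g t) -> (forall t, f' t = g' t) ->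
  C1fun f f' -> C1fun g g'.
Proof. by move=> /funext -> /funext ->. Qed.

Lemma C1_cst (c : R) : C1fun (fun=> c) (fun=> 0).
Proof. by split=> [t|t]; [exact: is_derive_cst|exact: cvg_cst]. Qed.

Lemma C1_id : C1fun id (fun=> 1).
Proof. by split=> [t|t]; [exact: is_derive_id|exact: cvg_cst]. Qed.

Lemma C1D f f' g g' : C1fun f f' -> C1fun g g' ->
  C1fun (fun t => f t + g t) (fun t => f' t + g' t).
Proof.
move=> [hf cf] [hg cg]; split=> t; first exact: is_deriveD.
by apply: cvgD; [exact: cf|exact: cg].
Qed.

Lemma C1M f f' g g' : C1fun f f' -> C1fun g g' ->
  C1fun (fun t => f t * g t) (fun t => f' t * g t + f t * g' t).
Proof.
move=> hf hg; split=> t.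
  have := @is_deriveM _ _ f g t 1 (f' t) (g' t) (hf.1 t) (hg.1 t).
  by move/is_derive_eq; apply; rewrite /GRing.scale/=; ring.
apply: cvgD; apply: cvgM; [exact: hf.2|exact: (C1_cont hg)|exact: (C1_cont hf)|exact: hg.2].
Qed.

Lemma C1Z (c : R) f f' : C1fun f f' -> C1fun (fun t => c * f t) (fun t => c * f' t).
Proof.
by move=> hf; apply: C1_eq (C1M (C1_cst c) hf) => // t; rewrite mul0r add0r.
Qed.

Lemma C1N f f' : C1fun f f' -> C1fun (fun t => - f t) (fun t => - f' t).
Proof. by move=> hf; apply: C1_eq (C1Z (-1) hf) => t; rewrite mulN1r. Qed.

Lemma C1_comp f f' g g' : C1fun f f' -> C1fun g g' ->
  C1fun (fun t => f (g t)) (fun t => f' (g t) * g' t).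
Proof.
move=> hf hg; split=> t.
  by have := @is_derive1_comp _ f g t _ _ (hf.1 (g t)) (hg.1 t).
apply: cvgM; last exact: hg.2.
by apply: (@continuous_comp _ _ _ g f'); [exact: (C1_cont hg)|exact: hf.2].
Qed.

Lemma max0_cont : continuous (fun t : R => Num.max t 0).
Proof. by move=> t; apply: continuous_max; [exact: cvg_id|exact: cvg_cst]. Qed.

(** Powers and logarithms of 1 + t are smooth only for t > -1, while compositions call for functions
    that are C^1 on the whole line. The affine continuation to the left of 0 changes nothing at
    nonnegative arguments. *)
Lemma C1_extend (F F' : R -> R) : (forall t : R, -1 < t -> is_derive t 1 F (F' t)) ->
  (forall t : R, -1 < t -> {for t, continuous F'}) ->
  C1fun (fun t => F (Num.max t 0) + F' 0 * Num.min t 0) (fun t => F' (Num.max t 0)).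
Proof.
move=> hF cF; split=> t; last first.
  apply: (@continuous_comp _ _ _ (fun t : R => Num.max t 0) F').
    exact: max0_cont.
  by apply: cF; rewrite lt_max ltrN10 orbT.
have [t0|t0|->] := ltgtP t 0.
- apply: (@near_eq_is_derive _ _ _ (fun t => F 0 + F' 0 * t)).
  + near=> z; have z0 : z < 0 by near: z; exact: lt_nbhsl.
    by rewrite max_r ?min_l// ltW.
  + by have := (C1D (C1_cst (F 0)) (C1Z (F' 0) C1_id)).1 t; rewrite add0r mulr1.
- apply: (@near_eq_is_derive _ _ _ F).
  + near=> z; have z0 : 0 < z by near: z; exact: lt_nbhsr.
    by rewrite max_l ?min_r ?mulr0 ?addr0// ltW.
  + by apply: hF; rewrite (lt_trans _ t0)// ltrN10.
(* At 0 the derivative is read off from Caratheodory's slope function, which is constant on the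
   left. *)
- have /is_derive1_caratheodory[G [G1 G2 G3]] := hF 0 (ltrN10 R).
  apply/is_derive1_caratheodory.
  exists (fun z => if z <= 0 then F' 0 else G z); split; last by rewrite lexx.
    move=> z; rewrite maxxx minxx mulr0 addr0; case: leP => z0.
      by ring.
    by rewrite mulr0 addr0.
  apply/cvgrPdist_le => e e0; rewrite lexx.
  have /cvgrPdist_le/(_ _ e0) := G2; rewrite G3; apply: filterS => z.
  by case: ifP => // _ _; rewrite subrr normr0 ltW.
Unshelve. all: by end_near. Qed.

Definition pos2 (t : R) := Num.max t 0 ^+ 2.

Lemma C1_pos2 : C1fun pos2 (fun t => 2 * Num.max t 0).
Proof.
have := @C1_extend (fun t => t * t) (fun t => 2 * t).
move=> h; apply: C1_eq (h _ _) => // t.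
- by rewrite mulr0 mul0r addr0 /pos2 expr2.
- by move=> _; have := (C1M C1_id C1_id).1 t; rewrite mul1r mulr1 -mulr2n mulr_natl.
- by move=> _; apply: cvgM; [exact: cvg_cst|exact: cvg_id].
Qed.

Lemma pos2_ge0 t : 0 <= pos2 t. Proof. exact: sqr_ge0. Qed.

Lemma pos2_pos t : 0 <= t -> pos2 t = t ^+ 2.
Proof. by move=> h; rewrite /pos2 max_l. Qed.

Lemma pos2_neg t : t <= 0 -> pos2 t = 0.
Proof. by move=> h; rewrite /pos2 max_r// expr0n. Qed.

Lemma C1_exp : C1fun (@expR R) (@expR R).
Proof. by split=> t; [exact: is_derive_expR|exact: continuous_expR]. Qed.

Lemma inv_cont (f : R -> R) : continuous f -> (forall t, f t != 0) ->
  continuous (fun t => (f t)^-1).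
Proof. by move=> cf f0 t; apply: cvgV => //; exact: cf. Qed.

Lemma C1_atan : C1fun (@atan R) (fun t => (1 + t ^+ 2)^-1).
Proof.
split=> t; first exact: is_derive1_atan.
move: t; apply: inv_cont => t.
  apply: cvgD; first exact: cvg_cst.
  exact: exprn_continuous.
by rewrite gt_eqF// ltr_pwDl// sqr_ge0.
Qed.

Lemma powR_cont (r x : R) : 0 < x -> {for x, continuous (fun t => t `^ r)}.
Proof.
move=> x0; apply/differentiable_continuous/derivable1_diffP.
by have [] := @is_derive1_powR R r x x0.
Qed.

Lemma sqrt_shift_gt0 (c t : R) : 0 < c -> 0 < c + pos2 t.
Proof. by move=> c0; have := pos2_ge0 t; lra. Qed.

(** After subtraction of sqrt c this is a C^1 version of the positive part: it vanishes for t <= 0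
    and tends to t^+ as c tends to 0. *)
Lemma C1_sqrt (c : R) : 0 < c ->
  C1fun (fun t => Num.sqrt (c + pos2 t))
        (fun t => Num.max t 0 / Num.sqrt (c + pos2 t)).
Proof.
move=> c0.
have sc : continuous (fun t => Num.sqrt (c + pos2 t)).
  move=> t; apply: (@continuous_comp _ _ _ (fun t => c + pos2 t) Num.sqrt).
    by apply: cvgD; [exact: cvg_cst|exact: (C1_cont C1_pos2)].
  exact: sqrt_continuous.
have s0 t : 0 < Num.sqrt (c + pos2 t) by rewrite sqrtr_gt0 sqrt_shift_gt0.
split=> t.
  have := @is_derive1_comp _ Num.sqrt (fun t => c + pos2 t) t _ _
     (is_derive1_sqrt (sqrt_shift_gt0 t c0)) ((C1D (C1_cst c) C1_pos2).1 t).
  move/is_derive_eq; apply.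
  by rewrite add0r; field; rewrite gt_eqF.
apply: cvgM; first exact: max0_cont.
by apply: cvgV; [rewrite gt_eqF|exact: sc].
Qed.

Lemma C1_primitive (w : R -> R) : continuous w ->
  exists F, F 0 = 0 /\ C1fun F (fun t => w (Num.max t 0)).
Proof.
move=> cw.
(* Starting the integral at -1 makes [G] differentiable on a neighbourhood of [0, +oo[, as
   [C1_extend] requires; [G 0] is subtracted at the end. *)
pose G (x : R) := \int[lebesgue_measure]_(t in `[-1, x]) w t.
have dG (t : R) : -1 < t -> is_derive t 1 G (w t).
  move=> t1.
  have tt1 : t < t + 1 by rewrite ltrDl.
  have [|h1 h2] := @continuous_FTC1_closed R w (-1) t (t + 1) tt1 _ t1 (cw t).
    apply: continuous_compact_integrable; first exact: segment_compact.
    exact: continuous_subspaceT.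
  by rewrite -h2 derive1E; exact: derivableP.
have h := @C1_extend G w dG (fun t _ => cw t).
exists (fun t => (G (Num.max t 0) + w 0 * Num.min t 0) + - G 0); split.
  by rewrite maxxx minxx mulr0 addr0 subrr.
by apply: C1_eq (C1D h (C1_cst (- G 0))) => // t; rewrite addr0.
Qed.

(** The lower bound [c] on the derivative gives at least linear growth in both directions, hence
    surjectivity by the intermediate value theorem. *)
Lemma C1_inverse (F w : R -> R) (c : R) : 0 < c -> C1fun F w -> (forall t, c <= w t) -> F 0 = 0 ->
  exists K, [/\ C1fun K (fun t => (w (K t))^-1), (forall t, F (K t) = t) & forall s, K (F s) = s].
Proof.
move=> c0 hF cw F0.
have inc (a b : R) : a < b -> F a < F b.
  move=> ab; have [x [_ _ e]] := C1_mvt hF (ltW ab).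
  by rewrite -subr_gt0 e mulr_gt0 ?subr_gt0// (lt_le_trans c0).
have inj : injective F.
  by move=> a b e; have [ab|ab|//] := ltgtP a b; have := inc _ _ ab; rewrite e ltxx.
have grow (s : R) : 0 <= s -> c * s <= F s.
  move=> s0; have [x [_ _]] := C1_mvt hF s0; rewrite F0 !subr0 => ->.
  by rewrite ler_wpM2r.
have grow' (s : R) : s <= 0 -> F s <= c * s.
  move=> s0; have [x [_ _]] := C1_mvt hF s0; rewrite F0 !sub0r => e.
  have -> : F s = w x * s by lra.
  by rewrite -subr_le0 -mulrBl mulr_ge0_le0// subr_ge0.
have surj t : exists s, F s = t.
  pose M := `|t| / c.
  have M0 : 0 <= M by rewrite divr_ge0// ltW.
  have cM : c * M = `|t| by rewrite /M mulrC divfK// gt_eqF.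
  have h1 : t <= F M by apply: (le_trans (ler_norm t)); rewrite -cM grow.
  have h2 : F (- M) <= t.
    by apply: (le_trans (grow' _ _)); rewrite ?oppr_le0// mulrN cM lerNl -normrN ler_norm.
  have MM : - M <= M by lra.
  have [|s _ e] := @IVT R F (- M) M t MM (continuous_subspaceT (C1_cont hF)).
    by rewrite ge_min h2 le_max h1 orbT.
  by exists s.
pose K t := projT1 (cid (surj t)).
have FK t : F (K t) = t by exact: projT2 (cid (surj t)).
have KF s : K (F s) = s by apply: inj; rewrite FK.
have dK (t : R) : is_derive t 1 K (w (K t))^-1.
  rewrite -{1}(FK t); apply: is_derive_inverse.
  - by near=> z; exact: KF.
  - by near=> z; exact: (C1_cont hF).
  - exact: hF.1.
  - by rewrite gt_eqF// (lt_le_trans c0).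
exists K; split=> //; split=> // t.
have cK : continuous K.
  by move=> z; apply/differentiable_continuous/derivable1_diffP; have [] := dK z.
apply: cvgV; first by rewrite gt_eqF// (lt_le_trans c0).
by apply: (@continuous_comp _ _ _ K w); [exact: cK|exact: hF.2].
Unshelve. all: by end_near. Qed.

End C1.

(** * The closure of a test class *)

Lemma cvg_addR {R : realType} (u v : nat -> R) (a b : R) :
  u n @[n --> \oo] --> a -> v n @[n --> \oo] --> b -> u n + v n @[n --> \oo] --> a + b.
Proof. by move=> hu hv; exact: cvgD. Qed.

Lemma cvg_mulcR {R : realType} (c : R) (u : nat -> R) (a : R) :
  u n @[n --> \oo] --> a -> c * u n @[n --> \oo] --> c * a.
Proof. by move=> hu; apply: cvgM => //; exact: cvg_cst. Qed.
Arguments cvg_mulcR {R} c {u a}.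

Section dot.
Context {R : realType} {N : nat}.
Implicit Types a b c : 'rV[R]_N.

Definition sq a := dotr a a.

Lemma dotrC a b : dotr a b = dotr b a.
Proof. by apply: eq_bigr => i _; rewrite mulrC. Qed.

Lemma dotrDl a b c : dotr (a + b) c = dotr a c + dotr b c.
Proof. by rewrite -big_split; apply: eq_bigr => i _; rewrite mxE mulrDl. Qed.

Lemma dotrZl k a b : dotr (k *: a) b = k * dotr a b.
Proof. by rewrite mulr_sumr; apply: eq_bigr => i _; rewrite mxE mulrA. Qed.

Lemma dotrDr a b c : dotr a (b + c) = dotr a b + dotr a c.
Proof. by rewrite dotrC dotrDl !(dotrC _ a). Qed.

Lemma dotrZr k a b : dotr a (k *: b) = k * dotr a b.
Proof. by rewrite dotrC dotrZl dotrC. Qed.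

Lemma dotrNl a b : dotr (- a) b = - dotr a b.
Proof. by rewrite -scaleN1r dotrZl mulN1r. Qed.

Lemma dotrNr a b : dotr a (- b) = - dotr a b.
Proof. by rewrite -scaleN1r dotrZr mulN1r. Qed.

Lemma dotr0l b : dotr 0 b = 0.
Proof. by rewrite -(scale0r 0) dotrZl mul0r. Qed.

Lemma dotr0r b : dotr b 0 = 0.
Proof. by rewrite dotrC dotr0l. Qed.

Lemma sqE a : sq a = \sum_i a ord0 i ^+ 2.
Proof. by apply: eq_bigr => i _; rewrite expr2. Qed.

Lemma sq_ge0 a : 0 <= sq a.
Proof. by rewrite sqE; apply: sumr_ge0 => i _; rewrite sqr_ge0. Qed.

Lemma sqZ k a : sq (k *: a) = k ^+ 2 * sq a.
Proof. by rewrite /sq dotrZl dotrZr mulrA expr2. Qed.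

Lemma sqN a : sq (- a) = sq a.
Proof. by rewrite /sq dotrNl dotrNr opprK. Qed.

Lemma sq0 : sq 0 = 0.
Proof. exact: dotr0l. Qed.

Lemma sqDE a b : sq (a + b) = sq a + 2 * dotr a b + sq b.
Proof. by rewrite /sq dotrDl !dotrDr (dotrC b a); ring. Qed.

Lemma sqBE a b : sq (a - b) = sq a - 2 * dotr a b + sq b.
Proof. by rewrite sqDE dotrNr sqN mulrN. Qed.

Lemma sqD a b : sq (a + b) <= 2 * sq a + 2 * sq b.
Proof. by have := sq_ge0 (a - b); rewrite sqBE sqDE; lra. Qed.

Lemma sqB a b : sq (a - b) <= 2 * sq a + 2 * sq b.
Proof. by have := sqD a (- b); rewrite sqN. Qed.

Lemma sqBC a b : sq (a - b) = sq (b - a).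
Proof. by rewrite -opprB sqN. Qed.

Lemma sq_coord a i : a ord0 i ^+ 2 <= sq a.
Proof. by rewrite sqE (bigD1 i)//= lerDl sumr_ge0// => j _; rewrite sqr_ge0. Qed.

Lemma sq_eq0 a : sq a = 0 -> a = 0.
Proof.
move=> h; apply/rowP => i; rewrite mxE; apply/eqP; rewrite -sqrf_eq0 eq_le sqr_ge0 andbT.
by rewrite -h sq_coord.
Qed.

Lemma dotr_cs a b : dotr a b ^+ 2 <= sq a * sq b.
Proof.
have [/sq_eq0 ->|b0] := eqVneq (sq b) 0.
  by rewrite dotr0r sq0 mulr0 expr0n.
have bp : 0 < sq b by rewrite lt_neqAle eq_sym b0 sq_ge0.
have := sq_ge0 (sq b *: a - dotr a b *: b).
rewrite sqBE !sqZ dotrZl dotrZr => h.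
have : 0 <= sq b * (sq a * sq b - dotr a b ^+ 2).
  by apply: le_trans h _; rewrite le_eqVlt; apply/orP; left; apply/eqP; ring.
by rewrite pmulr_rge0// subr_ge0.
Qed.

Definition nrm a := Num.sqrt (sq a).

Lemma nrm_ge0 a : 0 <= nrm a. Proof. exact: sqrtr_ge0. Qed.

Lemma nrm_sq a : nrm a ^+ 2 = sq a. Proof. by rewrite sqr_sqrtr// sq_ge0. Qed.

Lemma dotr_nrm a b : `|dotr a b| <= nrm a * nrm b.
Proof.
rewrite -(@ler_pXn2r _ 2)// ?nnegrE ?mulr_ge0 ?nrm_ge0//.
by rewrite real_normK ?num_real// exprMn !nrm_sq dotr_cs.
Qed.

Lemma nrm_lip a b : `|nrm a - nrm b| <= nrm (a - b).
Proof.
rewrite -(@ler_pXn2r _ 2)// ?nnegrE ?nrm_ge0//.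
rewrite real_normK ?num_real// nrm_sq sqBE sqrrB !nrm_sq.
by have := le_trans (ler_norm _) (dotr_nrm a b); rewrite mulr2n; lra.
Qed.

End dot.

Section ae_subseq.
Context {d : measure_display} {T : measurableType d} {R : realType}.
Variable nu : {measure set T -> \bar R}.

Lemma ae_subseq0 (w : nat -> T -> R) : (forall n, L1 nu (w n)) ->
  (forall n x, 0 <= w n x) -> I nu (w n) @[n --> \oo] --> (0 : R) ->
  exists s : nat -> nat, (forall n, (s n < s n.+1)%N) /\
    aE nu (fun x => w (s n) x @[n --> \oo] --> (0 : R)).
Proof.
move=> Lw w0 /cvg_epsP hc.
have e0 n : 0 < (2^-1 : R) ^+ n by rewrite exprn_gt0.
pose N n := projT1 (cid (hc _ (e0 n))).
have hN n := projT2 (cid (hc _ (e0 n))).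
have [s [s1 s2]] := subseq_rate N; exists s; split => //.
have hI n : I nu (w (s n)) <= 2^-1 ^+ n.
  by have := hN n (s n) (s2 n); rewrite subr0 ger0_norm// I_ge0.
have iE M : iota 0 M.+1 = iota 0 M ++ [:: M] by rewrite -addn1 iotaD.
pose g M x := \sum_(n <- iota 0 M) w (s n) x.
have bnd : aE nu (fun x => exists b, forall M, g M x <= b).
  apply: (@mono_ae_bounded _ _ _ _ g 2).
  - by move=> M; apply: L1_sum.
  - by move=> M x; apply: sumr_ge0.
  - by move=> M x; rewrite /g iE big_cat/= big_seq1 lerDl.
  - move=> M; rewrite /g I_sum//.
    have key : \sum_(n <- iota 0 M) (2^-1 : R) ^+ n <= 2 - 2 * 2^-1 ^+ M.
      elim: M => [|M ih]; first by rewrite big_nil expr0; lra.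
      by rewrite iE big_cat/= big_seq1 exprS; move: ih; set A := (2^-1 : R) ^+ M; lra.
    apply: (@le_trans _ _ (\sum_(n <- iota 0 M) (2^-1 : R) ^+ n)).
      by apply: ler_sum.
    by apply: (le_trans key); rewrite gerBl mulr_ge0// exprn_ge0// invr_ge0.
apply: (aE_mp bnd) => x [b hb].
have gE : (fun n => g n x) = series (fun n => w (s n) x).
  by apply/funext => n; rewrite /g seriesEnat/= /index_iota subn0.
apply: cvg_series_cvg_0; rewrite -gE.
apply: nondecreasing_is_cvgn.
  by apply/nondecreasing_seqP => n; rewrite /g iE big_cat/= big_seq1 lerDl.
by exists b => _ [n _ <-].
Qed.

End ae_subseq.

(** What the argument uses of C^1 functions with compact support: an algebra stable under C^1 maps
    fixing 0, with chain rule, integration by parts, the fundamental lemma of the calculus of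
    variations and Poincare's inequality. Up to the abstract existence theorem, R^N enters only
    through these properties and a Sobolev inequality assumed there. *)
Record test_class {d} {T : measurableType d} {R : realType}
    (nu : {measure set T -> \bar R}) {N : nat}
    (C : set (T -> R)) (D : (T -> R) -> T -> 'rV[R]_N) : Prop := TestClass {
  tc_mf : forall f, C f -> measf f;
  tc_mfD : forall f i, C f -> measf (fun t => D f t ord0 i);
  tc_bdd : forall f, C f -> exists M, forall t, `|f t| <= M;
  tc_bddD : forall f, C f -> exists M, forall t i, `|D f t ord0 i| <= M;
  tc_0 : C (fun=> 0);
  tc_lin : forall a f g, C f -> C g -> C (fun t => a * f t + g t);
  tc_Dlin : forall a f g, C f -> C g ->
    D (fun t => a * f t + g t) = fun t => a *: D f t + D g t;
  tc_mul : forall f g, C f -> C g -> C (fun t => f t * g t);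
  tc_Dmul : forall f g, C f -> C g ->
    D (fun t => f t * g t) = fun t => g t *: D f t + f t *: D g t;
  tc_comp : forall r r' f, C1fun r r' -> r 0 = 0 -> C f -> C (fun t => r (f t));
  tc_Dcomp : forall r r' f, C1fun r r' -> r 0 = 0 -> C f ->
    D (fun t => r (f t)) = fun t => r' (f t) *: D f t;
  tc_ibp : forall f i, C f -> I nu (fun t => D f t ord0 i) = 0;
  tc_fl : forall h, L1 nu h -> (forall f, C f -> I nu (fun t => h t * f t) = 0) ->
    aE nu (fun t => h t = 0);
  tc_poincare : exists2 K, 0 <= K & forall f, C f ->
    I nu (fun t => f t ^+ 2) <= K * I nu (fun t => sq (D f t))
}.

Lemma measf_cst0 {d} {T : measurableType d} {R : realType} : measf (fun=> 0 : R) (T := T).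
Proof. exact: measurable_cst. Qed.

Section vg.
Context {T : Type} {R : realType} {N : nat}.

(* Pairs of a function and a candidate gradient, as a vector space. *)
Record vg := Vg { vf : T -> R ; vv : T -> 'rV[R]_N }.

HB.instance Definition _ := gen_eqMixin vg.
HB.instance Definition _ := gen_choiceMixin vg.

Let add x y := Vg (fun t => vf x t + vf y t) (fun t => vv x t + vv y t).
Let opp x := Vg (fun t => - vf x t) (fun t => - vv x t).
Let zero := Vg (fun=> 0) (fun=> 0).
Let scale (a : R) x := Vg (fun t => a * vf x t) (fun t => a *: vv x t).

Let vgP x y : (forall t, vf x t = vf y t) -> (forall t, vv x t = vv y t) -> x = y.
Proof. by case: x y => [f g] [f' g'] /= /funext -> /funext ->. Qed.

Let addA : associative add.
Proof. by move=> x y z; apply: vgP => t /=; rewrite addrA. Qed.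
Let addC : commutative add.
Proof. by move=> x y; apply: vgP => t /=; rewrite addrC. Qed.
Let add0 : left_id zero add.
Proof. by move=> x; apply: vgP => t /=; rewrite add0r. Qed.
Let addN : left_inverse zero opp add.
Proof. by move=> x; apply: vgP => t /=; rewrite addNr. Qed.

HB.instance Definition _ := GRing.isZmodule.Build vg addA addC add0 addN.

Let scaleA a b x : scale a (scale b x) = scale (a * b) x.
Proof. by apply: vgP => t /=; rewrite ?mulrA ?scalerA. Qed.
Let scale1 : left_id 1 scale.
Proof. by move=> x; apply: vgP => t /=; rewrite ?mul1r ?scale1r. Qed.
Let scaleDr : right_distributive scale +%R.
Proof. by move=> a x y; apply: vgP => t /=; rewrite ?mulrDr ?scalerDr. Qed.
Let scaleDl x : {morph scale^~ x : a b / a + b}.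
Proof. by move=> a b; apply: vgP => t /=; rewrite ?mulrDl ?scalerDl. Qed.

HB.instance Definition _ :=
  GRing.Zmodule_isLmodule.Build R vg scaleA scale1 scaleDr scaleDl.

Lemma vfD x y t : vf (x + y) t = vf x t + vf y t. Proof. by []. Qed.
Lemma vvD x y t : vv (x + y) t = vv x t + vv y t. Proof. by []. Qed.
Lemma vfN x t : vf (- x) t = - vf x t. Proof. by []. Qed.
Lemma vvN x t : vv (- x) t = - vv x t. Proof. by []. Qed.
Lemma vfZ (a : R) x t : vf (a *: x) t = a * vf x t. Proof. by []. Qed.
Lemma vvZ (a : R) x t : vv (a *: x) t = a *: vv x t. Proof. by []. Qed.
Lemma vf0 t : vf 0 t = 0. Proof. by []. Qed.
Lemma vv0 t : vv 0 t = 0. Proof. by []. Qed.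
Definition vgE := (vfD, vvD, vfN, vvN, vfZ, vvZ, vf0, vv0).

End vg.
Arguments vg T R N : clear implicits.

(** * The energy space: closure of the test functions *)

Section space.
Context {d : measure_display} {T : measurableType d} {R : realType}.
Variable nu : {measure set T -> \bar R}.
Hypothesis nufin : (nu setT < +oo)%E.
Context {N : nat}.
Variables (C : set (T -> R)) (D : (T -> R) -> T -> 'rV[R]_N).
Hypothesis tc : test_class nu C D.
Notation L1 := (L1 nu).
Notation L2 := (L2 nu).
Notation I := (I nu).
Notation aE := (aE nu).

Notation VG := (vg T R N).
Implicit Types x y z : VG.

Definition L2v (g : T -> 'rV[R]_N) := forall i, L2 (fun t => g t ord0 i).
Definition isL2 x := L2 (vf x) /\ L2v (vv x).
Fact E2_key : unit. Proof. exact: tt. Qed.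
Definition E2 x := locked_with E2_key (I (fun t => (vf x) t ^+ 2 + sq ((vv x) t))).
Definition emb (f : T -> R) : VG := Vg f (D f).
Definition Hcl (S : set (T -> R)) x := isL2 x /\
  forall e : R, 0 < e -> exists2 f, S f & E2 (x - emb f) <= e.
(** The space W^{1,2}_0, as a set of pairs: the gradient is carried along as data, and [H_closable]
    shows that the function determines it almost everywhere. *)
Definition H : set VG := Hcl C.
Definition bddC M := [set f | C f /\ forall t, `|f t| <= M].
(** The approximating test functions obey the same bound as the limit. This keeps their products
    with other functions bounded and lets dominated convergence apply in the product rule. *)
Definition Hb M x := (forall t, `|(vf x) t| <= M) /\ Hcl (bddC M) x.

Lemma E2E x : E2 x = I (fun t => (vf x) t ^+ 2 + sq ((vv x) t)).
Proof. by rewrite /E2 unlock. Qed.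

Lemma L2v_dot g h : L2v g -> L2v h -> L1 (fun t => dotr (g t) (h t)).
Proof. by move=> hg hh; apply: L1_sum => i; exact: L2M. Qed.

Lemma L2v_sq g : L2v g -> L1 (fun t => sq (g t)).
Proof. by move=> hg; exact: L2v_dot. Qed.

Lemma L2vD g h : L2v g -> L2v h -> L2v (fun t => g t + h t).
Proof.
by move=> hg hh i; under eq_fun do rewrite mxE; exact: L2D.
Qed.

Lemma L2vZ (k : R) g : L2v g -> L2v (fun t => k *: g t).
Proof.
by move=> hg i; under eq_fun do rewrite mxE; exact: L2Z.
Qed.

Lemma L2vB g h : L2v g -> L2v h -> L2v (fun t => g t - h t).
Proof.
by move=> hg hh i; under eq_fun do rewrite !mxE; exact: L2B.
Qed.

Lemma L2v_bM (M : R) (k : T -> R) g : measf k -> (forall t, `|k t| <= M) -> L2v g ->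
  L2v (fun t => k t *: g t).
Proof.
by move=> mk hk hg i; under eq_fun do rewrite mxE; exact: (L2_bM mk hk (hg i)).
Qed.

Lemma isL2P a x y : isL2 x -> isL2 y -> isL2 (a *: x + y).
Proof.
move=> [x1 x2] [y1 y2]; split; first exact: L2D (L2Z a x1) y1.
exact: L2vD (L2vZ a x2) y2.
Qed.

Lemma isL2Z a x : isL2 x -> isL2 (a *: x).
Proof. by move=> [x1 x2]; split; [exact: L2Z|exact: L2vZ]. Qed.

Lemma isL2D x y : isL2 x -> isL2 y -> isL2 (x + y).
Proof. by move=> [x1 x2] [y1 y2]; split; [exact: L2D|exact: L2vD]. Qed.

Lemma isL2B x y : isL2 x -> isL2 y -> isL2 (x - y).
Proof. by move=> [x1 x2] [y1 y2]; split; [exact: L2B|exact: L2vB]. Qed.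

Lemma E2_L1 x : isL2 x -> L1 (fun t => (vf x) t ^+ 2 + sq ((vv x) t)).
Proof. by move=> [[? ?] ?]; apply: L1D => //; exact: L2v_sq. Qed.

Lemma E2_split x : isL2 x -> E2 x = I (fun t => (vf x) t ^+ 2) + I (fun t => sq ((vv x) t)).
Proof. by move=> [x1 x2]; rewrite E2E ID//; [exact: x1.2|exact: L2v_sq]. Qed.

Lemma E2_ge0 x : 0 <= E2 x.
Proof. by rewrite E2E; apply: I_ge0 => t; rewrite addr_ge0 ?sqr_ge0 ?sq_ge0. Qed.

Lemma E2D x y : isL2 x -> isL2 y -> E2 (x + y) <= 2 * E2 x + 2 * E2 y.
Proof.
move=> hx hy; have hxy := isL2D hx hy.
have h1 := E2_L1 hx; have h2 := E2_L1 hy.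
rewrite !E2E -!IZ// -ID; [|exact: L1Z|exact: L1Z].
apply: I_le; [exact: E2_L1|by apply: L1D; exact: L1Z|].
move=> t; have := sqD ((vv x) t) ((vv y) t).
have := sqr_ge0 ((vf x) t - (vf y) t).
rewrite !vgE.
by move: (sq ((vv x) t + (vv y) t)) => S; move: ((vf x) t) ((vf y) t) => a b; nra.
Qed.

Lemma E2BC x y : E2 (x - y) = E2 (y - x).
Proof.
rewrite !E2E; apply: I_eq => t; rewrite !vgE.
by rewrite sqBC; congr (_ + _); ring.
Qed.

Lemma E2_tri x y z : isL2 x -> isL2 y -> isL2 z ->
  E2 (x - z) <= 2 * E2 (x - y) + 2 * E2 (y - z).
Proof.
move=> hx hy hz; rewrite -[x - z](_ : (x - y) + (y - z) = _); last by rewrite addrA subrK.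
by apply: E2D; exact: isL2B.
Qed.

Lemma emb_isL2 f : C f -> isL2 (emb f).
Proof.
move=> hf; split.
  by have [M hM] := tc_bdd tc hf; apply: (L2_bdd nufin _ hM); exact: (tc_mf tc hf).
move=> i; have [M hM] := tc_bddD tc hf.
by apply: (@L2_bdd _ _ _ _ nufin _ M) => //; [exact: (tc_mfD tc i hf)|move=> t; exact: hM].
Qed.

Lemma D0 : D (fun=> 0) = fun=> 0.
Proof.
have e : (fun t : T => (-1) * (0 : R) + 0) = fun=> 0 by apply/funext => t; rewrite mulr0 addr0.
have := tc_Dlin tc (-1) (tc_0 tc) (tc_0 tc); rewrite e => h.
by apply/funext => t; rewrite h scaleN1r addNr.
Qed.

Lemma emb0 : emb (fun=> 0) = 0.
Proof. by rewrite /emb D0. Qed.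

Lemma embP a f g : C f -> C g -> emb (fun t => a * f t + g t) = a *: emb f + emb g.
Proof. by move=> hf hg; rewrite /emb (tc_Dlin tc). Qed.

Lemma H_isL2 x : H x -> isL2 x. Proof. by case. Qed.

Lemma Hcl_closed S x : S `<=` C -> isL2 x ->
  (forall e : R, 0 < e -> exists2 y, Hcl S y & E2 (x - y) <= e) -> Hcl S x.
Proof.
move=> SC hx h; split => // e e0.
have e4 : 0 < e / 4 by rewrite divr_gt0.
have [y [hy yS] xy] := h _ e4; have [f Sf yf] := yS _ e4.
exists f => //; have hf := emb_isL2 (SC _ Sf).
by apply: (le_trans (E2_tri hx hy hf)); lra.
Qed.

Lemma Hcl_cvg S x (y : nat -> VG) : S `<=` C -> isL2 x -> (forall n, Hcl S (y n)) ->
  E2 (x - y n) @[n --> \oo] --> (0 : R) -> Hcl S x.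
Proof.
move=> SC hx hy /cvg_epsP h; apply: Hcl_closed => // e e0.
have [n hn] := h e e0; exists (y n) => //.
by have := hn n (leqnn _); rewrite subr0 ger0_norm// E2_ge0.
Qed.

Lemma emb_Hcl (S : set (T -> R)) f : C f -> S f -> Hcl S (emb f).
Proof.
move=> Cf Sf; split; first exact: emb_isL2.
move=> e e0; exists f => //; rewrite subrr.
rewrite (_ : E2 0 = 0) ?ltW// E2E (@I_eq _ _ _ _ _ (fun=> 0)) ?I_0// => t.
by rewrite !vgE sq0 expr0n addr0.
Qed.

Lemma emb_H f : C f -> H (emb f).
Proof. by move=> hf; exact: emb_Hcl. Qed.

Lemma H0 : H 0.
Proof. by rewrite -emb0; apply: emb_H; exact: tc_0 tc. Qed.

Lemma E2Z a x : isL2 x -> E2 (a *: x) = a ^+ 2 * E2 x.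
Proof.
move=> hx; rewrite !E2E -IZ; last exact: E2_L1.
apply: I_eq => t; rewrite !vgE.
by rewrite sqZ; ring.
Qed.

Lemma HP a x y : H x -> H y -> H (a *: x + y).
Proof.
move=> [hx xC] [hy yC]; split; first exact: isL2P.
move=> e e0.
have a0 : 0 < 4 * (a ^+ 2 + 1) by have := sqr_ge0 a; lra.
have [f Cf xf] := xC _ (divr_gt0 e0 a0).
have e4 : 0 < e / 4 by rewrite divr_gt0.
have [g Cg yg] := yC _ e4.
exists (fun t => a * f t + g t); first exact: (tc_lin tc).
rewrite embP// opprD addrACA -scalerBr.
have hxf := isL2B hx (emb_isL2 Cf); have hyg := isL2B hy (emb_isL2 Cg).
apply: (le_trans (E2D (isL2Z a hxf) hyg)); rewrite E2Z//.
have k0 : 0 < a ^+ 2 + 1 by have := sqr_ge0 a; lra.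
have b : (a ^+ 2 + 1) * E2 (x - emb f) <= (a ^+ 2 + 1) * (e / (4 * (a ^+ 2 + 1))).
  by rewrite ler_pM2l.
have e' : (a ^+ 2 + 1) * (e / (4 * (a ^+ 2 + 1))) = e / 4.
  by field; rewrite gt_eqF.
move: b yg (E2_ge0 (x - emb f)); rewrite e'.
move: (E2 (x - emb f)) (E2 (y - emb g)) => u w; nra.
Qed.

Lemma HZ a x : H x -> H (a *: x).
Proof. by move=> hx; rewrite -[_ *: _]addr0; apply: HP => //; exact: H0. Qed.

Lemma HD x y : H x -> H y -> H (x + y).
Proof. by move=> hx hy; rewrite -[x]scale1r; exact: HP. Qed.

Lemma HB x y : H x -> H y -> H (x - y).
Proof. by move=> hx hy; rewrite addrC -scaleN1r; exact: HP. Qed.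

Lemma Hb_H M x : Hb M x -> H x.
Proof.
by move=> [_ [hx h]]; split => // e /h [f [Cf _] hf]; exists f.
Qed.

Lemma Hb_emb f : C f -> exists2 M, 0 <= M & Hb M (emb f).
Proof.
move=> Cf; have [M hM] := tc_bdd tc Cf; exists `|M|; first exact: normr_ge0.
have hM' t : `|f t| <= `|M| by exact: le_trans (hM t) (ler_norm M).
by split => //; exact: emb_Hcl.
Qed.

Lemma E2_complete (x : nat -> VG) : (forall n, isL2 (x n)) ->
  (forall e : R, 0 < e -> exists M, forall n m, (M <= n)%N -> (M <= m)%N ->
     E2 (x n - x m) <= e) ->
  exists2 y, isL2 y & E2 (x n - y) @[n --> \oo] --> (0 : R).
Proof.
move=> hx hc.
(* The function and its partial derivatives form one family, with index 0 for the function, so that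
   [L2_complete] applies. *)
pose h n (j : 'I_N.+1) t := if unlift ord0 j is Some i then (vv (x n)) t ord0 i else (vf (x n)) t.
have h0 n t : h n ord0 t = (vf (x n)) t by rewrite /h unlift_none.
have hS n t i : h n (lift ord0 i) t = (vv (x n)) t ord0 i by rewrite /h liftK.
have hh n j : L2 (h n j).
  case: (unliftP ord0 j) => [i|] ->.
    by rewrite (_ : h n _ = fun t => (vv (x n)) t ord0 i)//; [exact: (hx n).2|exact/funext].
  by rewrite (_ : h n _ = (vf (x n)))//; [exact: (hx n).1|exact/funext].
have [|l [hl lc]] := L2_complete nufin hh.
  move=> e /hc[M hM]; exists M => n m Mn Mm; apply: le_trans (hM n m Mn Mm).
  rewrite le_eqVlt; apply/orP; left; apply/eqP; rewrite E2E; apply: I_eq => t.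
  rewrite big_ord_recl !h0 sqE; congr (_ + _).
  by apply: eq_bigr => i _; rewrite !hS !vgE !mxE.
exists (Vg (l ord0) (fun t => \row_i l (lift ord0 i) t)).
  by split => //= i; under eq_fun do rewrite mxE; exact: hl.
apply: cvg_trans lc; apply: near_eq_cvg; near=> n; rewrite E2E; apply: I_eq => t.
rewrite big_ord_recl !h0 sqE; congr (_ + _).
by apply: eq_bigr => i _; rewrite !hS !vgE !mxE.
Unshelve. all: by end_near. Qed.

Lemma H_complete (x : nat -> VG) : (forall n, H (x n)) ->
  (forall e : R, 0 < e -> exists M, forall n m, (M <= n)%N -> (M <= m)%N ->
     E2 (x n - x m) <= e) ->
  exists2 y, H y & E2 (x n - y) @[n --> \oo] --> (0 : R).
Proof.
move=> hx hc; have [y hy yc] := E2_complete (fun n => (hx n).1) hc.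
exists y => //; apply: (Hcl_cvg (@subset_refl _ C) hy hx).
by under eq_cvg do rewrite E2BC.
Qed.

Lemma Hcl_seq S x : S `<=` C -> Hcl S x -> exists f : nat -> T -> R,
  [/\ forall n, S (f n), E2 (x - emb (f n)) @[n --> \oo] --> (0 : R) &
      aE (fun t => f n t @[n --> \oo] --> ((vf x) t : R))].
Proof.
move=> SC [hx h].
have e0 n : 0 < (2^-1 : R) ^+ n by rewrite exprn_gt0.
pose f n := projT1 (cid2 (h _ (e0 n))).
have Sf n : S (f n).
  by rewrite /f; case: cid2.
have hf n : E2 (x - emb (f n)) <= 2^-1 ^+ n.
  by rewrite /f; case: cid2.
have cv : E2 (x - emb (f n)) @[n --> \oo] --> (0 : R).
  have g0 : (2^-1 : R) ^+ n @[n --> \oo] --> (0 : R).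
    by apply: cvg_expr; rewrite ger0_norm ?invr_ge0// invf_lt1// ltr1n.
  by apply: (squeeze_cvgr _ (cvg_cst 0) g0); apply: nearW => n; rewrite E2_ge0 hf.
have hd n := isL2B hx (emb_isL2 (SC _ (Sf n))).
have cvI : I (fun t => vf (x - emb (f n)) t ^+ 2 + sq (vv (x - emb (f n)) t)) @[n --> \oo] --> (0 : R).
  by under eq_cvg do rewrite -E2E.
have [s [s1 s2]] := ae_subseq0 (fun n => E2_L1 (hd n))
  (fun n t => addr_ge0 (sqr_ge0 _) (sq_ge0 _)) cvI.
exists (fun n => f (s n)); split; [by move=> n; exact: Sf|exact: (cvg_subseq s1 cv)|].
apply: (aE_mp s2) => t ht.
have h1 : ((vf x) t - f (s n) t) ^+ 2 @[n --> \oo] --> (0 : R).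
  apply: (squeeze_cvgr _ (cvg_cst 0) ht).
  by apply: nearW => n; rewrite sqr_ge0 lerDl sq_ge0.
apply/cvg_epsP => e ep; have e2 : 0 < e ^+ 2 by rewrite exprn_gt0.
have /cvg_epsP/(_ _ e2)[M hM] := h1; exists M => n Mn.
have := hM n Mn; rewrite subr0 ger0_norm ?sqr_ge0// distrC.
by rewrite -(real_normK (num_real ((vf x) t - _))) ler_pXn2r// nnegrE ltW.
Qed.

Lemma cvg_sqr (u : nat -> R) (l : R) : u n @[n --> \oo] --> l ->
  u n ^+ 2 @[n --> \oo] --> l ^+ 2.
Proof. by move=> h; under eq_cvg do rewrite expr2; rewrite expr2; exact: cvgM. Qed.

Lemma cvg_sq0 (u : nat -> R) : u n @[n --> \oo] --> (0 : R) ->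
  u n ^+ 2 @[n --> \oo] --> (0 : R).
Proof. by move=> /cvg_sqr; rewrite expr0n. Qed.

Lemma cvg_C1 (r r' : R -> R) (u : nat -> R) (l : R) : C1fun r r' ->
  u n @[n --> \oo] --> l -> r (u n) @[n --> \oo] --> r l.
Proof.
by move=> hr hu; apply: (@cvg_comp _ _ _ u r _ (nbhs l)) => //; exact: (C1_cont hr).
Qed.

Lemma cvg_C1' (r r' : R -> R) (u : nat -> R) (l : R) : C1fun r r' ->
  u n @[n --> \oo] --> l -> r' (u n) @[n --> \oo] --> r' l.
Proof.
by move=> [_ hr] hu; apply: (@cvg_comp _ _ _ u r' _ (nbhs l)) => //; exact: hr.
Qed.

Lemma lip_sq (r r' : R -> R) M : C1fun r r' -> (forall t, `|r' t| <= M) ->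
  forall a b, (r a - r b) ^+ 2 <= M ^+ 2 * (a - b) ^+ 2.
Proof.
move=> hr hM a b.
have M0 : 0 <= M by apply: le_trans (hM 0).
rewrite -exprMn -(real_normK (num_real (r a - r b))) -(real_normK (num_real (M * _))).
by rewrite lerXn2r ?nnegrE// normrM (ger0_norm M0); exact: (C1_lip hr).
Qed.

Lemma I_dct0 (f : nat -> T -> R) g : (forall n, measf (f n)) -> L1 g ->
  (forall n t, 0 <= f n t <= g t) -> aE (fun t => f n t @[n --> \oo] --> (0 : R)) ->
  I (f n) @[n --> \oo] --> (0 : R).
Proof.
move=> mf Lg h hc; rewrite -(I_0 nu).
have hb n : aE (fun t => `|f n t| <= g t).
  by apply: aE_all => t; have /andP[h0 h1] := h n t; rewrite ger0_norm.
by have [] := I_dct mf measf_cst0 Lg hc hb.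
Qed.

(** The gradient error splits into r'(f_n) (Dx - Df_n) and (r'(x) - r'(f_n)) Dx. The first is small
    in L2 because r' is bounded; the square of the second, [w n] below, is handled by dominated
    convergence along approximations converging almost everywhere. *)
Lemma Hcl_comp (S S' : set (T -> R)) (r r' : R -> R) (M : R) x : S `<=` C -> S' `<=` C ->
  C1fun r r' -> (forall t, `|r' t| <= M) -> r 0 = 0 ->
  (forall f, S f -> S' (fun t => r (f t))) -> Hcl S x ->
  Hcl S' (Vg (fun t => r (vf x t)) (fun t => r' (vf x t) *: vv x t)).
Proof.
move=> SC SC' hr hM r0 hS hx.
have [f [Sf fx fae]] := Hcl_seq SC hx.
have [x1 x2] := hx.1.
have Cf n := SC _ (Sf n).
have mr' : measf (fun t => r' (vf x t)) by apply: mf_cont x1.1; exact: hr.2.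
have L2y : isL2 (Vg (fun t => r (vf x t)) (fun t => r' (vf x t) *: vv x t)).
  split=> /=; last exact: (L2v_bM mr').
  apply: (L2_dom _ (L2Z M x1)).
    by apply: mf_cont x1.1; exact: (C1_cont hr).
  move=> t; rewrite normrM (le_trans _ (ler_wpM2r _ (ler_norm M)))//.
  by have := C1_lip hr hM (vf x t) 0; rewrite r0 !subr0.
apply: (@Hcl_cvg _ _ (fun n => emb (fun t => r (f n t))) SC' L2y).
  by move=> n; apply: emb_Hcl; [exact: SC' (hS _ (Sf n))|exact: hS].
pose w n t := (r' (vf x t) - r' (f n t)) ^+ 2 * sq (vv x t).
have mw n : measf (w n).
  apply: mfM; last exact: L1_mf (L2v_sq x2).
  apply: mfX; apply: mfB => //; apply: mf_cont; first exact: hr.2.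
  exact: (tc_mf tc).
have w0 n t : 0 <= w n t by rewrite mulr_ge0 ?sqr_ge0 ?sq_ge0.
have wb n t : 0 <= w n t <= (2 * M) ^+ 2 * sq (vv x t).
  rewrite w0 /=; apply: ler_wpM2r; first exact: sq_ge0.
  rewrite -(real_normK (num_real (_ - _))) lerXn2r ?nnegrE//.
    by rewrite mulr_ge0// (le_trans _ (hM 0)).
  by apply: (le_trans (ler_normB _ _)); rewrite mulr_natl mulr2n lerD.
have Lg := L1Z ((2 * M) ^+ 2) (L2v_sq x2).
have wc : I (w n) @[n --> \oo] --> (0 : R).
  apply: (I_dct0 mw Lg wb); apply: (aE_mp fae) => t ht.
  rewrite -(mul0r (sq (vv x t))); apply: cvgM; last exact: cvg_cst.
  apply: cvg_sq0.
  rewrite -(subrr (r' (vf x t))); apply: cvgB; first exact: cvg_cst.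
  exact: (cvg_C1' hr ht).
have Lw n : L1 (w n).
  by apply: (L1_dom (mw n) Lg) => t; rewrite ger0_norm//; have /andP[] := wb n t.
have cv := cvg_addR (cvg_mulcR (2 * M ^+ 2) fx) (cvg_mulcR 2 wc).
rewrite !mulr0 addr0 in cv.
apply: (squeeze_cvgr _ (cvg_cst 0) cv); apply: nearW => n; rewrite E2_ge0 /=.
have Ld := E2_L1 (isL2B hx.1 (emb_isL2 (Cf n))).
rewrite [in leRHS]E2E -!IZ// E2E -ID; [|exact: L1Z|exact: L1Z].
apply: I_le.
- by apply: E2_L1; apply: isL2B => //; apply: emb_isL2; exact: SC' (hS _ (Sf n)).
- by apply: L1D; exact: L1Z.
move=> t; rewrite !vgE /= (tc_Dcomp tc hr r0 (Cf n)) /w.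
rewrite (_ : r' (vf x t) *: vv x t - r' (f n t) *: D (f n) t =
  r' (f n t) *: (vv x t - D (f n) t) + (r' (vf x t) - r' (f n t)) *: vv x t); last first.
  by apply/rowP => i; rewrite !mxE; ring.
have h1 := sqD (r' (f n t) *: (vv x t - D (f n) t)) ((r' (vf x t) - r' (f n t)) *: vv x t).
rewrite !sqZ in h1.
have h2 := lip_sq hr hM (vf x t) (f n t).
have h3 : r' (f n t) ^+ 2 <= M ^+ 2.
  by rewrite -(real_normK (num_real (r' _))) lerXn2r ?nnegrE// (le_trans _ (hM 0)).
have h4 := ler_wpM2r (sq_ge0 (vv x t - D (f n) t)) h3.
have h5 := mulr_ge0 (sqr_ge0 M) (sqr_ge0 (vf x t - f n t)).
by apply: (le_trans (lerD h2 h1)); move: h4 h5; lra.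
Qed.

Lemma H_comp (r r' : R -> R) (M : R) x : C1fun r r' -> (forall t, `|r' t| <= M) -> r 0 = 0 -> H x ->
  H (Vg (fun t => r (vf x t)) (fun t => r' (vf x t) *: vv x t)).
Proof.
move=> hr hM r0 hx; apply: (Hcl_comp (@subset_refl _ C) (@subset_refl _ C) hr hM r0 _ hx).
by move=> f Cf; exact: (tc_comp tc hr).
Qed.

(** The product rule, by a similar splitting. Only [w] and [r] have to be bounded; [x] is any
    element of [H]. *)
Lemma Hb_mulcomp (r r' : R -> R) (A M K : R) w x : C1fun r r' ->
  (forall t, `|r' t| <= M) -> (forall t, `|r t| <= K) -> Hb A w -> H x ->
  Hb (A * K) (Vg (fun t => vf w t * r (vf x t))
     (fun t => r (vf x t) *: vv w t + (vf w t * r' (vf x t)) *: vv x t)).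
Proof.
move=> hr hM hK [wA hw] hx.
set y := Vg _ _.
have M0 : 0 <= M by apply: le_trans (hM 0).
have K0 : 0 <= K by apply: le_trans (hK 0).
have [[w1 w2] _] := hw; have [x1 x2] := H_isL2 hx.
have SC : bddC A `<=` C by move=> f [].
have [om [So oc oae]] := Hcl_seq SC hw.
have [f [Cf fx fae]] := Hcl_seq (@subset_refl _ C) hx.
have Co n := SC _ (So n).
have oA n t : `|om n t| <= A by exact: (So n).2.
have mr : measf (fun t => r (vf x t)) by apply: mf_cont x1.1; exact: (C1_cont hr).
have mr' : measf (fun t => r' (vf x t)) by apply: mf_cont x1.1; exact: hr.2.
have L2y : isL2 y.
  split=> /=.
    by apply: (L2_bdd nufin (M := A * K)); [exact: mfM w1.1 mr|move=> t; rewrite normrM ler_pM].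
  apply: L2vD; first exact: (L2v_bM mr (fun t => hK _) w2).
  apply: (@L2v_bM (A * M)) => //; first exact: mfM w1.1 mr'.
  by move=> t; rewrite normrM ler_pM.
split; first by move=> t /=; rewrite normrM ler_pM.
(* A test class does not contain the nonzero constants in general, so om r(f) is written with r - r
   0, which maps test functions to test functions. *)
pose q n t := 1 * (om n t * (r (f n t) - r 0)) + r 0 * om n t.
have hr0 : C1fun (fun t => r t - r 0) r'.
  by apply: C1_eq (C1D hr (C1_cst (- r 0))) => // t; rewrite addr0.
have Cr n : C (fun t => r (f n t) - r 0).
  by apply: (tc_comp tc hr0 _ (Cf n)); rewrite subrr.
have Com n : C (fun t => om n t * (r (f n t) - r 0)) by exact: (tc_mul tc).
have Cro n : C (fun t => r 0 * om n t).
  have := tc_lin tc (r 0) (Co n) (tc_0 tc).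
  by under [X in C X -> _]eq_fun do rewrite addr0.
have Cq n : C (q n) by exact: (tc_lin tc).
have qE n t : q n t = om n t * r (f n t) by rewrite /q; ring.
have DqE n t : D (q n) t = r (f n t) *: D (om n) t + (om n t * r' (f n t)) *: D (f n) t.
  rewrite /q (tc_Dlin tc)// (tc_Dmul tc)//.
  have -> : (fun t => r 0 * om n t) = (fun t => r 0 * om n t + 0) by apply/funext => u; rewrite addr0.
  rewrite (tc_Dlin tc _ (Co n) (tc_0 tc)) D0 addr0.
  rewrite (tc_Dcomp tc hr0 _ (Cf n)) ?subrr//.
  by apply/rowP => j; rewrite !mxE; ring.
have SC' : bddC (A * K) `<=` C by move=> g [].
apply: (@Hcl_cvg _ _ (fun n => emb (q n)) SC' L2y).
  move=> n; apply: emb_Hcl; first exact: Cq.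
  by split => // t; rewrite qE normrM ler_pM.
pose a1 n t := (r (vf x t) - r (f n t)) ^+ 2 * (vf w t ^+ 2 + sq (vv w t)).
pose a2 n t := (vf w t * r' (vf x t) - om n t * r' (f n t)) ^+ 2 * sq (vv x t).
have Lw := E2_L1 hw.1.
have mf n := tc_mf tc (Cf n). have mo n := tc_mf tc (Co n).
have ma1 n : measf (a1 n).
  apply: mfM; last exact: L1_mf Lw.
  by apply: mfX; apply: mfB => //; apply: mf_cont => //; exact: (C1_cont hr).
have ma2 n : measf (a2 n).
  apply: mfM; last exact: L1_mf (L2v_sq x2).
  apply: mfX; apply: mfB; first exact: mfM w1.1 mr'.
  by apply: mfM => //; apply: mf_cont => //; exact: hr.2.
have b1 n t : 0 <= a1 n t <= (2 * K) ^+ 2 * (vf w t ^+ 2 + sq (vv w t)).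
  have h0 : 0 <= vf w t ^+ 2 + sq (vv w t) by rewrite addr_ge0 ?sqr_ge0 ?sq_ge0.
  rewrite mulr_ge0 ?sqr_ge0//=; apply: ler_wpM2r => //.
  rewrite -(real_normK (num_real (_ - _))) lerXn2r ?nnegrE ?mulr_ge0//.
  by apply: (le_trans (ler_normB _ _)); rewrite mulr_natl mulr2n lerD.
have b2 n t : 0 <= a2 n t <= (2 * (A * M)) ^+ 2 * sq (vv x t).
  rewrite mulr_ge0 ?sqr_ge0 ?sq_ge0//=; apply: ler_wpM2r; first exact: sq_ge0.
  have A0 : 0 <= A by apply: le_trans (wA t).
  rewrite -(real_normK (num_real (_ - _))) lerXn2r ?nnegrE ?mulr_ge0//.
  by apply: (le_trans (ler_normB _ _)); rewrite mulr_natl mulr2n !normrM lerD// ler_pM.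
have Lg1 := L1Z ((2 * K) ^+ 2) Lw. have Lg2 := L1Z ((2 * (A * M)) ^+ 2) (L2v_sq x2).
have c1 : I (a1 n) @[n --> \oo] --> (0 : R).
  apply: (I_dct0 ma1 Lg1 b1); apply: (aE_mp fae) => t ht.
  rewrite -(mul0r (vf w t ^+ 2 + sq (vv w t))); apply: cvgM; last exact: cvg_cst.
  apply: cvg_sq0; rewrite -(subrr (r (vf x t))); apply: cvgB; first exact: cvg_cst.
  exact: (cvg_C1 hr ht).
have c2 : I (a2 n) @[n --> \oo] --> (0 : R).
  apply: (I_dct0 ma2 Lg2 b2); apply: (aE_mp2 fae oae) => t ht ot.
  rewrite -(mul0r (sq (vv x t))); apply: cvgM; last exact: cvg_cst.
  apply: cvg_sq0; rewrite -(subrr (vf w t * r' (vf x t))); apply: cvgB; first exact: cvg_cst.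
  by apply: cvgM => //; exact: (cvg_C1' hr ht).
have La1 n : L1 (a1 n).
  by apply: (L1_dom (ma1 n) Lg1) => t; rewrite ger0_norm//; have /andP[] := b1 n t.
have La2 n : L1 (a2 n).
  by apply: (L1_dom (ma2 n) Lg2) => t; rewrite ger0_norm//; have /andP[] := b2 n t.
have cv := cvg_addR (cvg_addR (cvg_mulcR (4 * K ^+ 2) oc) (cvg_mulcR (4 * (A * M) ^+ 2) fx))
  (cvg_addR (cvg_mulcR 4 c1) (cvg_mulcR 4 c2)).
rewrite !mulr0 !addr0 in cv.
apply: (squeeze_cvgr _ (cvg_cst 0) cv); apply: nearW => n; rewrite E2_ge0 /=.
have Ldo := E2_L1 (isL2B hw.1 (emb_isL2 (Co n))).
have Ldf := E2_L1 (isL2B (H_isL2 hx) (emb_isL2 (Cf n))).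
have LP := L1Z (4 * K ^+ 2) Ldo; have LQ := L1Z (4 * (A * M) ^+ 2) Ldf.
have L3 := L1Z 4 (La1 n); have L4 := L1Z 4 (La2 n).
have -> : (4 * K ^+ 2 * E2 (w - emb (om n)) + 4 * (A * M) ^+ 2 * E2 (x - emb (f n))) +
   (4 * I (a1 n) + 4 * I (a2 n)) = I (fun t =>
   (4 * K ^+ 2 * (vf (w - emb (om n)) t ^+ 2 + sq (vv (w - emb (om n)) t)) +
    4 * (A * M) ^+ 2 * (vf (x - emb (f n)) t ^+ 2 + sq (vv (x - emb (f n)) t))) +
   (4 * a1 n t + 4 * a2 n t)).
  by rewrite (ID (L1D LP LQ) (L1D L3 L4)) (ID LP LQ) (ID L3 L4) (IZ _ Ldo) (IZ _ Ldf)
    (IZ _ (La1 n)) (IZ _ (La2 n)) !E2E.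
rewrite E2E; apply: I_le.
- by apply: E2_L1; apply: isL2B => //; apply: emb_isL2.
- exact: L1D (L1D LP LQ) (L1D L3 L4).
move=> t; rewrite !vgE /= qE DqE /a1 /a2.
set p := r (vf x t); set p' := r' (vf x t); set s := r (f n t); set s' := r' (f n t).
set v := vf x t; set g := vv x t; set u := vf w t; set h := vv w t.
set Of := om n t; set Ff := f n t; set DO := D (om n) t; set DF := D (f n) t.
have e1 : u * p - Of * s = s * (u - Of) + u * (p - s) by ring.
have e2 : p *: h + (u * p') *: g - (s *: DO + (Of * s') *: DF) =
   (s *: (h - DO) + (p - s) *: h) + ((Of * s') *: (g - DF) + (u * p' - Of * s') *: g).
  apply/rowP => i; rewrite !mxE; ring.
have s2 : s ^+ 2 <= K ^+ 2.
  by rewrite -(real_normK (num_real s)) lerXn2r ?nnegrE// hK.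
have os2 : (Of * s') ^+ 2 <= (A * M) ^+ 2.
  have A0 : 0 <= A by apply: le_trans (wA t).
  by rewrite -(real_normK (num_real (Of * s'))) lerXn2r ?nnegrE ?mulr_ge0// normrM;
    apply: ler_pM => //; [exact: oA|exact: hM].
rewrite e1 e2.
have h1 := sqD (s *: (h - DO) + (p - s) *: h) ((Of * s') *: (g - DF) + (u * p' - Of * s') *: g).
have h2 := sqD (s *: (h - DO)) ((p - s) *: h).
have h3 := sqD ((Of * s') *: (g - DF)) ((u * p' - Of * s') *: g).
rewrite !sqZ in h2 h3.
have h4 : (s * (u - Of) + u * (p - s)) ^+ 2 <=
   2 * (s ^+ 2 * (u - Of) ^+ 2) + 2 * ((p - s) ^+ 2 * u ^+ 2).
  have := sqr_ge0 (s * (u - Of) - u * (p - s)).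
  by move: (u - Of) (p - s) => X Y; nra.
have k1 := ler_wpM2r (sqr_ge0 (u - Of)) s2.
have k2 := ler_wpM2r (sq_ge0 (h - DO)) s2.
have k3 := ler_wpM2r (sq_ge0 (g - DF)) os2.
have k4 := mulr_ge0 (sqr_ge0 (A * M)) (sqr_ge0 (v - Ff)).
have k5 := mulr_ge0 (sqr_ge0 (p - s)) (sqr_ge0 u).
have k6 := mulr_ge0 (sqr_ge0 K) (sqr_ge0 (u - Of)).
move: h1 h2 h3 h4 k1 k2 k3 k4 k5 k6.
rewrite !mulrDr.
move: (sq (_ + _ + _)) (sq (s *: _ + _)) (sq ((Of * s') *: _ + _)) ((_ + _) ^+ 2).
move=> X1 X2 X3 X4.
move: (s ^+ 2 * _) (s ^+ 2 * _) ((Of * s') ^+ 2 * _) ((p - s) ^+ 2 * _) ((p - s) ^+ 2 * _).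
move=> m0 m1 m2 m3 m4; lra.
Qed.

Lemma E2_cvg_f (x : VG) (f : nat -> VG) : isL2 x -> (forall n, isL2 (f n)) ->
  E2 (x - f n) @[n --> \oo] --> (0 : R) ->
  I (fun t => (vf x t - vf (f n) t) ^+ 2) @[n --> \oo] --> (0 : R).
Proof.
move=> hx hf hc; apply: (squeeze_cvgr _ (cvg_cst 0) hc); apply: nearW => n.
rewrite I_sq_ge0 E2E /=; apply: I_le.
- exact: (L2B hx.1 (hf n).1).2.
- exact: E2_L1 (isL2B hx (hf n)).
- by move=> t; rewrite lerDl sq_ge0.
Qed.

Lemma E2_cvg_v (x : VG) (f : nat -> VG) i : isL2 x -> (forall n, isL2 (f n)) ->
  E2 (x - f n) @[n --> \oo] --> (0 : R) ->
  I (fun t => (vv x t ord0 i - vv (f n) t ord0 i) ^+ 2) @[n --> \oo] --> (0 : R).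
Proof.
move=> hx hf hc; apply: (squeeze_cvgr _ (cvg_cst 0) hc); apply: nearW => n.
rewrite I_sq_ge0 E2E /=; apply: I_le.
- exact: (L2B (hx.2 i) ((hf n).2 i)).2.
- exact: E2_L1 (isL2B hx (hf n)).
- move=> t; apply: ler_wpDl; first exact: sqr_ge0.
  by have := sq_coord (vv x t - vv (f n) t) i; rewrite !mxE.
Qed.

Lemma H_weak x f i : H x -> C f ->
  I (fun t => vv x t ord0 i * f t) = - I (fun t => vf x t * D f t ord0 i).
Proof.
move=> hx Cf; have hf := emb_isL2 Cf; have h2 := H_isL2 hx.
have [g [Cg gc _]] := Hcl_seq (@subset_refl _ C) hx.
have hg n := emb_isL2 (Cg n).
have c1 := cvg_L2M (fun n => L2B (h2.2 i) ((hg n).2 i)) hf.1 (E2_cvg_v i h2 hg gc).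
have c2 := cvg_L2M (fun n => L2B h2.1 (hg n).1) (hf.2 i) (E2_cvg_f h2 hg gc).
suff e n : I (fun t => (vv x t ord0 i - vv (emb (g n)) t ord0 i) * vf (emb f) t) +
    I (fun t => (vf x t - vf (emb (g n)) t) * vv (emb f) t ord0 i) =
    I (fun t => vv x t ord0 i * f t) + I (fun t => vf x t * D f t ord0 i).
  apply/eqP; rewrite -addr_eq0; apply/eqP.
  have cc : I (fun t => vv x t ord0 i * f t) + I (fun t => vf x t * D f t ord0 i) @[n --> \oo] --> (0 + 0 : R).
    rewrite [X in X @ _ --> _](_ : _ = fun n =>
      I (fun t => (vv x t ord0 i - vv (emb (g n)) t ord0 i) * vf (emb f) t) +
      I (fun t => (vf x t - vf (emb (g n)) t) * vv (emb f) t ord0 i)).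
      exact: cvgD c1 c2.
    by apply/funext => n; rewrite e.
  by rewrite addr0 in cc; rewrite -(cvg_lim _ cc)// lim_cst.
have L1a := L2M (h2.2 i) hf.1. have L1b := L2M h2.1 (hf.2 i).
have L1c := L2M ((hg n).2 i) hf.1. have L1d := L2M (hg n).1 (hf.2 i).
have ib : I (fun t => vv (emb (g n)) t ord0 i * f t) + I (fun t => vf (emb (g n)) t * D f t ord0 i) = 0.
  rewrite -ID//; rewrite -(tc_ibp tc i (tc_mul tc (Cg n) Cf)) (tc_Dmul tc (Cg n) Cf).
  by apply: I_eq => t /=; rewrite !mxE; ring.
have -> : I (fun t => (vv x t ord0 i - vv (emb (g n)) t ord0 i) * vf (emb f) t) =
    I (fun t => vv x t ord0 i * f t) - I (fun t => vv (emb (g n)) t ord0 i * f t).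
  by rewrite -IB//; apply: I_eq => t; rewrite mulrBl.
have -> : I (fun t => (vf x t - vf (emb (g n)) t) * vv (emb f) t ord0 i) =
    I (fun t => vf x t * D f t ord0 i) - I (fun t => vf (emb (g n)) t * D f t ord0 i).
  by rewrite -IB//; apply: I_eq => t; rewrite mulrBl.
by rewrite addrACA -opprD ib subr0.
Qed.

(** Elements of [H] satisfy the integration by parts formula, so if the function vanishes its
    gradient vanishes against every test function. *)
Lemma H_closable x : H x -> aE (fun t => vf x t = 0) -> aE (fun t => vv x t = 0).
Proof.
move=> hx h0; have h2 := H_isL2 hx.
have hi i : aE (fun t => vv x t ord0 i = 0).
  apply: (tc_fl tc); first exact: L2_L1 (h2.2 i).
  move=> f Cf; rewrite (H_weak i hx Cf) (I_eq_ae (g := fun=> 0)) ?I_0 ?oppr0//.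
  - by apply: mfM; [exact: h2.1.1|exact: (tc_mfD tc i Cf)].
  - exact: measf_cst0.
  - by apply: (aE_mp h0) => t ->; rewrite mul0r.
by have := aE_fin hi => h; apply: (aE_mp h) => t ht; apply/rowP => i; rewrite ht mxE.
Qed.

Lemma isL2_ae x y : measf (vf y) -> (forall i, measf (fun t => vv y t ord0 i)) ->
  aE (fun t => vf x t = vf y t) -> aE (fun t => vv x t = vv y t) -> isL2 x -> isL2 y.
Proof.
move=> m1 m2 e1 e2 [x1 x2]; split; first exact: L2_eq_ae e1 x1.
move=> i; apply: L2_eq_ae (x2 i) => //.
by apply: (aE_mp e2) => t ->.
Qed.

Lemma E2_ae x y : isL2 x -> isL2 y ->
  aE (fun t => vf x t = vf y t) -> aE (fun t => vv x t = vv y t) -> E2 (x - y) = 0.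
Proof.
move=> hx hy e1 e2; rewrite E2E -(I_0 nu); apply: I_eq_ae.
- exact: L1_mf (E2_L1 (isL2B hx hy)).
- exact: measf_cst0.
- apply: (aE_mp2 e1 e2) => t h1 h2; rewrite !vgE h1 h2 !subrr sq0 expr0n addr0//.
Qed.

Lemma Hcl_ae S x y : S `<=` C -> measf (vf y) -> (forall i, measf (fun t => vv y t ord0 i)) ->
  aE (fun t => vf x t = vf y t) -> aE (fun t => vv x t = vv y t) -> Hcl S x -> Hcl S y.
Proof.
move=> SC m1 m2 e1 e2 hx; have hy := isL2_ae m1 m2 e1 e2 hx.1.
apply: Hcl_closed => // e e0; exists x => //.
by rewrite E2BC (E2_ae hx.1 hy e1 e2) ltW.
Qed.

(* n^-1 atan(n v) tends to 0 and its gradient to the restriction of the gradient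
   of v to {v = 0}. *)
Lemma H_grad0 x : H x -> aE (fun t => vf x t = 0 -> vv x t = 0).
Proof.
move=> hx; have h2 := H_isL2 hx.
pose r n (t : R) := n.+1%:R^-1 * atan (n.+1%:R * t).
pose r' n (t : R) := (1 + (n.+1%:R * t) ^+ 2)^-1.
have hr n : C1fun (r n) (r' n).
  apply: C1_eq (C1Z n.+1%:R^-1 (C1_comp C1_atan (C1Z n.+1%:R C1_id))) => // t.
  by rewrite mulr1 mulrC mulfK// pnatr_eq0.
have d1 n (t : R) : 1 <= 1 + (n.+1%:R * t) ^+ 2 by rewrite lerDl sqr_ge0.
have r1 n (t : R) : 0 <= r' n t <= 1.
  by rewrite invr_ge0 invf_le1 ?d1 ?andbT ?(le_trans ler01) ?(lt_le_trans ltr01).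
have rb n (t : R) : `|r' n t| <= 1 by have /andP[a b] := r1 n t; rewrite ger0_norm.
have r0 n : r n 0 = 0 by rewrite /r mulr0 atan0 mulr0.
have hy n := H_comp (hr n) (rb n) (r0 n) hx.
pose y n : VG := Vg (fun t => r n (vf x t)) (fun t => r' n (vf x t) *: vv x t).
pose ind t : R := (vf x t == 0)%:R.
have mind : measf ind.
  rewrite (_ : ind = \1_(vf x @^-1` [set 0])).
    by apply: mf_ind; rewrite -[X in measurable X]setTI; apply: h2.1.1.
  by apply/funext => t; rewrite indicE /ind; congr (nat_of_bool _)%:R; apply/idP/idP;
    rewrite inE => /eqP.
have i1 t : `|ind t| <= 1 by rewrite /ind; case: (_ == _); rewrite ?normr0 ?normr1.
pose z : VG := Vg (fun=> 0) (fun t => ind t *: vv x t).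
have hz2 : isL2 z by split=> /=; [exact: L2_0|exact: (L2v_bM mind i1 h2.2)].
have hz : H z.
  apply: (@Hcl_cvg _ _ y (@subset_refl _ C) hz2 hy).
  rewrite -(I_0 nu); under eq_cvg do rewrite E2E.
  have Lg := E2_L1 h2.
  have [] // := @I_dct _ _ _ nu (fun n t => vf (z - y n) t ^+ 2 + sq (vv (z - y n) t)) (fun=> 0) _ _ _ Lg.
  - by move=> n; exact: L1_mf (E2_L1 (isL2B hz2 (H_isL2 (hy n)))).
  - exact: measf_cst0.
  - apply: aE_all => t.
    have inv0 : (n.+1%:R^-1 : R) @[n --> \oo] --> (0 : R) by exact: cvg_harmonic.
    rewrite -(addr0 0); apply: cvgD.
      apply: cvg_sq0; rewrite -oppr0.
      rewrite (_ : (fun n => vf (z - y n) t) = fun n => - r n (vf x t)); last first.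
        by apply/funext => n; exact: sub0r.
      apply: cvgN.
      apply/cvg_epsP => e e0.
      have /cvg_epsP/(_ (e / pi))[|M hM] := inv0; first by rewrite divr_gt0 ?pi_gt0.
      exists M => n Mn; have := hM n Mn; rewrite !subr0 /r normrM => hn.
      have h3 : `|atan (n.+1%:R * vf x t)| <= pi :> R.
        have := atan_gtNpi2 (n.+1%:R * vf x t); have := atan_ltpi2 (n.+1%:R * vf x t).
        by have := pi_gt0 R; rewrite ler_norml; lra.
      by apply: (le_trans (ler_pM _ _ hn h3)) => //; rewrite divfK// gt_eqF// pi_gt0.
    rewrite (_ : (fun n => sq (vv (z - y n) t)) =
      fun n => (ind t - r' n (vf x t)) ^+ 2 * sq (vv x t)); last first.
      by apply/funext => n; rewrite !vgE /z /y /= -scalerBl sqZ.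
    rewrite -(mul0r (sq (vv x t))); apply: cvgM; last exact: cvg_cst.
    apply: cvg_sq0; rewrite /ind; have [v0|v0] := eqVneq (vf x t) 0.
      by under eq_cvg do rewrite v0 /r' mulr0 expr0n addr0 invr1 subrr; exact: cvg_cst.
    rewrite -[X in X @ _ --> _]/(fun n => 0 - r' n (vf x t)).
    rewrite (_ : (fun n => _) = fun n => - r' n (vf x t)); last by apply/funext => n; rewrite sub0r.
    rewrite -oppr0; apply: cvgN.
    have v2 : 0 < vf x t ^+ 2 by rewrite lt_neqAle eq_sym sqrf_eq0 v0 sqr_ge0.
    have cc : (vf x t ^+ 2)^-1 * n.+1%:R^-1 @[n --> \oo] --> (0 : R).
      by rewrite -(mulr0 (vf x t ^+ 2)^-1); apply: cvgM => //; exact: cvg_cst.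
    apply: (squeeze_cvgr _ (cvg_cst 0) cc); apply: nearW => n.
    have /andP[-> _] := r1 n (vf x t); rewrite /= -invfM.
    have p1 : 0 < vf x t ^+ 2 * n.+1%:R by rewrite mulr_gt0.
    have p2 : 0 < 1 + (n.+1%:R * vf x t) ^+ 2 by exact: lt_le_trans ltr01 (d1 n (vf x t)).
    rewrite lef_pV2 ?posrE//.
    have nn : (n.+1%:R : R) <= n.+1%:R ^+ 2 by rewrite -natrX ler_nat expnS leq_pmulr.
    by rewrite exprMn; have := ler_wpM2r (ltW v2) nn; lra.
  - move=> n; apply: aE_all => t; rewrite ger0_norm ?addr_ge0 ?sqr_ge0 ?sq_ge0//.
    have -> : vf (z - y n) t = - r n (vf x t) by exact: sub0r.
    have -> : vv (z - y n) t = (ind t - r' n (vf x t)) *: vv x t by rewrite scalerBl.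
    rewrite sqrrN sqZ; apply: lerD.
      have := lip_sq (hr n) (rb n) (vf x t) 0.
      by rewrite r0 !subr0 expr1n mul1r.
    rewrite -[leRHS]mul1r; apply: ler_wpM2r; first exact: sq_ge0.
    have /andP[a1 a2] := r1 n (vf x t).
    have i01 : 0 <= ind t <= 1 by rewrite /ind; case: (_ == _); rewrite ?lexx ?ler01.
    by move: a1 a2 i01; move: (ind t) (r' n (vf x t)) => p q; nra.
have := H_closable hz (aE_all _ _) => h.
apply: (aE_mp (h _)) => // t /= + v0; rewrite /ind v0 eqxx scale1r//.
Qed.

Lemma H_poincare : exists2 K, 0 < K & forall x, H x ->
  I (fun t => vf x t ^+ 2) <= K * I (fun t => sq (vv x t)).
Proof.
have [K K0 hK] := tc_poincare tc.
(* The factor 4 comes from two uses of (a + b)^2 <= 2 a^2 + 2 b^2, and the summand 1 makes the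
   constant positive. *)
exists (4 * K + 1); first lra.
move=> x hx; have h2 := H_isL2 hx.
have A0 : 0 <= I (fun t => sq (vv x t)) by apply: I_ge0 => t; exact: sq_ge0.
suff h : I (fun t => vf x t ^+ 2) <= 4 * K * I (fun t => sq (vv x t)).
  by rewrite mulrDl mul1r (le_trans h)// lerDl.
apply/ler_addgt0Pr => e e0.
have e1 : 0 < e / (2 + 4 * K) by rewrite divr_gt0//; lra.
have [f Cf xf] := hx.2 _ e1.
have hf := emb_isL2 Cf.
have sp := E2_split (isL2B h2 hf).
have i1 : I (fun t => vf x t ^+ 2) <=
    2 * I (fun t => vf (x - emb f) t ^+ 2) + 2 * I (fun t => f t ^+ 2).
  rewrite -!IZ ?(hf.1.2)//; last exact: (L2B h2.1 hf.1).2.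
  rewrite -ID; [|apply: L1Z; exact: (L2B h2.1 hf.1).2|apply: L1Z; exact: hf.1.2].
  apply: I_le; first exact: h2.1.2.
    by apply: L1D; apply: L1Z; [exact: (L2B h2.1 hf.1).2|exact: hf.1.2].
  move=> t; rewrite !vgE /=; have := sqr_ge0 (vf x t - 2 * f t); nra.
have i2 : I (fun t => sq (D f t)) <=
    2 * I (fun t => sq (vv (x - emb f) t)) + 2 * I (fun t => sq (vv x t)).
  have La := L2v_sq (isL2B h2 hf).2; have Lb := L2v_sq h2.2.
  rewrite -!IZ// -ID; [|exact: L1Z|exact: L1Z].
  apply: I_le; first exact: (L2v_sq hf.2).
    by apply: L1D; exact: L1Z.
  move=> t; rewrite !vgE /=; have := sqB (vv x t) (vv x t - D f t).
  by rewrite opprB addrCA subrr addr0 [X in _ <= X]addrC.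
have i3 := hK f Cf.
have p1 : 0 <= I (fun t => vf (x - emb f) t ^+ 2) by exact: I_sq_ge0.
have p2 : 0 <= I (fun t => sq (vv (x - emb f) t)) by apply: I_ge0 => t; exact: sq_ge0.
have xf' : (2 + 4 * K) * E2 (x - emb f) <= e.
  by rewrite mulrC -ler_pdivlMr//; lra.
rewrite sp in xf'.
move: i1 i2 i3 p1 p2 xf'.
move: (I _) (I _) (I _) (I _) (I _) => a b c g k.
nra.
Qed.

End space.

Lemma cvg_cstR {R : realType} (c : R) : (fun _ : nat => c) @ \oo --> c.
Proof. exact: cvg_cst. Qed.
Arguments cvg_cstR {R} c.

Lemma cvg_uniq {R : realType} (u : nat -> R) (a b : R) :
  u n @[n --> \oo] --> a -> u n @[n --> \oo] --> b -> a = b.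
Proof. by move=> ha hb; rewrite -(cvg_lim _ ha)// -(cvg_lim _ hb). Qed.

(** * The linear part as a bilinear form, and Riesz representation for it *)

Section energy.
Context {d : measure_display} {T : measurableType d} {R : realType}.
Variable nu : {measure set T -> \bar R}.
Hypothesis nufin : (nu setT < +oo)%E.
Context {N : nat}.
Variables (C : set (T -> R)) (D : (T -> R) -> T -> 'rV[R]_N).
Hypothesis tc : test_class nu C D.
Notation L1 := (L1 nu).
Notation L2 := (L2 nu).
Notation I := (I nu).
Notation aE := (aE nu).
Notation VG := (vg T R N).
Notation isL2 := (@isL2 _ T R nu N).
Notation E2 := (@E2 _ T R nu N).
Notation H := (H nu C D).

Variables (alpha beta : R) (b : T -> R).
Hypothesis alpha0 : 0 < alpha.
Hypothesis mb : measf b.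
Hypothesis hb : forall t, alpha <= b t <= beta.

Let ba t : alpha <= b t. Proof. by have /andP[] := hb t. Qed.
Let bb t : b t <= beta. Proof. by have /andP[] := hb t. Qed.
Let b0 t : 0 < b t. Proof. exact: lt_le_trans alpha0 (ba t). Qed.
Let bn t : `|b t| <= beta. Proof. by rewrite ger0_norm// ltW. Qed.

(** Only lam = 0 belongs to the equation; for lam > 0 the form is equivalent to [E2], hence
    complete. *)
Definition en (lam : R) (x y : VG) :=
  I (fun t => b t * dotr (vv x t) (vv y t) + lam * (vf x t * vf y t)).

Lemma en_L1g x y : isL2 x -> isL2 y -> L1 (fun t => b t * dotr (vv x t) (vv y t)).
Proof. by move=> hx hy; apply: (L1_bM mb bn); exact: L2v_dot hx.2 hy.2. Qed.

Lemma en_L1 lam x y : isL2 x -> isL2 y ->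
  L1 (fun t => b t * dotr (vv x t) (vv y t) + lam * (vf x t * vf y t)).
Proof.
by move=> hx hy; apply: L1D; [exact: en_L1g|apply: L1Z; exact: L2M hx.1 hy.1].
Qed.

Lemma en_split lam x y : isL2 x -> isL2 y ->
  en lam x y = en 0 x y + lam * I (fun t => vf x t * vf y t).
Proof.
move=> hx hy; rewrite /en -IZ; last exact: L2M hx.1 hy.1.
rewrite -ID; [|exact: en_L1|by apply: L1Z; exact: L2M hx.1 hy.1].
by apply: I_eq => t; ring.
Qed.

Lemma en0E x y : en 0 x y = I (fun t => b t * dotr (vv x t) (vv y t)).
Proof. by apply: I_eq => t; rewrite mul0r addr0. Qed.

Lemma enC lam x y : en lam x y = en lam y x.
Proof. by apply: I_eq => t; rewrite dotrC (mulrC (vf x t)). Qed.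

Lemma enP lam a x y z : isL2 x -> isL2 y -> isL2 z ->
  en lam (a *: x + y) z = a * en lam x z + en lam y z.
Proof.
move=> hx hy hz; rewrite /en -IZ; last exact: en_L1.
rewrite -ID; [|by apply: L1Z; exact: en_L1|exact: en_L1].
by apply: I_eq => t; rewrite !vgE dotrDl dotrZl; ring.
Qed.

Lemma enPr lam a x y z : isL2 x -> isL2 y -> isL2 z ->
  en lam z (a *: x + y) = a * en lam z x + en lam z y.
Proof. by move=> *; rewrite enC enP// !(enC lam z). Qed.

Lemma enB lam x y z : isL2 x -> isL2 y -> isL2 z ->
  en lam (x - y) z = en lam x z - en lam y z.
Proof.
move=> hx hy hz; rewrite addrC -scaleN1r enP//; ring.
Qed.

Lemma en_ge0 lam x : 0 <= lam -> 0 <= en lam x x.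
Proof.
move=> l0; apply: I_ge0 => t; rewrite addr_ge0//; first by rewrite mulr_ge0 ?sq_ge0 ?(ltW (b0 t)).
by rewrite -expr2 mulr_ge0 ?sqr_ge0.
Qed.

Lemma en_coer lam x : 0 <= lam -> isL2 x ->
  alpha * I (fun t => sq (vv x t)) + lam * I (fun t => vf x t ^+ 2) <= en lam x x.
Proof.
move=> l0 hx; have h1 := L2v_sq hx.2; have h2 := hx.1.2.
rewrite -!IZ// -ID; [|exact: L1Z|exact: L1Z].
apply: I_le; [by apply: L1D; exact: L1Z|exact: en_L1|].
by move=> t; rewrite -expr2 lerD2r; apply: ler_wpM2r => //; exact: sq_ge0.
Qed.

Lemma en_E2 lam x : 0 < lam -> isL2 x -> E2 x <= (alpha^-1 + lam^-1) * en lam x x.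
Proof.
move=> l0 hx; have := en_coer (ltW l0) hx; rewrite E2_split//.
have g0 : 0 <= I (fun t => sq (vv x t)) by apply: I_ge0 => t; exact: sq_ge0.
have v0 : 0 <= I (fun t => vf x t ^+ 2) by exact: I_sq_ge0.
move: g0 v0; set g := I (fun t => sq _); set v := I (fun t => _ ^+ 2); set Q := en _ _ _ => g0 v0 h.
have ai : 0 < alpha^-1 by rewrite invr_gt0.
have li : 0 < lam^-1 by rewrite invr_gt0.
have h1 := ler_wpM2l (ltW ai) h; have h2 := ler_wpM2l (ltW li) h.
rewrite !mulrDr !mulrA !mulVf ?gt_eqF// !mul1r in h1 h2.
have p1 : 0 <= alpha^-1 * lam * v by rewrite !mulr_ge0// ltW.
have p2 : 0 <= lam^-1 * alpha * g by rewrite !mulr_ge0// ltW.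
by rewrite mulrDl; move: h1 h2 p1 p2; lra.
Qed.

Lemma en_leE2 lam x : 0 <= lam -> isL2 x -> en lam x x <= (beta + lam) * E2 x.
Proof.
move=> l0 hx; rewrite E2E -IZ; last exact: E2_L1.
apply: I_le; [exact: en_L1|by apply: L1Z; exact: E2_L1|].
move=> t; rewrite -expr2 -/(sq _).
have be0 : 0 <= beta by exact: le_trans (ltW (b0 t)) (bb t).
have := ler_wpM2r (sq_ge0 (vv x t)) (bb t).
have := mulr_ge0 be0 (sqr_ge0 (vf x t)); have := mulr_ge0 l0 (sq_ge0 (vv x t)).
by move: (sq _) (vf x t ^+ 2) => p q; lra.
Qed.

Let E0 lam : forall x, H x -> 0 <= lam -> 0 <= en lam x x.
Proof. by move=> x _; exact: en_ge0. Qed.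

Lemma en_complete lam (x : nat -> VG) : 0 < lam -> (forall n, H (x n)) ->
  (forall e : R, 0 < e -> exists M, forall n m, (M <= n)%N -> (M <= m)%N ->
     en lam (x n - x m) (x n - x m) <= e) ->
  exists2 y, H y & en lam (x n - y) (x n - y) @[n --> \oo] --> (0 : R).
Proof.
move=> l0 hx hc.
set k := alpha^-1 + lam^-1.
have k0 : 0 < k by rewrite addr_gt0 ?invr_gt0.
have [|y hy hcy] := H_complete nufin tc hx.
  move=> e e0; have [M hM] := hc (e / k) (divr_gt0 e0 k0).
  exists M => n m Mn Mm; have hd := isL2B (H_isL2 (hx n)) (H_isL2 (hx m)).
  apply: (le_trans (en_E2 l0 hd)).
  by rewrite -/k mulrC -ler_pdivlMr//; exact: hM.
exists y => //.
have c2 := cvg_mulcR (beta + lam) hcy; rewrite mulr0 in c2.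
apply: (squeeze_cvgr _ (cvg_cst 0) c2); apply: nearW => n.
have hd := isL2B (H_isL2 (hx n)) (H_isL2 hy).
by apply/andP; split; [apply: en_ge0; exact: ltW|apply: en_leE2 => //; exact: ltW].
Qed.

Lemma riesz_H lam (l : VG -> R) K : 0 < lam -> linear_on H l ->
  (forall x, H x -> l x <= K + 4^-1 * en lam x x) ->
  exists2 y, H y & forall z, H z -> en lam y z = l z.
Proof.
move=> l0; apply: riesz_min.
- exact: (H0 nufin tc).
- by move=> a x y; exact: (HP nufin tc).
- exact: enC.
- by move=> a x y z /H_isL2 hx /H_isL2 hy /H_isL2 hz; exact: enP.
- by move=> x _; apply: en_ge0; exact: ltW.
- by move=> x; exact: en_complete.
Qed.

Lemma cvg_en lam (x : nat -> VG) y z : (forall n, isL2 (x n)) -> isL2 y -> isL2 z ->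
  E2 (y - x n) @[n --> \oo] --> (0 : R) -> en lam (x n) z @[n --> \oo] --> en lam y z.
Proof.
move=> hx hy hz hc.
have cf := cvg_L2M (fun n => L2B hy.1 (hx n).1) hz.1 (E2_cvg_f hy hx hc).
have cv i : I (fun t => (vv y t ord0 i - vv (x n) t ord0 i) * (b t * vv z t ord0 i)) @[n --> \oo] --> (0 : R).
  apply: cvg_L2M; [by move=> n; exact: (L2B (hy.2 i) ((hx n).2 i))|exact: (L2_bM mb bn (hz.2 i))|exact: E2_cvg_v].
have c1 := cvg_addR (cvg_bigsum (s := index_enum 'I_N) cv) (cvg_mulcR lam cf).
rewrite mulr0 addr0 big1_eq in c1.
have c2 := cvg_addR (cvg_cstR (en lam y z)) (cvg_mulcR (-1) c1); rewrite mulr0 addr0 in c2.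
rewrite (_ : (fun n => en lam (x n) z) = fun n => en lam y z + -1 *
    (\sum_i I (fun t => (vv y t ord0 i - vv (x n) t ord0 i) * (b t * vv z t ord0 i)) +
    lam * I (fun t => (vf y t - vf (x n) t) * vf z t))); first exact: c2.
apply/funext => n.
rewrite -I_sum; last by move=> i; apply: L2M; [exact: (L2B (hy.2 i) ((hx n).2 i))|exact: (L2_bM mb bn (hz.2 i))].
rewrite -IZ; last exact: L2M (L2B hy.1 (hx n).1) hz.1.
have e : I (fun t => \sum_i (vv y t ord0 i - vv (x n) t ord0 i) * (b t * vv z t ord0 i)) +
  I (fun t => lam * ((vf y t - vf (x n) t) * vf z t)) = en lam (y - x n) z.
  rewrite -ID.
  - apply: I_eq => t; rewrite !vgE; congr (_ + _).
    rewrite /dotr mulr_sumr; apply: eq_bigr => i _; rewrite !mxE; ring.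
  - apply: L1_sum => i; apply: L2M; [exact: (L2B (hy.2 i) ((hx n).2 i))|exact: (L2_bM mb bn (hz.2 i))].
  - by apply: L1Z; exact: L2M (L2B hy.1 (hx n).1) hz.1.
by rewrite e enB//; ring.
Qed.

End energy.

(** * Weak sequential closedness of the energy space *)

Section weak_closure.
Context {d : measure_display} {T : measurableType d} {R : realType}.
Variable nu : {measure set T -> \bar R}.
Hypothesis nufin : (nu setT < +oo)%E.
Context {N : nat}.
Variables (C : set (T -> R)) (D : (T -> R) -> T -> 'rV[R]_N).
Hypothesis tc : test_class nu C D.
Notation L1 := (L1 nu).
Notation L2 := (L2 nu).
Notation I := (I nu).
Notation aE := (aE nu).
Notation VG := (vg T R N).
Notation isL2 := (@isL2 _ T R nu N).
Notation E2 := (@E2 _ T R nu N).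
Notation H := (H nu C D).

Let one : T -> R := fun=> 1.
Let m1 : measf one. Proof. exact: measurable_cst. Qed.
Let h1 (t : T) : (1 : R) <= one t <= 1. Proof. by rewrite lexx. Qed.
Let P (x y : VG) := en nu one 1 x y.

Let PE x : P x x = E2 x.
Proof. by rewrite E2E; apply: I_eq => t; rewrite !mul1r -expr2 addrC. Qed.

(* y has the same inner products with H as its projection onto H; this replaces
   weak compactness. *)
Lemma H_weak_closed (x : nat -> VG) y K : (forall n, H (x n)) ->
  measf (vf y) -> (forall i, measf (fun t => vv y t ord0 i)) ->
  (forall n, E2 (x n) <= K) ->
  aE (fun t => vf (x n) t @[n --> \oo] --> vf y t) ->
  aE (fun t => forall i, vv (x n) t ord0 i @[n --> \oo] --> vv y t ord0 i) ->
  H y /\ E2 y <= K.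
Proof.
move=> hx my1 my2 hK c1 c2.
have hx2 n := H_isL2 (hx n).
have fat1 : L1 (fun t => vf y t ^+ 2 + sq (vv y t)) /\
    I (fun t => vf y t ^+ 2 + sq (vv y t)) <= K.
  apply: (@I_fatou _ _ _ nu (fun n t => vf (x n) t ^+ 2 + sq (vv (x n) t)) _ (fun=> K)).
  - by move=> n; exact: E2_L1.
  - apply: mfD; first exact: mfX.
    by apply: mf_sum => i; exact: mfM.
  - by move=> n t; rewrite addr_ge0 ?sqr_ge0 ?sq_ge0.
  - by move=> t; rewrite addr_ge0 ?sqr_ge0 ?sq_ge0.
  - apply: (aE_mp2 c1 c2) => t ht ht2.
    apply: cvg_addR; first exact: cvg_sqr.
    rewrite sqE; under eq_cvg do rewrite sqE.
    by apply: (cvg_bigsum (u := fun i n => vv (x n) t ord0 i ^+ 2)) => i; exact: cvg_sqr.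
  - by move=> n; rewrite -E2E; exact: hK.
  - exact: cvg_cst.
have hy : isL2 y.
  split; first split => //.
    apply: (L1_dom _ fat1.1); first exact: mfX.
    by move=> t; rewrite ger0_norm ?sqr_ge0// lerDl sq_ge0.
  move=> i; split => //; apply: (L1_dom _ fat1.1); first exact: mfX.
  by move=> t; rewrite ger0_norm ?sqr_ge0//; apply: ler_wpDl; [exact: sqr_ge0|exact: sq_coord].
split; last by rewrite E2E; exact: fat1.2.
have [||z hz hzy] := @riesz_H _ T R nu nufin N C D tc 1 1 one ltr01 m1 h1 1 (P y) (P y y) ltr01.
- by move=> a u v /H_isL2 hu /H_isL2 hv; rewrite /P (enPr (beta := 1) ltr01 m1 h1).
- move=> u hu; have hu2 := H_isL2 hu.
  have : 0 <= P (- (2^-1) *: u + y) (- (2^-1) *: u + y) by rewrite PE E2_ge0.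
  have hcu : isL2 (- (2^-1) *: u + y) by exact: isL2P.
  rewrite /P (enP (beta := 1) ltr01 m1 h1)// !(enPr (beta := 1) ltr01 m1 h1)//.
  rewrite (enC _ _ _ u y); move: (en nu one 1 u u) (en nu one 1 y u) (en nu one 1 y y) => p q r; lra.
have hz2 := H_isL2 hz.
pose w := y - z.
have hw : isL2 w by exact: isL2B.
have Pw u : H u -> P w u = 0.
  by move=> hu; have hu2 := H_isL2 hu; rewrite /P /w (enB (beta := 1) ltr01 m1 h1)// hzy// subrr.
have wx : P (x n - y) w @[n --> \oo] --> (0 : R).
  have bnd (u : nat -> T -> R) (l : T -> R) : L2 l -> (forall n, L2 (u n)) ->
      (forall n t, u n t ^+ 2 <= vf (x n) t ^+ 2 + sq (vv (x n) t)) ->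
      forall n, I (fun t => (u n t - l t) ^+ 2) <= 2 * K + 2 * I (fun t => l t ^+ 2).
    move=> hl hu ule n.
    have hd := L2B (hu n) hl.
    apply: (@le_trans _ _ (2 * I (fun t => u n t ^+ 2) + 2 * I (fun t => l t ^+ 2))).
      rewrite -!IZ; [|exact: hl.2|exact: (hu n).2].
      rewrite -ID; [|apply: L1Z; exact: (hu n).2|apply: L1Z; exact: hl.2].
      apply: I_le; [exact: hd.2|apply: L1D; apply: L1Z; [exact: (hu n).2|exact: hl.2]|].
      by move=> t; have := sqr_ge0 (u n t + l t); nra.
    rewrite lerD2r ler_pM2l//; apply: le_trans (hK n); rewrite E2E.
    by apply: I_le; [exact: (hu n).2|exact: E2_L1|exact: ule].
  have cf : I (fun t => (vf (x n) t - vf y t) * vf w t) @[n --> \oo] --> (0 : R).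
    apply: cvg_weak.
    - by move=> n; exact: L2B (hx2 n).1 hy.1.
    - exact: hw.1.
    - apply: bnd; [exact: hy.1|by move=> n; exact: (hx2 n).1|].
      by move=> n t; rewrite lerDl sq_ge0.
    - apply: (aE_mp c1) => t ht; rewrite -(subrr (vf y t)).
      by apply: cvgB => //; exact: cvg_cst.
  have cv i : I (fun t => (vv (x n) t ord0 i - vv y t ord0 i) * vv w t ord0 i) @[n --> \oo] --> (0 : R).
    apply: cvg_weak.
    - by move=> n; exact: L2B ((hx2 n).2 i) (hy.2 i).
    - exact: (hw.2 i).
    - apply: bnd; [exact: (hy.2 i)|by move=> n; exact: ((hx2 n).2 i)|].
      by move=> n t; apply: ler_wpDl; [exact: sqr_ge0|exact: sq_coord].
    - apply: (aE_mp c2) => t ht; rewrite -(subrr (vv y t ord0 i)).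
      by apply: cvgB => //; exact: cvg_cst.
  have c3 := cvg_addR (cvg_bigsum (s := index_enum 'I_N) cv) cf.
  rewrite addr0 big1_eq in c3.
  rewrite (_ : (fun n => P (x n - y) w) = fun n =>
    \sum_i I (fun t => (vv (x n) t ord0 i - vv y t ord0 i) * vv w t ord0 i) +
    I (fun t => (vf (x n) t - vf y t) * vf w t)) //.
  apply/funext => n; rewrite -I_sum; last first.
    by move=> i; apply: L2M; [exact: L2B ((hx2 n).2 i) (hy.2 i)|exact: (hw.2 i)].
  rewrite -ID; last first.
  - exact: L2M (L2B (hx2 n).1 hy.1) hw.1.
  - by apply: L1_sum => i; apply: L2M; [exact: L2B ((hx2 n).2 i) (hy.2 i)|exact: (hw.2 i)].
  apply: I_eq => t; rewrite !vgE !mul1r; congr (_ + _).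
  by apply: eq_bigr => i _; rewrite !mxE.
have yw : P y w = 0.
  have e n : P (x n - y) w = - P y w.
    by rewrite /P (enB (beta := 1) ltr01 m1 h1)// (enC _ _ _ (x n)) -/(P w (x n)) Pw ?sub0r//.
  have : (fun n => P (x n - y) w) = fun=> - P y w by apply/funext => n; exact: e.
  move=> e2; rewrite e2 in wx.
  by have := cvg_uniq (cvg_cstR _) wx => /eqP; rewrite oppr_eq0 => /eqP.
have zw : P z w = 0 by rewrite /P enC -/(P w z) Pw.
have ww : E2 w = 0.
  by rewrite -PE {1}/w /P (enB (beta := 1) ltr01 m1 h1)// -/(P y w) -/(P z w) yw zw subrr.
apply: (Hcl_closed nufin tc (@subset_refl _ C) hy) => e e0; exists z => //.
by rewrite -/w ww ltW.
Qed.

End weak_closure.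

(** * Approximate problems *)

(** Here p and p' stand for r(v) and r'(v), and n for the norm of the gradient of v. The Lipschitz
    term L n p is paid by the coercive term a p' n^2, up to a multiple of v p; this works for test
    functions with r(v) <= v r'(v). *)
Lemma absorb_gradient {R : realType} (L a n p p' v : R) :
  0 <= L -> 0 < a -> 0 <= n -> 0 <= p -> 0 <= p' -> 0 <= v -> p <= v * p' ->
  L * n * p <= a * p' * n ^+ 2 + L ^+ 2 / (4 * a) * (v * p).
Proof.
move=> L0 a0 n0 p0 p'0 v0 h.
have a4 : 0 < 4 * a by rewrite mulr_gt0.
suff : 4 * a * (L * n * p) <= 4 * a * (a * p' * n ^+ 2) + L ^+ 2 * (v * p).
  move=> k; rewrite -(ler_pM2l a4) mulrDr.
  by rewrite [_ * (L ^+ 2 / _ * _)]mulrA [4 * a * (_ / _)]mulrC divfK ?gt_eqF.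
have [->|pn] := eqVneq p 0.
  by rewrite !mulr0 addr0 !mulr_ge0 ?exprn_ge0// ltW.
have p'p : 0 < p'.
  rewrite lt_neqAle p'0 andbT eq_sym; apply/eqP => e.
  by move: h; rewrite e mulr0 => h; move: pn; rewrite eq_le p0 h.
(* p' * (2 a n - L p / p')^2 >= 0 *)
have : p' * (4 * a * (L * n * p)) <= p' * (4 * a * (a * p' * n ^+ 2) + L ^+ 2 * (v * p)).
  have h2 : L ^+ 2 * p * p <= L ^+ 2 * p * (v * p') by apply: ler_wpM2l => //; rewrite mulr_ge0// sqr_ge0.
  by have := sqr_ge0 (2 * a * p' * n - L * p); nra.
by rewrite ler_pM2l.
Qed.

Lemma cvg_leR {R : realType} (u : nat -> R) (l c : R) :
  (forall n, u n <= c) -> u n @[n --> \oo] --> l -> l <= c.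
Proof.
move=> h /cvg_epsP hu; apply/ler_addgt0Pr => e e0; have [k hk] := hu e e0.
by have := hk k (leqnn _); rewrite ler_norml => /andP[+ _]; have := h k; lra.
Qed.

Lemma cvg_geR {R : realType} (u : nat -> R) (l c : R) :
  (forall n, c <= u n) -> u n @[n --> \oo] --> l -> c <= l.
Proof.
move=> h /cvg_epsP hu; apply/ler_addgt0Pr => e e0; have [k hk] := hu e e0.
by have := hk k (leqnn _); rewrite ler_norml => /andP[_ +]; have := h k; lra.
Qed.

Lemma I_zero {d} {T : measurableType d} {R : realType} (nu : {measure set T -> \bar R}) (f : T -> R) :
  (forall t, f t = 0) -> I nu f = 0.
Proof. by move=> h; rewrite -(I_0 nu); exact: I_eq. Qed.

(** * Problems with a bounded Lipschitz lower order term *)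

Section solve.
Context {d : measure_display} {T : measurableType d} {R : realType}.
Variable nu : {measure set T -> \bar R}.
Hypothesis nufin : (nu setT < +oo)%E.
Context {N : nat}.
Variables (C : set (T -> R)) (D : (T -> R) -> T -> 'rV[R]_N).
Hypothesis tc : test_class nu C D.
Notation L1 := (L1 nu).
Notation L2 := (L2 nu).
Notation I := (I nu).
Notation aE := (aE nu).
Notation VG := (vg T R N).
Notation isL2 := (@isL2 _ T R nu N).
Notation E2 := (@E2 _ T R nu N).
Notation H := (H nu C D).
Variables (alpha beta : R) (b : T -> R).
Hypothesis alpha0 : 0 < alpha.
Hypothesis mb : measf b.
Hypothesis hb : forall t, alpha <= b t <= beta.
Notation en := (en nu b).

Variables (F : R -> 'rV[R]_N -> R) (M L : R).
Hypothesis mF : forall (v : T -> R) (g : T -> 'rV[R]_N), measf v -> (forall i, measf (fun t : T => g t ord0 i)) ->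
  measf (fun t => F (v t) (g t)).
Hypothesis FM : forall s xi, `|F s xi| <= M.
Hypothesis L0 : 0 <= L.
Hypothesis FL : forall s xi s' xi', `|F s xi - F s' xi'| <= L * (`|s - s'| + nrm (xi - xi')).

Definition FF (x : VG) t := F (vf x t) (vv x t).
(** The first summand absorbs the Lipschitz dependence on the function, the second that on the
    gradient after Young's inequality with the ellipticity constant; the third leaves a strictly
    positive remainder in the comparison principle. *)
Definition lam0 := 4 * L + 16 * L ^+ 2 / alpha + 1.

Let lam0_gt0 : 0 < lam0.
Proof.
have : 0 <= 16 * L ^+ 2 / alpha by rewrite divr_ge0 ?mulr_ge0 ?sqr_ge0// ltW.
by have := L0; rewrite /lam0; lra.
Qed.

Let ba t : alpha <= b t. Proof. by have /andP[] := hb t. Qed.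

Lemma FF_L2 x : isL2 x -> L2 (FF x).
Proof.
move=> [x1 x2]; apply: (L2_bdd nufin (M := M)); last by move=> t; exact: FM.
by apply: mF; [exact: x1.1|move=> i; exact: (x2 i).1].
Qed.

Lemma FF_lip x y (k : R) t : 
  `|FF x t - FF y t| * `|k| <=
  8^-1 * (lam0 * (vf x t - vf y t) ^+ 2 + b t * sq (vv x t - vv y t)) + 4^-1 * (lam0 * k ^+ 2).
Proof.
have h := FL (vf x t) (vv x t) (vf y t) (vv y t).
set dv := `|vf x t - vf y t| in h; set dg := nrm (vv x t - vv y t) in h.
have -> : (vf x t - vf y t) ^+ 2 = dv ^+ 2 by rewrite real_normK ?num_real.
have -> : k ^+ 2 = `|k| ^+ 2 by rewrite real_normK ?num_real.
rewrite -nrm_sq -/dg.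
have dv0 : 0 <= dv by exact: normr_ge0.
have dg0 : 0 <= dg by exact: nrm_ge0.
have k0 := normr_ge0 k.
apply: (le_trans (ler_wpM2r k0 h)).
have c1 : 4 * L <= lam0.
  have : 0 <= 16 * L ^+ 2 / alpha by rewrite divr_ge0 ?mulr_ge0 ?sqr_ge0// ltW.
  by rewrite /lam0; lra.
have c2 : 16 * L ^+ 2 / alpha <= lam0 by have := L0; rewrite /lam0; lra.
have a1 : L * dv * `|k| <= 8^-1 * (lam0 * dv ^+ 2) + 8^-1 * (lam0 * `|k| ^+ 2).
  have := ler_wpM2r (addr_ge0 (sqr_ge0 dv) (sqr_ge0 `|k|)) c1.
  have := mulr_ge0 L0 (sqr_ge0 (dv - `|k|)); nra.
have a2 : L * dg * `|k| <= 8^-1 * (b t * dg ^+ 2) + 8^-1 * (lam0 * `|k| ^+ 2).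
  have := ler_wpM2r (sqr_ge0 `|k|) c2; have := ler_wpM2r (sqr_ge0 dg) (ba t).
  have e : 0 <= (8 * alpha)^-1 * (alpha * dg - 4 * L * `|k|) ^+ 2.
    by rewrite mulr_ge0 ?sqr_ge0// invr_ge0 mulr_ge0// ltW.
  have e' : (8 * alpha)^-1 * (alpha * dg - 4 * L * `|k|) ^+ 2 =
    8^-1 * (alpha * dg ^+ 2) - L * dg * `|k| + 8^-1 * (16 * L ^+ 2 / alpha * `|k| ^+ 2).
    by field; rewrite gt_eqF.
  by rewrite e' in e; move: e; lra.
by rewrite mulrDr mulrDl; move: a1 a2; lra.
Qed.

Lemma FF_I x y z : isL2 x -> isL2 y -> isL2 z ->
  I (fun t => (FF x t - FF y t) * vf z t) <=
  8^-1 * en lam0 (x - y) (x - y) + 4^-1 * (lam0 * I (fun t => vf z t ^+ 2)).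
Proof.
move=> hx hy hz; have hd := isL2B hx hy.
have La := en_L1 alpha0 mb hb lam0 hd hd.
rewrite -(IZ _ hz.1.2) -(IZ _ La) -IZ; last exact: L1Z hz.1.2.
rewrite -ID; [|exact: L1Z|apply: L1Z; exact: L1Z hz.1.2].
apply: I_le.
- exact: L2M (L2B (FF_L2 hx) (FF_L2 hy)) hz.1.
- by apply: L1D; [exact: L1Z|apply: L1Z; exact: L1Z hz.1.2].
move=> t; apply: (le_trans (ler_norm _)); rewrite normrM.
apply: (le_trans (FF_lip x y (vf z t) t)).
by rewrite !vgE -!expr2 -/(sq _) [X in 8^-1 * X + _]addrC.
Qed.

Lemma solve_lambda h : L2 h -> exists2 x, H x & forall z, H z ->
  en lam0 x z + I (fun t => FF x t * vf z t) = I (fun t => h t * vf z t).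
Proof.
move=> hh.
pose l (x z : VG) := I (fun t => (h t - FF x t) * vf z t).
have Lh x : isL2 x -> L2 (fun t => h t - FF x t) by move=> hx; apply: L2B => //; exact: FF_L2.
have [|||||||||x hx hxz] := @contraction_solvable R VG H (en lam0) _ _ _ _ _ _ l
   (fun x => lam0^-1 * I (fun t => (h t - FF x t) ^+ 2)) .
- exact: (H0 nufin tc).
- by move=> a x y; exact: (HP nufin tc).
- exact: enC.
- by move=> a x y z /H_isL2 hx /H_isL2 hy /H_isL2 hz; exact: (enP alpha0 mb hb).
- by move=> x _; have h0 := @en_ge0; have := en_ge0 nu alpha0 hb x (ltW lam0_gt0).
- by move=> x; exact: (en_complete nufin tc alpha0 mb hb).
- move=> x /H_isL2 hx a u v /H_isL2 hu /H_isL2 hv.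
  rewrite /l -IZ; last exact: L2M (Lh x hx) hu.1.
  rewrite -ID; [|apply: L1Z; exact: L2M (Lh x hx) hu.1|exact: L2M (Lh x hx) hv.1].
  by apply: I_eq => t; rewrite !vgE; ring.
- move=> x z /H_isL2 hx /H_isL2 hz.
  have ha : L2 (fun t => h t - FF x t) by exact: Lh.
  have l4 : 0 < lam0^-1 by rewrite invr_gt0.
  have co := en_coer alpha0 mb hb (ltW lam0_gt0) hz.
  have g0 : 0 <= I (fun t => sq (vv z t)) by apply: I_ge0 => t; exact: sq_ge0.
  have : l x z <= lam0^-1 * I (fun t => (h t - FF x t) ^+ 2) + 4^-1 * (lam0 * I (fun t => vf z t ^+ 2)).
    rewrite /l -(IZ _ hz.1.2) -(IZ _ ha.2) -IZ; last exact: L1Z hz.1.2.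
    rewrite -ID; [|exact: L1Z ha.2|apply: L1Z; exact: L1Z hz.1.2].
    apply: I_le; [exact: L2M ha hz.1|apply: L1D; [exact: L1Z ha.2|apply: L1Z; exact: L1Z hz.1.2]|].
    move=> t; set p := h t - _; set q := vf z t.
    have e : 0 <= lam0^-1 * (p - 2^-1 * lam0 * q) ^+ 2 by rewrite mulr_ge0 ?sqr_ge0// ltW.
    have e' : lam0^-1 * (p - 2^-1 * lam0 * q) ^+ 2 =
      lam0^-1 * p ^+ 2 - p * q + 4^-1 * (lam0 * q ^+ 2) by field; rewrite gt_eqF.
    by rewrite e' in e; lra.
  have ag := mulr_ge0 (ltW alpha0) g0.
  by move: co ag; lra.
- move=> x y z /H_isL2 hx /H_isL2 hy /H_isL2 hz.
  have -> : l x z - l y z = I (fun t => (FF y t - FF x t) * vf z t).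
    rewrite /l -IB; [|exact: L2M (Lh x hx) hz.1|exact: L2M (Lh y hy) hz.1].
    by apply: I_eq => t; ring.
  apply: (le_trans (FF_I hy hx hz)).
  have co := en_coer alpha0 mb hb (ltW lam0_gt0) hz.
  have g0 : 0 <= I (fun t => sq (vv z t)) by apply: I_ge0 => t; exact: sq_ge0.
  have ag := mulr_ge0 (ltW alpha0) g0.
  have -> : en lam0 (y - x) (y - x) = en lam0 (x - y) (x - y).
    by apply: I_eq => t; rewrite !vgE -(opprB (vf x t)) -(opprB (vv x t)) dotrNl dotrNr opprK mulrNN.
  have q0 : 0 <= en lam0 (x - y) (x - y) by exact: (en_ge0 nu alpha0 hb _ (ltW lam0_gt0)).
  by move: co ag q0; lra.
exists x => // z hz; rewrite hxz// /l -ID; last 2 first.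
- exact: L2M (Lh x (H_isL2 hx)) (H_isL2 hz).1.
- exact: L2M (FF_L2 (H_isL2 hx)) (H_isL2 hz).1.
by apply: I_eq => t; ring.
Qed.

(** Only the difference of the two inequalities is tested, so a subsolution and a supersolution
    suffice. Once the gradient term is absorbed, what remains is that the integral of d r(d), with d
    = x1 - x2, is at most 0. *)
Lemma comparison x1 x2 h1 h2 : H x1 -> H x2 -> L2 h1 -> L2 h2 -> aE (fun t => h1 t <= h2 t) ->
  (forall z, H z -> (forall t, 0 <= vf z t) ->
    en lam0 x1 z + I (fun t => FF x1 t * vf z t) <= I (fun t => h1 t * vf z t)) ->
  (forall z, H z -> (forall t, 0 <= vf z t) ->
    I (fun t => h2 t * vf z t) <= en lam0 x2 z + I (fun t => FF x2 t * vf z t)) ->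
  aE (fun t => vf x1 t <= vf x2 t).
Proof.
move=> hx1 hx2 hh1 hh2 h12 sub sup.
(* A C^1 substitute for the positive part, with bounded derivative and r(t) <= t r'(t), as the
   absorption of the gradient requires. *)
pose r (t : R) := Num.sqrt (1 + pos2 t) - 1.
pose r' (t : R) := Num.max t 0 / Num.sqrt (1 + pos2 t).
have hr : C1fun r r'.
  by apply: C1_eq (C1D (C1_sqrt ltr01) (C1_cst (-1))) => // t; rewrite addr0.
have s1 (t : R) : 1 <= Num.sqrt (1 + pos2 t).
  by rewrite -{1}(sqrtr1 R) ler_sqrt ?lerDl ?pos2_ge0// addr_ge0 ?pos2_ge0.
have s0 (t : R) : 0 < Num.sqrt (1 + pos2 t) by exact: lt_le_trans ltr01 (s1 t).
have ss (t : R) : Num.sqrt (1 + pos2 t) ^+ 2 = 1 + pos2 t.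
  by rewrite sqr_sqrtr// addr_ge0// pos2_ge0.
have r'0 (t : R) : 0 <= r' t by rewrite divr_ge0 ?le_max ?lexx ?orbT// ltW.
have r'1 (t : R) : `|r' t| <= 1.
  rewrite ger0_norm// ler_pdivrMr// mul1r -(@ler_pXn2r _ 2)// ?nnegrE ?le_max ?lexx ?orbT ?sqrtr_ge0//.
  by rewrite ss /pos2 lerDr.
have r0 (t : R) : 0 <= r t by rewrite subr_ge0.
have rneg (t : R) : t <= 0 -> r t = 0 by move=> t0; rewrite /r pos2_neg// addr0 sqrtr1 subrr.
have rkey (t : R) : 0 <= t -> r t <= t * r' t.
  move=> t0; rewrite /r /r' max_l// mulrA -expr2 -(pos2_pos t0).
  by rewrite ler_pdivlMr// mulrBl mul1r -expr2 ss; have := s1 t; lra.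
pose dd := x1 - x2.
have hd : H dd by exact: (HB nufin tc).
have hd2 := H_isL2 hd.
have r00 : r 0 = 0 by exact: rneg.
pose z : VG := Vg (fun t => r (vf dd t)) (fun t => r' (vf dd t) *: vv dd t).
have hz : H z by exact: (H_comp nufin tc hr r'1 r00 hd).
have hz2 := H_isL2 hz.
have z0 t : 0 <= vf z t by exact: r0.
have h2x1 := H_isL2 hx1; have h2x2 := H_isL2 hx2.
have LF1 := L2M (FF_L2 h2x1) hz2.1; have LF2 := L2M (FF_L2 h2x2) hz2.1.
have Le := en_L1 alpha0 mb hb lam0 hd2 hz2.
have tot : en lam0 dd z + I (fun t => (FF x1 t - FF x2 t) * vf z t) <= 0.
  have -> : I (fun t => (FF x1 t - FF x2 t) * vf z t) =
     I (fun t => FF x1 t * vf z t) - I (fun t => FF x2 t * vf z t).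
    by rewrite -IB//; apply: I_eq => t; rewrite mulrBl.
  rewrite /dd (enB alpha0 mb hb)//.
  have : I (fun t => h1 t * vf z t) <= I (fun t => h2 t * vf z t).
    apply: I_le_ae; [exact: L2M hh1 hz2.1|exact: L2M hh2 hz2.1|].
    by apply: (aE_mp h12) => t ht; exact: ler_wpM2r.
  have := sub z hz z0; have := sup z hz z0; lra.
(* The choice of [lam0] leaves the coefficient 1 in front of d r(d) once L + L^2 / (4 alpha) has
   been spent. *)
have lower t : vf dd t * r (vf dd t) <=
   (b t * dotr (vv dd t) (vv z t) + lam0 * (vf dd t * vf z t)) + (FF x1 t - FF x2 t) * vf z t.
  rewrite /= dotrZr -/(sq _).
  set dv := vf dd t; set dg := vv dd t.
  have [dv0|dv0] := leP dv 0.
    have -> : r' dv = 0 by rewrite /r' max_r// mul0r.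
    by rewrite rneg// !mulr0 !mul0r !mulr0 !addr0.
  have fl := FL (vf x1 t) (vv x1 t) (vf x2 t) (vv x2 t).
  rewrite -[vf x1 t - vf x2 t]/dv -[vv x1 t - vv x2 t]/dg (gtr0_norm dv0) in fl.
  have fl2 : - (L * (dv + nrm dg)) <= F (vf x1 t) (vv x1 t) - F (vf x2 t) (vv x2 t).
    by move: fl; rewrite ler_norml => /andP[].
  have fl3 := ler_wpM2r (r0 dv) fl2.
  have ab := absorb_gradient L0 alpha0 (nrm_ge0 dg) (r0 dv) (r'0 dv) (ltW dv0) (rkey _ (ltW dv0)).
  rewrite nrm_sq in ab.
  have bq := ler_wpM2r (mulr_ge0 (r'0 dv) (sq_ge0 dg)) (ba t).
  have dr : 0 <= dv * r dv by rewrite mulr_ge0// ltW.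
  have lm : (L + L ^+ 2 / (4 * alpha) + 1) * (dv * r dv) <= lam0 * (dv * r dv).
    apply: ler_wpM2r => //; rewrite /lam0.
    have e : L ^+ 2 / (4 * alpha) = 64^-1 * (16 * L ^+ 2 / alpha) by field; rewrite gt_eqF.
    have : 0 <= 16 * L ^+ 2 / alpha by rewrite divr_ge0 ?mulr_ge0 ?sqr_ge0// ltW.
    by rewrite e; move: L0; lra.
  rewrite /FF; move: fl3 ab bq dr lm.
  move: (F _ _ - F _ _) (L ^+ 2 / (4 * alpha)) (nrm dg) (sq dg) => f q n s.
  by rewrite -[vf x1 t - vf x2 t]/dv; move: (r dv) (r' dv) (dv) => rd r'd d1; lra.
have Ldr : L1 (fun t => vf dd t * r (vf dd t)) by exact: L2M hd2.1 hz2.1.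
have Itot : I (fun t => vf dd t * r (vf dd t)) <= 0.
  apply: le_trans tot; rewrite -ID//; last first.
    by apply: L2M hz2.1; exact: L2B (FF_L2 h2x1) (FF_L2 h2x2).
  apply: I_le => //; apply: L1D => //.
  by apply: L2M hz2.1; exact: L2B (FF_L2 h2x1) (FF_L2 h2x2).
have dr0 t : 0 <= vf dd t * r (vf dd t).
  have [v0|v0] := leP (vf dd t) 0; first by rewrite rneg// mulr0.
  by rewrite mulr_ge0// ltW.
apply: (aE_mp (I_eq0 Ldr dr0 Itot)) => t /eqP; rewrite mulf_eq0.
have e : vf dd t = vf x1 t - vf x2 t by [].
rewrite -subr_le0 -e => /orP[/eqP -> //|/eqP rz].
rewrite leNgt; apply/negP => v0; move: rz; rewrite /r => /eqP.
rewrite subr_eq0 => /eqP s1e; have := ss (vf dd t); rewrite s1e expr1n pos2_pos ?ltW//.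
by move=> h; have : 0 < vf dd t ^+ 2 by [rewrite exprn_gt0]; lra.
Qed.

Lemma FF_E2 x y : isL2 x -> isL2 y ->
  I (fun t => (FF x t - FF y t) ^+ 2) <= 2 * L ^+ 2 * E2 (x - y).
Proof.
move=> hx hy; rewrite E2E -IZ; last exact: E2_L1 (isL2B hx hy).
apply: I_le; [exact: (L2B (FF_L2 hx) (FF_L2 hy)).2|by apply: L1Z; exact: E2_L1 (isL2B hx hy)|].
move=> t; have := FL (vf x t) (vv x t) (vf y t) (vv y t).
rewrite !vgE -(nrm_sq (_ - _)) -(real_normK (num_real (FF x t - FF y t))) -(real_normK (num_real (vf x t - vf y t))).
have k0 := normr_ge0 (FF x t - FF y t); move: k0 (normr_ge0 (vf x t - vf y t)) (nrm_ge0 (vv x t - vv y t)).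
rewrite -/(FF x t) -/(FF y t).
move: `|FF x t - FF y t| `|vf x t - vf y t| (nrm (vv x t - vv y t)) => k p q k0 p0 q0 h.
apply: (@le_trans _ _ ((L * (p + q)) ^+ 2)).
  by rewrite lerXn2r// nnegrE ?mulr_ge0 ?addr_ge0.
have -> : (L * (p + q)) ^+ 2 = L ^+ 2 * (p + q) ^+ 2 by rewrite exprMn.
by have := mulr_ge0 (sqr_ge0 L) (sqr_ge0 (p - q)); lra.
Qed.

Lemma E2_subseq (x : nat -> VG) y : isL2 y -> (forall n, isL2 (x n)) ->
  E2 (x n - y) @[n --> \oo] --> (0 : R) ->
  exists s : nat -> nat, (forall n, (s n < s n.+1)%N) /\
    aE (fun t => vf (x (s n)) t @[n --> \oo] --> vf y t).
Proof.
move=> hy hx hc.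
have c1 : I (fun t => (vf (x n) t - vf y t) ^+ 2) @[n --> \oo] --> (0 : R).
  have := E2_cvg_f hy hx; under eq_cvg do rewrite E2BC; move=> /(_ hc).
  by under eq_cvg do under I_eq do rewrite -sqrrN opprB.
have [s [s1 s2]] := ae_subseq0 (fun n => (L2B (hx n).1 hy.1).2) (fun n t => sqr_ge0 _) c1.
exists s; split => //; apply: (aE_mp s2) => t /cvg_epsP h; apply/cvg_epsP => e e0.
have [k hk] := h _ (exprn_gt0 2 e0); exists k => n kn; have := hk n kn.
rewrite subr0 ger0_norm ?sqr_ge0// -(real_normK (num_real (vf _ t - _))).
by rewrite ler_pXn2r ?nnegrE// ltW.
Qed.

Hypothesis F0 : F 0 0 = 0.
Hypothesis Fge0 : forall s xi, 0 <= F s xi.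

Definition supersol f y := forall z, H z -> (forall t, 0 <= vf z t) ->
  I (fun t => f t * vf z t) <= en 0 y z + I (fun t => FF y t * vf z t).

Lemma energy_bound : exists2 K, 0 < K & forall x f, H x -> L2 f ->
  alpha * I (fun t => sq (vv x t)) <= I (fun t => f t * vf x t) ->
  I (fun t => vf x t ^+ 2) <= K * I (fun t => f t ^+ 2).
Proof.
have [K K0 hK] := H_poincare nufin tc.
(* Poincare's inequality, then Young's with t = 2 K / alpha, by which half of the left-hand side is
   absorbed. *)
exists (4 * (K / alpha) ^+ 2); first by rewrite mulr_gt0// exprn_gt0// divr_gt0.
move=> x f hx hf e; have hx2 := H_isL2 hx.
have Ka : 0 < K / alpha by rewrite divr_gt0.
have h1 : I (fun t => vf x t ^+ 2) <= K / alpha * I (fun t => f t * vf x t).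
  rewrite -mulrA; apply: (le_trans (hK x hx)); rewrite ler_wpM2l ?(ltW K0)//.
  by rewrite mulrC ler_pdivlMr// mulrC.
have t0 : 0 < 2 * (K / alpha) by rewrite mulr_gt0.
have h2 := ler_wpM2l (ltW Ka) (I_young t0 hf hx2.1).
have e2 : K / alpha * ((2 * (K / alpha))^-1 * I (fun t => vf x t ^+ 2)) = 2^-1 * I (fun t => vf x t ^+ 2).
  by field; rewrite !gt_eqF.
by rewrite mulrDr e2 in h2; lra.
Qed.

(** Starting from 0, each iterate solves the problem with [lam0] times the previous one on the
    right. Comparison makes the iterates increase and keeps them below every nonnegative
    supersolution, whence minimality. Monotonicity and the sign of [F] give a bound that does not
    involve [lam0]. *)
Lemma minimal_solution f : L2 f -> (forall t, 0 <= f t) -> exists x, [/\ H x,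
  forall t, 0 <= vf x t,
  forall z, H z -> en 0 x z + I (fun t => FF x t * vf z t) = I (fun t => f t * vf z t) &
  forall y, H y -> (forall t, 0 <= vf y t) -> supersol f y -> aE (fun t => vf x t <= vf y t)].
Proof.
move=> hf f0; have l0 := ltW lam0_gt0.
pose rhs (v : VG) t := f t + lam0 * vf v t.
have hS (v : VG) : {x | H v -> H x /\ forall z, H z ->
    en lam0 x z + I (fun t => FF x t * vf z t) = I (fun t => rhs v t * vf z t)}.
  apply: cid; have [hv|nv] := pselect (H v); last by exists 0 => /nv.
  by have [x hx hxz] := solve_lambda (L2D hf (L2Z lam0 (H_isL2 hv).1)); exists x.
pose S v := sval (hS v).
have [x [x0 xS]] : exists x : nat -> VG, x 0%N = 0 /\ forall n, x n.+1 = S (x n).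
  by exists (fix x n := if n is m.+1 then S (x m) else 0); split.
have Hx n : H (x n).
  by elim: n => [|n ih]; [rewrite x0; exact: (H0 nufin tc)|rewrite xS; exact: (svalP (hS (x n)) ih).1].
have hx2 n := H_isL2 (Hx n).
have Lr n : L2 (rhs (x n)) by exact: L2D hf (L2Z lam0 (hx2 n).1).
have eqx n z : H z -> en lam0 (x n.+1) z + I (fun t => FF (x n.+1) t * vf z t) =
    I (fun t => rhs (x n) t * vf z t) by rewrite xS; exact: (svalP (hS (x n)) (Hx n)).2.
have FF0 t : FF 0 t = 0 by rewrite /FF !vgE.
have mono n : aE (fun t => vf (x n) t <= vf (x n.+1) t).
  elim: n => [|n ih].
    apply: (comparison (Hx 0%N) (Hx 1%N) (L2_0 nu) (Lr 0%N)).
    - by apply: aE_all => t; rewrite /rhs x0 vgE mulr0 addr0.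
    - move=> z hz z0; rewrite /en !I_zero ?addr0// => t.
      + by rewrite mul0r.
      + by rewrite x0 FF0 mul0r.
      + by rewrite x0 !vgE dotr0l mul0r !mulr0 addr0.
    - by move=> z hz z0; rewrite eqx.
  apply: (comparison (Hx _) (Hx _) (Lr n) (Lr n.+1)).
  - by apply: (aE_mp ih) => t h; rewrite /rhs lerD2l ler_wpM2l.
  - by move=> z hz z0; rewrite eqx.
  - by move=> z hz z0; rewrite eqx.
have monoall : aE (fun t => forall n, vf (x n) t <= vf (x n.+1) t) by exact: aE_nat.
have mono2 : aE (fun t => forall n m, (n <= m)%N -> vf (x n) t <= vf (x m) t).
  apply: (aE_mp monoall) => t h n m /subnKC <-; elim: (m - n)%N => [|k ih]; first by rewrite addn0.
  by rewrite addnS (le_trans ih).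
have pos : aE (fun t => forall n, 0 <= vf (x n) t).
  by apply: (aE_mp mono2) => t h n; have := h 0%N n (leq0n _); rewrite x0 vgE.
have [K K0 hK] := energy_bound.
pose KC := K * I (fun t => f t ^+ 2).
have bd n : I (fun t => vf (x n) t ^+ 2) <= KC.
  apply: hK => //; case: n => [|n].
    have -> : I (fun t => f t * vf (x 0%N) t) = 0 by rewrite -(I_0 nu); apply: I_eq => t; rewrite x0 vgE mulr0.
    by rewrite I_zero ?mulr0// => t; rewrite x0 vgE sq0.
  set y := x n.+1; have hy : isL2 y by exact: hx2.
  have co := en_coer alpha0 mb hb (lexx 0) hy; rewrite mul0r addr0 in co.
  apply: (le_trans co); have := eqx n y (Hx _); rewrite (en_split alpha0 mb hb)//.
  have i1 : 0 <= I (fun t => FF y t * vf y t).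
    rewrite -(I_0 nu); apply: I_le_ae; [exact: L1_0|exact: L2M (FF_L2 hy) hy.1|].
    by apply: (aE_mp pos) => t h; apply: mulr_ge0; [exact: Fge0|exact: h].
  have -> : I (fun t => rhs (x n) t * vf y t) =
      I (fun t => f t * vf y t) + lam0 * I (fun t => vf (x n) t * vf y t).
    rewrite -IZ; last exact: L2M (hx2 n).1 hy.1.
    rewrite -ID; [|exact: L2M hf hy.1|by apply: L1Z; exact: L2M (hx2 n).1 hy.1].
    by apply: I_eq => t; rewrite /rhs; ring.
  have i2 : I (fun t => vf (x n) t * vf y t) <= I (fun t => vf y t * vf y t).
    apply: I_le_ae; [exact: L2M (hx2 n).1 hy.1|exact: L2M hy.1 hy.1|].
    by apply: (aE_mp2 pos mono2) => t h1 h2; rewrite ler_wpM2r ?h1// h2.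
  have := ler_wpM2l l0 i2; lra.
(* For 0 <= p <= q one has (q - p)^2 <= q^2 - p^2, so the convergence of the bounded monotone
   sequence of squared norms makes the iterates Cauchy in L2. *)
pose a n := I (fun t => vf (x n) t ^+ 2).
have aB n m : (n <= m)%N -> I (fun t => (vf (x m) t - vf (x n) t) ^+ 2) <= a m - a n.
  move=> nm; rewrite -IB; [|exact: (hx2 m).1.2|exact: (hx2 n).1.2].
  apply: I_le_ae; [exact: (L2B (hx2 m).1 (hx2 n).1).2|exact: L1B (hx2 m).1.2 (hx2 n).1.2|].
  apply: (aE_mp2 pos mono2) => t h1 h2; have := h1 n; have := h2 _ _ nm.
  by move: (vf _ t) (vf _ t) => p q; nra.
have andec n m : (n <= m)%N -> a n <= a m.
  by move=> nm; rewrite -subr_ge0 (le_trans _ (aB n m nm))// I_sq_ge0.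
have ac : cvgn a.
  apply: nondecreasing_is_cvgn; first by move=> n m; exact: andec.
  by exists KC => _ [n _ <-]; exact: bd.
have fC (e : R) : 0 < e -> exists M, forall n m, (M <= n)%N -> (M <= m)%N ->
    I (fun t => (vf (x m) t - vf (x n) t) ^+ 2) <= e.
  move=> e0; have e2 : 0 < e / 2 by rewrite divr_gt0.
  have [k hk] := (cvg_epsP _ _).1 ac (e / 2) e2.
  exists k => n m kn km; have := hk n kn; have := hk m km; rewrite -/(a n) -/(a m).
  rewrite !ler_norml => /andP[? ?] /andP[? ?].
  have [nm|/ltnW mn] := leqP n m; first by apply: (le_trans (aB n m nm)); lra.
  rewrite (@I_eq _ _ _ _ _ (fun t => (vf (x n) t - vf (x m) t) ^+ 2)); last by move=> t; ring.
  by apply: (le_trans (aB m n mn)); lra.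
(* The difference of two equations, tested with the difference of their solutions, bounds the energy
   distance by L2 distances of iterates. *)
have [y Hy yc] : exists2 y, H y & E2 (x n - y) @[n --> \oo] --> (0 : R).
  apply: (H_complete nufin tc) => // e e0.
  pose Q := (alpha^-1 + lam0^-1) * (2 * lam0).
  have Q0 : 0 < Q by rewrite !mulr_gt0// addr_gt0 ?invr_gt0.
  have [k hk] := fC (e / Q) (divr_gt0 e0 Q0).
  exists k.+1 => -[//|n] [//|m] kn km.
  have hd := isL2B (hx2 n.+1) (hx2 m.+1).
  apply: (le_trans (en_E2 alpha0 mb hb lam0_gt0 hd)).
  set dd := x n.+1 - x m.+1 in hd *.
  have Hd : H dd by exact: (HB nufin tc).
  suff : en lam0 dd dd <= 2 * lam0 * (e / Q).
    move=> h; have ai : 0 <= alpha^-1 + lam0^-1 by rewrite addr_ge0// invr_ge0// ltW.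
    apply: (le_trans (ler_wpM2l ai h)).
    have -> : (alpha^-1 + lam0^-1) * (2 * lam0 * (e / Q)) = Q * (e / Q) by exact: mulrA.
    by rewrite mulrC divfK// gt_eqF.
  have e1 : en lam0 dd dd = I (fun t => (FF (x m.+1) t - FF (x n.+1) t) * vf dd t) +
      lam0 * I (fun t => (vf (x n) t - vf (x m) t) * vf dd t).
    rewrite {1}/dd (enB alpha0 mb hb)//.
    have e1 := eqx n dd Hd; have e2 := eqx m dd Hd.
    have L1a := L2M (FF_L2 (hx2 n.+1)) hd.1; have L1b := L2M (FF_L2 (hx2 m.+1)) hd.1.
    have -> : I (fun t => (FF (x m.+1) t - FF (x n.+1) t) * vf dd t) =
       I (fun t => FF (x m.+1) t * vf dd t) - I (fun t => FF (x n.+1) t * vf dd t).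
      by rewrite -IB//; apply: I_eq => t; ring.
    have : lam0 * I (fun t => (vf (x n) t - vf (x m) t) * vf dd t) =
      I (fun t => rhs (x n) t * vf dd t) - I (fun t => rhs (x m) t * vf dd t).
      rewrite -IB; [|exact: L2M (Lr n) hd.1|exact: L2M (Lr m) hd.1].
      rewrite -IZ; last exact: L2M (L2B (hx2 n).1 (hx2 m).1) hd.1.
      by apply: I_eq => t; rewrite /rhs; ring.
    by move=> ->; rewrite -e1 -e2; lra.
  have i1 := FF_I (hx2 m.+1) (hx2 n.+1) hd.
  have e3 : en lam0 (x m.+1 - x n.+1) (x m.+1 - x n.+1) = en lam0 dd dd.
    apply: I_eq => t; rewrite !vgE -(opprB (vf (x n.+1) t)) -(opprB (vv (x n.+1) t)).
    by rewrite dotrNl dotrNr opprK mulrNN.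
  rewrite e3 in i1.
  have i2 := I_young ltr01 (L2B (hx2 n).1 (hx2 m).1) hd.1; rewrite invr1 !mul1r in i2.
  have i2' : I (fun t => (vf (x n) t - vf (x m) t) * vf dd t) <=
     2^-1 * I (fun t => (vf (x n) t - vf (x m) t) ^+ 2) + 2^-1 * I (fun t => vf dd t ^+ 2).
    have La := (L2B (hx2 n).1 (hx2 m).1).2.
    rewrite -(IZ _ La) -(IZ _ hd.1.2) -ID; [|exact: L1Z|exact: L1Z hd.1.2].
    apply: I_le; [exact: L2M (L2B (hx2 n).1 (hx2 m).1) hd.1|by apply: L1D; [exact: L1Z|exact: L1Z hd.1.2]|].
    by move=> t; have := sqr_ge0 (vf (x n) t - vf (x m) t - vf dd t); lra.
  have b1 := hk m n km kn.
  have b2 : I (fun t => vf dd t ^+ 2) <= e / Q.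
    exact: (hk m.+1 n.+1 (leqW km) (leqW kn)).
  have := ler_wpM2l l0 i2'; have := ler_wpM2l l0 b1; have := ler_wpM2l l0 b2.
  have en0 := en_ge0 nu alpha0 hb dd l0.
  have eQ : 0 <= lam0 * (e / Q) by rewrite mulr_ge0// divr_ge0// ltW.
  move: e1 i1 en0 eQ; rewrite -!mulrA.
  move: (I _) (I _) (I _) (I _) (en _ _ _) (e / Q) => p q r s u w; lra.
have hy2 := H_isL2 Hy.
have [s [s1 s2]] := E2_subseq hy2 hx2 yc.
(* The positive part equals the limit almost everywhere and is nonnegative at every point. *)
pose x' := Vg (fun t => Num.max (vf y t) 0) (vv y).
have mx' : measf (vf x') by apply: mf_max; [exact: hy2.1.1|exact: mf_cst].
have ex' : aE (fun t => vf y t = vf x' t).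
  apply: (aE_mp2 s2 pos) => t h1 h2; rewrite /= max_l//.
  by apply: (cvg_geR _ h1) => n; exact: h2.
have egx : aE (fun t => vv y t = vv x' t) by exact: aE_all.
have Hx' : H x' by apply: (Hcl_ae nufin tc (@subset_refl _ C) mx' _ ex' egx Hy) => i; exact: (hy2.2 i).1.
have hx'2 := H_isL2 Hx'.
have xc : E2 (x' - x n) @[n --> \oo] --> (0 : R).
  have z0 := E2_ae hx'2 hy2 (aE_mp ex' (fun t e => esym e)) (aE_mp egx (fun t e => esym e)).
  have c2 := cvg_mulcR 2 yc; rewrite mulr0 in c2.
  apply: (squeeze_cvgr _ (cvg_cst 0) c2); apply: nearW => n; rewrite E2_ge0 /=.
  by apply: (le_trans (E2_tri hx'2 hy2 (hx2 n))); rewrite z0 mulr0 add0r E2BC.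
have xc1 : E2 (x' - x n.+1) @[n --> \oo] --> (0 : R) by exact: (cvg_subseq (u := fun n => E2 (x' - x n)) (s := fun n => n.+1) (fun n => ltnSn _) xc).
exists x'; split => //.
- by move=> t; rewrite /= le_max lexx orbT.
- move=> z hz; have hz2 := H_isL2 hz.
  have c1 := cvg_en alpha0 mb hb (lam := lam0) (fun n => hx2 n.+1) hx'2 hz2 xc1.
  have c2 : I (fun t => (FF (x n.+1) t - FF x' t) * vf z t) @[n --> \oo] --> (0 : R).
    apply: (cvg_L2M (fun n => L2B (FF_L2 (hx2 n.+1)) (FF_L2 hx'2)) hz2.1).
    have c2 := cvg_mulcR (2 * L ^+ 2) xc1; rewrite mulr0 in c2.
    apply: (squeeze_cvgr _ (cvg_cst 0) c2); apply: nearW => n.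
    by rewrite I_sq_ge0 /= E2BC; exact: FF_E2.
  have c3 := cvg_L2M (fun n => L2B hx'2.1 (hx2 n).1) hz2.1 (E2_cvg_f hx'2 hx2 xc).
  have := cvg_addR (cvg_addR c1 c2) (cvg_mulcR lam0 c3).
  rewrite mulr0 !addr0 => c4.
  have c5 : (fun n => en lam0 (x n.+1) z + I (fun t => (FF (x n.+1) t - FF x' t) * vf z t) +
      lam0 * I (fun t => (vf x' t - vf (x n) t) * vf z t)) =
      (fun=> I (fun t => f t * vf z t) + lam0 * I (fun t => vf x' t * vf z t) - I (fun t => FF x' t * vf z t)).
    apply/funext => n; have := eqx n z hz.
    have -> : I (fun t => (FF (x n.+1) t - FF x' t) * vf z t) =
       I (fun t => FF (x n.+1) t * vf z t) - I (fun t => FF x' t * vf z t).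
      rewrite -IB; [|exact: L2M (FF_L2 _) hz2.1|exact: L2M (FF_L2 _) hz2.1].
      by apply: I_eq => t; ring.
    have -> : I (fun t => (vf x' t - vf (x n) t) * vf z t) =
       I (fun t => vf x' t * vf z t) - I (fun t => vf (x n) t * vf z t).
      rewrite -IB; [|exact: L2M hx'2.1 hz2.1|exact: L2M (hx2 n).1 hz2.1].
      by apply: I_eq => t; ring.
    have -> : I (fun t => rhs (x n) t * vf z t) =
        I (fun t => f t * vf z t) + lam0 * I (fun t => vf (x n) t * vf z t).
      rewrite -IZ; last exact: L2M (hx2 n).1 hz2.1.
      rewrite -ID; [|exact: L2M hf hz2.1|by apply: L1Z; exact: L2M (hx2 n).1 hz2.1].
      by apply: I_eq => t; rewrite /rhs; ring.
    by lra.
  rewrite c5 in c4; have := cvg_uniq c4 (cvg_cstR _).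
  by rewrite (en_split alpha0 mb hb)//; lra.
- move=> w Hw w0 sw; have hw2 := H_isL2 Hw.
  have le n : aE (fun t => vf (x n) t <= vf w t).
    elim: n => [|n ih]; first by apply: aE_all => t; rewrite x0 vgE.
    apply: (comparison (Hx _) Hw (Lr n) (L2D hf (L2Z lam0 hw2.1))).
    + by apply: (aE_mp ih) => t h; rewrite /rhs lerD2l ler_wpM2l.
    + by move=> z hz z0; rewrite eqx.
    + move=> z hz z0; have hz2 := H_isL2 hz; rewrite (en_split alpha0 mb hb)//.
      have := sw z hz z0.
      have -> : I (fun t => (f t + lam0 * vf w t) * vf z t) =
          I (fun t => f t * vf z t) + lam0 * I (fun t => vf w t * vf z t).
        rewrite -IZ; last exact: L2M hw2.1 hz2.1.
        rewrite -ID; [|exact: L2M hf hz2.1|by apply: L1Z; exact: L2M hw2.1 hz2.1].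
        by apply: I_eq => t; ring.
      by lra.
  apply: (aE_mp3 s2 (aE_nat le) ex') => t h1 h2 <-.
  by apply: (cvg_leR _ h1) => n; exact: h2.
Qed.

End solve.

(** * Truncations and the change of unknown *)

Lemma max0_contract {R : realDomainType} (a b : R) : `|Num.max a 0 - Num.max b 0| <= `|a - b|.
Proof.
by have [a0|a0] := leP a 0; have [b0|b0] := leP b 0; rewrite ?subrr ?normr0// ?sub0r ?subr0 ?normrN;
  rewrite ler_norml; apply/andP; split; have := ler_norm (a - b); have := lerNnormlW (lexx `|a - b|); lra.
Qed.

Section truncations.
Context {R : realType}.
Implicit Types (c t s : R).

Lemma powR_decr c t s : 0 <= c -> 0 < t -> t <= s -> s `^ (- c) <= t `^ (- c).
Proof.
move=> c0 t0 ts; rewrite !powRN lef_pV2 ?posrE ?powR_gt0//; last exact: lt_le_trans ts.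
by apply: ge0_ler_powR => //; rewrite nnegrE ltW// (lt_le_trans t0).
Qed.

(** For t >= 0 this is (1 + t)^c; the other term is the continuation of [C1_extend]. *)
Definition pw c t := (1 + Num.max t 0) `^ c + c * Num.min t 0.

Lemma pwE c t : 0 <= t -> pw c t = (1 + t) `^ c.
Proof. by move=> t0; rewrite /pw max_l// min_r// mulr0 addr0. Qed.

Lemma C1_pw c : C1fun (pw c) (fun t => c * (1 + Num.max t 0) `^ (c - 1)).
Proof.
have := @C1_extend R (fun t => (1 + t) `^ c) (fun t => c * (1 + t) `^ (c - 1)).
move=> h; apply: C1_eq (h _ _) => //.
- by move=> t; rewrite /pw addr0 powR1 mulr1.
- move=> t t1; have t0 : 0 < 1 + t by lra.
  have h1 : is_derive t 1 (fun t : R => 1 + t) 1.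
    by have := ((C1D (C1_cst 1) C1_id).1 t : is_derive t (1 : R) (fun t : R => 1 + t) (0 + 1)); rewrite add0r.
  have := @is_derive1_comp R (fun t => t `^ c) (fun t => 1 + t) t _ _ (is_derive1_powR c t0) h1.
  by rewrite mulr1.
- move=> t t1; have t0 : 0 < 1 + t by lra.
  apply: cvgM; first exact: cvg_cst.
  apply: (@continuous_comp _ _ _ (fun t : R => 1 + t) (fun t => t `^ (c - 1))); last exact: powR_cont.
  by apply: cvgD; [exact: cvg_cst|exact: cvg_id].
Qed.

(* 1 for t <= k and 0 for t >= k + 1. *)
Definition chi (k : R) t := pos2 (1 - pos2 (t - k)).
Definition chi' (k : R) t := - (4 * (Num.max (1 - pos2 (t - k)) 0 * Num.max (t - k) 0)).

Lemma C1_chi k : C1fun (chi k) (chi' k).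
Proof.
have h1 := C1_comp C1_pos2 (C1D C1_id (C1_cst (- k))).
have h2 := C1_comp C1_pos2 (C1D (C1_cst 1) (C1N h1)).
by apply: C1_eq h2 => // t; rewrite /chi' /=; ring.
Qed.

Lemma chi_ge0 k t : 0 <= chi k t. Proof. exact: pos2_ge0. Qed.

Lemma chi_le1 k t : chi k t <= 1.
Proof.
have := pos2_ge0 (t - k); rewrite /chi; set q := pos2 (t - k) => q0.
have [h|h] := leP 0 (1 - q); last by rewrite pos2_neg// ltW.
by rewrite pos2_pos//; nra.
Qed.

Lemma chi_1 k t : t <= k -> chi k t = 1.
Proof. by move=> tk; rewrite /chi (@pos2_neg _ (t - k)) ?subr_le0// subr0 pos2_pos// expr1n. Qed.

Lemma chi_0 k t : k + 1 <= t -> chi k t = 0.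
Proof.
move=> tk; have h : 1 <= t - k by lra.
by rewrite /chi pos2_neg// (@pos2_pos _ (t - k)) ?(le_trans ler01)// subr_le0 expr_ge1// (le_trans ler01).
Qed.

Lemma chi_lt k t : chi k t != 0 -> t < k + 1.
Proof. by apply: contraNT; rewrite -leNgt => /chi_0 ->. Qed.

Lemma chi'_le0 k t : chi' k t <= 0.
Proof. by rewrite oppr_le0 !mulr_ge0// le_max lexx orbT. Qed.

Lemma chi'_l k t : t <= k -> chi' k t = 0.
Proof. by move=> tk; rewrite /chi' (@max_r _ _ (t - k)) ?subr_le0// !mulr0 oppr0. Qed.

Lemma chi'_r k t : k + 1 <= t -> chi' k t = 0.
Proof.
move=> tk; have h : 1 <= t - k by lra.
rewrite /chi' (@max_r _ _ (1 - _)) ?mul0r ?mulr0 ?oppr0//.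
by rewrite (@pos2_pos _ (t - k)) ?(le_trans ler01)// subr_le0 expr_ge1// (le_trans ler01).
Qed.

Lemma chi'_bd k t : `|chi' k t| <= 4.
Proof.
have [h|h] := leP t k; first by rewrite chi'_l// normr0.
have [h1|h1] := leP (k + 1) t; first by rewrite chi'_r// normr0.
rewrite /chi' normrN ger0_norm ?mulr_ge0 ?le_max ?lexx ?orbT//.
rewrite (@max_l _ _ (t - k)) ?subr_ge0 ?ltW//.
have := pos2_ge0 (t - k); set q := pos2 _ => q0.
have p0 : 0 <= Num.max (1 - q) 0 by rewrite le_max lexx orbT.
have p1 : Num.max (1 - q) 0 <= 1 by rewrite ge_max ler01 andbT; lra.
move: (Num.max _ _) p0 p1 => p p0 p1; nra.
Qed.

Lemma chi_mono (k k' : R) t : k <= k' -> chi k t <= chi k' t.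
Proof.
move=> kk; have [h|h] := leP t k'; first by rewrite (chi_1 h) chi_le1.
have p0 : pos2 (t - k') <= pos2 (t - k).
  by rewrite !pos2_pos ?subr_ge0 ?lerXn2r ?nnegrE ?subr_ge0 ?lerB// ltW// (le_lt_trans kk).
rewrite /chi; have [h1|h1] := leP 0 (1 - pos2 (t - k)); last by rewrite pos2_neg ?pos2_ge0// ltW.
move: p0 h1; move: (pos2 (t - k)) (pos2 (t - k')) => q q' h2 h3.
by rewrite !pos2_pos ?lerXn2r ?nnegrE//; lra.
Qed.

(** With the weight stopped at s = k the primitive has a derivative bounded below, hence a global
    C^1 inverse, even for p > 1, when the primitive of (1 + s)^-p is bounded. Two such inverses
    agree where one of their values does not exceed the smaller level, because the weights agree up
    to that level. *)
Lemma truncated_inverses (p : R) : 0 <= p -> exists K : nat -> R -> R,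
  [/\ forall k : nat, C1fun (K k) (fun t => (1 + Num.max 0 (Num.min (K k t) k%:R)) `^ p),
      forall k : nat, K k 0 = 0 &
      forall (k j : nat) t, (k <= j)%N -> (K k t <= k%:R) || (K j t <= k%:R) -> K k t = K j t].
Proof.
move=> p0.
pose w (k : nat) s := (1 + Num.max 0 (Num.min s k%:R)) `^ (- p).
have m0 (k : nat) s : 0 < 1 + Num.max 0 (Num.min s k%:R) by rewrite ltr_pwDl// le_max lexx.
have wc (k : nat) : continuous (w k).
  have c1 : continuous (fun s : R => Num.max 0 (Num.min s k%:R)).
    have e : (fun s : R => Num.max 0 (Num.min s k%:R)) = fun s => Num.max (Num.min s k%:R) 0.
      by apply/funext => s; rewrite maxC.
    rewrite e; move=> s; apply: (@continuous_comp _ _ _ (fun s : R => Num.min s k%:R) (fun t => Num.max t 0)); last exact: max0_cont.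
    by apply: continuous_min; [exact: cvg_id|exact: cvg_cst].
  move=> s; apply: (@continuous_comp _ _ _ (fun s => 1 + Num.max 0 (Num.min s k%:R)) (fun t => t `^ (- p))); last exact: powR_cont.
  by apply: cvgD; [exact: cvg_cst|exact: c1].
have hexH (k : nat) : exists F : R -> R, F 0 = 0 /\ C1fun F (w k).
  have [F [F0 hF]] := C1_primitive (wc k); exists F; split => //; apply: C1_eq hF => // t.
  have [t0|/ltW t0] : 0 <= t \/ t < 0 by case: (lerP 0 t) => h; [left|right].
    by rewrite max_l.
  by rewrite (max_r t0) /w !max_l// ge_min ?lexx ?t0.
have [H hH] := choice hexH.
have hexK (k : nat) : exists F : R -> R,
    [/\ C1fun F (fun t => (w k (F t))^-1), forall t, H k (F t) = t & forall s, F (H k s) = s].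
  have c0 : 0 < (1 + k%:R : R) `^ (- p) by rewrite powR_gt0// ltr_pwDl.
  apply: (C1_inverse c0 (hH k).2 _ (hH k).1) => t.
  by apply: powR_decr => //; rewrite lerD2l ge_max ge_min lexx orbT ler0n.
have [K hK] := choice hexK.
have inc (k : nat) a b : a < b -> H k a < H k b.
  move=> ab; have [x [_ _ e]] := C1_mvt (hH k).2 (ltW ab).
  by rewrite -subr_gt0 e mulr_gt0 ?subr_gt0// powR_gt0.
have agree (k j : nat) s : (k <= j)%N -> s <= k%:R -> H k s = H j s.
  move=> kj sk.
  have wE r : r <= k%:R -> w k r = w j r.
    by move=> rk; rewrite /w !min_l// (le_trans rk)// ler_nat.
  have hD := C1D (hH k).2 (C1N (hH j).2).
  suff : H k s - H j s = H k 0 - H j 0 by rewrite (hH k).1 (hH j).1 subrr => /eqP; rewrite subr_eq0 => /eqP.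
  have [s0|s0] := leP 0 s.
    have [x [_ xs e]] := C1_mvt hD s0; rewrite wE ?subrr ?mul0r in e; last exact: le_trans sk.
    by apply/eqP; rewrite -subr_eq0 e.
  have [x [_ xs e]] := C1_mvt hD (ltW s0); rewrite wE ?subrr ?mul0r in e; last exact: le_trans xs _.
  by apply/esym/eqP; rewrite -subr_eq0 e.
exists K; split => [k|k|k j t kj].
- have [h _ _] := hK k; apply: C1_eq h => // t.
  by rewrite /w powRN invrK.
- have [_ _ h] := hK k; by rewrite -[in LHS](hH k).1 h.
- have [_ Hk Kk] := hK k; have [_ Hj Kj] := hK j => /orP[h|h].
    by rewrite -{2}(Hk t) (agree k j) ?Kj.
  by rewrite -{1}(Hj t) -(agree k j) ?Kk.
Qed.

Lemma C1_compact_lip f f' (a : R) : C1fun f f' -> 0 <= a -> (forall t, a <= t -> f' t = 0) ->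
  exists2 L, 0 <= L & forall s t, 0 <= s -> 0 <= t -> `|f s - f t| <= L * `|s - t|.
Proof.
move=> hf a0 h0.
have cn : {within `[0, a], continuous (fun t => `|f' t|)}.
  apply: continuous_subspaceT => t; apply: cvg_norm; exact: hf.2.
have [c _ hc] := EVT_max a0 cn; exists `|f' c|; first exact: normr_ge0.
have bd t : 0 <= t -> `|f' t| <= `|f' c|.
  move=> t0; have [at_|ta] := leP a t; first by rewrite h0// normr0.
  by apply: hc; rewrite in_itv/= t0 ltW.
have key s t : 0 <= s -> s <= t -> `|f t - f s| <= `|f' c| * `|t - s|.
  move=> s0 st; have [x [sx _ ->]] := C1_mvt hf st.
  by rewrite normrM ler_wpM2r// bd// (le_trans s0).
move=> s t s0 t0; have [st|/ltW ts] := leP s t; last exact: key.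
by rewrite distrC (distrC s); exact: key.
Qed.

End truncations.

(** * The change of unknown and the regularised singular term *)

Section nonlinearity.
Context {R : realType}.
Implicit Types (t s : R).
Variables (p th : R).
Hypothesis p0 : 0 <= p.
Hypothesis th0 : 0 < th.
Variable K : nat -> R -> R.
(* K k is the inverse of the primitive of (1 + min(s, k))^-p, so that the unknown
   v = K^-1(u) turns the principal part into div(b grad v). *)
Definition Kd (k : nat) t := (1 + Num.max 0 (Num.min (K k t) k%:R)) `^ p.
Hypothesis K_C1 : forall k, C1fun (K k) (Kd k).
Hypothesis K_0 : forall k, K k 0 = 0.
Hypothesis K_agree : forall k j t, (k <= j)%N -> (K k t <= k%:R) || (K j t <= k%:R) -> K k t = K j t.

Lemma Kd_ge1 k t : 1 <= Kd k t.
Proof.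
have e : (1 : R) `^ p = 1 by rewrite powR1.
rewrite -e; apply: ge0_ler_powR => //; rewrite ?nnegrE ?ler01//.
  by rewrite addr_ge0// le_max lexx.
by rewrite lerDl le_max lexx.
Qed.

Lemma Kd_gt0 k t : 0 < Kd k t. Proof. exact: lt_le_trans (Kd_ge1 k t). Qed.

Lemma Kd_le k t : Kd k t <= (1 + k%:R) `^ p.
Proof.
apply: ge0_ler_powR => //; rewrite ?nnegrE ?addr_ge0// ?le_max ?lexx//.
by rewrite lerD2l ge_max ge_min lexx orbT ler0n.
Qed.

Lemma Kd_E k t : 0 <= K k t -> K k t <= k%:R -> Kd k t = (1 + K k t) `^ p.
Proof. by move=> h1 h2; rewrite /Kd min_l// max_r. Qed.

Lemma K_mono k t s : t <= s -> K k t <= K k s.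
Proof. by apply: (C1_nd (K_C1 k)) => x; rewrite ltW// Kd_gt0. Qed.

Lemma K_lt k t s : t < s -> K k t < K k s.
Proof.
move=> ts; have [c [_ _ e]] := C1_mvt (K_C1 k) (ltW ts).
by rewrite -subr_gt0 e mulr_gt0 ?Kd_gt0// subr_gt0.
Qed.

Lemma K_ge k t : 0 <= t -> t <= K k t.
Proof.
move=> t0; have [c [_ _ e]] := C1_mvt (K_C1 k) t0.
by rewrite K_0 !subr0 in e; rewrite e ler_peMl// Kd_ge1.
Qed.

Lemma K_ge0 k t : 0 <= t -> 0 <= K k t. Proof. by move=> t0; rewrite -(K_0 k) K_mono. Qed.

Lemma K_gt0 k t : 0 < t -> 0 < K k t. Proof. by move=> t0; rewrite -(K_0 k) K_lt. Qed.

Lemma K_le0 k t : t <= 0 -> K k t <= 0. Proof. by move=> t0; rewrite -(K_0 k) K_mono. Qed.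

(* [good] is t < H(+oo), the range of the change of unknown, which is bounded
   when p > 1; [uu] is a junk value elsewhere. *)
Definition good t := exists k, K k t <= k%:R.
Definition uu t := K (xget 0%N [set k | K k t <= k%:R]) t.

Lemma uuE k t : K k t <= k%:R -> uu t = K k t.
Proof.
move=> h; rewrite /uu; case: xgetP => [j _ /= hj|/(_ k)//].
have [kj|/ltnW jk] := leqP k j; first by rewrite (K_agree kj) ?h.
by rewrite (K_agree jk) ?hj.
Qed.

Lemma good_mono k j t : (k <= j)%N -> K k t <= k%:R -> K j t <= j%:R.
Proof. by move=> kj h; rewrite -(K_agree kj) ?h// (le_trans h)// ler_nat. Qed.

Definition dlt (n : nat) : R := n.+1%:R^-1.

Lemma dlt_gt0 n : 0 < dlt n. Proof. by rewrite invr_gt0. Qed.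

Lemma dlt_mono n m : (n <= m)%N -> dlt m <= dlt n.
Proof. by move=> nm; rewrite lef_pV2 ?posrE// ler_nat. Qed.

Lemma dlt_cvg : dlt n @[n --> \oo] --> (0 : R).
Proof. exact: cvg_harmonic. Qed.

(* Equal to (1 + s)^(2p) s (s + 1/(n+1))^(-1-th) for s >= 0. *)
Definition Qn n s := pw (2 * p) s * (s * (dlt n `^ (- (1 + th)) * pw (- (1 + th)) ((dlt n)^-1 * s))).

Lemma QnE n s : 0 <= s -> Qn n s = (1 + s) `^ (2 * p) * (s * (s + dlt n) `^ (- (1 + th))).
Proof.
move=> s0; have d0 := dlt_gt0 n; have ds : 0 <= (dlt n)^-1 * s by rewrite mulr_ge0// invr_ge0 ltW.
rewrite /Qn !pwE// -powRM ?addr_ge0 ?(ltW d0)//.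
have -> : dlt n * (1 + (dlt n)^-1 * s) = s + dlt n by field; rewrite gt_eqF.
by [].
Qed.

Lemma Qn_ge0 n s : 0 <= s -> 0 <= Qn n s.
Proof. by move=> s0; rewrite QnE// !mulr_ge0// powR_ge0. Qed.

Lemma Qn_mono n m s : (n <= m)%N -> 0 <= s -> Qn n s <= Qn m s.
Proof.
move=> nm s0; rewrite !QnE// ler_wpM2l ?powR_ge0// ler_wpM2l//.
apply: powR_decr; [by rewrite addr_ge0// ltW|by rewrite ltr_wpDl// dlt_gt0|].
by rewrite lerD2l dlt_mono.
Qed.

Definition qn n s := chi n%:R s * Qn n s.

Lemma C1_qn n : exists2 q', C1fun (qn n) q' & forall s, n.+1%:R <= s -> q' s = 0.
Proof.
have h1 := C1_comp (C1_pw (- (1 + th))) (C1Z (dlt n)^-1 C1_id).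
have h2 := C1M (C1_pw (2 * p)) (C1M C1_id (C1Z (dlt n `^ (- (1 + th))) h1)).
have h3 := C1M (C1_chi n%:R) h2.
eexists; first exact: h3.
move=> s; rewrite -natr1 => hs.
by rewrite /= chi'_r// chi_0// !mul0r addr0.
Qed.

(** [chi n] vanishes from n + 1 on, which is where [K n.+1] stops being the exact change of unknown:
    the truncation of [K] is never felt by [Gn]. *)
Definition Gn n t := qn n (Num.max (K n.+1 t) 0).

Let max0 t : 0 <= Num.max t 0 :> R. Proof. by rewrite le_max lexx orbT. Qed.

Lemma Gn_ge0 n t : 0 <= Gn n t.
Proof. by rewrite mulr_ge0 ?chi_ge0 ?Qn_ge0. Qed.

Lemma Gn_0 n t : t <= 0 -> Gn n t = 0.
Proof. by move=> t0; rewrite /Gn max_r ?K_le0// /qn /Qn mul0r !mulr0. Qed.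

Lemma Gn_lip n : exists2 L, 0 <= L & forall s t, `|Gn n s - Gn n t| <= L * `|s - t|.
Proof.
have [q' hq hq0] := C1_qn n.
have [L L0 hL] := C1_compact_lip hq (ler0n _ n.+1) hq0.
exists (L * (1 + n.+1%:R) `^ p); first by rewrite mulr_ge0// powR_ge0.
move=> s t; apply: (le_trans (hL _ _ (max0 _) (max0 _))).
rewrite -mulrA ler_wpM2l//.
have h1 : `|K n.+1 s - K n.+1 t| <= (1 + n.+1%:R) `^ p * `|s - t|.
  by apply: (C1_lip (K_C1 n.+1)) => x; rewrite gtr0_norm ?Kd_gt0 ?Kd_le.
apply: le_trans h1; exact: max0_contract.
Qed.

Lemma Gn_bdd n : exists2 M, 0 <= M & forall t, Gn n t <= M.
Proof.
have [q' hq hq0] := C1_qn n.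
have [L L0 hL] := C1_compact_lip hq (ler0n _ n.+1) hq0.
exists (L * n.+1%:R); first by rewrite mulr_ge0.
move=> t; set s := Num.max (K n.+1 t) 0.
have [h|h] := leP n.+1%:R s.
  by rewrite /Gn /qn chi_0 -?natr1 -/s ?mul0r ?mulr_ge0// natr1.
have := hL s 0 (max0 _) (lexx _).
have -> : qn n 0 = 0 by rewrite /qn /Qn mul0r !mulr0.
rewrite !subr0 => h1; apply: (le_trans (ler_norm _)); apply: (le_trans h1).
by rewrite ler_wpM2l// ger0_norm ?max0// ltW.
Qed.

Lemma Gn_mono n m t : (n <= m)%N -> Gn n t <= Gn m t.
Proof.
move=> nm; have [t0|t0] := leP t 0; first by rewrite !Gn_0.
rewrite /Gn !max_l ?K_ge0 ?(ltW t0)// /qn.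
have [->|/chi_lt] := eqVneq (chi n%:R (K n.+1 t)) 0.
  by rewrite mul0r mulr_ge0 ?chi_ge0 ?Qn_ge0 ?K_ge0 ?(ltW t0).
rewrite natr1 => /ltW h.
have nm1 : (n.+1 <= m.+1)%N by [].
rewrite -(K_agree nm1) ?h// ler_pM ?chi_ge0 ?Qn_ge0 ?K_ge0 ?(ltW t0)//.
  by apply: chi_mono; rewrite ler_nat.
by apply: Qn_mono; rewrite ?K_ge0 ?(ltW t0).
Qed.

(** As K(t) >= t, the singularity in u is dominated by the same power of v. This is what allows an
    integrating factor that depends on v alone. *)
Lemma Gn_up k n t : 0 <= t -> K k t <= k%:R ->
  Gn n t <= (1 + k%:R) `^ (2 * p) * (t + dlt n) `^ (- th).
Proof.
move=> t0 hk; rewrite /Gn max_l ?K_ge0// /qn.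
have [->|/chi_lt] := eqVneq (chi n%:R (K n.+1 t)) 0.
  by rewrite mul0r mulr_ge0// powR_ge0.
rewrite natr1 => /ltW h.
have s0 := K_ge0 n.+1 t0.
have d0 := dlt_gt0 n.
apply: (@le_trans _ _ (Qn n (K n.+1 t))); first by rewrite ler_piMl ?Qn_ge0 ?chi_le1.
rewrite QnE//; apply: ler_pM; rewrite ?powR_ge0 ?mulr_ge0 ?powR_ge0//.
  have -> : K n.+1 t = K k t by rewrite -(uuE h) -(uuE hk).
  by apply: ge0_ler_powR; rewrite ?nnegrE ?mulr_ge0 ?addr_ge0 ?K_ge0 ?lerD2l.
have sd : 0 < K n.+1 t + dlt n by rewrite ltr_wpDl.
apply: (@le_trans _ _ ((K n.+1 t + dlt n) `^ (- th))).
  rewrite opprD powRD; last by apply/implyP => _; rewrite gt_eqF.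
  rewrite powR_inv1 ?(ltW sd)// mulrA ler_piMl ?powR_ge0// ler_pdivrMr// mul1r lerDl ltW//.
apply: powR_decr; [exact: ltW|by rewrite ltr_wpDl|].
by rewrite lerD2r K_ge.
Qed.

(* The equation for v reads - div(b grad v) + B Glim(v) |grad v|^2 = f. *)
Definition Glim t := (1 + uu t) `^ (2 * p) * uu t `^ (- th).

(** Index and argument move together, as along the diagonal sequence. Passing from level k to k + 1
    turns the bound on K(t) into a strict one, which persists at the arguments [tn n]. *)
Lemma Gn_cvg (t : R) (tn : nat -> R) (ix : nat -> nat) : 0 < t -> good t ->
  (forall n, (n <= ix n)%N) -> tn n @[n --> \oo] --> t -> Gn (ix n) (tn n) @[n --> \oo] --> Glim t.
Proof.
move=> t0 [k hk] hix ht.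
have hk1 : K k.+1 t < k.+1%:R.
  rewrite -(K_agree (leqnSn k)) ?hk// (le_lt_trans hk)// ltr_nat//.
have uE : uu t = K k.+1 t by apply: uuE; exact: ltW.
have c1 : K k.+1 (tn n) @[n --> \oo] --> K k.+1 t by exact: (cvg_C1 (K_C1 _) ht).
have u0 : 0 < K k.+1 t by exact: K_gt0.
have c2 : (1 + K k.+1 (tn n)) `^ (2 * p) * (K k.+1 (tn n) * (K k.+1 (tn n) + dlt (ix n)) `^ (- (1 + th)))
    @[n --> \oo] --> Glim t.
  have -> : Glim t = (1 + K k.+1 t) `^ (2 * p) * (K k.+1 t * (K k.+1 t + 0) `^ (- (1 + th))).
    rewrite /Glim uE addr0 opprD powRD; last by apply/implyP => _; rewrite gt_eqF.
    by rewrite powR_inv1 ?(ltW u0)//; congr (_ * _); rewrite mulrA mulfV ?gt_eqF// mul1r.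
  apply: cvgM.
    apply: (@cvg_comp _ _ _ (fun n => 1 + K k.+1 (tn n)) (fun t => t `^ (2 * p)) _ (nbhs (1 + K k.+1 t))).
      by apply: cvgD => //; exact: cvg_cst.
    by apply: powR_cont; rewrite addr_gt0.
  apply: cvgM => //.
  apply: (@cvg_comp _ _ _ (fun n => K k.+1 (tn n) + dlt (ix n)) (fun t => t `^ (- (1 + th))) _ (nbhs (K k.+1 t + 0))).
    apply: cvgD => //.
    apply: (squeeze_cvgr _ (cvg_cst 0) dlt_cvg); apply: nearW => n.
    by rewrite ltW ?dlt_gt0//= dlt_mono.
  by apply: powR_cont; rewrite addr0.
apply: cvg_trans c2; apply: near_eq_cvg.
have nb1 : \forall n \near \oo, K k.+1 (tn n) < k.+1%:R by exact: (cvgr_lt _ c1).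
have nb2 : \forall n \near \oo, 0 < K k.+1 (tn n) by exact: (cvgr_gt _ c1).
near=> n.
have h1 : K k.+1 (tn n) < k.+1%:R by near: n.
have h2 : 0 < K k.+1 (tn n) by near: n.
have h3 : (k.+1 <= n)%N by near: n; exact: nbhs_infty_ge.
have e : K (ix n).+1 (tn n) = K k.+1 (tn n).
  by rewrite -(@K_agree k.+1 (ix n).+1) ?(ltW h1)// ltnW// ltnS (leq_trans h3).
rewrite /Gn e max_l ?(ltW h2)// /qn chi_1 ?mul1r ?QnE ?(ltW h2)//.
by rewrite (le_trans (ltW h1))// ler_nat (leq_trans h3).
Unshelve. all: by end_near.
Qed.

End nonlinearity.

(** * Approximating sequence *)

Section tests.
Context {R : realType}.
Implicit Types (t s : R).

Definition lg t := ln (1 + Num.max t 0) + Num.min t 0.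

Lemma C1_lg : C1fun lg (fun t => (1 + Num.max t 0)^-1).
Proof.
have := @C1_extend R (fun t => ln (1 + t)) (fun t => (1 + t)^-1).
move=> h; apply: C1_eq (h _ _) => //.
- by move=> t; rewrite /lg addr0 invr1 mul1r.
- move=> t t1; have t0 : 0 < 1 + t by lra.
  have h1 : is_derive t 1 (fun t : R => 1 + t) 1.
    by have := ((C1D (C1_cst 1) C1_id).1 t : is_derive t (1 : R) (fun t : R => 1 + t) (0 + 1)); rewrite add0r.
  have := @is_derive1_comp R (@ln R) (fun t => 1 + t) t _ _ (is_derive1_ln t0) h1.
  by rewrite mulr1.
- move=> t t1; have t0 : 1 + t != 0 by rewrite gt_eqF//; lra.
  by apply: cvgV => //; apply: cvgD; [exact: cvg_cst|exact: cvg_id].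
Qed.

Let max1 t : 1 <= 1 + Num.max t 0.
Proof. by rewrite lerDl le_max lexx orbT. Qed.

Let max1_gt0 t : 0 < 1 + Num.max t 0. Proof. exact: lt_le_trans ltr01 (max1 t). Qed.

Lemma lg'_bd t : `|(1 + Num.max t 0)^-1| <= 1.
Proof. by rewrite ger0_norm ?invr_ge0 ?(ltW (max1_gt0 t))// invf_le1. Qed.

Lemma lg0 : lg 0 = 0.
Proof. by rewrite /lg max_l// min_l// !addr0 ln1. Qed.

Lemma lg_mono t s : t <= s -> lg t <= lg s.
Proof. by apply: (C1_nd C1_lg) => x; rewrite invr_ge0 ltW. Qed.

Lemma lg_ge0 t : 0 <= t -> 0 <= lg t. Proof. by move=> /lg_mono; rewrite lg0. Qed.

Lemma lg_expR t : 0 <= t -> t <= expR (lg t).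
Proof.
move=> t0; rewrite /lg max_l// min_r// addr0 lnK ?posrE; last by rewrite ltr_pwDl.
by rewrite lerDr.
Qed.

(** Equal to t / (1 + t) for t >= 0. It is bounded by 1, so that the tested datum costs no more than
    its mass, and its derivative is the square of that of log(1 + t). *)
Definition sat t := 1 - pw (-1) t.

Lemma C1_sat : C1fun sat (fun t => (1 + Num.max t 0)^-1 ^+ 2).
Proof.
apply: C1_eq (C1D (C1_cst 1) (C1N (C1_pw (-1)))) => // t.
rewrite add0r mulN1r opprK (_ : -1 - 1 = - 2%:R); last by ring.
by rewrite powR_invn ?(ltW (max1_gt0 t))// exprVn.
Qed.

Lemma sat0 : sat 0 = 0.
Proof. by rewrite /sat pwE// addr0 powR1 subrr. Qed.

Lemma sat_le1 t : 0 <= t -> sat t <= 1.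
Proof. by move=> t0; rewrite /sat pwE// gerBl powR_ge0. Qed.

Lemma sat'_bd t : `|(1 + Num.max t 0)^-1 ^+ 2| <= 1.
Proof. by rewrite normrX exprn_ile1// lg'_bd. Qed.

Lemma sat_ge0 t : 0 <= t -> 0 <= sat t.
Proof. by move=> t0; rewrite -sat0; apply: (C1_nd C1_sat _ t0) => x; exact: sqr_ge0. Qed.

(* Increases to the indicator function of t > 0 as e decreases to 0. *)
Definition pind (e : R) t := sat (e^-1 * pos2 t).
Definition pind' (e : R) t := (1 + Num.max (e^-1 * pos2 t) 0)^-1 ^+ 2 * (e^-1 * (2 * Num.max t 0)).

Lemma C1_pind e : C1fun (pind e) (pind' e).
Proof. exact: C1_comp C1_sat (C1Z e^-1 C1_pos2). Qed.

Lemma pind'_ge0 e t : 0 < e -> 0 <= pind' e t.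
Proof. 
move=> e0; rewrite /pind'; apply: mulr_ge0; first exact: sqr_ge0.
by rewrite mulr_ge0 ?invr_ge0 ?(ltW e0)// mulr_ge0// le_max lexx orbT. Qed.

Lemma pind'_bd e t : 0 < e -> e <= 1 -> `|pind' e t| <= e^-1.
Proof.
move=> e0 e1; rewrite ger0_norm ?pind'_ge0//.
have ei0 : 0 < e^-1 by rewrite invr_gt0.
have m0 : 0 <= Num.max t 0 by rewrite le_max lexx orbT.
rewrite /pind' /pos2 (@max_l _ _ (e^-1 * _)) ?mulr_ge0 ?sqr_ge0 ?(ltW ei0)//.
set q := Num.max t 0 in m0 *.
have h : 1 + q ^+ 2 <= 1 + e^-1 * q ^+ 2.
  by rewrite lerD2l ler_peMl ?sqr_ge0// invf_ge1.
rewrite mulrCA ler_piMr ?(ltW ei0)//.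
set w := e^-1 * q ^+ 2 in h *.
have w1 : 1 <= 1 + w by have := sqr_ge0 q; lra.
have w0 : 0 < 1 + w by exact: lt_le_trans w1.
rewrite exprVn mulrC ler_pdivrMr ?exprn_gt0// mul1r.
have := sqr_ge0 (q - 1); nra.
Qed.

Lemma pind_ge0 e t : 0 < e -> 0 <= pind e t.
Proof. by move=> e0; rewrite sat_ge0// mulr_ge0 ?pos2_ge0// invr_ge0 ltW. Qed.

Lemma pind_le1 e t : 0 < e -> pind e t <= 1.
Proof. by move=> e0; rewrite sat_le1// mulr_ge0 ?pos2_ge0// invr_ge0 ltW. Qed.

Lemma pind0 e : pind e 0 = 0.
Proof. by rewrite /pind pos2_neg// mulr0 sat0. Qed.

Lemma pindE e t : 0 < e -> pind e t = pos2 t / (e + pos2 t).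
Proof.
move=> e0; have p0 := pos2_ge0 t; have q0 : 0 < e + pos2 t by lra.
have pe : 0 <= e^-1 * pos2 t by rewrite mulr_ge0// invr_ge0 ltW.
rewrite /pind /sat pwE// powR_inv1 ?addr_ge0//.
by field; rewrite !gt_eqF.
Qed.

Lemma pind_cvg t : pind (dlt n) t @[n --> \oo] --> ((0 < t)%R%:R : R).
Proof.
have [t0|t0] := leP t 0.
  rewrite (_ : (fun n => _) = fun=> 0); last by apply/funext => n; rewrite /pind pos2_neg// mulr0 sat0.
  exact: cvg_cst.
rewrite (_ : (fun n => _) = fun n => pos2 t / (dlt n + pos2 t)); last first.
  by apply/funext => n; rewrite pindE ?dlt_gt0.
have p0 : 0 < pos2 t by rewrite pos2_pos ?(ltW t0)// exprn_gt0.
rewrite (_ : true%:R = pos2 t / (0 + pos2 t)); last by rewrite add0r divff// gt_eqF.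
apply: cvgM; first exact: cvg_cst.
apply: cvgV; first by rewrite add0r gt_eqF.
by apply: cvgD; [exact: dlt_cvg|exact: cvg_cst].
Qed.

End tests.

(** * A priori estimates by the mass of the datum *)

Section solutions.
Context {d : measure_display} {T : measurableType d} {R : realType}.
Variable nu : {measure set T -> \bar R}.
Hypothesis nufin : (nu setT < +oo)%E.
Context {N : nat}.
Variables (C : set (T -> R)) (D : (T -> R) -> T -> 'rV[R]_N).
Hypothesis tc : test_class nu C D.
Notation L1 := (L1 nu).
Notation L2 := (L2 nu).
Notation I := (I nu).
Notation aE := (aE nu).
Notation VG := (vg T R N).
Notation isL2 := (@isL2 _ T R nu N).
Notation E2 := (@E2 _ T R nu N).
Notation H := (H nu C D).
Notation Hb := (Hb nu C D).
Variables (alpha beta : R) (b : T -> R).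
Hypothesis alpha0 : 0 < alpha.
Hypothesis mb : measf b.
Hypothesis hb : forall t, alpha <= b t <= beta.
Notation en := (en nu b).

Let ba t : alpha <= b t. Proof. by have /andP[] := hb t. Qed.
Let b0 t : 0 < b t. Proof. exact: lt_le_trans alpha0 (ba t). Qed.
Let bn t : `|b t| <= beta. Proof. by rewrite ger0_norm ?(ltW (b0 t))//; have /andP[] := hb t. Qed.

Definition sol (Phi h : T -> R) (x : VG) := [/\ H x, L2 Phi, L2 h &
  forall z, H z -> en 0 x z + I (fun t => Phi t * vf z t) = I (fun t => h t * vf z t)].

Lemma L1_bg2 (k : T -> R) M x : measf k -> (forall t, `|k t| <= M) -> isL2 x ->
  L1 (fun t => b t * (k t * sq (vv x t))).
Proof.
by move=> mk hk hx; apply: (L1_bM mb bn); apply: (L1_bM mk hk); exact: L2v_sq hx.2.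
Qed.

Lemma sol_test Phi h x r r' M : sol Phi h x -> C1fun r r' -> (forall t, `|r' t| <= M) -> r 0 = 0 ->
  [/\ L1 (fun t => b t * (r' (vf x t) * sq (vv x t))), L1 (fun t => Phi t * r (vf x t)),
      L1 (fun t => h t * r (vf x t)) &
  I (fun t => b t * (r' (vf x t) * sq (vv x t))) + I (fun t => Phi t * r (vf x t)) =
    I (fun t => h t * r (vf x t))].
Proof.
move=> [hx LP Lh eq] hr hM r0.
have hz := H_comp nufin tc hr hM r0 hx; have hz2 := H_isL2 hz.
split.
- by apply: (L1_bg2 (M := M)); [exact: mf_cont hr.2 (H_isL2 hx).1.1|by []|exact: (H_isL2 hx)].
- exact: L2M LP hz2.1.
- exact: L2M Lh hz2.1.
rewrite -(eq _ hz) en0E; congr (_ + _).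
by apply: I_eq => t; rewrite /= dotrZr.
Qed.

Lemma sol_mtest Phi h x r r' M K A w : sol Phi h x -> C1fun r r' -> (forall t, `|r' t| <= M) ->
  (forall t, `|r t| <= K) -> Hb A w ->
  [/\ L1 (fun t => b t * (r (vf x t) * dotr (vv x t) (vv w t))),
      L1 (fun t => b t * (vf w t * r' (vf x t) * sq (vv x t))),
      L1 (fun t => Phi t * (vf w t * r (vf x t))),
      L1 (fun t => h t * (vf w t * r (vf x t))) &
  I (fun t => b t * (r (vf x t) * dotr (vv x t) (vv w t))) +
  I (fun t => b t * (vf w t * r' (vf x t) * sq (vv x t))) + I (fun t => Phi t * (vf w t * r (vf x t))) =
    I (fun t => h t * (vf w t * r (vf x t)))].
Proof.
move=> [hx LP Lh eq] hr hM hK hw; have hx2 := H_isL2 hx; have hw2 := H_isL2 (Hb_H hw).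
have hz := Hb_H (Hb_mulcomp nufin tc hr hM hK hw hx); have hz2 := H_isL2 hz.
have mr : measf (fun t => r (vf x t)) by exact: mf_cont (C1_cont hr) hx2.1.1.
have La : L1 (fun t => b t * (r (vf x t) * dotr (vv x t) (vv w t))).
  apply: (L1_bM mb bn); apply: (L1_bM mr) => [t|]; [exact: hK|exact: L2v_dot hx2.2 hw2.2].
have Lb : L1 (fun t => b t * (vf w t * r' (vf x t) * sq (vv x t))).
  apply: (L1_bg2 (M := A * M)) => //.
    by apply: mfM; [exact: hw2.1.1|exact: mf_cont hr.2 hx2.1.1].
  by move=> t; rewrite normrM; apply: ler_pM => //; exact: hw.1.
split => //; first exact: L2M LP hz2.1.
  exact: L2M Lh hz2.1.
rewrite -(eq _ hz) en0E -ID//; congr (_ + _).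
by apply: I_eq => t; rewrite /= dotrDr !dotrZr -/(sq _); ring.
Qed.

Lemma sol_energy Phi h x : sol Phi h x -> (forall t, 0 <= vf x t) -> (forall t, 0 <= Phi t) ->
  (forall t, 0 <= h t) ->
  alpha * I (fun t => (1 + vf x t)^-1 ^+ 2 * sq (vv x t)) <= I h.
Proof.
move=> hs v0 P0 h0; have [La Lb Lc e] := sol_test hs C1_sat (@sat'_bd R) (@sat0 R).
have hx2 := let: And4 h _ _ _ := hs in H_isL2 h.
have Lh : L1 h by case: hs => _ _ hh _; exact: L2_L1 hh.
have p1 : 0 <= I (fun t => Phi t * sat (vf x t)) by apply: I_ge0 => t; rewrite mulr_ge0// sat_ge0.
have p2 : I (fun t => h t * sat (vf x t)) <= I h.
  by apply: I_le => // t; rewrite ler_piMr// sat_le1.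
have Ld : L1 (fun t => (1 + vf x t)^-1 ^+ 2 * sq (vv x t)).
  apply: (L1_eq (f := fun t => (1 + Num.max (vf x t) 0)^-1 ^+ 2 * sq (vv x t))).
    by move=> t; rewrite max_l.
  apply: (L1_bM (M := 1)); [|by move=> t; exact: sat'_bd|exact: L2v_sq hx2.2].
  exact: mf_cont C1_sat.2 hx2.1.1.
rewrite -IZ//.
have : I (fun t => alpha * ((1 + vf x t)^-1 ^+ 2 * sq (vv x t))) <=
    I (fun t => b t * ((1 + Num.max (vf x t) 0)^-1 ^+ 2 * sq (vv x t))).
  apply: I_le => //; first exact: L1Z.
  by move=> t; rewrite max_l// ler_wpM2r// mulr_ge0 ?sqr_ge0 ?sq_ge0.
by move: e p1 p2; lra.
Qed.

(** Poincare's inequality for log(1 + v), whose gradient is bounded by the test v / (1 + v). The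
    bound depends on the datum through its mass alone, hence is uniform in the truncations of
    [f]. *)
Lemma sol_log : exists2 K, 0 < K & forall Phi h x, sol Phi h x -> (forall t, 0 <= vf x t) ->
  (forall t, 0 <= Phi t) -> (forall t, 0 <= h t) ->
  L1 (fun t => lg (vf x t) ^+ 2) /\ I (fun t => lg (vf x t) ^+ 2) <= K * I h.
Proof.
have [K K0 hK] := H_poincare nufin tc.
exists (K / alpha); first by rewrite divr_gt0.
move=> Phi h x hs v0 P0 h0; have := sol_energy hs v0 P0 h0.
have Hx : H x by case: hs.
have hz := H_comp nufin tc C1_lg (@lg'_bd R) (@lg0 R) Hx; have hz2 := H_isL2 hz.
move=> e; split; first exact: hz2.1.2.
apply: (le_trans (hK _ hz)); rewrite -mulrA ler_wpM2l ?(ltW K0)//.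
rewrite mulrC ler_pdivlMr//; apply: le_trans e; rewrite mulrC ler_wpM2l ?(ltW alpha0)//.
rewrite le_eqVlt; apply/orP; left; apply/eqP; apply: I_eq => t.
by rewrite /= sqZ max_l.
Qed.

(** Test with approximations of the indicator of v > 0: the principal part contributes a nonnegative
    term, and nothing of [Phi] is lost, as it vanishes where v does. *)
Lemma sol_mass Phi h x : sol Phi h x -> (forall t, 0 <= vf x t) -> (forall t, 0 <= Phi t) ->
  (forall t, 0 <= h t) -> (forall t, vf x t = 0 -> Phi t = 0) -> I Phi <= I h.
Proof.
move=> hs v0 P0 h0 hP.
have Lh : L1 h by case: hs => _ _ hh _; exact: L2_L1 hh.
have LP : L1 Phi by case: hs => _ hh _ _; exact: L2_L1 hh.
have d1 n : (dlt n : R) <= 1 by rewrite invf_le1// ler1n.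
have tst n := sol_test hs (C1_pind (dlt n : R)) (fun t => pind'_bd t (dlt_gt0 n) (d1 n)) (pind0 _).
suff : L1 Phi /\ I Phi <= I h by case.
apply: (@I_fatou _ _ _ nu (fun n t => Phi t * pind (dlt n) (vf x t)) Phi (fun=> I h)).
- by move=> n; have [] := tst n.
- exact: L1_mf LP.
- by move=> n t; rewrite mulr_ge0// pind_ge0// dlt_gt0.
- by [].
- apply: aE_all => t; have [e|e] := eqVneq (vf x t) 0.
    rewrite hP// (_ : (fun n => _) = fun=> 0); first exact: cvg_cst.
    by apply/funext => n; rewrite mul0r.
  have vp : 0 < vf x t by rewrite lt_neqAle eq_sym e v0.
  have := cvg_mulcR (Phi t) (@pind_cvg R (vf x t)); rewrite vp mulr1; exact.
- move=> n; have [La Lb Lc e] := tst n.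
  have p1 : 0 <= I (fun t => b t * (pind' (dlt n) (vf x t) * sq (vv x t))).
    apply: I_ge0 => t; apply: mulr_ge0; first exact: ltW.
    by rewrite mulr_ge0 ?sq_ge0// pind'_ge0// dlt_gt0.
  have p2 : I (fun t => h t * pind (dlt n) (vf x t)) <= I h.
    by apply: I_le => // t; rewrite ler_piMr// pind_le1// dlt_gt0.
  by move: e p1 p2; lra.
- exact: cvg_cst.
Qed.

End solutions.

(** * Almost everywhere limit of the doubly indexed minimal solutions *)

Section approximation.
Context {d : measure_display} {T : measurableType d} {R : realType}.
Variable nu : {measure set T -> \bar R}.
Hypothesis nufin : (nu setT < +oo)%E.
Context {N : nat}.
Variables (C : set (T -> R)) (D : (T -> R) -> T -> 'rV[R]_N).
Hypothesis tc : test_class nu C D.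
Notation L1 := (L1 nu).
Notation L2 := (L2 nu).
Notation I := (I nu).
Notation aE := (aE nu).
Notation VG := (vg T R N).
Notation isL2 := (@isL2 _ T R nu N).
Notation E2 := (@E2 _ T R nu N).
Notation H := (H nu C D).
Variables (alpha beta : R) (b : T -> R).
Hypothesis alpha0 : 0 < alpha.
Hypothesis mb : measf b.
Hypothesis hb : forall t, alpha <= b t <= beta.
Notation en := (en nu b).
Notation sol := (sol nu C D b).

Variables (B : R) (G : nat -> R -> R).
Hypothesis B0 : 0 < B.
Hypothesis G_ge0 : forall n t, 0 <= G n t.
Hypothesis G_0 : forall n, G n 0 = 0.
Hypothesis G_lip : forall n, exists2 L, 0 <= L & forall s t, `|G n s - G n t| <= L * `|s - t|.
Hypothesis G_bdd : forall n, exists2 M, 0 <= M & forall t, G n t <= M.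
Hypothesis G_mono : forall n m t, (n <= m)%N -> G n t <= G m t.

Definition Fn (n : nat) (s : R) (xi : 'rV[R]_N) := B * (G n s * Num.min (nrm xi) n%:R ^+ 2).

Let min0 (n : nat) (xi : 'rV[R]_N) : 0 <= Num.min (nrm xi) n%:R.
Proof. by rewrite le_min nrm_ge0 ler0n. Qed.

Lemma Fn_ge0 n s xi : 0 <= Fn n s xi.
Proof. by rewrite mulr_ge0 ?(ltW B0)// mulr_ge0// sqr_ge0. Qed.

Lemma Fn_0 n xi : Fn n 0 xi = 0.
Proof. by rewrite /Fn G_0 mul0r mulr0. Qed.

Lemma Fn_mono n m s xi : (n <= m)%N -> Fn n s xi <= Fn m s xi.
Proof.
move=> nm; rewrite ler_wpM2l ?(ltW B0)// ler_pM ?sqr_ge0 ?G_mono//.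
rewrite lerXn2r ?nnegrE ?min0// le_min !ge_min lexx/=.
by rewrite ler_nat nm orbT.
Qed.

Lemma G_cont n : continuous (G n).
Proof.
move=> t; have [L L0 hL] := G_lip n; apply/cvgrPdist_le => e e0.
have L1 : 0 < L + 1 by lra.
near=> s; apply: (le_trans (hL _ _)).
apply: (@le_trans _ _ ((L + 1) * `|t - s|)); first by rewrite ler_wpM2r// lerDl.
rewrite mulrC -ler_pdivlMr//; near: s.
by apply: cvgr_dist_le => //; rewrite divr_gt0.
Unshelve. all: by end_near. Qed.

Lemma mf_nrm (g : T -> 'rV[R]_N) : (forall i, measf (fun t => g t ord0 i)) -> measf (fun t => nrm (g t)).
Proof.
move=> hg; apply: (mf_cont (k := Num.sqrt)); first exact: sqrt_continuous.
by apply: mf_sum => i; apply: mfM.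
Qed.

Lemma mf_Fn n (v : T -> R) (g : T -> 'rV[R]_N) : measf v -> (forall i, measf (fun t => g t ord0 i)) ->
  measf (fun t => Fn n (v t) (g t)).
Proof.
move=> mv mg; apply: mfM; first exact: mf_cst.
apply: mfM; first exact: mf_cont (@G_cont n) mv.
apply: mfX; apply: mf_min; [exact: mf_nrm|exact: mf_cst].
Qed.

Lemma Fn_bdd n : exists M, forall s xi, `|Fn n s xi| <= M.
Proof.
have [M M0 hM] := G_bdd n; exists (B * (M * n%:R ^+ 2)) => s xi.
rewrite ger0_norm ?Fn_ge0// ler_wpM2l ?(ltW B0)// ler_pM ?sqr_ge0//.
by rewrite lerXn2r ?nnegrE ?min0// ge_min lexx orbT.
Qed.

Lemma Fn_lip n : exists2 L, 0 <= L & forall s xi s' xi',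
  `|Fn n s xi - Fn n s' xi'| <= L * (`|s - s'| + nrm (xi - xi')).
Proof.
have [M M0 hM] := G_bdd n; have [L L0 hL] := G_lip n.
exists (B * (L * n%:R ^+ 2 + 2 * M * n%:R)).
  by rewrite mulr_ge0 ?(ltW B0)// addr_ge0// !mulr_ge0// exprn_ge0.
move=> s xi s' xi'; rewrite /Fn -mulrBr normrM (ger0_norm (ltW B0)) -[leRHS]mulrA.
apply: ler_wpM2l; first exact: ltW.
set m := Num.min (nrm xi) n%:R; set m' := Num.min (nrm xi') n%:R.
have mm : `|m - m'| <= nrm (xi - xi').
  apply: le_trans (nrm_lip xi xi'); rewrite /m /m'.
  have [h|h] := leP (nrm xi) n%:R; have [h'|h'] := leP (nrm xi') n%:R => //;
   rewrite ler_norml; apply/andP; split; have := ler_norm (nrm xi - nrm xi');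
   have := lerNnormlW (lexx `|nrm xi - nrm xi'|); have := normr_ge0 (nrm xi - nrm xi'); lra.
have m0 : 0 <= m by exact: min0.
have m'0 : 0 <= m' by exact: min0.
have mn : m <= n%:R by rewrite /m ge_min lexx orbT.
have m'n : m' <= n%:R by rewrite /m' ge_min lexx orbT.
have e : G n s * m ^+ 2 - G n s' * m' ^+ 2 = (G n s - G n s') * m ^+ 2 + G n s' * ((m + m') * (m - m')).
  by ring.
rewrite e; apply: (le_trans (ler_normD _ _)); rewrite !normrM.
have h1 : `|G n s - G n s'| * (`|m| * `|m|) <= L * `|s - s'| * n%:R ^+ 2.
  rewrite -normrM -expr2; by rewrite ler_pM// normrX (ger0_norm m0) lerXn2r ?nnegrE.
have h2 : `|G n s'| * (`|m + m'| * `|m - m'|) <= M * (2 * n%:R * nrm (xi - xi')).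
  rewrite ler_pM// ?mulr_ge0//; first by rewrite ger0_norm.
  by rewrite ler_pM// ger0_norm ?addr_ge0//; lra.
have := nrm_ge0 (xi - xi'); have := normr_ge0 (s - s').
move: (nrm _) `|s - s'| h1 h2 => q a h1 h2 a0 q0.
have p1 : 0 <= L * n%:R ^+ 2 * q by rewrite !mulr_ge0// exprn_ge0.
have p2 : 0 <= 2 * M * n%:R * a by rewrite !mulr_ge0.
by move: h1 h2 p1 p2; lra.
Qed.

Variable f : T -> R.
Hypothesis Lf : L1 f.
Hypothesis f0 : forall t, 0 <= f t.
Definition fk (k : nat) t := Num.min (f t) k%:R.

Lemma fk_ge0 k t : 0 <= fk k t. Proof. by rewrite le_min f0 ler0n. Qed.

Lemma fk_le k t : fk k t <= f t. Proof. by rewrite ge_min lexx. Qed.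

Lemma fk_mono k j t : (k <= j)%N -> fk k t <= fk j t.
Proof. by move=> kj; rewrite le_min !ge_min lexx/= ler_nat kj orbT. Qed.

Lemma fk_L2 k : L2 (fk k).
Proof.
apply: (L2_bdd nufin (M := k%:R)); first by apply: mf_min; [exact: L1_mf Lf|exact: mf_cst].
by move=> t; rewrite ger0_norm ?fk_ge0// ge_min lexx orbT.
Qed.

Lemma fk_I k : I (fk k) <= I f.
Proof. by apply: I_le => //; [exact: L2_L1 (fk_L2 k)|move=> t; exact: fk_le]. Qed.

Definition FFn n (x : VG) t := Fn n (vf x t) (vv x t).

Definition msol n k x := [/\ sol (FFn n x) (fk k) x, forall t, 0 <= vf x t &
  forall y, H y -> (forall t, 0 <= vf y t) ->
   (forall z, H z -> (forall t, 0 <= vf z t) ->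
     I (fun t => fk k t * vf z t) <= en 0 y z + I (fun t => FFn n y t * vf z t)) ->
   aE (fun t => vf x t <= vf y t)].

Lemma FFn_L2 n x : isL2 x -> L2 (FFn n x).
Proof.
move=> hx; have [M hM] := Fn_bdd n; apply: (L2_bdd nufin (M := M)); last by move=> t; exact: hM.
by apply: mf_Fn; [exact: hx.1.1|move=> i; exact: (hx.2 i).1].
Qed.

Lemma msol_exists n k : exists x, msol n k x.
Proof.
have [M hM] := Fn_bdd n; have [L L0 hL] := Fn_lip n.
have [x [Hx x0 ex mx]] := minimal_solution nufin tc alpha0 mb hb (fun v g => @mf_Fn n v g)
  hM L0 hL (Fn_0 n 0) (Fn_ge0 n) (fk_L2 k) (fk_ge0 k).
exists x; split => //; split => //; [exact: FFn_L2 (H_isL2 Hx)|exact: fk_L2].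
Qed.

(** A larger nonlinearity lowers the minimal solution and a larger datum raises it. The decreasing
    limit in n is taken first, at fixed k, then the increasing limit in k; the diagonal picks for
    each k an index at which the L1 distance to the first limit is at most 1 / (k + 1). *)
Lemma approximating_sequence : exists (x : nat -> VG) (ix jx : nat -> nat) (v : T -> R),
  [/\ forall n, (n <= ix n)%N /\ (n <= jx n)%N,
      forall n, sol (FFn (ix n) (x n)) (fk (jx n)) (x n) /\ (forall t, 0 <= vf (x n) t),
      measf v, forall t, 0 <= v t &
      aE (fun t => vf (x n) t @[n --> \oo] --> v t)].
Proof.
pose X n k := projT1 (cid (msol_exists n k)).
have hX n k : msol n k (X n k) by exact: (projT2 (cid (msol_exists n k))).
have HX n k : H (X n k) by have [[]] := hX n k.
have X2 n k := H_isL2 (HX n k).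
have eX n k z : H z -> en 0 (X n k) z + I (fun t => FFn n (X n k) t * vf z t) = I (fun t => fk k t * vf z t).
  by have [[_ _ _ e] _ _] := hX n k; exact: e.
have X0 n k t : 0 <= vf (X n k) t by have [_ h _] := hX n k.
have FL n x z : isL2 x -> isL2 z -> L1 (fun t => FFn n x t * vf z t).
  by move=> hx hz; exact: L2M (FFn_L2 n hx) hz.1.
have decr n k : aE (fun t => vf (X n.+1 k) t <= vf (X n k) t).
  have [_ _ m] := hX n.+1 k; apply: m => // z hz z0; rewrite -(eX n k z hz) lerD2l.
  have hz2 := H_isL2 hz.
  apply: I_le; [exact: FL|exact: FL|move=> t].
  by rewrite ler_wpM2r// Fn_mono.
have incr n k : aE (fun t => vf (X n k) t <= vf (X n k.+1) t).
  have [_ _ m] := hX n k; apply: m => // z hz z0; rewrite (eX n k.+1 z hz).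
  have hz2 := H_isL2 hz.
  apply: I_le; [exact: L2M (fk_L2 k) hz2.1|exact: L2M (fk_L2 k.+1) hz2.1|move=> t].
  by rewrite ler_wpM2r// fk_mono.
(* Countably many comparisons hold simultaneously on [A]; outside of it the solutions are replaced
   by 0, so that monotonicity holds at every point. *)
have [A [mA AE hA]] := aE_set (aE_mp2 (aE_nat (fun k => aE_nat (fun n => decr n k)))
   (aE_nat (fun k => aE_nat (fun n => incr n k))) (fun t h1 h2 => conj h1 h2)).
pose Y n k t := \1_A t * vf (X n k) t.
have iA t : \1_A t = 1 :> R \/ \1_A t = 0 :> R.
  by rewrite indicE; case: (t \in A); [left|right].
have Y0 n k t : 0 <= Y n k t by rewrite mulr_ge0// indicE.
have Yd n k t : Y n.+1 k t <= Y n k t.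
  rewrite /Y indicE; have [tA|] := boolP (t \in A); last by rewrite !mul0r.
  by rewrite !mul1r; have [h _] := hA t (set_mem tA); exact: h.
have Yi n k t : Y n k t <= Y n k.+1 t.
  rewrite /Y indicE; have [tA|] := boolP (t \in A); last by rewrite !mul0r.
  by rewrite !mul1r; have [_ h] := hA t (set_mem tA); exact: h.
have YX n k : aE (fun t => Y n k t = vf (X n k) t).
  by apply: (aE_mp AE) => t tA; rewrite /Y indicE mem_set// mul1r.
have mY n k : measf (Y n k) by apply: mfM; [exact: mf_ind|exact: (X2 n k).1.1].
have LY n k : L2 (Y n k).
  apply: (L2_eq_ae _ _ (X2 n k).1) => //; exact: (aE_mp (YX n k) (fun t e => esym e)).
have hV k t : cvgn (Y ^~ k ^~ t).
  apply: nonincreasing_is_cvgn.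
    apply/nonincreasing_seqP => n; exact: Yd.
  by exists 0 => _ [n _ <-].
pose V k t : R := limn (Y ^~ k ^~ t).
have cV k t : Y n k t @[n --> \oo] --> V k t by exact: hV.
have V0 k t : 0 <= V k t by apply: (cvg_geR _ (cV k t)) => n; exact: Y0.
have YV n k t : V k t <= Y n k t.
  by apply: (@nonincreasing_cvgn_ge R (Y ^~ k ^~ t) _ _ n) => //; apply/nonincreasing_seqP => m; exact: Yd.
have mV k : measf (V k) by apply: (mf_cvg (mY ^~ k)) => t; exact: cV.
have Vi k t : V k t <= V k.+1 t.
  apply: (cvg_geR _ (cV k.+1 t)) => n; exact: le_trans (YV n k t) (Yi n k t).
have LV k : L1 (V k).
  apply: (L1_dom (mV k) (L2_L1 nufin (LY 0%N k))) => t; rewrite ger0_norm//.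
have Yd0 n k t : Y n k t <= Y 0%N k t.
  by elim: n => [|n ih]; [exact: lexx|exact: le_trans (Yd n k t) ih].
have cIV k : I (fun t => Y n k t - V k t) @[n --> \oo] --> (0 : R).
  apply: (I_dct0 (g := Y 0%N k)).
  - by move=> n; apply: mfB.
  - exact: L2_L1 (LY 0%N k).
  - move=> n t; rewrite subr_ge0 YV/=.
    by have := V0 k t; have := Yd0 n k t; lra.
  - apply: aE_all => t; have := cvg_addR (cV k t) (cvg_cstR (- V k t)); rewrite subrr; exact.
have [K K0 hK] := sol_log nufin tc alpha0 mb hb.
have lgb k : I (fun t => lg (V k t) ^+ 2) <= K * I f.
  have [hs x0 _] := hX 0%N k.
  have [Ll bl] := hK _ _ _ hs x0 (fun t => Fn_ge0 0 _ _) (fk_ge0 k).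
  apply: (@le_trans _ _ (I (fun t => lg (vf (X 0%N k) t) ^+ 2))); last first.
    by apply: (le_trans bl); rewrite ler_wpM2l ?(ltW K0)// fk_I.
  have ae1 : aE (fun t => lg (V k t) ^+ 2 <= lg (vf (X 0%N k) t) ^+ 2).
    apply: (aE_mp (YX 0%N k)) => t e.
    have h := YV 0%N k t; rewrite e in h.
    by rewrite lerXn2r ?nnegrE ?lg_ge0 ?lg_mono.
  apply: I_le_ae => //; apply: (L1_dom_ae _ Ll); first by apply: mfX; exact: mf_cont (C1_cont C1_lg) (mV k).
  by apply: (aE_mp ae1) => t; rewrite ger0_norm ?sqr_ge0.
(* The integrals of the increasing functions log(1 + V k)^2 are bounded, so [V k] is bounded at
   almost every point; no uniform bound of [V k] in a Lebesgue space is at hand yet. *)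
have Vb : aE (fun t => exists c, forall k, V k t <= c).
  have LlV k : L1 (fun t => lg (V k t) ^+ 2).
    have [hs x0 _] := hX 0%N k.
    have [Ll bl] := hK _ _ _ hs x0 (fun t => Fn_ge0 0 _ _) (fk_ge0 k).
    apply: (L1_dom_ae _ Ll); first by apply: mfX; exact: mf_cont (C1_cont C1_lg) (mV k).
    apply: (aE_mp (YX 0%N k)) => t e.
    have h := YV 0%N k t; rewrite e in h.
    by rewrite ger0_norm ?sqr_ge0// lerXn2r ?nnegrE ?lg_ge0 ?lg_mono.
  apply: (aE_mp (mono_ae_bounded LlV (fun k t => sqr_ge0 _) _ lgb)).
    by move=> k t; rewrite lerXn2r ?nnegrE ?lg_ge0 ?lg_mono.
  move=> t [c hc]; exists (expR (1 + c)) => k.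
  apply: (le_trans (lg_expR (V0 k t))); rewrite ler_expR.
  have := hc k; have := lg_ge0 (V0 k t); move: (lg _) => q q0 hq.
  by have := sqr_ge0 (q - 1); nra.
pose v t : R := limn (V ^~ t).
have cv : aE (fun t => V k t @[k --> \oo] --> v t).
  apply: (aE_mp Vb) => t [c hc].
  apply: nondecreasing_is_cvgn; first by apply/nondecreasing_seqP => k; exact: Vi.
  by exists c => _ [k _ <-].
have ex k : exists n, (k <= n)%N /\ I (fun t => Y n k t - V k t) <= dlt k.
  have [m hm] := (cvg_epsP _ _).1 (cIV k) _ (dlt_gt0 k).
  exists (maxn k m); split; first exact: leq_maxl.
  by have := hm _ (leq_maxr k m); rewrite subr0 => /(le_trans (ler_norm _)).
have [nk hnk] := choice ex.
have LYV k : L1 (fun t => Y (nk k) k t - V k t) by apply: L1B => //; exact: L2_L1.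
have YV0 k t : 0 <= Y (nk k) k t - V k t by rewrite subr_ge0.
have c0 : I (fun t => Y (nk k) k t - V k t) @[k --> \oo] --> (0 : R).
  apply: (squeeze_cvgr _ (cvg_cst 0) dlt_cvg); apply: nearW => k.
  by rewrite I_ge0//=; exact: (hnk k).2.
have [s [s1 s2]] := ae_subseq0 LYV YV0 c0.
have [A2 [mA2 AE2 hA2]] := aE_set cv.
pose v' t := \1_A2 t * v t.
have cv' t : \1_A2 t * V k t @[k --> \oo] --> v' t.
  rewrite /v' indicE; have [tA|] := boolP (t \in A2); last first.
    have -> : (fun k => false%:R * V k t) = fun=> false%:R * v t.
      by apply/funext => k; rewrite !mul0r.
    by move=> _; exact: cvg_cst.
  by apply: cvg_mulcR; exact: hA2 (set_mem tA).
exists (fun n => X (nk (s n)) (s n)), (nk \o s), s, v'; split.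
- move=> n; have h := subseq_ge s1 n; split => //=.
  exact: leq_trans h (hnk (s n)).1.
- by move=> n; have [hs x0 _] := hX (nk (s n)) (s n).
- by apply: (mf_cvg _ cv') => k; apply: mfM => //; exact: mf_ind.
- move=> t; apply: (cvg_geR _ (cv' t)) => k; rewrite mulr_ge0// indicE//.
- apply: (aE_mp3 s2 AE2 (aE_nat (fun k => aE_nat (fun n => YX n k)))) => t h1 h2 h3.
  have h4 : V (s n) t @[n --> \oo] --> v t by exact: (cvg_subseq (u := fun k => V k t) s1 (hA2 t h2)).
  have := cvg_addR h1 h4; rewrite add0r /v' indicE mem_set// mul1r => h5.
  rewrite (_ : (fun n => _) = fun n => Y (nk (s n)) (s n) t - V (s n) t + V (s n) t)//.
  by apply/funext => n; rewrite subrK h3.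
Qed.

End approximation.

Lemma cvg_indM {T : Type} {R : realType} (A : set T) (t : T) (u : nat -> R) (l : R) :
  (A t -> u n @[n --> \oo] --> l) -> \1_A t * u n @[n --> \oo] --> \1_A t * l.
Proof.
move=> h; have [tA|tA] := pselect (A t); first by apply: cvg_mulcR; exact: h.
have e : \1_A t = 0 :> R by rewrite indicE memNset.
have -> : (fun n => \1_A t * u n) = fun=> \1_A t * l by apply/funext => n; rewrite e !mul0r.
exact: cvg_cst.
Qed.

(** * Almost everywhere convergence of the gradients *)

Section gradients.
Context {d : measure_display} {T : measurableType d} {R : realType}.
Variable nu : {measure set T -> \bar R}.
Hypothesis nufin : (nu setT < +oo)%E.
Context {N : nat}.
Variables (C : set (T -> R)) (D : (T -> R) -> T -> 'rV[R]_N).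
Hypothesis tc : test_class nu C D.
Notation L1 := (L1 nu).
Notation L2 := (L2 nu).
Notation I := (I nu).
Notation aE := (aE nu).
Notation VG := (vg T R N).
Notation isL2 := (@isL2 _ T R nu N).
Notation E2 := (@E2 _ T R nu N).
Notation H := (H nu C D).
Variables (alpha beta : R) (b : T -> R).
Hypothesis alpha0 : 0 < alpha.
Hypothesis mb : measf b.
Hypothesis hb : forall t, alpha <= b t <= beta.
Notation en := (en nu b).
Notation sol := (sol nu C D b).

Variables (B : R) (G : nat -> R -> R).
Hypothesis B0 : 0 < B.
Hypothesis G_ge0 : forall n t, 0 <= G n t.
Hypothesis G_0 : forall n, G n 0 = 0.
Hypothesis G_lip : forall n, exists2 L, 0 <= L & forall s t, `|G n s - G n t| <= L * `|s - t|.
Hypothesis G_bdd : forall n, exists2 M, 0 <= M & forall t, G n t <= M.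
Hypothesis G_mono : forall n m t, (n <= m)%N -> G n t <= G m t.

Variable f : T -> R.
Hypothesis Lf : L1 f.
Hypothesis f0 : forall t, 0 <= f t.
Notation FFn := (FFn B G).
Notation fk := (fk f).

Let ba t : alpha <= b t. Proof. by have /andP[] := hb t. Qed.
Let b0 t : 0 < b t. Proof. exact: lt_le_trans alpha0 (ba t). Qed.

Lemma sol_mass_f n k x : sol (FFn n x) (fk k) x -> (forall t, 0 <= vf x t) ->
  I (FFn n x) <= I f.
Proof.
move=> hs x0; apply: (le_trans _ (fk_I nufin Lf f0 k)).
apply: (sol_mass nufin tc alpha0 mb hb hs x0).
- by move=> t; exact: Fn_ge0.
- exact: fk_ge0.
- by move=> t e; rewrite /FFn e; exact: Fn_0.
Qed.

(** The test function is bounded by 2 e, and the two data and the two lower order terms have mass at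
    most that of [f], whence 8 e I f. Its derivative is at least 1/2 where |x - y| <= e; the
    complement is counted by the last integral. *)
Lemma sol_diff n m j k x y (e : R) : 0 < e ->
  sol (FFn n x) (fk j) x -> (forall t, 0 <= vf x t) ->
  sol (FFn m y) (fk k) y -> (forall t, 0 <= vf y t) ->
  I (fun t => Num.min 1 (sq (vv x t - vv y t))) <=
    16 * e / alpha * I f + I (fun t => Num.min 1 ((vf x t - vf y t) ^+ 2 / e ^+ 2)).
Proof.
move=> e0 hsx x0 hsy y0.
have Hx : H x by case: hsx. have Hy : H y by case: hsy.
have Hd := HB nufin tc Hx Hy; have hd2 := H_isL2 Hd.
have hx2 := H_isL2 Hx; have hy2 := H_isL2 Hy.
pose r (t : R) := e * atan (e^-1 * t).
pose r' (t : R) := (1 + (e^-1 * t) ^+ 2)^-1.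
have hr : C1fun r r'.
  apply: C1_eq (C1Z e (C1_comp C1_atan (C1Z e^-1 C1_id))) => // t.
  by rewrite mulr1 mulrCA mulfV ?gt_eqF// mulr1.
have den (t : R) : 1 <= 1 + (e^-1 * t) ^+ 2 by rewrite lerDl sqr_ge0.
have den0 (t : R) : 0 < 1 + (e^-1 * t) ^+ 2 by exact: lt_le_trans (den t).
have r'0 (t : R) : 0 < r' t by rewrite invr_gt0.
have r'1 (t : R) : `|r' t| <= 1 by rewrite gtr0_norm// invf_le1.
have rb (t : R) : `|r t| <= 2 * e.
  rewrite normrM (gtr0_norm e0) mulrC ler_wpM2r ?(ltW e0)//.
  have := @atan_ltpi2 R (e^-1 * t); have := @atan_gtNpi2 R (e^-1 * t); have := @pihalf_lt2 R.
  by move=> h1 h2 h3; rewrite ler_norml; apply/andP; split; lra.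
have r00 : r 0 = 0 by rewrite /r mulr0 atan0 mulr0.
have hz := H_comp nufin tc hr r'1 r00 Hd; have hz2 := H_isL2 hz.
set z := Vg _ _ in hz hz2.
have [_ LPx Lfx ex] := hsx; have [_ LPy Lfy ey] := hsy.
have e1 := ex z hz; have e2 := ey z hz.
have ed : en 0 (x - y) z = I (fun t => b t * (r' (vf (x - y) t) * sq (vv (x - y) t))).
  by rewrite en0E; apply: I_eq => t; rewrite /= dotrZr.
have e3 : en 0 (x - y) z = en 0 x z - en 0 y z by exact: (enB alpha0 mb hb).
have bnd (w : T -> R) : L2 w -> (forall t, 0 <= w t) -> I w <= I f ->
    `|I (fun t => w t * vf z t)| <= 2 * e * I f.
  move=> hw w0 wf; have Lw := L2_L1 nufin hw.
  apply: (le_trans (norm_I (L2M hw hz2.1))).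
  apply: (@le_trans _ _ (I (fun t => 2 * e * w t))).
    apply: I_le; [exact: L1_norm (L2M hw hz2.1)|exact: L1Z|].
    by move=> t; rewrite normrM (ger0_norm (w0 t)) mulrC ler_wpM2r// rb.
  by rewrite IZ// ler_wpM2l// mulr_ge0// ltW.
have b1 := bnd _ LPx (fun t => Fn_ge0 B0 G_ge0 n _ _) (sol_mass_f hsx x0).
have b2 := bnd _ LPy (fun t => Fn_ge0 B0 G_ge0 m _ _) (sol_mass_f hsy y0).
have b3 := bnd _ Lfx (fk_ge0 f0 j) (fk_I nufin Lf f0 j).
have b4 := bnd _ Lfy (fk_ge0 f0 k) (fk_I nufin Lf f0 k).
have mr' : measf (fun t => r' (vf (x - y) t)) by exact: mf_cont hr.2 hd2.1.1.
have Lg : L1 (fun t => r' (vf (x - y) t) * sq (vv (x - y) t)).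
  by apply: (L1_bM mr' (M := 1)) => [t|]; [exact: r'1|exact: L2v_sq hd2.2].
have main : alpha * I (fun t => r' (vf (x - y) t) * sq (vv (x - y) t)) <= 8 * e * I f.
  have : alpha * I (fun t => r' (vf (x - y) t) * sq (vv (x - y) t)) <= en 0 (x - y) z.
    rewrite ed -IZ//; apply: I_le; [exact: L1Z| |].
      apply: (L1_bg2 alpha0 mb hb (M := 1) mr') => // t; exact: r'1.
    by move=> t; rewrite ler_wpM2r// mulr_ge0 ?sq_ge0// ltW.
  rewrite e3; move: b1 b2 b3 b4 e1 e2; rewrite !ler_norml => /andP[? ?] /andP[? ?] /andP[? ?] /andP[? ?].
  lra.
have Lm : L1 (fun t => Num.min 1 ((vf x t - vf y t) ^+ 2 / e ^+ 2)).
  apply: (L1_bdd nufin (M := 1)).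
    apply: mf_min; first exact: mf_cst.
    by apply: mfM; [exact: mfX hd2.1.1|exact: mf_cst].
  move=> t; rewrite ger0_norm ?ge_min ?lexx// le_min ler01 mulr_ge0 ?sqr_ge0//.
  by rewrite invr_ge0 sqr_ge0.
apply: (@le_trans _ _ (2 * I (fun t => r' (vf (x - y) t) * sq (vv (x - y) t)) +
   I (fun t => Num.min 1 ((vf x t - vf y t) ^+ 2 / e ^+ 2)))); last first.
  rewrite lerD2r.
  have : I (fun t => r' (vf (x - y) t) * sq (vv (x - y) t)) <= 8 * e * I f / alpha.
    by rewrite ler_pdivlMr// mulrC.
  have -> : 16 * e / alpha * I f = 2 * (8 * e * I f / alpha) by field; rewrite gt_eqF.
  by move=> h; rewrite ler_wpM2l.
rewrite -IZ// -ID//; last exact: L1Z.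
apply: I_le; [|by apply: L1D => //; exact: L1Z|].
  apply: (L1_dom _ (L2v_sq hd2.2)).
    by apply: mf_min; [exact: mf_cst|exact: L1_mf (L2v_sq hd2.2)].
  by move=> t; rewrite ger0_norm ?ge_min ?lexx ?orbT// le_min ler01 sq_ge0.
move=> t; rewrite !vgE.
set q := sq _; have q0 : 0 <= q by exact: sq_ge0.
have -> : (vf x t - vf y t) ^+ 2 / e ^+ 2 = (e^-1 * (vf x t - vf y t)) ^+ 2.
  by rewrite exprMn exprVn mulrC.
rewrite /r'; set w := (e^-1 * _) ^+ 2; have w0 : 0 <= w by exact: sqr_ge0.
have [w1|w1] := leP 1 w.
  have : Num.min 1 q <= 1 by rewrite ge_min lexx.
  have : 0 <= 2 * ((1 + w)^-1 * q) by rewrite !mulr_ge0// invr_ge0; lra.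
  lra.
have : 2^-1 <= (1 + w)^-1 by rewrite lef_pV2 ?posrE//; lra.
move=> /(ler_wpM2r q0) h; have : Num.min 1 q <= q by rewrite ge_min lexx orbT.
lra.
Qed.

(** A change on a null set preserves the equation; this lets the convergences of the final sequence
    hold at every point. *)
Lemma sol_restrict n k x y (A : set T) : measurable A -> aE (fun t => A t) ->
  vf y = (fun t => \1_A t * vf x t) -> vv y = (fun t => \1_A t *: vv x t) ->
  sol (FFn n x) (fk k) x -> sol (FFn n y) (fk k) y.
Proof.
move=> mA AE e1 e2 [Hx LP Lh ex]; have hx2 := H_isL2 Hx.
have a1 : aE (fun t => vf x t = vf y t) by apply: (aE_mp AE) => t tA; rewrite e1 indicE mem_set// mul1r.
have a2 : aE (fun t => vv x t = vv y t) by apply: (aE_mp AE) => t tA; rewrite e2 indicE mem_set// scale1r.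
have Hy : H y.
  apply: (Hcl_ae nufin tc (@subset_refl _ C) _ _ a1 a2 Hx).
    by rewrite e1; apply: mfM; [exact: mf_ind|exact: hx2.1.1].
  move=> i; rewrite e2; under [X in measf X]eq_fun do rewrite mxE.
  by apply: mfM; [exact: mf_ind|exact: (hx2.2 i).1].
have hy2 := H_isL2 Hy; have LP' := FFn_L2 nufin B0 G_ge0 G_lip G_bdd n hy2.
split => // z hz; have hz2 := H_isL2 hz; rewrite -(ex z hz); congr (_ + _).
  rewrite !en0E; apply: I_eq_ae.
  - exact: L1_mf (en_L1g alpha0 mb hb hy2 hz2).
  - exact: L1_mf (en_L1g alpha0 mb hb hx2 hz2).
  - by apply: (aE_mp a2) => t ->.
apply: I_eq_ae; [exact: L1_mf (L2M LP' hz2.1)|exact: L1_mf (L2M LP hz2.1)|].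
by apply: (aE_mp2 a1 a2) => t h1 h2; rewrite /FFn h1 h2.
Qed.

Lemma gradient_sequence : exists (x : nat -> VG) (ix jx : nat -> nat) (v : T -> R) (g : T -> 'rV[R]_N),
  [/\ forall n, (n <= ix n)%N /\ (n <= jx n)%N,
      forall n, sol (FFn (ix n) (x n)) (fk (jx n)) (x n) /\ (forall t, 0 <= vf (x n) t),
      forall t, vf (x n) t @[n --> \oo] --> v t &
      forall t i, vv (x n) t ord0 i @[n --> \oo] --> g t ord0 i].
Proof.
have [x [ix [jx [v [hij hsol mv v0 cv]]]]] :=
  approximating_sequence nufin tc alpha0 mb hb B0 G_ge0 G_0 G_lip G_bdd G_mono Lf f0.
have Hx n : H (x n) by have [[]] := hsol n.
have hx2 n := H_isL2 (Hx n).
have If0 : 0 <= I f by exact: I_ge0.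
have cau (e : R) : 0 < e -> exists K, forall n m, (K <= n)%N -> (K <= m)%N ->
    I (fun t => Num.min 1 (\sum_i (vv (x n) t ord0 i - vv (x m) t ord0 i) ^+ 2)) <= e.
  (* [eta] is such that the first term of [sol_diff] is at most e / 2; the other half comes from the
     convergence of the functions themselves. *)
  move=> e0; pose Q := 32 / alpha * (I f + 1).
  have Q0 : 0 < Q by rewrite mulr_gt0 ?divr_gt0//; lra.
  pose eta := e / Q; have eta0 : 0 < eta by rewrite divr_gt0.
  pose W n t := Num.min 1 (2 * (vf (x n) t - v t) ^+ 2 / eta ^+ 2).
  have W0 n t : 0 <= W n t.
    by rewrite le_min ler01 divr_ge0 ?sqr_ge0// mulr_ge0 ?sqr_ge0.
  have mW n : measf (W n).
    apply: mf_min; first exact: mf_cst.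
    apply: mfM; last exact: mf_cst.
    apply: mfM; first exact: mf_cst.
    by apply: mfX; apply: mfB => //; exact: (hx2 n).1.1.
  have W1 n t : W n t <= 1 by rewrite ge_min lexx.
  have cW : I (W n) @[n --> \oo] --> (0 : R).
    apply: (I_dct0 (g := fun=> 1)) => //; first exact: L1_cst.
      by move=> n t; rewrite W0 W1.
    apply: (aE_mp cv) => t ct.
    have c1 : vf (x n) t - v t @[n --> \oo] --> (0 : R).
      by have := cvg_addR ct (cvg_cstR (- v t)); rewrite subrr.
    have c2 := cvg_mulcR (2 / eta ^+ 2) (cvg_sq0 c1); rewrite mulr0 in c2.
    apply: (squeeze_cvgr _ (cvg_cst 0) c2); apply: nearW => n.
    by rewrite W0/= ge_min; apply/orP; right; rewrite mulrAC.
  have e4 : 0 < e / 4 by rewrite divr_gt0.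
  have [K hK] := (cvg_epsP _ _).1 cW _ e4.
  exists K => n m kn km.
  have [hn xn0] := hsol n; have [hm xm0] := hsol m.
  have := sol_diff eta0 hn xn0 hm xm0.
  rewrite (@I_eq _ _ _ _ _ (fun t => Num.min 1 (\sum_i (vv (x n) t ord0 i - vv (x m) t ord0 i) ^+ 2))); last first.
    by move=> t; rewrite sqE; congr (Num.min _ _); apply: eq_bigr => i _; rewrite !mxE.
  move=> h; apply: (le_trans h).
  have i1 : 16 * eta / alpha * I f <= e / 2.
    have -> : e / 2 = 16 * eta / alpha * (I f + 1).
      by rewrite /eta /Q; field; rewrite !gt_eqF//; lra.
    apply: ler_wpM2l; last by rewrite lerDl.
    by apply: divr_ge0; [apply: mulr_ge0 => //; exact: ltW|exact: ltW].
  have LW k : L1 (W k) by apply: (L1_bdd nufin (M := 1)) => // t; rewrite ger0_norm.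
  have i2 : I (fun t => Num.min 1 ((vf (x n) t - vf (x m) t) ^+ 2 / eta ^+ 2)) <= I (W n) + I (W m).
    rewrite -ID//; apply: I_le; [|exact: L1D|].
      apply: (L1_bdd nufin (M := 1)).
        apply: mf_min; first exact: mf_cst.
        apply: mfM; last exact: mf_cst.
        by apply: mfX; apply: mfB; [exact: (hx2 n).1.1|exact: (hx2 m).1.1].
      move=> t; rewrite ger0_norm ?ge_min ?lexx// le_min ler01 mulr_ge0 ?sqr_ge0//.
      by rewrite invr_ge0 sqr_ge0.
    move=> t; rewrite /W.
    set p := 2 * (vf (x n) t - v t) ^+ 2 / eta ^+ 2; set q := 2 * (vf (x m) t - v t) ^+ 2 / eta ^+ 2.
    have p0 : 0 <= p by rewrite divr_ge0 ?sqr_ge0// mulr_ge0 ?sqr_ge0.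
    have q0 : 0 <= q by rewrite divr_ge0 ?sqr_ge0// mulr_ge0 ?sqr_ge0.
    have : (vf (x n) t - vf (x m) t) ^+ 2 / eta ^+ 2 <= p + q.
      rewrite /p /q -mulrDl ler_wpM2r ?invr_ge0 ?sqr_ge0//.
      have := sqr_ge0 ((vf (x n) t - v t) + (vf (x m) t - v t)); nra.
    move: (_ / _) p0 q0 => w p0 q0 h1.
    have [h2|h2] := leP 1 w; have [h3|h3] := leP 1 p; have [h4|h4] := leP 1 q; lra.
  have := hK n kn; have := hK m km; rewrite !subr0 !ler_norml => /andP[_ h1] /andP[_ h2].
  move: i1 i2 h1 h2; lra.
have [s [s1 [l [ml cl]]]] := cauchy_measure_subseq nufin (fun n i => ((hx2 n).2 i).1) cau.
have [A [mA AE hA]] := aE_set (aE_mp2 cv cl (fun t h1 h2 => conj h1 h2)).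
pose y n := Vg (fun t => \1_A t * vf (x (s n)) t) (fun t => \1_A t *: vv (x (s n)) t).
exists y, (ix \o s), (jx \o s), (fun t => \1_A t * v t), (fun t => \row_i (\1_A t * l i t)); split.
- by move=> n; have h := subseq_ge s1 n; have [h1 h2] := hij (s n); split; exact: leq_trans h _.
- move=> n; have [hs x0] := hsol (s n); split; last by move=> t; rewrite mulr_ge0// indicE.
  exact: (sol_restrict mA AE _ _ hs).
- move=> t /=; apply: cvg_indM => tA; have [h _] := hA t tA.
  exact: (cvg_subseq (u := fun n => vf (x n) t) s1 h).
- move=> t i; rewrite mxE.
  have -> : (fun n => vv (y n) t ord0 i) = fun n => \1_A t * vv (x (s n)) t ord0 i.
    by apply/funext => n; rewrite mxE.
  by apply: cvg_indM => tA; have [_ h] := hA t tA; exact: h.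
Qed.

End gradients.

(** * Passage to the limit *)

Lemma cvg_powR_pos {R : realType} (q : R) (u : nat -> R) (l : R) : 0 < l ->
  u n @[n --> \oo] --> l -> u n `^ q @[n --> \oo] --> l `^ q.
Proof.
by move=> lp hu; apply: (@cvg_comp _ _ _ u (fun t => t `^ q) _ (nbhs l)) => //; exact: powR_cont.
Qed.

Lemma cvg_powR {R : realType} (q : R) (u : nat -> R) (l : R) : 0 < q -> (forall n, 0 <= u n) ->
  u n @[n --> \oo] --> l -> u n `^ q @[n --> \oo] --> l `^ q.
Proof.
move=> q0 u0 hu; have l0 : 0 <= l by exact: cvg_geR hu.
have [l1|] := eqVneq l 0; last first.
  move=> ln; have lp : 0 < l by rewrite lt_neqAle eq_sym ln.
  by apply: (@cvg_comp _ _ _ u (fun t => t `^ q) _ (nbhs l)) => //; exact: powR_cont.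
rewrite l1 powR0 ?gt_eqF//; apply/cvg_epsP => e e0.
have [K hK] := (cvg_epsP _ _).1 hu _ (powR_gt0 q^-1 e0).
exists K => n Kn; have := hK n Kn; rewrite l1 !subr0 (ger0_norm (u0 n)) ger0_norm ?powR_ge0// => h.
apply: (@le_trans _ _ ((e `^ q^-1) `^ q)).
  by apply: ge0_ler_powR => //; rewrite ?nnegrE ?(ltW q0)// powR_ge0.
by rewrite -powRrM mulVf ?gt_eqF// powRr1// ltW.
Qed.

Lemma cvg_subR {R : realType} (u w : nat -> R) (a c : R) :
  u n @[n --> \oo] --> a -> w n @[n --> \oo] --> c -> u n - w n @[n --> \oo] --> a - c.
Proof. by move=> h1 h2; apply: cvgB. Qed.

Lemma cvg_absR {R : realType} (u : nat -> R) (l : R) :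
  u n @[n --> \oo] --> l -> `|u n| @[n --> \oo] --> `|l|.
Proof. exact: cvg_norm. Qed.

Section truncation.
Context {R : realType}.
Variable k : nat.

Lemma tau_exists : exists tau : R -> R, tau 0 = 0 /\ C1fun tau (chi k%:R).
Proof.
have [F [F0 hF]] := C1_primitive (C1_cont (C1_chi (k%:R : R))).
exists F; split => //; apply: C1_eq hF => // t.
have [t0|t0] : 0 <= t \/ t < 0 by case: (lerP 0 t) => h; [left|right].
  by rewrite max_l.
by rewrite max_r ?(ltW t0)// !chi_1// (le_trans (ltW t0)).
Qed.

(** A C^1 version of min(t, k): the identity up to k, constant from k + 1 on. *)
Definition tau : R -> R := projT1 (cid tau_exists).

Lemma tau0 : tau 0 = 0. Proof. exact: (projT2 (cid tau_exists)).1. Qed.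
Lemma C1_tau : C1fun tau (chi k%:R). Proof. exact: (projT2 (cid tau_exists)).2. Qed.

Lemma tau_mono a b : a <= b -> tau a <= tau b.
Proof. by apply: (C1_nd C1_tau) => t; exact: chi_ge0. Qed.

Lemma tau_id t : t <= k%:R -> tau t = t.
Proof.
move=> tk; have [t0|/ltW t0] := leP 0 t.
  have [c [c1 c2]] := C1_mvt C1_tau t0; rewrite chi_1 ?mul1r; last exact: le_trans tk.
  by rewrite tau0 !subr0.
have [c [c1 c2]] := C1_mvt C1_tau t0; rewrite chi_1 ?mul1r; last exact: le_trans c2 _.
by rewrite tau0 !sub0r => /oppr_inj.
Qed.

Lemma tau_ge0 t : 0 <= t -> 0 <= tau t.
Proof. by move=> t0; rewrite -tau0 tau_mono. Qed.

Lemma tau_le t : 0 <= t -> tau t <= t.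
Proof.
move=> t0; have [c [_ _]] := C1_mvt C1_tau t0; rewrite tau0 !subr0 => ->.
by rewrite ler_piMl// chi_le1.
Qed.

Lemma tau_le_max t : tau t <= k.+1%:R.
Proof.
have [h|h] := leP t k.+1%:R.
  by apply: (le_trans (tau_mono h)); exact: tau_le.
have [c [c1 _]] := C1_mvt C1_tau (ltW h); rewrite chi_0; last by rewrite natr1.
rewrite mul0r => /eqP; rewrite subr_eq0 => /eqP ->; exact: tau_le.
Qed.

Lemma tau_ge t : k%:R <= t -> k%:R <= tau t.
Proof. by move=> /tau_mono; rewrite tau_id. Qed.

End truncation.

Lemma C1_bounded {R : realType} (r r' : R -> R) (a c : R) : C1fun r r' -> a <= c ->
  (forall t, t <= a -> r t = 0 /\ r' t = 0) -> (forall t, c <= t -> r t = 0 /\ r' t = 0) ->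
  exists2 M, 0 <= M & forall t, `|r t| <= M /\ `|r' t| <= M.
Proof.
move=> hr ac ha hc.
have key (h : R -> R) : continuous h -> (forall t, t <= a -> h t = 0) -> (forall t, c <= t -> h t = 0) ->
    exists2 M, 0 <= M & forall t, `|h t| <= M.
  move=> ch h1 h2.
  have cn : {within `[a, c], continuous (fun t => `|h t|)}.
    by apply: continuous_subspaceT => t; apply: cvg_norm; exact: ch.
  have [e _ he] := EVT_max ac cn; exists `|h e|; first exact: normr_ge0.
  move=> t; have [ta|at_] := leP t a; first by rewrite h1// normr0.
  have [ct|tc] := leP c t; first by rewrite h2// normr0.
  by apply: he; rewrite in_itv/= !ltW.
have [M M0 hM] := key r (C1_cont hr) (fun t ta => (ha t ta).1) (fun t ta => (hc t ta).1).
have [M' M'0 hM'] := key r' hr.2 (fun t ta => (ha t ta).2) (fun t ta => (hc t ta).2).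
exists (M + M'); first exact: addr_ge0.
by move=> t; split; [apply: (le_trans (hM t)); rewrite lerDl|apply: (le_trans (hM' t)); rewrite lerDr].
Qed.

Lemma powR_absorb {R : realType} (Z c e : R) : 0 < Z -> e < 1 -> Z <= c * Z `^ e -> Z <= c `^ ((1 - e)^-1).
Proof.
move=> Z0 e1 h; have e0 : 0 < 1 - e by rewrite subr_gt0.
have hZ : Z `^ (1 - e) <= c.
  rewrite powRB; last by apply/implyP => _; rewrite gt_eqF.
  by rewrite powRr1 ?(ltW Z0)// ler_pdivrMr// powR_gt0.
rewrite -{1}[Z]powRr1 ?(ltW Z0)// -[X in _ `^ X](mulfV (lt0r_neq0 e0)) powRrM.
by apply: ge0_ler_powR => //; rewrite ?nnegrE ?invr_ge0 ?(ltW e0) ?powR_ge0// (le_trans (powR_ge0 _ _) hZ).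
Qed.

(** Young's inequality with exponents m and m / (m - 1), obtained by comparing U^gam with (lam x)^(m
    - 1); the relation between [gam] and [s] says that the conjugate power of U^gam is U^s. The
    parameter [lam] serves to balance the two terms, and m = 1 is included. *)
Lemma young_param {R : realType} (x U lam m gam s : R) : 0 <= x -> 1 <= U -> 0 < lam -> 1 <= m ->
  gam * m = s * (m - 1) ->
  x * U `^ gam <= lam `^ (m - 1) * x `^ m + lam^-1 * U `^ s.
Proof.
move=> x0 U1 l0 m1 eq; have U0 : 0 < U by exact: lt_le_trans U1.
have m0 : 0 < m by exact: lt_le_trans m1.
have lx : 0 <= lam * x by rewrite mulr_ge0// ltW.
have [h|h] := leP (U `^ gam) ((lam * x) `^ (m - 1)).
  apply: (@le_trans _ _ (lam `^ (m - 1) * x `^ m)).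
    rewrite -(mulr_powRB1 x0 m0) mulrCA; apply: ler_wpM2l => //.
    by rewrite -powRM ?(ltW l0).
  by rewrite lerDl mulr_ge0 ?powR_ge0// invr_ge0 ltW.
have [e|mn] := eqVneq m 1.
  move: eq h; rewrite e subrr mulr0 mulr1 => ->; by rewrite !powRr0 ltxx.
have m10 : 0 < m - 1 by rewrite subr_gt0 lt_neqAle eq_sym mn.
have h2 : lam * x <= U `^ (gam / (m - 1)).
  have e : lam * x = ((lam * x) `^ (m - 1)) `^ (m - 1)^-1 by rewrite -powRrM mulfV ?gt_eqF// powRr1.
  rewrite e powRrM.
  by apply: ge0_ler_powR; rewrite ?nnegrE ?invr_ge0 ?(ltW m10) ?powR_ge0// ltW.
apply: (@le_trans _ _ (lam^-1 * U `^ s)); last by rewrite lerDr mulr_ge0 ?powR_ge0.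
have -> : s = gam / (m - 1) + gam by rewrite -[s](mulfK (lt0r_neq0 m10)) -eq; field; rewrite gt_eqF.
rewrite powRD; last by apply/implyP => _; rewrite gt_eqF.
rewrite mulrA ler_wpM2r ?powR_ge0//.
by rewrite -(ler_pM2l l0) mulrA mulfV ?gt_eqF// mul1r.
Qed.

Lemma powR_1D {R : realType} (z q : R) : 0 <= z -> 0 <= q -> (1 + z) `^ q <= 2 `^ q * (1 + z `^ q).
Proof.
move=> z0 q0; have [h|h] := leP z 1.
  apply: (@le_trans _ _ (2 `^ q)); last by rewrite ler_peMr ?powR_ge0// lerDl powR_ge0.
  by apply: ge0_ler_powR => //; rewrite ?nnegrE; lra.
apply: (@le_trans _ _ ((2 * z) `^ q)).
  by apply: ge0_ler_powR => //; rewrite ?nnegrE; lra.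
by rewrite powRM// ler_wpM2l ?powR_ge0// lerDr.
Qed.

(** Young's inequality with exponents 1 / a and 1 / (1 - a), by comparison of x with y^(a / (1 -
    a)). *)
Lemma young_pow {R : realType} (x y a : R) : 0 <= x -> 0 < y -> 0 < a -> a < 1 ->
  (x * y) `^ a <= x + y `^ (a / (1 - a)).
Proof.
move=> x0 y0 a0 a1; have a10 : 0 < 1 - a by rewrite subr_gt0.
have [h|h] := leP x (y `^ (a / (1 - a))).
  apply: (@le_trans _ _ (y `^ (a / (1 - a)))); last by rewrite lerDr.
  apply: (@le_trans _ _ ((y `^ (a / (1 - a)) * y) `^ a)).
    apply: ge0_ler_powR; [exact: ltW|by rewrite nnegrE mulr_ge0// ltW|by rewrite nnegrE mulr_ge0 ?powR_ge0// ltW|].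
    by apply: ler_wpM2r => //; exact: ltW.
  have -> : y `^ (a / (1 - a)) * y = y `^ ((1 - a)^-1).
    rewrite -{2}[y](powRr1 (ltW y0)) -powRD; last by apply/implyP => _; rewrite gt_eqF.
    by congr (_ `^ _); field; rewrite gt_eqF.
  by rewrite -powRrM mulrC.
apply: (@le_trans _ _ x); last by rewrite lerDl powR_ge0.
have xp : 0 < x by apply: le_lt_trans h; exact: powR_ge0.
rewrite powRM ?(ltW y0)//.
have h2 : y `^ a <= x `^ (1 - a).
  have -> : y `^ a = (y `^ (a / (1 - a))) `^ (1 - a) by rewrite -powRrM divfK// gt_eqF.
  by apply: ge0_ler_powR; rewrite ?nnegrE ?powR_ge0 ?(ltW a10)// ltW.
apply: (le_trans (ler_wpM2l (powR_ge0 x a) h2)).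
rewrite -powRD; last by apply/implyP => _; rewrite gt_eqF.
by rewrite addrC subrK powRr1.
Qed.

Lemma powR_abs_le {R : realType} (x s : R) : 1 <= s -> `|x| <= 1 + `|x| `^ s.
Proof.
move=> s1; have [h|h] := leP `|x| 1; first by rewrite (le_trans h)// lerDl powR_ge0.
by apply: (@le_trans _ _ (`|x| `^ s)); [apply: le1r_powR => //; exact: ltW|rewrite lerDr].
Qed.

Lemma mf_powR {d} {T : measurableType d} {R : realType} (h : T -> R) (c : R) :
  measf h -> measf (fun t => h t `^ c).
Proof. by move=> mh; apply: (measurableT_comp (f := fun t => t `^ c)) => //; exact: measurable_powR. Qed.

Lemma powR_absD {R : realType} (x y q : R) : 0 <= q ->
  `|x + y| `^ q <= 2 `^ q * (`|x| `^ q + `|y| `^ q).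
Proof.
move=> q0; have [h|h] := leP `|x| `|y|.
  apply: (@le_trans _ _ ((2 * `|y|) `^ q)).
    apply: ge0_ler_powR => //; rewrite ?nnegrE ?mulr_ge0//.
    by apply: (le_trans (ler_normD _ _)); lra.
  by rewrite powRM// ler_wpM2l ?powR_ge0// lerDr powR_ge0.
apply: (@le_trans _ _ ((2 * `|x|) `^ q)).
  apply: ge0_ler_powR => //; rewrite ?nnegrE ?mulr_ge0//.
  by apply: (le_trans (ler_normD _ _)); lra.
by rewrite powRM// ler_wpM2l ?powR_ge0// lerDl powR_ge0.
Qed.

(** Converts smallness in L2 into smallness in L^q for q < 2 and a finite measure: the constant [e]
    takes care of small values, the square of large ones. *)
Lemma powR_le_sq {R : realType} (x q e : R) : 0 < q -> q < 2 -> 0 < e ->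
  `|x| `^ q <= e + e `^ ((q - 2) / q) * x ^+ 2.
Proof.
move=> q0 q2 e0; have [h|h] := leP (`|x| `^ q) e.
  by apply: (le_trans h); rewrite lerDl mulr_ge0 ?powR_ge0 ?sqr_ge0.
have x0 : 0 < `|x|.
  rewrite lt_neqAle normr_ge0 andbT eq_sym; apply/eqP => e1.
  by move: h; rewrite e1 powR0 ?gt_eqF// ltNge (ltW e0).
apply: (@le_trans _ _ (e `^ ((q - 2) / q) * x ^+ 2)); last by rewrite lerDr ltW.
have -> : x ^+ 2 = `|x| `^ 2 by rewrite powR_mulrn// real_normK ?num_real.
have -> : q = (q - 2) + 2 by ring.
rewrite powRD; last by apply/implyP => _; rewrite gt_eqF.
rewrite ler_wpM2r ?powR_ge0// subrK.
have -> : `|x| `^ (q - 2) = (`|x| `^ q) `^ ((q - 2) / q) by rewrite -powRrM mulrC divfK// gt_eqF.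
rewrite -[(q - 2) / q]opprK -mulNr; apply: powR_decr => //; last exact: ltW.
by rewrite divr_ge0 ?(ltW q0)//; lra.
Qed.

(** * The limit equation, by two opposite inequalities *)

Section limit.
Context {d : measure_display} {T : measurableType d} {R : realType}.
Variable nu : {measure set T -> \bar R}.
Hypothesis nufin : (nu setT < +oo)%E.
Context {N : nat}.
Variables (C : set (T -> R)) (D : (T -> R) -> T -> 'rV[R]_N).
Hypothesis tc : test_class nu C D.
Notation L1 := (L1 nu).
Notation L2 := (L2 nu).
Notation L2v := (@L2v _ T R nu N).
Notation I := (I nu).
Notation aE := (aE nu).
Notation VG := (vg T R N).
Notation isL2 := (@isL2 _ T R nu N).
Notation E2 := (@E2 _ T R nu N).
Notation H := (H nu C D).
Notation Hb := (Hb nu C D).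
Variables (alpha beta : R) (b : T -> R).
Hypothesis alpha0 : 0 < alpha.
Hypothesis mb : measf b.
Hypothesis hb : forall t, alpha <= b t <= beta.
Notation en := (en nu b).
Notation sol := (sol nu C D b).
Variables (B p th : R).
Hypothesis B0 : 0 < B.
Hypothesis p0 : 0 <= p.
Hypothesis th0 : 0 < th.
Hypothesis th1 : th < 1.
Variable K : nat -> R -> R.
Hypothesis K_C1 : forall k, C1fun (K k) (Kd p K k).
Hypothesis K_0 : forall k, K k 0 = 0.
Hypothesis K_agree : forall (k j : nat) t, (k <= j)%N -> (K k t <= k%:R) || (K j t <= k%:R) -> K k t = K j t.
Variable f : T -> R.
Hypothesis Lf : L1 f.
Hypothesis f0 : forall t, 0 <= f t.
Notation G := (Gn p th K).
Notation FFn := (FFn B G).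
Notation fk := (fk f).
Variables (x : nat -> VG) (ix jx : nat -> nat) (v : T -> R) (g : T -> 'rV[R]_N).
Hypothesis hij : forall n, (n <= ix n)%N /\ (n <= jx n)%N.
Hypothesis hsol : forall n, sol (FFn (ix n) (x n)) (fk (jx n)) (x n) /\ (forall t, 0 <= vf (x n) t).
Hypothesis cv : forall t, vf (x n) t @[n --> \oo] --> v t.
Hypothesis cg : forall t i, vv (x n) t ord0 i @[n --> \oo] --> g t ord0 i.
Arguments cv t : clear implicits.
Arguments cg t i : clear implicits.
Notation w n := (vf (x n)).
Notation gn n := (vv (x n)).

Let ba t : alpha <= b t. Proof. by have /andP[] := hb t. Qed.
Let b0 t : 0 < b t. Proof. exact: lt_le_trans alpha0 (ba t). Qed.
Let bb t : b t <= beta. Proof. by have /andP[] := hb t. Qed.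
Let bn t : `|b t| <= beta. Proof. by rewrite ger0_norm ?(ltW (b0 t)). Qed.
Let Hx n : H (x n). Proof. by have [[]] := hsol n. Qed.
Let hx2 n : isL2 (x n). Proof. exact: H_isL2 (Hx n). Qed.
Let w0 n t : 0 <= w n t. Proof. by have [_ h] := hsol n; exact: h. Qed.
Let mw n : measf (w n). Proof. exact: (hx2 n).1.1. Qed.
Let G0 n t : 0 <= G n t. Proof. exact: Gn_ge0. Qed.
Let Phi0 n t : 0 <= FFn (ix n) (x n) t. Proof. exact: Fn_ge0. Qed.
Let LPhi n : L2 (FFn (ix n) (x n)). Proof. by have [[]] := hsol n. Qed.
Let fn0 n t : 0 <= fk n t. Proof. exact: fk_ge0. Qed.
Let Lfn n : L1 (fk n). Proof. exact: (L2_L1 nufin (fk_L2 nufin Lf f0 n)). Qed.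
Let v0 t : 0 <= v t. Proof. exact: (cvg_geR (fun n => w0 n t) (cv t)). Qed.
Let mv : measf v. Proof. by apply: (mf_cvg _ cv). Qed.
Let mg i : measf (fun t => g t ord0 i).
Proof. by apply: (mf_cvg _ (cg ^~ i)) => n; exact: ((hx2 n).2 i).1. Qed.
Let msqg : measf (fun t => sq (g t)).
Proof. by apply: mf_sum => i; exact: mfM. Qed.

Let v1 t : 0 < 1 + v t. Proof. by rewrite ltr_pwDl. Qed.
Let w1 n t : 0 < 1 + w n t. Proof. by rewrite ltr_pwDl. Qed.

Lemma cvg_sqg t : sq (gn n t) @[n --> \oo] --> sq (g t).
Proof. by apply: cvg_bigsum => i; apply: cvgM; exact: cg. Qed.

Lemma cvg_fk t : fk (jx n) t @[n --> \oo] --> f t.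
Proof.
apply/cvg_epsP => e e0; pose k := (Num.truncn (f t)).+1.
exists k => n kn; rewrite /fk min_l ?subrr ?normr0 ?(ltW e0)//.
have h1 : f t <= k%:R by rewrite ltW// truncnS_gt.
apply: (le_trans h1); rewrite ler_nat; apply: leq_trans kn _; exact: (hij n).2.
Qed.

Definition Cf := I f / alpha.

Lemma energy_n n : L1 (fun t => (1 + w n t)^-1 ^+ 2 * sq (gn n t)) /\
  I (fun t => (1 + w n t)^-1 ^+ 2 * sq (gn n t)) <= Cf.
Proof.
have [hs _] := hsol n; split.
  apply: (L1_bM (M := 1)); [| |exact: L2v_sq (hx2 n).2].
    apply: mfX; apply: (aE_mf (f := fun t => (1 + Num.max (w n t) 0)^-1)); first by move=> t; rewrite max_l.
    exact: mf_cont C1_lg.2 (mw n).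
  move=> t; rewrite normrX exprn_ile1// ger0_norm ?invr_ge0 ?(ltW (w1 n t))//.
  by rewrite invf_le1// lerDl.
rewrite /Cf ler_pdivlMr// mulrC; apply: le_trans (fk_I nufin Lf f0 (jx n)).
exact: (sol_energy nufin tc alpha0 mb hb hs).
Qed.

Lemma energy_lim : L1 (fun t => (1 + v t)^-1 ^+ 2 * sq (g t)) /\
  I (fun t => (1 + v t)^-1 ^+ 2 * sq (g t)) <= Cf.
Proof.
apply: (@I_fatou _ _ _ nu (fun n t => (1 + w n t)^-1 ^+ 2 * sq (gn n t)) _ (fun=> Cf)).
- by move=> n; exact: (energy_n n).1.
- apply: mfM => //; apply: mfX.
  apply: (aE_mf (f := fun t => (1 + Num.max (v t) 0)^-1)); first by move=> t; rewrite max_l.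
  exact: mf_cont C1_lg.2 mv.
- by move=> n t; rewrite mulr_ge0 ?sqr_ge0 ?sq_ge0.
- by move=> t; rewrite mulr_ge0 ?sqr_ge0 ?sq_ge0.
- apply: aE_all => t; apply: cvgM; last exact: cvg_sqg.
  apply: cvg_sqr; apply: cvgV; first by rewrite gt_eqF.
  by apply: cvgD; [exact: cvg_cst|exact: cv].
- by move=> n; exact: (energy_n n).2.
- exact: cvg_cst.
Qed.

(** At this stage gradients are bounded only after division by 1 + v. A weight [r] such that r (1 +
    v) is bounded brings them back to L2. *)
Let weighted_L2v (y : VG) (r : T -> R) (M : R) : measf r -> (forall i, measf (fun t => vv y t ord0 i)) ->
  (forall t, 0 <= vf y t) -> L1 (fun t => (1 + vf y t)^-1 ^+ 2 * sq (vv y t)) ->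
  I (fun t => (1 + vf y t)^-1 ^+ 2 * sq (vv y t)) <= Cf ->
  (forall t, `|r t| * (1 + vf y t) <= M) ->
  [/\ L2v (fun t => r t *: vv y t), L1 (fun t => r t ^+ 2 * sq (vv y t)) &
    I (fun t => r t ^+ 2 * sq (vv y t)) <= M ^+ 2 * Cf].
Proof.
move=> mr my y0 Ly Iy hr.
have y1 t : 0 < 1 + vf y t by rewrite ltr_pwDl.
have pw t : r t ^+ 2 * sq (vv y t) <= M ^+ 2 * ((1 + vf y t)^-1 ^+ 2 * sq (vv y t)).
  rewrite mulrA ler_wpM2r ?sq_ge0// exprVn ler_pdivlMr ?exprn_gt0// -exprMn.
  rewrite -(real_normK (num_real (r t * _))) normrM (ger0_norm (ltW (y1 t))).
  by rewrite lerXn2r ?nnegrE ?mulr_ge0 ?(ltW (y1 t))// (le_trans _ (hr t))// mulr_ge0 ?(ltW (y1 t)).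
have L : L1 (fun t => r t ^+ 2 * sq (vv y t)).
  apply: (L1_dom _ (L1Z (M ^+ 2) Ly)).
    by apply: mfM; [exact: mfX|apply: mf_sum => i; exact: mfM].
  by move=> t; rewrite ger0_norm; [exact: pw|rewrite mulr_ge0 ?sqr_ge0 ?sq_ge0].
split => //.
  move=> i; split; first by under [X in measf X]eq_fun do rewrite mxE; exact: mfM.
  apply: (L1_dom _ L); first by apply: mfX; under [X in measf X]eq_fun do rewrite mxE; exact: mfM.
  by move=> t; rewrite ger0_norm ?sqr_ge0// mxE exprMn ler_wpM2l ?sqr_ge0// sq_coord.
apply: (@le_trans _ _ (I (fun t => M ^+ 2 * ((1 + vf y t)^-1 ^+ 2 * sq (vv y t))))).
  by apply: I_le => //; exact: L1Z.
by rewrite IZ// ler_wpM2l// sqr_ge0.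
Qed.

Lemma weighted_n n (r : T -> R) (M : R) : measf r -> (forall t, `|r t| * (1 + w n t) <= M) ->
  [/\ L2v (fun t => r t *: gn n t), L1 (fun t => r t ^+ 2 * sq (gn n t)) &
    I (fun t => r t ^+ 2 * sq (gn n t)) <= M ^+ 2 * Cf].
Proof.
move=> mr hr; have [e1 e2] := energy_n n.
by apply: (weighted_L2v (y := x n)) => // i; exact: ((hx2 n).2 i).1.
Qed.

Lemma weighted_lim (r : T -> R) (M : R) : measf r -> (forall t, `|r t| * (1 + v t) <= M) ->
  [/\ L2v (fun t => r t *: g t), L1 (fun t => r t ^+ 2 * sq (g t)) &
    I (fun t => r t ^+ 2 * sq (g t)) <= M ^+ 2 * Cf].
Proof.
by move=> mr hr; have [e1 e2] := energy_lim; apply: (weighted_L2v (y := Vg v g)).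
Qed.

(** Convergence at every point and boundedness in L2 of the weighted gradients give weak
    convergence, which suffices since the other factor is fixed. *)
Lemma weak_limit (rn : nat -> T -> R) (r : T -> R) M zeta : (forall n, measf (rn n)) ->
  (forall t, rn n t @[n --> \oo] --> r t) -> (forall n t, `|rn n t| * (1 + w n t) <= M) -> L2v zeta ->
  [/\ measf r, forall t, `|r t| * (1 + v t) <= M,
   L1 (fun t => b t * (r t * dotr (g t) (zeta t))) &
   I (fun t => b t * (rn n t * dotr (gn n t) (zeta t))) @[n --> \oo] -->
   I (fun t => b t * (r t * dotr (g t) (zeta t)))].
Proof.
move=> mrn cr hrn hz.
have mr : measf r by exact: mf_cvg cr.
have hr t : `|r t| * (1 + v t) <= M.
  apply: (@cvg_leR _ (fun n => `|rn n t| * (1 + w n t))); first by move=> n; exact: hrn.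
  apply: cvgM; first exact: cvg_absR.
  by apply: cvgD; [exact: cvg_cst|exact: cv].
have [h1 _ h3] := weighted_lim mr hr.
have hn n := weighted_n (mrn n) (hrn n).
have bz i : L2 (fun t => b t * zeta t ord0 i) by exact: L2_bM mb bn (hz i).
have Lr : L1 (fun t => b t * (r t * dotr (g t) (zeta t))).
  by apply: L1_eq (L1_bM mb bn (L2v_dot h1 hz)) => t; rewrite dotrZl.
have Lrn n : L1 (fun t => b t * (rn n t * dotr (gn n t) (zeta t))).
  by have [h _ _] := hn n; apply: L1_eq (L1_bM mb bn (L2v_dot h hz)) => t; rewrite dotrZl.
split => //.
have ci i : I (fun t => ((rn n t *: gn n t) ord0 i - (r t *: g t) ord0 i) * (b t * zeta t ord0 i))
    @[n --> \oo] --> (0 : R).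
  apply: (cvg_weak (C := 4 * (M ^+ 2 * Cf))) => //.
  - by move=> n; have [h _ _] := hn n; exact: L2B (h i) (h1 i).
  - move=> n; have [k1 k2 k3] := hn n.
    have [_ l2 l3] := weighted_lim mr hr.
    apply: (@le_trans _ _ (I (fun t => 2 * (rn n t ^+ 2 * sq (gn n t)) + 2 * (r t ^+ 2 * sq (g t))))).
      apply: I_le; [exact: (L2B (k1 i) (h1 i)).2|by apply: L1D; exact: L1Z|].
      move=> t; rewrite !mxE.
      have a1 := ler_wpM2l (sqr_ge0 (rn n t)) (sq_coord (gn n t) i).
      have a2 := ler_wpM2l (sqr_ge0 (r t)) (sq_coord (g t) i).
      move: a1 a2; rewrite -!exprMn; move: (rn n t * _) (r t * _) (_ * sq _) (_ * sq _) => q1 q2 q3 q4 a1 a2.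
      by have := sqr_ge0 (q1 + q2); nra.
    by rewrite ID ?IZ//; [lra|exact: L1Z|exact: L1Z].
  - apply: aE_all => t; rewrite -(subrr ((r t *: g t) ord0 i)).
    apply: cvgB; last exact: cvg_cst.
    rewrite mxE (_ : (fun n => _) = fun n => rn n t * gn n t ord0 i); last by apply/funext => n; rewrite mxE.
    by apply: cvgM; [exact: cr|exact: cg].
have cs := cvg_bigsum (s := index_enum 'I_N) ci; rewrite big1_eq in cs.
have c2 := cvg_addR cs (cvg_cstR (I (fun t => b t * (r t * dotr (g t) (zeta t))))).
rewrite add0r in c2.
rewrite (_ : (fun n => _) = fun n => \sum_i I (fun t => ((rn n t *: gn n t) ord0 i - (r t *: g t) ord0 i) *
   (b t * zeta t ord0 i)) + I (fun t => b t * (r t * dotr (g t) (zeta t)))); first exact: c2.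
apply/funext => n; have [k1 _ _] := hn n.
rewrite -I_sum; last by move=> i; exact: L2M (L2B (k1 i) (h1 i)) (bz i).
rewrite -ID//; last by apply: L1_sum => i; exact: L2M (L2B (k1 i) (h1 i)) (bz i).
apply: I_eq => t; rewrite /dotr !mulr_sumr -big_split/=; apply: eq_bigr => i _.
by rewrite !mxE; ring.
Qed.

(** [v] itself is not known to lie in [H]; its images under such [r] are, as limits of elements
    bounded in energy. *)
Lemma trunc_H (r r' : R -> R) M : C1fun r r' -> r 0 = 0 ->
  (forall t, `|r' t| * (1 + Num.max t 0) <= M) ->
  H (Vg (fun t => r (v t)) (fun t => r' (v t) *: g t)).
Proof.
move=> hr r0 hM.
have r'M t : `|r' t| <= M.
  by apply: le_trans (hM t); rewrite ler_peMr// lerDl le_max lexx orbT.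
have [KP KP0 hKP] := H_poincare nufin tc.
pose y n : VG := Vg (fun t => r (w n t)) (fun t => r' (w n t) *: gn n t).
have Hy n : H (y n) by exact: (H_comp nufin tc hr r'M r0 (Hx n)).
have mr (z : T -> R) : measf z -> measf (fun t => r' (z t)) by move=> mz; exact: mf_cont hr.2 mz.
have wb n t : `|r' (w n t)| * (1 + w n t) <= M by have := hM (w n t); rewrite max_l.
suff [] : H (Vg (fun t => r (v t)) (fun t => r' (v t) *: g t)) /\
   E2 (Vg (fun t => r (v t)) (fun t => r' (v t) *: g t)) <= (KP + 1) * (M ^+ 2 * Cf) by [].
apply: (H_weak_closed nufin tc (x := y)) => //=.
- exact: mf_cont (C1_cont hr) mv.
- by move=> i; under [X in measf X]eq_fun do rewrite mxE; apply: mfM => //; exact: mr.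
- move=> n; have [k1 k2 k3] := weighted_n (mr _ (mw n)) (wb n).
  rewrite (E2_split (H_isL2 (Hy n))) mulrDl mul1r.
  have e : I (fun t => sq (vv (y n) t)) = I (fun t => r' (w n t) ^+ 2 * sq (gn n t)).
    by apply: I_eq => t; rewrite /= sqZ.
  by apply: lerD; [apply: (le_trans (hKP _ (Hy n))); rewrite ler_wpM2l ?(ltW KP0)// e|rewrite e].
- by apply: aE_all => t; exact: (cvg_C1 hr (cv t)).
- apply: aE_all => t i; rewrite mxE.
  rewrite (_ : (fun n => _) = fun n => r' (w n t) * gn n t ord0 i); last by apply/funext => n; rewrite mxE.
  by apply: cvgM; [exact: (cvg_C1' hr (cv t))|exact: cg].
Qed.

(** A cut-off in the level of u, expressed in v: it is 1 while u <= k and 0 from u = k + 1 on, a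
    range on which [K k.+1] is the exact change of unknown. *)
Definition tht (k : nat) t := chi k%:R (K k.+1 t).
Definition thd (k : nat) t := chi' k%:R (K k.+1 t) * Kd p K k.+1 t.

Lemma C1_tht k : C1fun (tht k) (thd k).
Proof. exact: C1_comp (C1_chi k%:R) (K_C1 k.+1). Qed.

Lemma tht_ge0 k t : 0 <= tht k t. Proof. exact: chi_ge0. Qed.
Lemma tht_le1 k t : tht k t <= 1. Proof. exact: chi_le1. Qed.
Lemma tht_abs k t : `|tht k t| <= 1. Proof. by rewrite ger0_norm ?tht_ge0 ?tht_le1. Qed.
Lemma thd_le0 k t : thd k t <= 0.
Proof. by rewrite mulr_le0_ge0 ?chi'_le0// ltW// Kd_gt0. Qed.

Lemma tht_1 k t : K k.+1 t <= k%:R -> tht k t = 1. Proof. exact: chi_1. Qed.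
Lemma tht_0 k t : k.+1%:R <= K k.+1 t -> tht k t = 0.
Proof. by rewrite -natr1; exact: chi_0. Qed.
Lemma thd_r k t : k.+1%:R <= K k.+1 t -> thd k t = 0.
Proof. by rewrite -natr1 => h; rewrite /thd chi'_r// mul0r. Qed.

Lemma thd_bd k t : `|thd k t| <= 4 * (1 + k.+1%:R) `^ p.
Proof.
rewrite normrM ler_pM// ?chi'_bd// ger0_norm ?Kd_le//.
by rewrite ltW// Kd_gt0.
Qed.

(* A function of v vanishing where u >= k+1 vanishes for v >= k+1, as v <= u. *)
Lemma support_weight k (r : R -> R) M : (forall t, `|r t| <= M) ->
  (forall t, k%:R <= K k t -> r t = 0) ->
  forall t, `|r t| * (1 + Num.max t 0) <= M * (1 + k%:R).
Proof.
move=> hM h0 t; have M0 : 0 <= M by exact: le_trans (hM 0).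
have [h|h] := leP k%:R (K k t); first by rewrite h0// normr0 mul0r mulr_ge0// addr_ge0.
apply: ler_pM => //; first by rewrite addr_ge0// le_max lexx orbT.
rewrite lerD2l ge_max ler0n andbT.
have [t0|t0] := leP 0 t; first exact: le_trans (K_ge p0 K_C1 K_0 k t0) (ltW h).
exact: le_trans (ltW t0) (ler0n _ _).
Qed.

Lemma good_tht t k : K k t <= k%:R -> forall j, (k <= j)%N -> tht j t = 1.
Proof.
move=> h j kj; apply: tht_1; rewrite -(K_agree (leqW kj)) ?h//.
by apply: (le_trans h); rewrite ler_nat.
Qed.

Lemma tht_cvg t : tht k t @[k --> \oo] --> ((`[< good K t >] : bool)%:R : R).
Proof.
have [[k hk]|ng] := pselect (good K t).
  rewrite asboolT; last by exists k.
  by apply/cvg_epsP => e e0; exists k => n kn; rewrite (good_tht hk kn) subrr normr0 ltW.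
rewrite asboolF// (_ : (fun k => _) = fun=> 0); first exact: cvg_cst.
apply/funext => k; apply: tht_0; rewrite leNgt; apply/negP => h.
by apply: ng; exists k.+1; exact: ltW.
Qed.
Arguments tht_cvg t : clear implicits.

Lemma tht_pos_good k t : tht k t != 0 -> K k.+1 t <= k.+1%:R.
Proof. by move=> h; rewrite leNgt; apply: contra h => /ltW/tht_0 ->. Qed.

(** The set on which the limit of the lower order terms is identified. Elsewhere [Phi] is 0, a valid
    lower bound for Fatou's lemma; both exceptional cases turn out to be negligible. *)
Definition iP t : R := ((0 < v t)%R%:R * (`[< good K (v t) >] : bool)%:R).
Definition Phi t := iP t * (B * (Glim p th K (v t) * sq (g t))).

Lemma iP01 t : iP t = 0 \/ iP t = 1.
Proof.
by rewrite /iP; case: (0 < v t); case: (`[< _ >]); rewrite ?mulr1 ?mulr0 ?mul0r; [right|left|left|left].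
Qed.

Lemma iP_ge0 t : 0 <= iP t. Proof. by case: (iP01 t) => ->. Qed.

Lemma iP1 t : iP t != 0 -> 0 < v t /\ good K (v t).
Proof.
rewrite /iP; case: (0 < v t) => //; last by rewrite mul0r eqxx.
by have [h|h] := asboolP (good K (v t)) => //; rewrite mulr0 eqxx.
Qed.

Lemma iP_eq1 t : 0 < v t -> good K (v t) -> iP t = 1.
Proof. by move=> h1 h2; rewrite /iP h1 asboolT// mulr1. Qed.

Lemma miP : measf iP.
Proof.
apply: (mf_cvg (h := fun n t => pind (dlt n) (v t) * tht n (v t))).
  move=> n; apply: mfM; first exact: mf_cont (C1_cont (C1_pind (dlt n))) mv.
  exact: mf_cont (C1_cont (C1_tht n)) mv.
by move=> t; apply: cvgM; [exact: pind_cvg|exact: tht_cvg].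
Qed.

Lemma cvg_FFn t : iP t != 0 ->
  FFn (ix n) (x n) t @[n --> \oo] --> B * (Glim p th K (v t) * sq (g t)).
Proof.
move=> /iP1[vp gv]; apply: cvg_mulcR; apply: cvgM.
  by apply: (Gn_cvg p0 K_C1 K_0 K_agree vp gv _ (cv t)) => n; have [] := hij n.
rewrite -(nrm_sq (g t)); apply: cvg_sqr.
have c1 : nrm (gn n t) @[n --> \oo] --> nrm (g t).
  apply: (@cvg_comp _ _ _ (fun n => sq (gn n t)) Num.sqrt _ (nbhs (sq (g t)))); first exact: cvg_sqg.
  exact: sqrt_continuous.
apply/cvg_epsP => e e0; have [k1 h1] := (cvg_epsP _ _).1 c1 _ e0.
have [k2 h2] := (cvg_epsP _ _).1 c1 _ ltr01.
pose k3 := (Num.truncn (nrm (g t) + 1)).+1.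
exists (maxn k1 (maxn k2 k3)) => n; rewrite !geq_max => /andP[n1 /andP[n2 n3]].
rewrite min_l; first exact: h1.
have := h2 n n2; rewrite ler_norml => /andP[_ h].
have h3 : nrm (g t) + 1 <= k3%:R by rewrite ltW// truncnS_gt.
have h4 : k3%:R <= (ix n)%:R :> R by rewrite ler_nat (leq_trans n3)//; have [] := hij n.
lra.
Qed.

Lemma cvg_iPFFn t : iP t * FFn (ix n) (x n) t @[n --> \oo] --> Phi t.
Proof.
have [h|h] := eqVneq (iP t) 0; last by apply: cvg_mulcR; exact: cvg_FFn.
rewrite /Phi h mul0r (_ : (fun n => _) = fun=> 0); first exact: cvg_cst.
by apply/funext => n; rewrite mul0r.
Qed.
Arguments cvg_iPFFn t : clear implicits.
Arguments cvg_fk t : clear implicits.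

Lemma mPhi : measf Phi.
Proof.
apply: (mf_cvg (h := fun n t => iP t * FFn (ix n) (x n) t)); last exact: cvg_iPFFn.
by move=> n; apply: mfM; [exact: miP|exact: (LPhi n).1].
Qed.

Lemma Phi_ge0 t : 0 <= Phi t.
Proof.
rewrite mulr_ge0 ?iP_ge0// mulr_ge0 ?(ltW B0)// mulr_ge0 ?sq_ge0// mulr_ge0// powR_ge0//.
Qed.

Lemma cvg_If (rn : nat -> T -> R) (r : T -> R) M : (forall n, measf (rn n)) ->
  (forall t, rn n t @[n --> \oo] --> r t) -> (forall n t, `|rn n t| <= M) ->
  [/\ forall n, L1 (fun t => fk (jx n) t * rn n t), L1 (fun t => f t * r t) &
   I (fun t => fk (jx n) t * rn n t) @[n --> \oo] --> I (fun t => f t * r t)].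
Proof.
move=> mr cr hr.
have L n : L1 (fun t => fk (jx n) t * rn n t).
  by apply: L1_eq (L1_bM (mr n) (hr n) (Lfn (jx n))) => t; rewrite mulrC.
have [h1 h2] : L1 (fun t => f t * r t) /\
   I (fun t => fk (jx n) t * rn n t) @[n --> \oo] --> I (fun t => f t * r t).
  apply: (I_dct (g := fun t => M * f t)).
  - by move=> n; exact: L1_mf (L n).
  - by apply: mfM; [exact: L1_mf Lf|exact: mf_cvg cr].
  - exact: L1Z.
  - by apply: aE_all => t; apply: cvgM; [exact: cvg_fk|exact: cr].
  - move=> n; apply: aE_all => t; rewrite normrM mulrC ler_pM//.
    by rewrite ger0_norm// fk_le.
by split.
Qed.

(** The test r(v_n) - r(0) is admissible and makes the principal part nonnegative; the constant r(0)
    is restored by the mass inequality, and Fatou's lemma passes to the limit. *)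
Lemma phi_energy (r r' : R -> R) M M' : C1fun r r' -> (forall t, `|r' t| <= M) ->
  (forall t, 0 <= r' t) -> 0 <= r 0 -> (forall t, 0 <= t -> r t <= M') ->
  L1 (fun t => Phi t * r (v t)) /\ I (fun t => Phi t * r (v t)) <= I (fun t => f t * r (v t)).
Proof.
move=> hr hM r'0 r0 rM.
have rp t : 0 <= t -> 0 <= r t by move=> t0; exact: le_trans r0 (C1_nd hr r'0 t0).
have mr (z : T -> R) : measf z -> measf (fun t => r (z t)) by move=> mz; exact: mf_cont (C1_cont hr) mz.
have hr2 : C1fun (fun t => r t - r 0) r'.
  by apply: C1_eq (C1D hr (C1_cst (- r 0))) => // t; rewrite addr0.
have r2b n t : `|r (w n t)| <= M' by rewrite ger0_norm ?rp ?rM.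
have Lfr n : L1 (fun t => fk (jx n) t * r (w n t)).
  by apply: L1_eq (L1_bM (mr _ (mw n)) (r2b n) (Lfn (jx n))) => t; rewrite mulrC.
have LPr n : L1 (fun t => FFn (ix n) (x n) t * r (w n t)).
  by apply: L1_eq (L1_bM (mr _ (mw n)) (r2b n) (L2_L1 nufin (LPhi n))) => t; rewrite mulrC.
have est n : I (fun t => FFn (ix n) (x n) t * r (w n t)) <= I (fun t => fk (jx n) t * r (w n t)).
  have [hs xp] := hsol n.
  have r200 : r 0 - r 0 = 0 by rewrite subrr.
  have [La Lb Lc e] := sol_test nufin tc alpha0 mb hb hs hr2 hM r200.
  have p1 : 0 <= I (fun t => b t * (r' (w n t) * sq (gn n t))).
    apply: I_ge0 => t; apply: mulr_ge0; first exact: ltW.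
    by rewrite mulr_ge0 ?sq_ge0.
  have mass : I (FFn (ix n) (x n)) <= I (fk (jx n)).
    apply: (sol_mass nufin tc alpha0 mb hb hs xp) => //.
    move=> t e0; rewrite /FFn e0; apply: Fn_0 => k; exact: Gn_0.
  have sp (h : T -> R) : L1 h -> L1 (fun t => h t * r (w n t)) ->
      I (fun t => h t * (r (w n t) - r 0)) = I (fun t => h t * r (w n t)) - r 0 * I h.
    by move=> Lh Lhr; rewrite -IZ// -IB//; [apply: I_eq => t; ring|exact: L1Z].
  rewrite !sp// in e; [|exact: L2_L1 (LPhi n)].
  by have := ler_wpM2l r0 mass; move: e p1; lra.
have Lfv : L1 (fun t => f t * r (v t)).
  apply: L1_eq (L1_bM (mr _ mv) (M := M') _ Lf) => t; first by rewrite mulrC.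
  by rewrite ger0_norm ?rp ?rM.
have [_ _ cI] := cvg_If (fun n => mr _ (mw n)) (fun t => cvg_C1 hr (cv t)) r2b.
apply: (@I_fatou _ _ _ nu (fun n t => iP t * FFn (ix n) (x n) t * r (w n t)) _ _ _ _ _ _ _ _ _ cI).
- move=> n; apply: L1_eq (L1_bM miP (M := 1) _ (LPr n)) => t; first by rewrite mulrA.
  by case: (iP01 t) => ->; rewrite ?normr0 ?normr1.
- by apply: mfM; [exact: mPhi|exact: mr].
- by move=> n t; apply: mulr_ge0; [apply: mulr_ge0; [exact: iP_ge0|exact: Phi0]|exact: rp].
- by move=> t; apply: mulr_ge0; [exact: Phi_ge0|exact: rp].
- by apply: aE_all => t; apply: cvgM; [exact: cvg_iPFFn|exact: (cvg_C1 hr (cv t))].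
- move=> n; apply: le_trans (est n); apply: I_le => //.
    apply: L1_eq (L1_bM miP (M := 1) _ (LPr n)) => t; first by rewrite mulrA.
    by case: (iP01 t) => ->; rewrite ?normr0 ?normr1.
  move=> t; case: (iP01 t) => ->; rewrite ?mul1r// !mul0r; apply: mulr_ge0; [exact: Phi0|exact: rp].
Qed.

(** The factor [chi 0 (- t)] is 1 for t >= 0 and 0 for t <= -1: the product has compact support,
    hence is bounded with its derivative, and nothing changes on nonnegative functions. *)
Lemma cutoff k (F F' : R -> R) : C1fun F F' -> exists r r' M,
  [/\ C1fun r r', forall t, `|r t| <= M, forall t, `|r' t| <= M,
   (forall t, 0 <= F t) -> forall t, 0 <= r t &
   forall t, 0 <= t -> r t = F t * tht k t /\ r' t = F' t * tht k t + F t * thd k t].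
Proof.
move=> hF; have h1 := C1_comp (C1_chi (0 : R)) (C1N C1_id).
have h2 := C1M (C1M hF (C1_tht k)) h1.
have [M _ hM] : exists2 M, 0 <= M & forall t, `|F t * tht k t * chi 0 (- t)| <= M /\
    `|(F' t * tht k t + F t * thd k t) * chi 0 (- t) + F t * tht k t * (chi' 0 (- t) * - 1)| <= M.
  have ac : (-1 : R) <= k.+1%:R by apply: (@le_trans _ _ 0) => //; lra.
  apply: (C1_bounded h2 ac) => t ht.
    have h : 0 + 1 <= - t by lra.
    by rewrite chi_0// chi'_r// mul0r !mulr0 addr0.
  have t0 : 0 <= t by exact: le_trans ht.
  have h : k.+1%:R <= K k.+1 t by apply: (le_trans ht); exact: (K_ge p0 K_C1 K_0 k.+1 t0).
  by rewrite tht_0// thd_r// !mulr0 !mul0r !addr0 mul0r.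
exists (fun t => F t * tht k t * chi 0 (- t)),
  (fun t => (F' t * tht k t + F t * thd k t) * chi 0 (- t) + F t * tht k t * (chi' 0 (- t) * - 1)), M.
split => //.
- by move=> t; have [] := hM t.
- by move=> t; have [] := hM t.
- move=> F0 t; apply: mulr_ge0; last exact: chi_ge0.
  by apply: mulr_ge0; [exact: F0|exact: tht_ge0].
- move=> t t0; have h : - t <= 0 by lra.
  by rewrite (chi_1 h) (chi'_l h) mulr1 mul0r mulr0 addr0 mulr1.
Qed.

Lemma tht_weight k t : 0 <= t -> tht k t * (1 + t) <= 1 + k.+1%:R.
Proof.
move=> t0; have := @support_weight k.+1 (tht k) 1 (tht_abs k) (@tht_0 k) t.
by rewrite max_l// mul1r ger0_norm ?tht_ge0.
Qed.

(** [tau 0] applied to v lies in [H], and its gradient is that of v wherever v = 0, since [chi 0] is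
    1 there. *)
Lemma g_eq0 : aE (fun t => v t = 0 -> g t = 0).
Proof.
have hM t : `|chi (0%N%:R : R) t| * (1 + Num.max t 0) <= 2.
  rewrite ger0_norm ?chi_ge0//; have [h|h] := leP 1 t.
    by rewrite chi_0 ?mul0r// add0r.
  have : Num.max t 0 <= 1 by rewrite ge_max ler01 ltW.
  have := @chi_le1 R 0%N%:R t; have := @chi_ge0 R 0%N%:R t.
  have : 0 <= Num.max t 0 by rewrite le_max lexx orbT.
  by move: (Num.max t 0) (chi _ t) => m c m0 c0 c1 m1; nra.
have hx := trunc_H (C1_tau 0) (tau0 0) hM.
apply: (aE_mp (H_grad0 nufin tc hx)) => t /= h e.
by have := h _; rewrite e tau0 chi_1 ?scale1r// => /(_ erefl).
Qed.

(** The derivative of the cut-off produces a quadratic term of unfavourable sign. Testing the same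
    equation with 1 - tht k (v_n) bounds it by the mass of [f] where u > k, which tends to 0 as k
    grows once u is known to be finite. *)
Lemma ineq_A k phi M : C phi -> (forall t, 0 <= phi t <= M) ->
  [/\ L1 (fun t => b t * (tht k (v t) * dotr (g t) (D phi t))),
      L1 (fun t => Phi t * (phi t * tht k (v t))) &
  I (fun t => b t * (tht k (v t) * dotr (g t) (D phi t))) + I (fun t => Phi t * (phi t * tht k (v t))) <=
    I (fun t => f t * (phi t * tht k (v t))) + M * I (fun t => f t * (1 - tht k (v t)))].
Proof.
move=> Cphi hphi.
have phi_0 t : 0 <= phi t by have /andP[] := hphi t.
have phi_M t : phi t <= M by have /andP[] := hphi t.
have mphi := tc_mf tc Cphi.
have phiM t : `|phi t| <= M by rewrite ger0_norm.
have [A A0 hA] := Hb_emb nufin tc Cphi; have hz2 := H_isL2 (Hb_H hA).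
have mth (z : T -> R) : measf z -> measf (fun t => tht k (z t)).
  by move=> mz; exact: mf_cont (C1_cont (C1_tht k)) mz.
have cth t : tht k (w n t) @[n --> \oo] --> tht k (v t) by exact: (cvg_C1 (C1_tht k) (cv t)).
have hM n t : `|tht k (w n t)| * (1 + w n t) <= 1 + k.+1%:R.
  by rewrite ger0_norm ?tht_ge0// tht_weight.
have [_ _ LX cX] := weak_limit (fun n => mth _ (mw n)) cth hM hz2.2.
have ptM t u : `|phi t * tht k u| <= M.
  by rewrite normrM -[leRHS]mulr1 ler_pM// tht_abs.
have mpth n : measf (fun t => phi t * tht k (w n t)) by exact: mfM mphi (mth _ (mw n)).
have [Lf1 Lf1v cf1] := cvg_If mpth (fun t => cvg_mulcR (phi t) (cth t)) (fun n t => ptM t (w n t)).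
have m1th (z : T -> R) : measf z -> measf (fun t => 1 - tht k (z t)).
  by move=> mz; apply: mfB; [exact: mf_cst|exact: mth].
have th1b u : `|1 - tht k u| <= 1.
  by rewrite ger0_norm ?subr_ge0 ?tht_le1// gerBl tht_ge0.
have c1th t : 1 - tht k (w n t) @[n --> \oo] --> 1 - tht k (v t).
  by apply: cvgB; [exact: cvg_cst|exact: cth].
have [Lf2 Lf2v cf2] := cvg_If (fun n => m1th _ (mw n)) c1th (fun n t => th1b (w n t)).
have LPt n : L1 (fun t => FFn (ix n) (x n) t * (phi t * tht k (w n t))).
  by apply: L1_eq (L1_bM (mpth n) (fun t => ptM t (w n t)) (L2_L1 nufin (LPhi n))) => t; rewrite mulrC.
pose X n := I (fun t => b t * (tht k (w n t) * dotr (gn n t) (D phi t))).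
have step n : I (fun t => FFn (ix n) (x n) t * (phi t * tht k (w n t))) <=
   I (fun t => fk (jx n) t * (phi t * tht k (w n t))) +
   M * I (fun t => fk (jx n) t * (1 - tht k (w n t))) + - 1 * X n.
  have [hs xp] := hsol n.
  have [K1 K2 K3 K4 e1] := sol_mtest nufin tc alpha0 mb hb hs (C1_tht k) (thd_bd k) (tht_abs k) hA.
  have hr2 : C1fun (fun t => 1 - tht k t) (fun t => - thd k t).
    by apply: C1_eq (C1D (C1_cst 1) (C1N (C1_tht k))) => // t; rewrite add0r.
  have thdN t : `|- thd k t| <= 4 * (1 + k.+1%:R) `^ p by rewrite normrN thd_bd.
  have r00 : 1 - tht k 0 = 0 by rewrite tht_1 ?subrr// K_0.
  have [J1 J2 J3 e2] := sol_test nufin tc alpha0 mb hb hs hr2 thdN r00.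
  have q1 : 0 <= I (fun t => FFn (ix n) (x n) t * (1 - tht k (w n t))).
    by apply: I_ge0 => t; rewrite mulr_ge0 ?subr_ge0 ?tht_le1.
  have q2 : I (fun t => - (b t * (phi t * thd k (w n t) * sq (gn n t)))) <=
     M * I (fun t => b t * (- thd k (w n t) * sq (gn n t))).
    rewrite -IZ//; apply: I_le; [exact: L1N K2|exact: L1Z|] => t.
    have h1 : 0 <= b t * (- thd k (w n t) * sq (gn n t)).
      by apply: mulr_ge0; [exact: ltW|rewrite mulr_ge0 ?sq_ge0// oppr_ge0 thd_le0].
    apply: le_trans (ler_wpM2r h1 (phi_M t)).
    by rewrite le_eqVlt; apply/orP; left; apply/eqP; ring.
  rewrite IN// in q2.
  have M0 : 0 <= M by exact: le_trans (phi_0 (point : T)) (phi_M point).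
  have q3 := ler_wpM2l M0 (_ : I (fun t => b t * (- thd k (w n t) * sq (gn n t))) <= I (fun t => fk (jx n) t * (1 - tht k (w n t)))).
  have q4 := q3 ltac:(lra).
  move: e1 q2 q4; rewrite /X /=; lra.
have cX' : X n @[n --> \oo] --> I (fun t => b t * (tht k (v t) * dotr (g t) (D phi t))) by exact: cX.
have cc := cvg_addR (cvg_addR cf1 (cvg_mulcR M cf2)) (cvg_mulcR (-1) cX').
have [L2' h2] : L1 (fun t => Phi t * (phi t * tht k (v t))) /\
   I (fun t => Phi t * (phi t * tht k (v t))) <=
   I (fun t => f t * (phi t * tht k (v t))) + M * I (fun t => f t * (1 - tht k (v t))) +
   -1 * I (fun t => b t * (tht k (v t) * dotr (g t) (D phi t))).
  apply: (@I_fatou _ _ _ nu (fun n t => iP t * FFn (ix n) (x n) t * (phi t * tht k (w n t))) _ _ _ _ _ _ _ _ _ cc).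
  - move=> n; apply: L1_eq (L1_bM miP (M := 1) _ (LPt n)) => t; first by rewrite mulrA.
    by case: (iP01 t) => ->; rewrite ?normr0 ?normr1.
  - apply: mfM; first exact: mPhi. by apply: mfM => //; exact: mth.
  - move=> n t; apply: mulr_ge0; first by apply: mulr_ge0; [exact: iP_ge0|exact: Phi0].
    by rewrite mulr_ge0 ?tht_ge0.
  - by move=> t; rewrite mulr_ge0 ?Phi_ge0// mulr_ge0 ?tht_ge0.
  - apply: aE_all => t; apply: cvgM; first exact: cvg_iPFFn.
    exact: cvg_mulcR (cth t).
  - move=> n; apply: le_trans (step n); apply: I_le => //.
      apply: L1_eq (L1_bM miP (M := 1) _ (LPt n)) => t; first by rewrite mulrA.
      by case: (iP01 t) => ->; rewrite ?normr0 ?normr1.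
    move=> t; case: (iP01 t) => ->; rewrite ?mul1r// !mul0r.
    by apply: mulr_ge0; [exact: Phi0|rewrite mulr_ge0 ?tht_ge0].
split => //.
move: h2; lra.
Qed.

(* [gamf] is a primitive of c (t + 1/(j+1))^-th, which dominates B Gn / alpha where
   u <= k + 1: with the weight exp(- gamf v) the lower order term changes sign. *)
Definition Mk (k : nat) : R := B / alpha * (1 + k.+1%:R) `^ (2 * p).
Definition gamf (c : R) (j : nat) t := c / (1 - th) * dlt j `^ (1 - th) * (pw (1 - th) ((dlt j)^-1 * t) - 1).
Definition gamf' (c : R) (j : nat) t := c * (dlt j `^ (- th) * (1 + Num.max ((dlt j)^-1 * t) 0) `^ (- th)).
Definition gamL (c : R) t := c / (1 - th) * t `^ (1 - th).

Lemma Mk_gt0 k : 0 < Mk k.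
Proof. by rewrite mulr_gt0 ?divr_gt0// powR_gt0// ltr_pwDl. Qed.

Lemma C1_gamf c j : C1fun (gamf c j) (gamf' c j).
Proof.
have h := C1Z (c / (1 - th) * dlt j `^ (1 - th))
  (C1D (C1_comp (C1_pw (1 - th)) (C1Z (dlt j)^-1 C1_id)) (C1_cst (- 1))).
apply: C1_eq h => // t; rewrite addr0 mulr1 /gamf'.
have d0 : 0 < dlt j :> R by exact: dlt_gt0.
have -> : 1 - th - 1 = - th by ring.
rewrite powRD; last by apply/implyP => _; rewrite gt_eqF.
rewrite powRr1 ?(ltW d0)//; set P := _ `^ _; set Q := _ `^ _.
by field; rewrite !gt_eqF//= subr_gt0.
Qed.

Lemma gamfE c j t : 0 <= t -> gamf c j t = c / (1 - th) * ((t + dlt j) `^ (1 - th) - dlt j `^ (1 - th)).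
Proof.
move=> t0; have d0 : 0 < dlt j :> R by exact: dlt_gt0.
have dt : 0 <= (dlt j)^-1 * t by rewrite mulr_ge0// invr_ge0 ltW.
rewrite /gamf pwE// -mulrA mulrBr mulr1 -powRM ?(ltW d0) ?addr_ge0//.
by have -> : dlt j * (1 + (dlt j)^-1 * t) = t + dlt j by field; rewrite gt_eqF.
Qed.

Lemma gamf'E c j t : 0 <= t -> gamf' c j t = c * (t + dlt j) `^ (- th).
Proof.
move=> t0; have d0 : 0 < dlt j :> R by exact: dlt_gt0.
have dt : 0 <= (dlt j)^-1 * t by rewrite mulr_ge0// invr_ge0 ltW.
rewrite /gamf' max_l// -powRM ?(ltW d0) ?addr_ge0//.
by have -> : dlt j * (1 + (dlt j)^-1 * t) = t + dlt j by field; rewrite gt_eqF.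
Qed.

Lemma gamf_cvg (c : R) (ij : nat -> nat) (tn : nat -> R) (t : R) : (forall n, (n <= ij n)%N) -> (forall n, 0 <= tn n) ->
  tn n @[n --> \oo] --> t -> gamf c (ij n) (tn n) @[n --> \oo] --> gamL c t.
Proof.
move=> hij' tn0 ct.
have cd : (dlt (ij n) : R) @[n --> \oo] --> (0 : R).
  apply: (squeeze_cvgr _ (cvg_cst 0) dlt_cvg); apply: nearW => n.
  by rewrite ltW ?dlt_gt0//= dlt_mono.
have th1' : 0 < 1 - th by rewrite subr_gt0.
rewrite (_ : (fun n => _) = fun n => c / (1 - th) * ((tn n + dlt (ij n)) `^ (1 - th) - dlt (ij n) `^ (1 - th))).
  have -> : gamL c t = c / (1 - th) * (t `^ (1 - th) - 0 `^ (1 - th)).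
    by rewrite powR0 ?gt_eqF// subr0.
  apply: cvg_mulcR.
  have c1 := cvg_addR ct cd; rewrite addr0 in c1.
  apply: cvgB; apply: cvg_powR => //.
    by move=> n; rewrite addr_ge0// ltW// dlt_gt0.
  by move=> n; rewrite ltW// dlt_gt0.
by apply/funext => n; rewrite gamfE.
Qed.

Lemma gamf'_cvg (c : R) (ij : nat -> nat) (tn : nat -> R) (t : R) : (forall n, (n <= ij n)%N) -> (forall n, 0 <= tn n) ->
  0 < t -> tn n @[n --> \oo] --> t -> gamf' c (ij n) (tn n) @[n --> \oo] --> c * t `^ (- th).
Proof.
move=> hij' tn0 t0 ct.
have cd : (dlt (ij n) : R) @[n --> \oo] --> (0 : R).
  apply: (squeeze_cvgr _ (cvg_cst 0) dlt_cvg); apply: nearW => n.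
  by rewrite ltW ?dlt_gt0//= dlt_mono.
rewrite (_ : (fun n => _) = fun n => c * (tn n + dlt (ij n)) `^ (- th)).
  apply: cvg_mulcR; have c1 := cvg_addR ct cd; rewrite addr0 in c1.
  by apply: (@cvg_comp _ _ _ (fun n => tn n + dlt (ij n)) (fun t => t `^ (- th)) _ (nbhs t)) => //; exact: powR_cont.
by apply/funext => n; rewrite gamf'E.
Qed.

Lemma gamf'_ge0 c j t : 0 <= c -> 0 <= gamf' c j t.
Proof. by move=> c0; rewrite mulr_ge0// mulr_ge0// powR_ge0. Qed.

Lemma gamf_ge0 c j t : 0 <= c -> 0 <= t -> 0 <= gamf c j t.
Proof.
move=> c0 t0; have e : gamf c j 0 = 0 by rewrite gamfE// add0r subrr mulr0.
by rewrite -e; apply: (C1_nd (C1_gamf c j)) => // s; exact: gamf'_ge0.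
Qed.

Lemma gamf_dom k n t : 0 <= t -> K k.+1 t <= k.+1%:R -> B * G n t <= alpha * gamf' (Mk k) n t.
Proof.
move=> t0 hk; rewrite gamf'E// /Mk.
have -> : alpha * (B / alpha * (1 + k.+1%:R) `^ (2 * p) * (t + dlt n) `^ (- th)) =
  B * ((1 + k.+1%:R) `^ (2 * p) * (t + dlt n) `^ (- th)) by field; rewrite gt_eqF.
by rewrite ler_wpM2l ?(ltW B0)//; apply: (Gn_up p0 th0 K_C1 K_0 K_agree).
Qed.

Definition Ew k t := expR (- gamL (Mk k) (v t)).
(** The limit of the integrand that the exponential weight makes nonnegative. *)
Definition Psi k (y : T -> R) t := iP t * ((b t * (Mk k * v t `^ (- th) * sq (g t)) -
   B * (Glim p th K (v t) * sq (g t))) * (y t * (Ew k t * tht k (v t)))).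

(** Here the derivative of the cut-off has the favourable sign and is dropped, and the nonnegative
    integrand [P n] is handled by Fatou's lemma. Its limit is kept: it contains the lower order
    term, and cancels what appears when the weight is removed. *)
Lemma ineq_B k (y : VG) A : Hb A y -> (forall t, 0 <= vf y t) ->
  (forall t, 0 <= Psi k (vf y) t) /\
  [/\ measf (Ew k), L1 (fun t => b t * (Ew k t * tht k (v t) * dotr (g t) (vv y t))),
     L1 (fun t => f t * (vf y t * (Ew k t * tht k (v t)))), L1 (Psi k (vf y)) &
   I (Psi k (vf y)) <= I (fun t => b t * (Ew k t * tht k (v t) * dotr (g t) (vv y t))) -
     I (fun t => f t * (vf y t * (Ew k t * tht k (v t))))].
Proof.
move=> hy y0; have hy2 := H_isL2 (Hb_H hy).
have M0 := ltW (Mk_gt0 k).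
have yA t : `|vf y t| <= A by exact: hy.1.
have hF n : C1fun (fun t => expR (- gamf (Mk k) n t)) (fun t => expR (- gamf (Mk k) n t) * - gamf' (Mk k) n t).
  exact: C1_comp C1_exp (C1N (C1_gamf (Mk k) n)).
pose F n t := expR (- gamf (Mk k) n t).
have F0 n t : 0 <= F n t by exact: expR_ge0.
have F1 n t : 0 <= t -> F n t <= 1.
  by move=> t0; rewrite -expR0 ler_expR oppr_le0 gamf_ge0.
have ctht t : tht k (w n t) @[n --> \oo] --> tht k (v t) by exact: (cvg_C1 (C1_tht k) (cv t)).
have hix n : (n <= ix n)%N by have [] := hij n.
have cF t : F (ix n) (w n t) @[n --> \oo] --> Ew k t.
  have h := gamf_cvg (c := Mk k) hix (fun n => w0 n t) (cv t).
  apply: (@cvg_comp _ _ _ (fun n => - gamf (Mk k) (ix n) (w n t)) (@expR R) _ (nbhs (- gamL (Mk k) (v t)))).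
    exact: cvgN.
  exact: continuous_expR.
have mF n : measf (fun t => F (ix n) (w n t)) by exact: mf_cont (C1_cont (hF (ix n))) (mw n).
have mth n : measf (fun t => tht k (w n t)) by exact: mf_cont (C1_cont (C1_tht k)) (mw n).
have mE : measf (Ew k) by exact: mf_cvg cF.
have cFt t : F (ix n) (w n t) * tht k (w n t) @[n --> \oo] --> Ew k t * tht k (v t).
  by apply: cvgM; [exact: cF|exact: ctht].
have Ft0 n t : 0 <= F (ix n) (w n t) * tht k (w n t) by rewrite mulr_ge0 ?tht_ge0.
have Ft1 n t : F (ix n) (w n t) * tht k (w n t) <= tht k (w n t) by rewrite ler_piMl ?tht_ge0 ?F1.
have hM n t : `|F (ix n) (w n t) * tht k (w n t)| * (1 + w n t) <= 1 + k.+1%:R.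
  rewrite ger0_norm//; apply: le_trans (tht_weight k (w0 n t)).
  by rewrite ler_wpM2r// ltW.
have [_ _ LX cX] := weak_limit (fun n => mfM (mF n) (mth n)) cFt hM hy2.2.
have yFb n t : `|vf y t * (F (ix n) (w n t) * tht k (w n t))| <= A.
  rewrite normrM -[leRHS]mulr1 ler_pM// ger0_norm//.
  by apply: (le_trans (Ft1 n t)); exact: tht_le1.
have myF n : measf (fun t => vf y t * (F (ix n) (w n t) * tht k (w n t))).
  by apply: mfM; [exact: hy2.1.1|exact: mfM].
have [Lfn' Lfv cf] := cvg_If myF (fun t => cvg_mulcR (vf y t) (cFt t)) yFb.
pose P n t := (b t * (gamf' (Mk k) (ix n) (w n t) * sq (gn n t)) - FFn (ix n) (x n) t) *
   (vf y t * (F (ix n) (w n t) * tht k (w n t))).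
(* Differentiating exp(- gamf) yields a factor gamf', and alpha gamf' dominates B G on the support
   of the cut-off. *)
have P0 n t : 0 <= P n t.
  have [e|e] := eqVneq (tht k (w n t)) 0; first by rewrite /P e !mulr0.
  apply: mulr_ge0; last by rewrite mulr_ge0.
  have := gamf_dom (ix n) (w0 n t) (tht_pos_good e) => h.
  rewrite subr_ge0; apply: (@le_trans _ _ (alpha * gamf' (Mk k) (ix n) (w n t) * sq (gn n t))).
    rewrite /FFn /Fn mulrA ler_pM ?sqr_ge0//.
      by rewrite mulr_ge0 ?(ltW B0)//.
    by rewrite -(nrm_sq (gn n t)) lerXn2r ?nnegrE ?nrm_ge0 ?le_min ?ge_min ?lexx ?nrm_ge0 ?ler0n.
  rewrite -mulrA; apply: ler_wpM2r; last exact: ba.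
  by rewrite mulr_ge0 ?sq_ge0// gamf'_ge0.
have step n : L1 (P n) /\ I (P n) <= I (fun t => b t * (F (ix n) (w n t) * tht k (w n t) * dotr (gn n t) (vv y t))) +
    -1 * I (fun t => fk (jx n) t * (vf y t * (F (ix n) (w n t) * tht k (w n t)))).
  have [hs xp] := hsol n.
  have [r [r' [Mr [hr rM r'M _ rE]]]] := cutoff k (hF (ix n)).
  have [K1 K2 K3 K4 e1] := sol_mtest nufin tc alpha0 mb hb hs hr r'M rM hy.
  have rE1 t : r (w n t) = F (ix n) (w n t) * tht k (w n t) by have [] := rE _ (w0 n t).
  have rE2 t : r' (w n t) = F (ix n) (w n t) * - gamf' (Mk k) (ix n) (w n t) * tht k (w n t) +
     F (ix n) (w n t) * thd k (w n t) by have [] := rE _ (w0 n t).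
  pose Q t := - (b t * (vf y t * r' (w n t) * sq (gn n t))) - FFn (ix n) (x n) t * (vf y t * r (w n t)).
  have LQ : L1 Q by apply: L1B => //; exact: L1N.
  have PQ t : P n t <= Q t.
    have h : 0 <= b t * vf y t * F (ix n) (w n t) * (- thd k (w n t)) * sq (gn n t).
      rewrite mulr_ge0 ?sq_ge0// mulr_ge0 ?oppr_ge0 ?thd_le0// mulr_ge0//.
      by rewrite mulr_ge0// ltW.
    have e : Q t = P n t + b t * vf y t * F (ix n) (w n t) * (- thd k (w n t)) * sq (gn n t).
      by rewrite /Q /P rE1 rE2; ring.
    by rewrite e lerDl.
  have mP : measf (P n).
    apply: mfM => //; apply: mfB; last exact: (LPhi n).1.
    apply: mfM => //; apply: mfM; first exact: mf_cont (C1_gamf _ _).2 (mw n).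
    by apply: mf_sum => i; apply: mfM; exact: ((hx2 n).2 i).1.
  have LP : L1 (P n) by apply: (L1_dom mP LQ) => t; rewrite ger0_norm.
  split => //; apply: (le_trans (I_le LP LQ PQ)).
  rewrite /Q IB//; last exact: L1N.
  rewrite IN//.
  have -> : I (fun t => b t * (F (ix n) (w n t) * tht k (w n t) * dotr (gn n t) (vv y t))) =
     I (fun t => b t * (r (w n t) * dotr (gn n t) (vv y t))) by apply: I_eq => t; rewrite rE1.
  have -> : I (fun t => fk (jx n) t * (vf y t * (F (ix n) (w n t) * tht k (w n t)))) =
     I (fun t => fk (jx n) t * (vf y t * r (w n t))) by apply: I_eq => t; rewrite rE1.
  by move: e1; lra.
have cc := cvg_addR cX (cvg_mulcR (-1) cf).
have pt t : iP t * P n t @[n --> \oo] --> Psi k (vf y) t.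
  have [e|e] := eqVneq (iP t) 0.
    rewrite /Psi e mul0r (_ : (fun n => _) = fun=> 0); first exact: cvg_cst.
    by apply/funext => n; rewrite mul0r.
  apply: cvg_mulcR; apply: cvgM; last exact: cvg_mulcR (cFt t).
  apply: cvgB; last exact: cvg_FFn.
  apply: cvg_mulcR; apply: cvgM; last exact: cvg_sqg.
  have [vp _] := iP1 e.
  exact: (gamf'_cvg (c := Mk k) hix (fun n => w0 n t) vp (cv t)).
have miPP n : L1 (fun t => iP t * P n t).
  apply: (L1_bM miP (M := 1)) => [t|]; last by have [] := step n.
  by case: (iP01 t) => ->; rewrite ?normr0 ?normr1.
have Psi0 t : 0 <= Psi k (vf y) t.
  by apply: (cvg_geR _ (pt t)) => n; apply: mulr_ge0; [exact: iP_ge0|exact: P0].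
have [LPsi hPsi] : L1 (Psi k (vf y)) /\ I (Psi k (vf y)) <=
   I (fun t => b t * (Ew k t * tht k (v t) * dotr (g t) (vv y t))) +
   -1 * I (fun t => f t * (vf y t * (Ew k t * tht k (v t)))).
  apply: (@I_fatou _ _ _ nu (fun n t => iP t * P n t) _ _ _ _ _ _ _ _ _ cc).
  - exact: miPP.
  - by apply: (mf_cvg (h := fun n t => iP t * P n t)) => // n; exact: L1_mf (miPP n).
  - by move=> n t; apply: mulr_ge0; [exact: iP_ge0|exact: P0].
  - exact: Psi0.
  - exact: aE_all.
  - move=> n; have [LP h] := step n; apply: (le_trans _ h); apply: I_le => // t.
    by case: (iP01 t) => ->; rewrite ?mul1r ?mul0r.
by split => //; split => //; move: hPsi; lra.
Qed.

Lemma K_succ k t : K k.+1 t <= k.+1%:R -> K k.+2 t = K k.+1 t.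
Proof. by move=> h; rewrite (@K_agree k.+1 k.+2) ?h. Qed.

(** Admissible functions that equal phi F(v) on the support of [tht k]: the truncations sit one
    level higher, at k + 1, so as to be inactive there. *)
Lemma B_test k phi (F F' : R -> R) : C phi -> (forall t, 0 <= phi t) -> C1fun F F' -> (forall t, 0 <= F t) ->
  exists y A, [/\ Hb A y, forall t, 0 <= vf y t &
    forall t, tht k (v t) != 0 -> vf y t = phi t * F (v t) /\
      vv y t = F (v t) *: D phi t + (phi t * F' (v t)) *: g t].
Proof.
move=> Cphi phi_0 hF F0.
have wt t : `|chi (k.+1%:R : R) t| * (1 + Num.max t 0) <= 1 + k.+2%:R.
  rewrite ger0_norm ?chi_ge0//; have m0 : 0 <= Num.max t 0 by rewrite le_max lexx orbT.
  have [h|h] := leP (k.+1%:R + 1) t; first by rewrite chi_0// mul0r addr_ge0.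
  rewrite natr1 in h; have : Num.max t 0 <= k.+2%:R by rewrite ge_max ler0n andbT ltW.
  have := @chi_le1 R k.+1%:R t; have := @chi_ge0 R k.+1%:R t; rewrite -[k.+2%:R]natr1.
  move: (Num.max t 0) m0 (chi _ t) => m m0 c c0 c1 m1; nra.
have hx := trunc_H (C1_tau k.+1) (tau0 k.+1) wt.
have [r [r' [Mr [hr rM r'M r0 rE]]]] := cutoff k.+1 hF.
have [A A0 hA] := Hb_emb nufin tc Cphi.
have hy := Hb_mulcomp nufin tc hr r'M rM hA hx.
eexists; exists (A * Mr); split; first exact: hy.
  by move=> t /=; rewrite mulr_ge0// r0.
move=> t /tht_pos_good hk /=.
have vk : v t <= k.+1%:R by exact: le_trans (K_ge p0 K_C1 K_0 k.+1 (v0 t)) hk.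
rewrite tau_id// chi_1// scale1r.
have [-> ->] := rE _ (v0 t).
have hk2 : K k.+2 (v t) <= k.+1%:R by rewrite K_succ.
by rewrite tht_1// /thd chi'_l// mul0r mulr0 addr0 !mulr1.
Qed.

Definition iZ t : R := (v t == 0)%:R.

Lemma iZ_cvg t : 1 - pind (dlt n) (v t) @[n --> \oo] --> iZ t.
Proof.
have := cvg_subR (cvg_cstR 1) (@pind_cvg R (v t)).
rewrite /iZ; have := v0 t; rewrite le_eqVlt => /orP[/eqP <-|h].
  by rewrite ltxx eqxx subr0.
by rewrite h gt_eqF// subrr.
Qed.
Arguments iZ_cvg t : clear implicits.

(** Test with phi (1 - pind (v)), which tends to phi on {v = 0} and to 0 elsewhere. On that set the
    gradient vanishes and the weight and the cut-off are 1, so only the integral of f phi over {v =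
    0} is left. *)
Lemma f_iZ_le0 phi : C phi -> (forall t, 0 <= phi t) ->
  L1 (fun t => f t * (phi t * iZ t)) /\ I (fun t => f t * (phi t * iZ t)) <= 0.
Proof.
move=> Cphi phi_0.
have [A A0 hA] := Hb_emb nufin tc Cphi.
have phiA t : `|phi t| <= A by exact: hA.1.
have mphi := tc_mf tc Cphi.
have [_ [mE LX0 _ _ _]] := ineq_B 0 hA phi_0.
have F0 n (t : R) : 0 <= 1 - pind (dlt n) t by rewrite subr_ge0 pind_le1// dlt_gt0.
have F1 n (t : R) : 1 - pind (dlt n) t <= 1 by rewrite gerBl pind_ge0// dlt_gt0.
have hF n : C1fun (fun t : R => 1 - pind (dlt n) t) (fun t => - pind' (dlt n) t).
  by apply: C1_eq (C1D (C1_cst 1) (C1N (C1_pind (dlt n)))) => // t; rewrite add0r.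
have mF n : measf (fun t => 1 - pind (dlt n) (v t)) by exact: mf_cont (C1_cont (hF n)) mv.
have mZ : measf iZ by exact: mf_cvg iZ_cvg.
pose W t := Ew 0 t * tht 0 (v t).
have W0 t : 0 <= W t by rewrite mulr_ge0 ?expR_ge0 ?tht_ge0.
have W1 t : W t <= 1.
  rewrite -[leRHS]mulr1; apply: ler_pM; rewrite ?expR_ge0 ?tht_ge0 ?tht_le1//.
  by rewrite -expR0 ler_expR oppr_le0 mulr_ge0 ?powR_ge0// divr_ge0 ?subr_ge0 ?(ltW th1)// ltW// Mk_gt0.
have mW : measf W by apply: mfM => //; exact: mf_cont (C1_cont (C1_tht 0)) mv.
have Fb n t : `|1 - pind (dlt n) (v t)| <= 1 by rewrite ger0_norm.
have Zb t : `|iZ t| <= 1 by rewrite /iZ; case: (v t == 0); rewrite ?normr1 ?normr0.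
pose XX t := b t * (W t * dotr (g t) (D phi t)).
have LXX : L1 XX by exact: LX0.
have step n : I (fun t => f t * (phi t * (1 - pind (dlt n) (v t)) * W t)) <=
    I (fun t => (1 - pind (dlt n) (v t)) * XX t).
  have [y [A' [hy y0 yE]]] := B_test 0 Cphi phi_0 (hF n) (F0 n).
  have [P0 [_ LX Lfy LP hP]] := ineq_B 0 hy y0.
  have -> : I (fun t => f t * (phi t * (1 - pind (dlt n) (v t)) * W t)) = I (fun t => f t * (vf y t * W t)).
    apply: I_eq => t; rewrite /W; have [->|/yE[-> _]//] := eqVneq (tht 0 (v t)) 0.
    by rewrite !mulr0.
  apply: (@le_trans _ _ (I (fun t => b t * (W t * dotr (g t) (vv y t))))).
    by have := I_ge0 nu P0; move: hP; rewrite -/(W _); lra.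
  apply: I_le => //; first exact: L1_bM (mF n) (Fb n) LXX.
  move=> t; rewrite /XX /W; have [->|/yE[_ ->]] := eqVneq (tht 0 (v t)) 0.
    by rewrite !mulr0 !mul0r !mulr0.
  rewrite dotrDr !dotrZr -/(sq (g t)).
  have h : 0 <= b t * (Ew 0 t * tht 0 (v t)) * phi t * pind' (dlt n) (v t) * sq (g t).
    rewrite mulr_ge0 ?sq_ge0// mulr_ge0 ?pind'_ge0 ?dlt_gt0// mulr_ge0// mulr_ge0 ?W0//.
    exact: ltW.
  move: h; move: (pind _ _) (pind' _ _) (Ew _ _) (tht _ _) (sq _) (dotr _ _) => q1 q2 q3 q4 q5 q6; lra.
have [LZ cZ] : L1 (fun t => f t * (phi t * iZ t * W t)) /\
   I (fun t => f t * (phi t * (1 - pind (dlt n) (v t)) * W t)) @[n --> \oo] --> I (fun t => f t * (phi t * iZ t * W t)).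
  apply: (I_dct (g := fun t => A * f t)).
  - move=> n; apply: mfM; first exact: L1_mf Lf.
    by apply: mfM => //; apply: mfM.
  - by apply: mfM; [exact: L1_mf Lf|apply: mfM => //; apply: mfM].
  - exact: L1Z.
  - apply: aE_all => t; apply: cvgM; first exact: cvg_cst.
    apply: cvgM; last exact: cvg_cst.
    by apply: cvgM; [exact: cvg_cst|exact: iZ_cvg].
  - move=> n; apply: aE_all => t; rewrite (normrM (f t)) (normrM (phi t * _)) (normrM (phi t)) (ger0_norm (f0 t)) mulrC ler_wpM2r//.
    rewrite -[leRHS]mulr1 ler_pM ?mulr_ge0//; last by rewrite ger0_norm.
    by rewrite -[leRHS]mulr1 ler_pM.
have [LZX cX] : L1 (fun t => iZ t * XX t) /\
   I (fun t => (1 - pind (dlt n) (v t)) * XX t) @[n --> \oo] --> I (fun t => iZ t * XX t).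
  apply: (I_dct (g := fun t => `|XX t|)).
  - by move=> n; apply: mfM => //; exact: L1_mf LXX.
  - by apply: mfM => //; exact: L1_mf LXX.
  - exact: L1_norm.
  - by apply: aE_all => t; apply: cvgM; [exact: iZ_cvg|exact: cvg_cst].
  - by move=> n; apply: aE_all => t; rewrite normrM ler_piMl.
have X0 : I (fun t => iZ t * XX t) = 0.
  rewrite -(I_0 nu); apply: I_eq_ae; [exact: L1_mf LZX|exact: mf_cst|].
  apply: (aE_mp g_eq0) => t h; rewrite /iZ; have [/h e|_] := eqVneq (v t) 0; last by rewrite mul0r.
  by rewrite /XX e dotr0l !mulr0.
have e t : f t * (phi t * iZ t * W t) = f t * (phi t * iZ t).
  rewrite /iZ; have [e|_] := eqVneq (v t) 0; last by rewrite mulr0 mul0r.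
  rewrite /W /Ew /gamL e powR0 ?subr_eq0 ?gt_eqF// mulr0 oppr0 expR0 mul1r.
  by rewrite tht_1 ?K_0// mulr1.
split; first exact: L1_eq LZ.
rewrite -(I_eq nu e) -X0.
have cc := cvg_subR cX cZ.
rewrite -subr_ge0; apply: (cvg_geR _ cc) => n; rewrite subr_ge0; exact: step.
Qed.

(** Squares of test functions are nonnegative test functions; they give f phi = 0 almost everywhere
    on {v = 0} for every phi, hence f = 0 there by the fundamental lemma. *)
Lemma v_gt0 : aE (fun t => 0 < f t) -> aE (fun t => 0 < v t).
Proof.
move=> fp.
have mZ : measf iZ.
  apply: (mf_cvg _ iZ_cvg) => n; apply: mfB; first exact: mf_cst.
  exact: mf_cont (C1_cont (C1_pind (dlt n))) mv.
have L : L1 (fun t => f t * iZ t).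
  apply: (L1_dom _ Lf); first by apply: mfM => //; exact: L1_mf Lf.
  move=> t; rewrite normrM (ger0_norm (f0 t)) ler_piMr//.
  by rewrite /iZ; case: (v t == 0); rewrite ?normr1 ?normr0.
have iZ0 t : 0 <= iZ t by rewrite /iZ.
have pp (phi : T -> R) t : 0 <= phi t * phi t by rewrite -expr2 sqr_ge0.
have ae0 : aE (fun t => f t * iZ t = 0).
  apply: (tc_fl tc L) => phi Cphi.
  have [L2' I2] := f_iZ_le0 (tc_mul tc Cphi Cphi) (pp phi).
  have p2 t : 0 <= f t * (phi t * phi t * iZ t).
    by apply: mulr_ge0 => //; apply: mulr_ge0 => //; rewrite -expr2 sqr_ge0.
  rewrite -(I_0 nu); apply: I_eq_ae.
  - by apply: mfM; [exact: L1_mf L|exact: (tc_mf tc Cphi)].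
  - exact: mf_cst.
  - apply: (aE_mp (I_eq0 L2' p2 I2)) => t /eqP.
    rewrite !mulf_eq0 => /orP[/eqP ->|/orP[/orP[]/eqP ->|/eqP ->]];
    by rewrite ?mulr0 ?mul0r.
apply: (aE_mp2 fp ae0) => t ft /eqP; rewrite mulf_eq0 gt_eqF//= /iZ.
have [e|e _] := eqVneq (v t) 0; first by rewrite oner_eq0.
by rewrite lt_neqAle eq_sym e v0.
Qed.

Lemma gamf_mono c j j' t : 0 <= c -> (j <= j')%N -> 0 <= t -> gamf c j t <= gamf c j' t.
Proof.
move=> c0 jj t0.
have z i : gamf c i 0 = 0 by rewrite gamfE// add0r subrr mulr0.
have [s [s0 _]] := C1_mvt (C1D (C1_gamf c j') (C1N (C1_gamf c j))) t0.
rewrite !z subrr subr0 => e; rewrite -subr_ge0 e; apply: mulr_ge0; last by rewrite subr0.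
rewrite !gamf'E// subr_ge0 ler_wpM2l//; apply: powR_decr; [exact: ltW| |by rewrite lerD2l dlt_mono].
by rewrite ltr_wpDl// dlt_gt0.
Qed.

Lemma gamf_le c j t : 0 <= c -> 0 <= t -> gamf c j t <= gamL c t.
Proof.
move=> c0 t0.
have h := @gamf_cvg c (fun n => n + j)%N (fun=> t) t (fun n => leq_addr _ _) (fun=> t0) (cvg_cstR t).
by apply: (cvg_geR _ h) => n; apply: gamf_mono => //; exact: leq_addl.
Qed.

(** The exponential weight is removed by testing with phi exp(gamf_j (v)): the regularised primitive
    is C^1 at 0, where its limit is not, and its exponential times [Ew] increases to 1. The terms
    created by its derivative are compensated by [Psi], provided v > 0. *)
Lemma ineq_B2 k phi : C phi -> (forall t, 0 <= phi t) -> aE (fun t => 0 < v t) ->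
  I (fun t => f t * (phi t * tht k (v t))) <=
  I (fun t => b t * (tht k (v t) * dotr (g t) (D phi t))) + I (fun t => Phi t * (phi t * tht k (v t))).
Proof.
move=> Cphi phi_0 vp.
have [A A0 hA] := Hb_emb nufin tc Cphi.
have phiA t : `|phi t| <= A by exact: hA.1.
have mphi := tc_mf tc Cphi.
have phi2 t : 0 <= phi t <= A by rewrite phi_0 (le_trans (ler_norm _) (phiA t)).
have [LX LP _] := ineq_A k Cphi phi2.
have M0 := ltW (Mk_gt0 k).
pose F j t := expR (gamf (Mk k) j t).
have F0 j t : 0 <= F j t by exact: expR_ge0.
have hF j : C1fun (F j) (fun t => F j t * gamf' (Mk k) j t).
  exact: C1_comp C1_exp (C1_gamf (Mk k) j).
pose Ej j t := F j (v t) * Ew k t.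
have Ej0 j t : 0 <= Ej j t by rewrite mulr_ge0// expR_ge0.
have Ej1 j t : Ej j t <= 1.
  by rewrite /Ej /F /Ew -expRD -expR0 ler_expR subr_le0 gamf_le.
have Ejb j t : `|Ej j t| <= 1 by rewrite ger0_norm.
have cEj t : Ej j t @[j --> \oo] --> (1 : R).
  have h := @gamf_cvg (Mk k) id (fun=> v t) (v t) (fun n => leqnn n) (fun=> v0 t) (cvg_cstR (v t)).
  have h2 := cvg_addR h (cvg_cstR (- gamL (Mk k) (v t))); rewrite subrr in h2.
  rewrite (_ : (fun j => _) = fun j => expR (gamf (Mk k) j (v t) - gamL (Mk k) (v t))).
    by have := cvg_C1 C1_exp h2; rewrite expR0.
  by apply/funext => j; rewrite /Ej /F /Ew expRD.
have [_ [mE _ _ _ _]] := ineq_B k hA phi_0.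
have mEj j : measf (Ej j).
  by apply: mfM => //; exact: mf_cont (C1_cont (hF j)) mv.
pose XX t := b t * (tht k (v t) * dotr (g t) (D phi t)).
pose PP t := Phi t * (phi t * tht k (v t)).
have LXP : L1 (fun t => XX t + PP t) by exact: L1D.
have step j : I (fun t => f t * (phi t * tht k (v t) * Ej j t)) <= I (fun t => Ej j t * (XX t + PP t)).
  have [y [A' [hy y0 yE]]] := B_test k Cphi phi_0 (hF j) (F0 j).
  have [P0 [_ LXy Lfy LPs hP]] := ineq_B k hy y0.
  have -> : I (fun t => f t * (phi t * tht k (v t) * Ej j t)) = I (fun t => f t * (vf y t * (Ew k t * tht k (v t)))).
    apply: I_eq => t; rewrite /Ej; have [->|/yE[-> _]] := eqVneq (tht k (v t)) 0.
      by rewrite !(mulr0, mul0r).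
    by ring.
  apply: (@le_trans _ _ (I (fun t => b t * (Ew k t * tht k (v t) * dotr (g t) (vv y t))) - I (Psi k (vf y)))).
    by move: hP; lra.
  rewrite -IB//; apply: I_le_ae; [exact: L1B|exact: L1_bM (mEj j) (Ejb j) LXP|].
  apply: (aE_mp vp) => t vt; rewrite /XX /PP /Psi.
  have [->|hk] := eqVneq (tht k (v t)) 0.
    by rewrite !(mulr0, mul0r) subrr addr0 mulr0.
  have [-> ->] := yE _ hk.
  have iPt : iP t = 1.
    by apply: iP_eq1 => //; exists k.+1; exact: tht_pos_good.
  rewrite /Phi iPt !mul1r dotrDr !dotrZr -/(sq (g t)) /Ej.
  have h1 : gamf' (Mk k) j (v t) <= Mk k * v t `^ (- th).
    rewrite gamf'E// ler_wpM2l//; apply: powR_decr; [exact: ltW|exact: vt|].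
    by rewrite lerDl ltW// dlt_gt0.
  have h2 : 0 <= b t * sq (g t) * (phi t * (F j (v t) * Ew k t * tht k (v t))).
    apply: mulr_ge0; first by apply: mulr_ge0; [exact: ltW|exact: sq_ge0].
    apply: mulr_ge0; first exact: phi_0.
    by apply: mulr_ge0; [apply: mulr_ge0; exact: expR_ge0|exact: tht_ge0].
  have := ler_wpM2r h2 h1.
  move: (gamf' _ _ _) (Mk k * _) (Glim _ _ _ _) (F _ _) (Ew _ _) (tht _ _) (sq _) (dotr _ _) => q1 q2 q3 q4 q5 q6 q7 q8; lra.
have cf : I (fun t => f t * (phi t * tht k (v t) * Ej j t)) @[j --> \oo] --> I (fun t => f t * (phi t * tht k (v t))).
  have [] // : L1 (fun t => f t * (phi t * tht k (v t))) /\
     I (fun t => f t * (phi t * tht k (v t) * Ej j t)) @[j --> \oo] --> I (fun t => f t * (phi t * tht k (v t))).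
  have mpt : measf (fun t => phi t * tht k (v t)).
    by apply: mfM => //; exact: mf_cont (C1_cont (C1_tht k)) mv.
  apply: (I_dct (g := fun t => A * f t)).
  - by move=> j; apply: mfM; [exact: L1_mf Lf|exact: mfM].
  - by apply: mfM => //; exact: L1_mf Lf.
  - exact: L1Z.
  - apply: aE_all => t; apply: cvgM; first exact: cvg_cst.
    by have := cvg_mulcR (phi t * tht k (v t)) (cEj t); rewrite mulr1.
  - move=> j; apply: aE_all => t.
    rewrite (normrM (f t)) (normrM (phi t * _)) (normrM (phi t)) (ger0_norm (f0 t)) mulrC ler_wpM2r//.
    rewrite -[leRHS]mulr1 ler_pM ?mulr_ge0//.
    by rewrite -[leRHS]mulr1 ler_pM// tht_abs.
have cX : I (fun t => Ej j t * (XX t + PP t)) @[j --> \oo] --> I (fun t => XX t + PP t).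
  have [] // : L1 (fun t => XX t + PP t) /\ I (fun t => Ej j t * (XX t + PP t)) @[j --> \oo] --> I (fun t => XX t + PP t).
  apply: (I_dct (g := fun t => `|XX t + PP t|)).
  - by move=> j; apply: mfM => //; exact: L1_mf LXP.
  - exact: L1_mf LXP.
  - exact: L1_norm.
  - apply: aE_all => t; have := cvg_mulcR (XX t + PP t) (cEj t); rewrite mulr1.
    by rewrite (_ : (fun j => _ * Ej j t) = fun j => Ej j t * (XX t + PP t))//; apply/funext => j; rewrite mulrC.
  - by move=> j; apply: aE_all => t; rewrite normrM ler_piMl.
rewrite -ID//.
have cc := cvg_subR cX cf.
rewrite -subr_ge0; apply: (cvg_geR _ cc) => j; rewrite subr_ge0; exact: step.
Qed.

(** * Summability of u and of its gradient *)

Definition pwT (c : R) k t := pw c (tau k (K k.+1 t)).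
Definition pwT' (c : R) k t := c * (1 + Num.max (tau k (K k.+1 t)) 0) `^ (c - 1) *
  (chi k%:R (K k.+1 t) * Kd p K k.+1 t).

Lemma C1_pwT c k : C1fun (pwT c k) (pwT' c k).
Proof. exact: C1_comp (C1_pw c) (C1_comp (C1_tau k) (K_C1 k.+1)). Qed.

Lemma pwT'_ge0 c k t : 0 <= c -> 0 <= pwT' c k t.
Proof.
move=> c0; apply: mulr_ge0; first by rewrite mulr_ge0 ?powR_ge0.
by apply: mulr_ge0; [exact: chi_ge0|rewrite ltW// Kd_gt0].
Qed.

Lemma pwT'_bd c k t : 0 <= c -> `|pwT' c k t| <=
  c * (1 + k.+1%:R) `^ `|c - 1| * (1 * (1 + k.+1%:R) `^ p).
Proof.
move=> c0; rewrite ger0_norm ?pwT'_ge0//.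
apply: ler_pM.
- by rewrite mulr_ge0 ?powR_ge0.
- by apply: mulr_ge0; [exact: chi_ge0|rewrite ltW// Kd_gt0].
- apply: ler_wpM2l => //.
  have h1 : 1 <= 1 + Num.max (tau k (K k.+1 t)) 0 by rewrite lerDl le_max lexx orbT.
  apply: (le_trans (ler_powR h1 (ler_norm _))).
  apply: ge0_ler_powR; [exact: normr_ge0|by rewrite nnegrE (le_trans ler01 h1)|by rewrite nnegrE addr_ge0|].
  by rewrite lerD2l ge_max tau_le_max ler0n.
- by apply: ler_pM; [exact: chi_ge0|rewrite ltW// Kd_gt0|exact: chi_le1|exact: Kd_le].
Qed.

Lemma pwT'_weight c k : 0 <= c -> exists M, (forall t, `|pwT' c k t| <= M) /\
  forall t, `|pwT' c k t| * (1 + Num.max t 0) <= M.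
Proof.
move=> c0; set M := c * (1 + k.+1%:R) `^ `|c - 1| * (1 * (1 + k.+1%:R) `^ p).
have M0 : 0 <= M by rewrite !mulr_ge0 ?powR_ge0.
exists (M * (1 + k.+1%:R)); split=> t.
  by apply: (le_trans (pwT'_bd k t c0)); rewrite ler_peMr// lerDl.
apply: (@support_weight k.+1 (pwT' c k) M) => [u|u hu]; first exact: pwT'_bd.
by rewrite /pwT' chi_0 ?mul0r ?mulr0// natr1.
Qed.

(** The truncation of u at level k; it belongs to the energy space, see [H_Tk]. *)
Definition Tk k t := tau k (K k.+1 (v t)).

Lemma Tk_ge0 k t : 0 <= Tk k t.
Proof. by rewrite tau_ge0// (K_ge0 p0 K_C1 K_0). Qed.

Lemma pwTE c k t : pwT c k (v t) = (1 + Tk k t) `^ c.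
Proof. by rewrite /pwT pwE// Tk_ge0. Qed.

Lemma mTk k : measf (Tk k).
Proof. exact: mf_cont (C1_cont (C1_comp (C1_tau k) (K_C1 k.+1))) mv. Qed.

Lemma mpwT c k : measf (fun t => (1 + Tk k t) `^ c).
Proof. by apply: (aE_mf (pwTE c k)); exact: mf_cont (C1_cont (C1_pwT c k)) mv. Qed.

(** The bound comes from the lower order term, B |Du|^2 u^-theta. The relation between [c] and [gam]
    turns the squared power of 1 + T_k into gam - theta, and u <= 1 + T_k on the support of the
    derivative. *)
Lemma grad_T_le c gam k t : 0 <= gam -> 2 * c = 2 - th + gam -> 0 < v t ->
  sq (pwT' c k (v t) *: g t) <= c ^+ 2 / B * (Phi t * (1 + Tk k t) `^ gam).
Proof.
move=> gam0 ceq vt.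
have RH : 0 <= c ^+ 2 / B * (Phi t * (1 + Tk k t) `^ gam).
  by rewrite mulr_ge0 ?divr_ge0 ?sqr_ge0 ?(ltW B0)// mulr_ge0 ?powR_ge0 ?Phi_ge0.
rewrite sqZ; have [h|h] := eqVneq (chi k%:R (K k.+1 (v t))) 0.
  by rewrite /pwT' h mul0r mulr0 expr0n mul0r.
have hk : K k.+1 (v t) <= k.+1%:R by exact: (tht_pos_good h).
have iPt : iP t = 1 by apply: iP_eq1 => //; exists k.+1.
set u := K k.+1 (v t) in h hk *.
have u0 : 0 < u by exact: (K_gt0 p0 K_C1 K_0).
have uE : uu K (v t) = u by exact: (uuE K_agree hk).
set U := 1 + Tk k t.
have U1 : 1 <= U by rewrite lerDl Tk_ge0.
have U0 : 0 < U by exact: lt_le_trans U1.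
have uU : u <= U.
  have [uk|/ltW ku] := leP u k%:R; first by rewrite /U /Tk tau_id// lerDr.
  by apply: (le_trans hk); rewrite -natr1 addrC lerD2l; exact: tau_ge.
have dE : pwT' c k (v t) = c * U `^ (c - 1) * (chi k%:R u * (1 + u) `^ p).
  rewrite /pwT' -/u max_l ?tau_ge0 ?(ltW u0)//.
  by rewrite (Kd_E p (ltW u0 : 0 <= K k.+1 (v t)) hk).
rewrite dE /Phi iPt mul1r /Glim uE.
have e1 : (1 + u) `^ (2 * p) = ((1 + u) `^ p) ^+ 2.
  by rewrite -powR_mulrn ?powR_ge0// -powRrM mulrC.
have e2 : (U `^ (c - 1)) ^+ 2 = U `^ gam * U `^ (- th).
  rewrite -powR_mulrn ?powR_ge0// -powRrM -powRD; last by apply/implyP => _; rewrite gt_eqF.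
  by congr (_ `^ _); lra.
have -> : (c * U `^ (c - 1) * (chi k%:R u * (1 + u) `^ p)) ^+ 2 * sq (g t) =
   c ^+ 2 * U `^ gam * ((1 + u) `^ p) ^+ 2 * sq (g t) * (chi k%:R u ^+ 2 * U `^ (- th)).
  by rewrite -[U `^ (- th)]mul1r -[X in _ = X]mulrA !exprMn e2; ring.
have -> : c ^+ 2 / B * (B * ((1 + u) `^ (2 * p) * u `^ (- th) * sq (g t)) * U `^ gam) =
   c ^+ 2 * U `^ gam * ((1 + u) `^ p) ^+ 2 * sq (g t) * (u `^ (- th)).
  by rewrite e1; field; rewrite gt_eqF.
apply: ler_wpM2l.
  apply: mulr_ge0; last exact: sq_ge0.
  apply: mulr_ge0; last exact: sqr_ge0.
  by apply: mulr_ge0; [exact: sqr_ge0|exact: powR_ge0].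
rewrite -[leRHS]mul1r; apply: ler_pM; rewrite ?sqr_ge0 ?powR_ge0//.
  by rewrite exprn_ile1 ?chi_ge0 ?chi_le1.
by apply: powR_decr => //; exact: ltW.
Qed.

Variables (m gam rr s q S : R).
Hypothesis m1 : 1 <= m.
Hypothesis gam0 : 0 <= gam.
Hypothesis rr0 : 0 <= rr.
Hypothesis q0 : 0 < q.
Hypothesis s1 : 1 <= s.
Hypothesis rr_eq : 2 * rr = 2 - th + gam.
Hypothesis s_eq : rr * q = s.
Hypothesis gam_eq : gam * m = s * (m - 1).
Hypothesis e_lt : (m - 1) / m * (q / 2) < 1.
Hypothesis Lfm : L1 (fun t => f t `^ m).
Hypothesis S0 : 0 <= S.
Hypothesis sobolev_H : forall (A : R) y, 0 < A -> H y -> I (fun t => sq (vv y t)) <= A ->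
  L1 (fun t => `|vf y t| `^ q) /\ I (fun t => `|vf y t| `^ q) <= (S * A) `^ (q / 2).
Hypothesis vp : aE (fun t => 0 < v t).

Let m_gt0 : 0 < m. Proof. exact: lt_le_trans m1. Qed.

(** Let Z be 1 plus the integral of (1 + T_k)^s. The energy inequality and Young's inequality bound
    the gradient term by a multiple of Z^((m - 1) / m); Sobolev's inequality returns Z <= c Z^e with
    e < 1, and the power is absorbed. Z is finite from the start since T_k is bounded, and [c] does
    not depend on k. *)
Lemma summability_bound : exists X0 X1 : R, forall k,
  [/\ L1 (fun t => (1 + Tk k t) `^ s), I (fun t => (1 + Tk k t) `^ s) <= X0,
   L1 (fun t => Phi t * (1 + Tk k t) `^ gam) & I (fun t => Phi t * (1 + Tk k t) `^ gam) <= X1].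
Proof.
pose nuT : R := I (fun=> 1); have nuT0 : 0 <= nuT by exact: I_ge0.
pose cf := I (fun t => f t `^ m) + 1.
have cf0 : 0 < cf by rewrite ltr_wpDl// I_ge0// => t; exact: powR_ge0.
pose cA := rr ^+ 2 / B * cf + 1.
have cA0 : 0 < cA by rewrite ltr_wpDl// mulr_ge0 ?(ltW cf0)// divr_ge0 ?sqr_ge0// ltW.
pose e := (m - 1) / m * (q / 2).
pose c := 1 + 2 `^ q * nuT + 2 `^ q * (S * cA) `^ (q / 2).
pose Z0 := c `^ ((1 - e)^-1).
have em0 : 0 <= (m - 1) / m by rewrite divr_ge0 ?subr_ge0 ?(ltW m_gt0).
exists Z0, (Z0 `^ ((m - 1) / m) * cf) => k.
pose U t := 1 + Tk k t.
have U1 t : 1 <= U t by rewrite lerDl Tk_ge0.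
have U0 t : 0 < U t by exact: lt_le_trans (U1 t).
have Uk t : U t <= 1 + k.+1%:R by rewrite lerD2l; exact: tau_le_max.
have Ub a t : 0 <= a -> U t `^ a <= (1 + k.+1%:R) `^ a.
  by move=> a0; apply: ge0_ler_powR; rewrite ?nnegrE ?(ltW (U0 t))// addr_ge0.
have LU a : 0 <= a -> L1 (fun t => U t `^ a).
  move=> a0; apply: (L1_bdd nufin (M := (1 + k.+1%:R) `^ a)); first exact: mpwT.
  by move=> t; rewrite ger0_norm ?powR_ge0// Ub.
have s0 : 0 <= s by exact: le_trans ler01 s1.
pose X := I (fun t => U t `^ s); have X0 : 0 <= X by apply: I_ge0 => t; exact: powR_ge0.
pose Z := X + 1; have Z1 : 1 <= Z by rewrite lerDr.
have Zp : 0 < Z by exact: lt_le_trans Z1.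
have [Mb [Mb1 Mb2]] := pwT'_weight k gam0.
have r0' : 0 <= pwT gam k 0 by rewrite /pwT K_0 tau0 pwE// powR_ge0.
have rM' t : 0 <= t -> pwT gam k t <= (1 + k.+1%:R) `^ gam.
  move=> t0; rewrite /pwT pwE ?tau_ge0 ?(K_ge0 p0 K_C1 K_0)//.
  apply: ge0_ler_powR; rewrite ?nnegrE ?addr_ge0 ?tau_ge0 ?(K_ge0 p0 K_C1 K_0)//.
  by rewrite lerD2l tau_le_max.
have [LPU IPU] := phi_energy (C1_pwT gam k) Mb1 (fun t => pwT'_ge0 k t gam0) r0' rM'.
have eP (h : T -> R) t : h t * pwT gam k (v t) = h t * U t `^ gam by rewrite pwTE.
rewrite (I_eq nu (eP Phi)) (I_eq nu (eP f)) in IPU.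
have {}LPU := L1_eq (eP Phi) LPU.
have LfU : L1 (fun t => f t * U t `^ gam).
  apply: L1_eq (L1_bM (mpwT gam k) (M := (1 + k.+1%:R) `^ gam) _ Lf) => t; first by rewrite mulrC.
  by rewrite ger0_norm ?powR_ge0//; exact: Ub.
have fU : I (fun t => f t * U t `^ gam) <= Z `^ ((m - 1) / m) * cf.
  (* This value makes both terms of Young's inequality multiples of Z^((m - 1) / m). *)
  pose lam := Z `^ m^-1; have lam0 : 0 < lam by rewrite powR_gt0.
  have LUs := LU s s0.
  apply: (@le_trans _ _ (I (fun t => lam `^ (m - 1) * f t `^ m + lam^-1 * U t `^ s))).
    apply: I_le => //; first by apply: L1D; exact: L1Z.
    by move=> t; exact: young_param.
  rewrite ID ?IZ//; [|exact: L1Z|exact: L1Z].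
  have e1 : lam `^ (m - 1) = Z `^ ((m - 1) / m) by rewrite /lam -powRrM mulrC.
  have e2 : lam^-1 * Z = Z `^ ((m - 1) / m).
    rewrite /lam -powRN -{2}[Z](powRr1 (ltW Zp)) -powRD; last by apply/implyP => _; rewrite gt_eqF.
    by congr (_ `^ _); field; rewrite gt_eqF.
  rewrite e1 /cf mulrDr mulr1 lerD2l -e2 -/X; apply: ler_wpM2l; last by rewrite lerDl.
  by rewrite invr_ge0 ltW.
have mono1 : Z <= Z0.
  have rr_ge : 0 <= rr by [].
  have [Mz [Mz1 Mz2]] := pwT'_weight k rr_ge.
  have hz1 : C1fun (fun t => pwT rr k t - 1) (pwT' rr k).
    by apply: C1_eq (C1D (C1_pwT rr k) (C1_cst (-1))) => // t; rewrite addr0.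
  have hz2 : pwT rr k 0 - 1 = 0 by rewrite /pwT K_0 tau0 pwE// addr0 powR1 subrr.
  have Hz := trunc_H hz1 hz2 Mz2.
  set z := Vg _ _ in Hz; have z2 := H_isL2 Hz.
  pose A := cA * Z `^ ((m - 1) / m).
  have Ze1 : 1 <= Z `^ ((m - 1) / m).
    by rewrite -[leLHS](powRr0 Z); apply: ler_powR.
  have A0 : 0 < A by rewrite mulr_gt0// powR_gt0.
  have gz : I (fun t => sq (vv z t)) <= A.
    apply: (@le_trans _ _ (I (fun t => rr ^+ 2 / B * (Phi t * U t `^ gam)))).
      apply: I_le_ae; [exact: L2v_sq z2.2|exact: L1Z|].
      by apply: (aE_mp vp) => t vt; exact: grad_T_le.
    rewrite IZ//; apply: (@le_trans _ _ (rr ^+ 2 / B * (Z `^ ((m - 1) / m) * cf))).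
      apply: ler_wpM2l; first by rewrite divr_ge0 ?sqr_ge0// ltW.
      exact: le_trans IPU fU.
    have -> : A = rr ^+ 2 / B * (Z `^ ((m - 1) / m) * cf) + Z `^ ((m - 1) / m) by rewrite /A /cA; ring.
    by rewrite lerDl powR_ge0.
  have [Lzq Izq] := sobolev_H A0 Hz gz.
  have zE t : 1 + vf z t = U t `^ rr by rewrite /z /= pwTE addrC subrK.
  have z0 t : 0 <= vf z t.
    rewrite -(lerD2l 1) addr0 zE -[leLHS](powRr0 (U t)); exact: ler_powR.
  have XX : X <= 2 `^ q * nuT + 2 `^ q * (S * A) `^ (q / 2).
    apply: (@le_trans _ _ (I (fun t => 2 `^ q * (1 + `|vf z t| `^ q)))).
      apply: I_le; first exact: LU.
        by apply: L1Z; apply: L1D => //; exact: L1_cst.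
      move=> t; rewrite -s_eq powRrM -zE ger0_norm//; apply: powR_1D => //; exact: ltW.
    rewrite IZ; last by apply: L1D => //; exact: L1_cst.
    rewrite ID//; last exact: L1_cst.
    by rewrite mulrDr lerD2l ler_wpM2l ?powR_ge0.
  apply: powR_absorb => //.
  have eA : (S * A) `^ (q / 2) = (S * cA) `^ (q / 2) * Z `^ e.
    rewrite /A mulrA powRM ?powR_ge0 ?mulr_ge0 ?(ltW cA0)//.
    by rewrite -powRrM.
  have Ze : 1 <= Z `^ e.
    rewrite -[leLHS](powRr0 Z); apply: ler_powR => //; rewrite mulr_ge0// divr_ge0// ltW//.
  rewrite eA in XX; rewrite /c !mulrDl mul1r.
  have h1 : 0 <= 2 `^ q * nuT by rewrite mulr_ge0 ?powR_ge0.
  have := ler_wpM2l h1 Ze; rewrite mulr1.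
  by move: XX Ze; rewrite /Z -!mulrA; lra.
split => //.
- exact: LU.
- by apply: le_trans mono1; rewrite /Z lerDl.
- apply: (le_trans IPU); apply: (le_trans fU); apply: ler_wpM2r; first exact: (ltW cf0).
  by apply: ge0_ler_powR; rewrite ?nnegrE ?(ltW Zp)// (le_trans (ltW Zp)).
Qed.

Definition gd t : R := (`[< good K (v t) >] : bool)%:R.
(** The factor [gd] discards the junk value of [uu] where v is not below H(+oo), and makes [ul] a
    limit of measurable functions at every point. *)
Definition ul t := gd t * uu K (v t).
(** The chain rule for u as a function of v, where du/dv = (1 + u)^p. *)
Definition Dul t := (1 + ul t) `^ p *: g t.

(** Where v is not below H(+oo), every T_k is at least k; the bound on the integrals of (1 + T_k)^s,
    uniform in k, leaves no measure to such points. *)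
Lemma v_good : aE (fun t => good K (v t)).
Proof.
have [X0 [X1 hX]] := summability_bound.
pose iB t := 1 - gd t.
have gd01 t : gd t = 0 \/ gd t = 1 by rewrite /gd; case: (`[< _ >]); [right|left].
have iB0 t : 0 <= iB t by rewrite /iB; case: (gd01 t) => ->; rewrite ?subr0 ?subrr.
have iB1 t : `|iB t| <= 1 by rewrite /iB; case: (gd01 t) => ->; rewrite ?subr0 ?subrr ?normr0 ?normr1.
have mgd : measf gd.
  apply: (mf_cvg (h := fun k t => tht k (v t))); last by move=> t; exact: tht_cvg.
  by move=> k; exact: mf_cont (C1_cont (C1_tht k)) mv.
have miB : measf iB by apply: mfB => //; exact: mf_cst.
have LB : L1 iB by exact: (L1_bdd nufin miB iB1).
have est k : k%:R * I iB <= X0.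
  have [L hXk _ _] := hX k.
  rewrite -IZ//; apply: le_trans hXk; apply: I_le; [exact: L1Z|exact: L|] => t.
  have U1 : 1 <= 1 + Tk k t by rewrite lerDl Tk_ge0.
  have [h|h] := boolP (`[< good K (v t) >]).
    by rewrite /iB /gd h subrr mulr0 powR_ge0.
  rewrite /iB /gd (negbTE h) subr0 mulr1.
  have hk : k%:R <= K k.+1 (v t).
    rewrite leNgt; apply: contra h => hk; apply/asboolP; exists k.+1.
    by rewrite ltW// (lt_trans hk)// ltr_nat.
  apply: (@le_trans _ _ (1 + Tk k t)); last exact: le1r_powR.
  by apply: (le_trans (tau_ge hk)); rewrite lerDr.
have I0 : I iB <= 0.
  rewrite leNgt; apply/negP => c0.
  have := est (Num.truncn (X0 / I iB)).+1; rewrite leNgt => /negP; apply.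
  by rewrite -ltr_pdivrMr// truncnS_gt.
apply: (aE_mp (I_eq0 LB iB0 I0)) => t; rewrite /iB /gd.
have [//|_] := asboolP (good K (v t)); rewrite subr0 => /eqP; rewrite oner_eq0//.
Qed.

Lemma mf_ul : measf ul.
Proof.
apply: (mf_cvg (h := fun k t => tht k (v t) * K k.+1 (v t))).
  move=> k; apply: mfM; first exact: mf_cont (C1_cont (C1_tht k)) mv.
  exact: mf_cont (C1_cont (K_C1 k.+1)) mv.
move=> t; rewrite /ul /gd.
have [[k hk]|ng] := pselect (good K (v t)).
  rewrite asboolT; last by exists k.
  rewrite mul1r; apply/cvg_epsP => e e0; exists k => j kj.
  rewrite (good_tht hk kj) mul1r -(uuE K_agree (good_mono K_agree (leqW kj) hk)) subrr normr0 ltW//.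
rewrite asboolF// mul0r (_ : (fun k => _) = fun=> 0); first exact: cvg_cst.
apply/funext => k; rewrite tht_0 ?mul0r// leNgt; apply/negP => h.
by apply: ng; exists k.+1; exact: ltW.
Qed.

Lemma uu_ge0 t : 0 <= uu K (v t).
Proof. exact: (K_ge0 p0 K_C1 K_0). Qed.

Lemma ul_ge0 t : 0 <= ul t.
Proof. by rewrite mulr_ge0 ?uu_ge0. Qed.

Lemma ul_good t : good K (v t) -> ul t = uu K (v t).
Proof. by move=> h; rewrite /ul /gd asboolT// mul1r. Qed.

Lemma ul_gt0 : aE (fun t => 0 < ul t).
Proof.
apply: (aE_mp2 vp v_good) => t vt gt; rewrite ul_good//.
by apply: (K_gt0 p0 K_C1 K_0).
Qed.

Lemma ul1 t : 1 <= 1 + ul t. Proof. by rewrite lerDl ul_ge0. Qed.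

Lemma mDul i : measf (fun t => Dul t ord0 i).
Proof.
under [X in measf X]eq_fun do rewrite mxE.
by apply: mfM => //; apply: mf_powR; apply: mfD; [exact: mf_cst|exact: mf_ul].
Qed.

Lemma Phi_ul t : 0 < v t -> good K (v t) -> Phi t = B * (sq (Dul t) / ul t `^ th).
Proof.
move=> vt gt; rewrite /Phi iP_eq1// mul1r /Glim /Dul sqZ ul_good//; congr (B * _).
have -> : ((1 + uu K (v t)) `^ p) ^+ 2 = (1 + uu K (v t)) `^ (2 * p).
  by rewrite -powR_mulrn ?powR_ge0// -powRrM mulrC.
by rewrite powRN mulrAC.
Qed.

Lemma Tk_cvg t : good K (v t) -> Tk k t @[k --> \oo] --> ul t.
Proof.
move=> gt; have [k hk] := gt; rewrite ul_good//; apply/cvg_epsP => e e0; exists k => j kj.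
have h := good_mono K_agree kj hk.
have e1 : K j.+1 (v t) = K j (v t) by rewrite -(K_agree (leqnSn j)) ?h.
by rewrite /Tk e1 tau_id// (uuE K_agree h) subrr normr0 ltW.
Qed.

Lemma Tk_le k t : good K (v t) -> Tk k t <= ul t.
Proof.
move=> gt; rewrite ul_good//; have [h|h] := leP (K k.+1 (v t)) k.+1%:R.
  by rewrite (uuE K_agree h); apply: tau_le; exact: (K_ge0 p0 K_C1 K_0).
apply: (le_trans (tau_le_max _ _)); rewrite leNgt; apply/negP => hu.
have [j hj] := gt; rewrite (uuE K_agree hj) in hu.
have [kj|/ltnW jk] := leqP k.+1 j.
  by move: h; rewrite (K_agree kj) ?(ltW hu) ?orbT// ltNge (ltW hu).
by move: h; rewrite -(K_agree jk) ?hj// ltNge (ltW hu).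
Qed.

Lemma L1_ul : L1 (fun t => (1 + ul t) `^ s).
Proof.
have [X0 [X1 hX]] := summability_bound.
have s0 : 0 < s by exact: lt_le_trans ltr01 s1.
suff [] : L1 (fun t => (1 + ul t) `^ s) /\ I (fun t => (1 + ul t) `^ s) <= X0 by [].
apply: (@I_fatou _ _ _ nu (fun k t => (1 + Tk k t) `^ s) _ (fun=> X0)).
- by move=> k; have [] := hX k.
- by apply: mf_powR; apply: mfD; [exact: mf_cst|exact: mf_ul].
- by move=> k t; exact: powR_ge0.
- by move=> t; exact: powR_ge0.
- apply: (aE_mp v_good) => t gt; apply: cvg_powR => //.
    by move=> k; rewrite addr_ge0 ?Tk_ge0.
  by apply: cvg_addR; [exact: cvg_cstR|exact: Tk_cvg].
- by move=> k; have [] := hX k.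
- exact: cvg_cst.
Qed.

Lemma L1_Phi_ul : L1 (fun t => Phi t * (1 + ul t) `^ gam).
Proof.
have [X0 [X1 hX]] := summability_bound.
suff [] : L1 (fun t => Phi t * (1 + ul t) `^ gam) /\ I (fun t => Phi t * (1 + ul t) `^ gam) <= X1 by [].
apply: (@I_fatou _ _ _ nu (fun k t => Phi t * (1 + Tk k t) `^ gam) _ (fun=> X1)).
- by move=> k; have [] := hX k.
- apply: mfM; first exact: mPhi.
  by apply: mf_powR; apply: mfD; [exact: mf_cst|exact: mf_ul].
- by move=> k t; rewrite mulr_ge0 ?powR_ge0 ?Phi_ge0.
- by move=> t; rewrite mulr_ge0 ?powR_ge0 ?Phi_ge0.
- apply: (aE_mp v_good) => t gt; apply: cvg_mulcR.
  have c1 := cvg_addR (cvg_cstR 1) (Tk_cvg gt).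
  by apply: cvg_powR_pos c1; rewrite (lt_le_trans ltr01 (ul1 t)).
- by move=> k; have [] := hX k.
- exact: cvg_cst.
Qed.

Lemma L1_Phi : L1 Phi.
Proof.
apply: (L1_dom mPhi L1_Phi_ul) => t; rewrite ger0_norm ?Phi_ge0//.
by rewrite ler_peMr ?Phi_ge0// -[leLHS](powRr0 (1 + ul t)); apply: ler_powR; [exact: ul1|].
Qed.

Variable sg : R.
Hypothesis sg1 : 1 <= sg.
Hypothesis sg2 : sg < 2.
Hypothesis sg_s : sg <= s.
Hypothesis sg_eq : (th - gam) * sg <= s * (2 - sg).

Let sg0 : 0 < sg. Proof. exact: lt_le_trans sg1. Qed.

(** |Du|^2 is at most the integrable function Phi (1 + u)^gam / B times (1 + u)^(theta - gam).
    Young's inequality with a = sg / 2 raises the second factor to a power of 1 + u not exceeding s,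
    by [sg_eq]. *)
Lemma L1_Dul : L1 (fun t => nrm (Dul t) `^ sg).
Proof.
have mn : measf (fun t => nrm (Dul t) `^ sg).
  by apply: mf_powR; apply: mf_nrm => i; exact: mDul.
apply: (L1_dom_ae mn (L1D (L1Z B^-1 L1_Phi_ul) L1_ul)).
apply: (aE_mp3 vp v_good ul_gt0) => t vt gt ut.
rewrite ger0_norm ?powR_ge0//.
have U0 : 0 < 1 + ul t by exact: lt_le_trans ltr01 (ul1 t).
pose X := B^-1 * (Phi t * (1 + ul t) `^ gam).
pose y := (1 + ul t) `^ (th - gam).
have X0 : 0 <= X by rewrite mulr_ge0 ?invr_ge0 ?(ltW B0)// mulr_ge0 ?Phi_ge0 ?powR_ge0.
have y0 : 0 < y by exact: powR_gt0.
have sqle : sq (Dul t) <= X * y.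
  have uth : 0 < ul t `^ th by exact: powR_gt0.
  have -> : X * y = sq (Dul t) / ul t `^ th * (1 + ul t) `^ th.
    rewrite /X /y Phi_ul// powRB; last by apply/implyP => _; rewrite gt_eqF.
    by field; rewrite !gt_eqF//= powR_gt0.
  rewrite mulrAC ler_pdivlMr// ler_wpM2l ?sq_ge0//.
  by apply: ge0_ler_powR; rewrite ?nnegrE ?(ltW th0) ?(ltW U0) ?(ltW ut)// lerDr.
have a0 : 0 < sg / 2 by rewrite divr_gt0.
have a1 : sg / 2 < 1 by rewrite ltr_pdivrMr// mul1r.
have -> : nrm (Dul t) `^ sg = (sq (Dul t)) `^ (sg / 2).
  by rewrite -nrm_sq -powR_mulrn ?nrm_ge0// -powRrM; congr (_ `^ _); field.
apply: (@le_trans _ _ ((X * y) `^ (sg / 2))).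
  by apply: ge0_ler_powR; rewrite ?nnegrE ?sq_ge0 ?(ltW a0)// mulr_ge0// ltW.
apply: (le_trans (young_pow X0 y0 a0 a1)); rewrite lerD2l /y -powRrM.
apply: ler_powR; first exact: ul1.
have h2 : 0 < 2 - sg by rewrite subr_gt0.
have -> : (th - gam) * (sg / 2 / (1 - sg / 2)) = (th - gam) * sg / (2 - sg).
  by field; rewrite !gt_eqF//; lra.
by rewrite ler_pdivrMr.
Qed.

Lemma Dul_coord t i : `|Dul t ord0 i| <= nrm (Dul t).
Proof.
rewrite -(@ler_pXn2r _ 2)// ?nnegrE ?nrm_ge0// real_normK ?num_real// nrm_sq.
exact: sq_coord.
Qed.

Lemma g_coord t i : `|g t ord0 i| <= `|Dul t ord0 i|.
Proof.
rewrite mxE normrM ler_peMl// ger0_norm ?powR_ge0//.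
by rewrite -[leLHS](powRr0 (1 + ul t)); apply: ler_powR; [exact: ul1|].
Qed.

Lemma L1_Dul_i i : L1 (fun t => Dul t ord0 i).
Proof.
apply: (L1_dom (mDul i) (L1D (L1_cst nufin 1) L1_Dul)) => t.
apply: (le_trans (Dul_coord t i)).
by rewrite -{1}(ger0_norm (nrm_ge0 (Dul t))) -{2}(ger0_norm (nrm_ge0 (Dul t))); exact: powR_abs_le.
Qed.

Lemma L1_g i : L1 (fun t => g t ord0 i).
Proof. by apply: (L1_dom (mg i) (L1_norm (L1_Dul_i i))) => t; exact: g_coord. Qed.

Lemma L1_bgD phi : C phi -> L1 (fun t => b t * dotr (g t) (D phi t)).
Proof.
move=> Cphi; have [M hM] := tc_bddD tc Cphi.
apply: (L1_bM mb bn); apply: L1_sum => i.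
apply: L1_eq (L1_bM (tc_mfD tc i Cphi) (fun t => hM t i) (L1_g i)) => t; exact: mulrC.
Qed.

Lemma L1_bddM (h phi : T -> R) : L1 h -> C phi -> L1 (fun t => h t * phi t).
Proof.
move=> Lh Cphi; have [M hM] := tc_bdd tc Cphi.
by apply: L1_eq (L1_bM (tc_mf tc Cphi) hM Lh) => t; exact: mulrC.
Qed.

(** * Removal of the cut-off and the equation for all test functions *)

Lemma cvg_tht_I (h : T -> R) : L1 h -> I (fun t => h t * tht k (v t)) @[k --> \oo] --> I h.
Proof.
move=> Lh; have [] // : L1 h /\ I (fun t => h t * tht k (v t)) @[k --> \oo] --> I h.
apply: (I_dct (g := fun t => `|h t|)).
- move=> k; apply: mfM; first exact: L1_mf Lh.
  exact: mf_cont (C1_cont (C1_tht k)) mv.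
- exact: L1_mf Lh.
- exact: L1_norm.
- apply: (aE_mp v_good) => t gt; have := cvg_mulcR (h t) (tht_cvg (v t)).
  by rewrite asboolT// mulr1.
- by move=> k; apply: aE_all => t; rewrite normrM ler_piMr// tht_abs.
Qed.

Lemma equation_ge0 phi : C phi -> (forall t, 0 <= phi t) ->
  I (fun t => b t * dotr (g t) (D phi t)) + I (fun t => Phi t * phi t) = I (fun t => f t * phi t).
Proof.
move=> Cphi phi_0.
have [M hM] := tc_bdd tc Cphi.
have phiM t : 0 <= phi t <= M by rewrite phi_0 (le_trans (ler_norm _) (hM t)).
have c1 := cvg_tht_I (L1_bgD Cphi).
have c2 := cvg_tht_I (L1_bddM L1_Phi Cphi).
have c3 := cvg_tht_I (L1_bddM Lf Cphi).
have c4 := cvg_subR (cvg_cstR (I f)) (cvg_tht_I Lf); rewrite subrr in c4.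
have e1 k : I (fun t => b t * (tht k (v t) * dotr (g t) (D phi t))) = I (fun t => b t * dotr (g t) (D phi t) * tht k (v t)).
  by apply: I_eq => t; ring.
have e2 k : I (fun t => Phi t * (phi t * tht k (v t))) = I (fun t => Phi t * phi t * tht k (v t)).
  by apply: I_eq => t; ring.
have e3 k : I (fun t => f t * (phi t * tht k (v t))) = I (fun t => f t * phi t * tht k (v t)).
  by apply: I_eq => t; ring.
have Lft k : L1 (fun t => f t * tht k (v t)).
  apply: L1_eq (L1_bM (mf_cont (C1_cont (C1_tht k)) mv) (fun t => tht_abs k (v t)) Lf) => t; exact: mulrC.
have e4 k : I (fun t => f t * (1 - tht k (v t))) = I f - I (fun t => f t * tht k (v t)).
  by rewrite -IB//; apply: I_eq => t; ring.
apply/eqP; rewrite eq_le; apply/andP; split.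
  have cc := cvg_subR (cvg_addR c3 (cvg_mulcR M c4)) (cvg_addR c1 c2).
  rewrite mulr0 addr0 in cc; rewrite -subr_ge0; apply: (cvg_geR _ cc) => k.
  have [_ _] := ineq_A k Cphi phiM; rewrite e1 e2 e3 e4; lra.
have cc := cvg_subR (cvg_addR c1 c2) c3; rewrite -subr_ge0; apply: (cvg_geR _ cc) => k.
have := ineq_B2 k Cphi phi_0 vp; rewrite e1 e2 e3; lra.
Qed.

(** The positive part of a test function need not be one; smoothed positive parts are, and dominated
    convergence applies to them and to their gradients. *)
Lemma equation_pos phi : C phi ->
  [/\ L1 (fun t => (0 < phi t)%R%:R * (b t * dotr (g t) (D phi t))),
      L1 (fun t => Phi t * Num.max (phi t) 0), L1 (fun t => f t * Num.max (phi t) 0) &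
  I (fun t => (0 < phi t)%R%:R * (b t * dotr (g t) (D phi t))) + I (fun t => Phi t * Num.max (phi t) 0) =
  I (fun t => f t * Num.max (phi t) 0)].
Proof.
move=> Cphi; have mphi := tc_mf tc Cphi.
have dp n : 0 < (dlt n : R) by exact: dlt_gt0.
pose r n (t : R) := Num.sqrt (dlt n + pos2 t) - Num.sqrt (dlt n).
pose r' n (t : R) := Num.max t 0 / Num.sqrt (dlt n + pos2 t).
have hr n : C1fun (r n) (r' n).
  by apply: C1_eq (C1D (C1_sqrt (dp n)) (C1_cst (- Num.sqrt (dlt n)))) => // t; rewrite addr0.
have sp n (t : R) : 0 < Num.sqrt (dlt n + pos2 t) by rewrite sqrtr_gt0 sqrt_shift_gt0.
have ss n (t : R) : Num.sqrt (dlt n + pos2 t) ^+ 2 = dlt n + pos2 t.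
  by rewrite sqr_sqrtr// ltW// sqrt_shift_gt0.
have mx (t : R) : 0 <= Num.max t 0 by rewrite le_max lexx orbT.
have mxs n (t : R) : Num.max t 0 <= Num.sqrt (dlt n + pos2 t).
  rewrite -(@ler_pXn2r _ 2)// ?nnegrE ?sqrtr_ge0// ss /pos2 lerDr ltW//.
have r0 n : r n 0 = 0 by rewrite /r pos2_neg// addr0 subrr.
have rge n (t : R) : 0 <= r n t.
  by rewrite subr_ge0 ler_sqrt ?lerDl ?pos2_ge0// addr_ge0 ?pos2_ge0// ltW.
have rle n (t : R) : r n t <= Num.max t 0.
  rewrite lerBlDr -(@ler_pXn2r _ 2)// ?nnegrE ?addr_ge0 ?sqrtr_ge0//.
  rewrite ss sqrrD /pos2 sqr_sqrtr ?(ltW (dp n))// addrC lerD2r lerDl.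
  by rewrite mulrn_wge0// mulr_ge0 ?sqrtr_ge0.
have r'b n (t : R) : 0 <= r' n t <= 1.
  by rewrite divr_ge0 ?(ltW (sp n t))//= ler_pdivrMr// mul1r.
have csq (t : R) : Num.sqrt (dlt n + pos2 t) @[n --> \oo] --> Num.max t 0.
  have h := cvg_addR (@dlt_cvg R) (cvg_cstR (pos2 t)); rewrite add0r in h.
  have h2 : Num.sqrt (dlt n + pos2 t) @[n --> \oo] --> Num.sqrt (pos2 t).
    apply: (@cvg_comp _ _ _ (fun n => dlt n + pos2 t) Num.sqrt _ (nbhs (pos2 t))) => //.
    exact: sqrt_continuous.
  by rewrite /pos2 sqrtr_sqr ger0_norm// in h2.
have cr (t : R) : r n t @[n --> \oo] --> Num.max t 0.
  have h := csq 0; rewrite maxxx in h.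
  have := cvg_subR (csq t) h; rewrite subr0 (_ : (fun n => _) = r ^~ t)//.
  by apply/funext => n; rewrite /r [pos2 0]pos2_neg// addr0.
have cr' (t : R) : r' n t @[n --> \oo] --> ((0 < t)%R%:R : R).
  have [t0|t0] := leP t 0.
    rewrite (_ : (fun n => _) = fun=> 0); first exact: cvg_cst.
    by apply/funext => n; rewrite /r' max_r// mul0r.
  have -> : true%:R = Num.max t 0 / Num.max t 0 :> R by rewrite divff// gt_eqF// lt_max t0.
  apply: cvgM; first exact: cvg_cst.
  apply: cvgV; last exact: csq.
  by rewrite gt_eqF// lt_max t0.
have LX := L1_bgD Cphi; have LPp := L1_bddM L1_Phi Cphi; have Lfp := L1_bddM Lf Cphi.
have mind : measf (fun t => (0 < phi t)%R%:R : R).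
  apply: (mf_cvg (h := fun n t => r' n (phi t))) => [n|t]; last exact: cr'.
  exact: mf_cont (hr n).2 mphi.
have cP (h : T -> R) : L1 (fun t => h t * phi t) -> measf h ->
   L1 (fun t => h t * Num.max (phi t) 0) /\
   I (fun t => h t * r n (phi t)) @[n --> \oo] --> I (fun t => h t * Num.max (phi t) 0).
  move=> Lh mh; apply: (I_dct (g := fun t => `|h t * phi t|)).
  - by move=> n; apply: mfM => //; exact: mf_cont (C1_cont (hr n)) mphi.
  - by apply: mfM => //; apply: mf_max => //; exact: mf_cst.
  - exact: L1_norm.
  - by apply: aE_all => t; apply: cvg_mulcR; exact: cr.
  - move=> n; apply: aE_all => t; rewrite !normrM ler_wpM2l// ger0_norm//.
    by apply: (le_trans (rle n _)); rewrite ge_max ler_norm normr_ge0.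
have [LPm cPm] := cP _ LPp mPhi.
have [Lfm' cfm] := cP _ Lfp (L1_mf Lf).
have [LXm cXm] : L1 (fun t => (0 < phi t)%R%:R * (b t * dotr (g t) (D phi t))) /\
   I (fun t => r' n (phi t) * (b t * dotr (g t) (D phi t))) @[n --> \oo] -->
   I (fun t => (0 < phi t)%R%:R * (b t * dotr (g t) (D phi t))).
  apply: (I_dct (g := fun t => `|b t * dotr (g t) (D phi t)|)).
  - by move=> n; apply: mfM; [exact: mf_cont (hr n).2 mphi|exact: L1_mf LX].
  - by apply: mfM => //; exact: L1_mf LX.
  - exact: L1_norm.
  - by apply: aE_all => t; apply: cvgM; [exact: cr'|exact: cvg_cst].
  - move=> n; apply: aE_all => t; rewrite normrM ler_piMl//.
    by have /andP[h1 h2] := r'b n (phi t); rewrite ger0_norm.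
split => //.
have e n : I (fun t => r' n (phi t) * (b t * dotr (g t) (D phi t))) + I (fun t => Phi t * r n (phi t)) =
    I (fun t => f t * r n (phi t)).
  have := equation_ge0 (tc_comp tc (hr n) (r0 n) Cphi) (fun t => rge n _).
  rewrite (tc_Dcomp tc (hr n) (r0 n) Cphi) => <-; congr (_ + _).
  by apply: I_eq => t; rewrite dotrZr; ring.
have cc := cvg_addR cXm cPm.
rewrite (_ : (fun n => _) = fun n => I (fun t => f t * r n (phi t))) in cc; last by apply/funext => n.
exact: (cvg_uniq cc cfm).
Qed.

(** phi is the difference of the positive parts of phi and of - phi. The gradient terms match
    because D phi = 0 almost everywhere on {phi = 0}. *)
Lemma equation phi : C phi ->
  I (fun t => b t * dotr (g t) (D phi t)) + I (fun t => Phi t * phi t) = I (fun t => f t * phi t).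
Proof.
move=> Cphi; have Cn := tc_lin tc (-1) Cphi (tc_0 tc).
have Dn := tc_Dlin tc (-1) Cphi (tc_0 tc).
have DnE t : D (fun t => -1 * phi t + 0) t = -1 *: D phi t by rewrite Dn (D0 tc) addr0.
have [LX LP Lf' e1] := equation_pos Cphi; have [LXn LPn Lfn'' e2] := equation_pos Cn.
have sp (h : T -> R) : L1 (fun t => h t * Num.max (phi t) 0) ->
    L1 (fun t => h t * Num.max (-1 * phi t + 0) 0) ->
    I (fun t => h t * Num.max (phi t) 0) - I (fun t => h t * Num.max (-1 * phi t + 0) 0) = I (fun t => h t * phi t).
  move=> h1 h2; rewrite -IB//; apply: I_eq => t; rewrite -mulrBr; congr (_ * _).
  rewrite mulN1r addr0; have [p0'|p0'] := leP (phi t) 0.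
    by rewrite max_l; lra.
  by rewrite max_r; lra.
rewrite -(sp _ LP LPn) -(sp _ Lf' Lfn'').
have -> : I (fun t => b t * dotr (g t) (D phi t)) =
   I (fun t => (0 < phi t)%R%:R * (b t * dotr (g t) (D phi t))) -
   I (fun t => (0 < -1 * phi t + 0)%R%:R * (b t * dotr (g t) (D (fun t => -1 * phi t + 0) t))).
  rewrite -IB//; apply: I_eq_ae; [exact: L1_mf (L1_bgD Cphi)|exact: L1_mf (L1B LX LXn)|].
  apply: (aE_mp (H_grad0 nufin tc (emb_H nufin tc Cphi))) => t /= h.
  rewrite DnE dotrZr mulN1r addr0.
  have [p0'|p0'|p0'] := ltgtP (phi t) 0.
  - have -> : 0 < - phi t by lra.
    by rewrite /=; ring.
  - have -> : (0 < - phi t) = false by apply/negbTE; rewrite -leNgt; lra.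
    by rewrite /=; ring.
  - by rewrite h// dotr0r !mulr0 subrr.
by move: e1 e2; lra.
Qed.

(** * Weak gradient of u and its approximation by test functions *)

Definition tkd k t := chi k%:R (K k.+1 t) * Kd p K k.+1 t.

Lemma H_Tk k : H (Vg (Tk k) (fun t => tkd k (v t) *: g t)).
Proof.
have h := C1_comp (C1_tau k) (K_C1 k.+1).
have b1 t : `|tkd k t| <= (1 + k.+1%:R) `^ p.
  rewrite /tkd normrM (ger0_norm (chi_ge0 _ _)) (gtr0_norm (Kd_gt0 p0 K k.+1 t)).
  rewrite -[leRHS]mul1r; apply: ler_pM; [exact: chi_ge0|by rewrite ltW// Kd_gt0|exact: chi_le1|exact: Kd_le].
have b2 : forall t, k.+1%:R <= K k.+1 t -> tkd k t = 0.
  by move=> t ht; rewrite /tkd chi_0 ?mul0r// natr1.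
have z : tau k (K k.+1 0) = 0 by rewrite K_0 tau0.
exact: (trunc_H h z (support_weight b1 b2)).
Qed.

Lemma tkd_Dul k t : tkd k (v t) *: g t = chi k%:R (K k.+1 (v t)) *: Dul t.
Proof.
rewrite /tkd /Dul !scalerA; have [->|h] := eqVneq (chi k%:R (K k.+1 (v t))) 0; first by rewrite !mul0r.
have hk : K k.+1 (v t) <= k.+1%:R by exact: (tht_pos_good h).
rewrite ul_good; last by exists k.+1.
by rewrite (uuE K_agree hk) (Kd_E p _ hk)//; exact: (K_ge0 p0 K_C1 K_0).
Qed.

Lemma DulZ (c : R) t i : (c *: Dul t) ord0 i = c * Dul t ord0 i.
Proof. by rewrite [LHS]mxE. Qed.

Lemma L1_ul1 : L1 ul.
Proof.
apply: (L1_dom mf_ul L1_ul) => t; rewrite ger0_norm ?ul_ge0//.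
by apply: (@le_trans _ _ (1 + ul t)); [rewrite lerDr|apply: le1r_powR => //; exact: ul1].
Qed.

Lemma weak_grad phi i : C phi ->
  I (fun t => ul t * D phi t ord0 i) = - I (fun t => Dul t ord0 i * phi t).
Proof.
move=> Cphi; have [M hM] := tc_bdd tc Cphi; have [M' hM'] := tc_bddD tc Cphi.
have mphi := tc_mf tc Cphi; have mD := tc_mfD tc i Cphi.
have LD : L1 (fun t => Dul t ord0 i * phi t) by exact: L1_bddM (L1_Dul_i i) Cphi.
have Lu : L1 (fun t => ul t * D phi t ord0 i).
  by apply: L1_eq (L1_bM mD (fun t => hM' t i) L1_ul1) => t; exact: mulrC.
have cD : I (fun t => Dul t ord0 i * phi t * tht k (v t)) @[k --> \oo] --> I (fun t => Dul t ord0 i * phi t).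
  exact: cvg_tht_I LD.
have cu : I (fun t => Tk k t * D phi t ord0 i) @[k --> \oo] --> I (fun t => ul t * D phi t ord0 i).
  have [] // : L1 (fun t => ul t * D phi t ord0 i) /\
     I (fun t => Tk k t * D phi t ord0 i) @[k --> \oo] --> I (fun t => ul t * D phi t ord0 i).
  apply: (I_dct (g := fun t => `|ul t * D phi t ord0 i|)).
  - by move=> k; apply: mfM => //; exact: mTk.
  - exact: L1_mf Lu.
  - exact: L1_norm.
  - by apply: (aE_mp v_good) => t gt; apply: cvgM; [exact: Tk_cvg|exact: cvg_cst].
  - move=> k; apply: (aE_mp v_good) => t gt; rewrite (normrM (Tk k t)) (normrM (ul t)) ler_wpM2r// (ger0_norm (Tk_ge0 k t)) (ger0_norm (ul_ge0 t)).
    exact: Tk_le.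
have e k : I (fun t => Dul t ord0 i * phi t * tht k (v t)) = - I (fun t => Tk k t * D phi t ord0 i).
  rewrite -(H_weak nufin tc i (H_Tk k) Cphi); apply: I_eq => t.
  by rewrite /= tkd_Dul DulZ /tht; ring.
have cn := cvg_mulcR (-1) cu; rewrite mulN1r in cn.
rewrite (_ : (fun k => _) = fun k => I (fun t => Dul t ord0 i * phi t * tht k (v t))) in cn.
  by rewrite (cvg_uniq cD cn) opprK.
by apply/funext => k; rewrite e mulN1r.
Qed.

(** T_k tends to u in W^{1,sg} by dominated convergence, and T_k, an element of [H], is approximated
    by test functions in W^{1,2}; as sg < 2 and the measure is finite, the second approximation also
    holds in W^{1,sg}. *)
Lemma C_approx (e : R) : 0 < e -> exists2 phi, C phi &
  I (fun t => `|ul t - phi t| `^ sg) <= e /\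
  forall i, I (fun t => `|Dul t ord0 i - D phi t ord0 i| `^ sg) <= e.
Proof.
move=> e0; have c2 : 0 < 2 `^ sg :> R by exact: powR_gt0.
(* The denominator pays for the quasi-triangle inequality [powR_absD] applied to two errors. *)
pose e1 := e / (2 * 2 `^ sg); have e10 : 0 < e1 by rewrite divr_gt0// mulr_gt0.
have s0 : 0 < s by exact: lt_le_trans ltr01 s1.
have key (h : nat -> T -> R) (l B' : T -> R) : (forall k, measf (h k)) -> measf l -> L1 B' ->
   aE (fun t => h k t @[k --> \oo] --> l t) -> (forall k, aE (fun t => `|l t - h k t| `^ sg <= B' t)) ->
   exists k0, forall k, (k0 <= k)%N -> L1 (fun t => `|l t - h k t| `^ sg) /\ I (fun t => `|l t - h k t| `^ sg) <= e1.
  move=> mh ml LB ch bh.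
  have mk k : measf (fun t => `|l t - h k t| `^ sg) by apply: mf_powR; apply: mf_norm; exact: mfB.
  have [_ cI] : L1 (fun=> 0) /\ I (fun t => `|l t - h k t| `^ sg) @[k --> \oo] --> I (fun=> 0).
    apply: (I_dct mk (measf_cst0 : measf (fun _ : T => 0 : R)) LB).
      apply: (aE_mp ch) => t ct.
      have h1 := cvg_subR (cvg_cstR (l t)) ct; rewrite subrr in h1.
      have h2 := cvg_absR h1; rewrite normr0 in h2.
      by have := cvg_powR sg0 (fun n => normr_ge0 _) h2; rewrite powR0// gt_eqF.
    by move=> k; apply: (aE_mp (bh k)) => t; rewrite (ger0_norm (powR_ge0 _ _)).
  rewrite I_0 in cI; have [k0 hk0] := (cvg_epsP _ _).1 cI _ e10.
  exists k0 => k kk; split; last first.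
    by have := hk0 k kk; rewrite subr0 => /(le_trans (ler_norm _)).
  apply: (L1_dom_ae (mk k) LB); apply: (aE_mp (bh k)) => t; by rewrite (ger0_norm (powR_ge0 _ _)).
have [k1 hk1] : exists k0, forall k, (k0 <= k)%N ->
    L1 (fun t => `|ul t - Tk k t| `^ sg) /\ I (fun t => `|ul t - Tk k t| `^ sg) <= e1.
  apply: (key _ _ (fun t => (1 + ul t) `^ s)); [exact: mTk|exact: mf_ul|exact: L1_ul| |].
    by apply: (aE_mp v_good) => t; exact: Tk_cvg.
  move=> k; apply: (aE_mp v_good) => t gt.
  rewrite ger0_norm ?subr_ge0 ?Tk_le//.
  apply: (@le_trans _ _ ((1 + ul t) `^ sg)); last by apply: ler_powR => //; exact: ul1.
  apply: ge0_ler_powR; rewrite ?nnegrE ?(ltW sg0) ?subr_ge0 ?Tk_le ?addr_ge0 ?ul_ge0//.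
  by have := Tk_ge0 k t; lra.
have hki i : exists k0, forall k, (k0 <= k)%N ->
    L1 (fun t => `|Dul t ord0 i - (tkd k (v t) *: g t) ord0 i| `^ sg) /\
    I (fun t => `|Dul t ord0 i - (tkd k (v t) *: g t) ord0 i| `^ sg) <= e1.
  apply: (key _ _ (fun t => nrm (Dul t) `^ sg)); [|exact: mDul|exact: L1_Dul| |].
  - by move=> k; exact: ((H_isL2 (H_Tk k)).2 i).1.
  - apply: (aE_mp v_good) => t gt.
    have := cvg_mulcR (Dul t ord0 i) (tht_cvg (v t)); rewrite asboolT// mulr1.
    rewrite (_ : (fun k => (tkd k (v t) *: g t) ord0 i) = fun k => Dul t ord0 i * tht k (v t))//.
    by apply/funext => k; rewrite tkd_Dul DulZ mulrC.
  - move=> k; apply: aE_all => t; rewrite tkd_Dul DulZ.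
    have -> : Dul t ord0 i - chi k%:R (K k.+1 (v t)) * Dul t ord0 i = (1 - chi k%:R (K k.+1 (v t))) * Dul t ord0 i by ring.
    apply: ge0_ler_powR; rewrite ?nnegrE ?(ltW sg0) ?nrm_ge0// normrM.
    apply: le_trans (Dul_coord t i); rewrite ler_piMl// ger0_norm ?subr_ge0 ?chi_le1//.
    by rewrite gerBl chi_ge0.
have [ki hki'] := choice hki.
pose k := maxn k1 (\max_i ki i).
have [Lu Iu] := hk1 k (leq_maxl _ _).
have hD i := hki' i k (leq_trans (leq_bigmax i) (leq_maxr _ _)).
have HT := H_Tk k; have [HT2 _] := HT.
pose nuT : R := I (fun=> 1); have nuT0 : 0 <= nuT by exact: I_ge0.
(* In |h|^sg <= eta + ce h^2 the constant [eta] costs at most e1 / 2 over the whole space, and [phi]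
   is chosen so that the second term does too. *)
pose eta := e1 / (2 * (nuT + 1)).
have eta0 : 0 < eta by rewrite divr_gt0// mulr_gt0//; lra.
pose ce := eta `^ ((sg - 2) / sg); have ce0 : 0 < ce by exact: powR_gt0.
have e2 : 0 < e1 / (2 * ce) by rewrite divr_gt0// mulr_gt0.
have [phi Cphi Ephi] := HT.2 _ e2.
have hp2 := emb_isL2 nufin tc Cphi.
have hd2 := isL2B HT2 hp2.
have Eb := Ephi; rewrite (E2_split hd2) in Eb.
have I1 := I_sq_ge0 nu (vf (Vg (Tk k) (fun t => tkd k (v t) *: g t) - emb D phi)).
have I2 : 0 <= I (fun t => sq (vv (Vg (Tk k) (fun t => tkd k (v t) *: g t) - emb D phi) t)).
  by apply: I_ge0 => t; exact: sq_ge0.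
have small (h : T -> R) : L2 h -> I (fun t => h t ^+ 2) <= e1 / (2 * ce) ->
    L1 (fun t => `|h t| `^ sg) /\ I (fun t => `|h t| `^ sg) <= e1.
  move=> [mh h2] Ih.
  have Lb : L1 (fun t => eta + ce * h t ^+ 2) by apply: L1D; [exact: L1_cst|exact: L1Z].
  have pb t : `|h t| `^ sg <= eta + ce * h t ^+ 2 by exact: powR_le_sq.
  have L : L1 (fun t => `|h t| `^ sg).
    apply: (L1_dom _ Lb); first by apply: mf_powR; exact: mf_norm.
    by move=> t; rewrite (ger0_norm (powR_ge0 _ _)).
  split; first exact: L.
  apply: (le_trans (I_le L Lb pb)).
  rewrite ID; [|exact: L1_cst|exact: L1Z].
  rewrite (IZ _ h2).
  have -> : I (fun=> eta) = eta * nuT.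
    rewrite /nuT -IZ; last exact: L1_cst.
    by apply: I_eq => t; rewrite mulr1.
  have i1 : eta * nuT <= e1 / 2.
    have -> : e1 / 2 = eta * (nuT + 1) by rewrite /eta; field; lra.
    by apply: ler_wpM2l; [exact: ltW|lra].
  have i2 := ler_wpM2l (ltW ce0) Ih.
  have e3 : ce * (e1 / (2 * ce)) = e1 / 2 by field; rewrite gt_eqF.
  by rewrite e3 in i2; lra.
exists phi => //.
have comb (l h1 h2 : T -> R) : measf l -> L1 (fun t => `|l t - h1 t| `^ sg) -> I (fun t => `|l t - h1 t| `^ sg) <= e1 ->
   L2 (fun t => h1 t - h2 t) -> I (fun t => (h1 t - h2 t) ^+ 2) <= e1 / (2 * ce) -> measf h2 ->
   I (fun t => `|l t - h2 t| `^ sg) <= e.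
  move=> ml La Ia hb' Ib mh2; have [Lb' Ib'] := small _ hb' Ib.
  have Lc : L1 (fun t => 2 `^ sg * (`|l t - h1 t| `^ sg + `|h1 t - h2 t| `^ sg)) by apply: L1Z; exact: L1D.
  have pc t : `|l t - h2 t| `^ sg <= 2 `^ sg * (`|l t - h1 t| `^ sg + `|h1 t - h2 t| `^ sg).
    have -> : l t - h2 t = (l t - h1 t) + (h1 t - h2 t) by ring.
    by apply: powR_absD; exact: ltW.
  have Ld : L1 (fun t => `|l t - h2 t| `^ sg).
    apply: (L1_dom _ Lc); first by apply: mf_powR; apply: mf_norm; exact: mfB.
    by move=> t; rewrite (ger0_norm (powR_ge0 _ _)).
  apply: (le_trans (I_le Ld Lc pc)); rewrite IZ; last exact: L1D.
  rewrite ID//; have -> : e = 2 `^ sg * (e1 + e1).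
    by rewrite /e1; field; rewrite gt_eqF.
  by apply: ler_wpM2l; [exact: (ltW c2)|exact: (lerD Ia Ib')].
split.
  apply: (comb ul (Tk k)); [exact: mf_ul|exact: Lu|exact: Iu|exact: hd2.1| |exact: (tc_mf tc Cphi)].
  by move: Eb I1 I2 => /=; lra.
move=> i; have [La Ia] := hD i.
apply: (comb _ (fun t => (tkd k (v t) *: g t) ord0 i)); [exact: mDul|exact: La|exact: Ia| | |exact: (tc_mfD tc i Cphi)].
  by apply: (L2_eq_ae (f := fun t => vv (Vg (Tk k) (fun t => tkd k (v t) *: g t) - emb D phi) t ord0 i));
    [apply: mfB; [exact: (HT2.2 i).1|exact: (tc_mfD tc i Cphi)]|apply: aE_all => t; rewrite vgE !mxE|exact: (hd2.2 i)].
apply: (@le_trans _ _ (I (fun t => sq (vv (Vg (Tk k) (fun t => tkd k (v t) *: g t) - emb D phi) t)))); last first.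
  by move: Eb I1 I2; lra.
apply: I_le.
- by apply: (L1_eq (f := fun t => (vv (Vg (Tk k) (fun t => tkd k (v t) *: g t) - emb D phi) t ord0 i) ^+ 2)); [move=> t; rewrite vgE !mxE|exact: (hd2.2 i).2].
- exact: L2v_sq hd2.2.
- move=> t; apply: le_trans (sq_coord _ i); by rewrite vgE !mxE.
Qed.

End limit.

(** * The abstract existence theorem *)

Section existence.
Context {d : measure_display} {T : measurableType d} {R : realType}.
Variable nu : {measure set T -> \bar R}.
Hypothesis nufin : (nu setT < +oo)%E.
Context {N : nat}.
Variables (C : set (T -> R)) (D : (T -> R) -> T -> 'rV[R]_N).
Hypothesis tc : test_class nu C D.
Notation L1 := (L1 nu).
Notation I := (I nu).
Notation aE := (aE nu).
Notation H := (H nu C D).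

(** The inequality passes to the closure by Fatou's lemma. The factor 4 leaves room for the
    gradients of the approximants, at most twice the squared error plus twice the squared norm, both
    bounded by [A]. *)
Lemma H_sobolev (q S : R) : 0 < q -> 0 <= S ->
  (forall (A : R) phi, 0 < A -> C phi -> I (fun t => sq (D phi t)) <= A ->
    I (fun t => `|phi t| `^ q) <= (S * A) `^ (q / 2)) ->
  forall (A : R) y, 0 < A -> H y -> I (fun t => sq (vv y t)) <= A ->
    L1 (fun t => `|vf y t| `^ q) /\ I (fun t => `|vf y t| `^ q) <= (4 * S * A) `^ (q / 2).
Proof.
move=> q0 S0 hS A y A0 Hy yA; have hy2 := H_isL2 Hy.
have [fn [Cf fE fae]] := Hcl_seq nufin tc (@subset_refl _ C) Hy.
have [k0 hk0] := (cvg_epsP _ _).1 fE _ A0.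
have Lfn n : L1 (fun t => `|fn n t| `^ q).
  have [M hM] := tc_bdd tc (Cf n).
  apply: (L1_bdd nufin (M := M `^ q)); first by apply: mf_powR; apply: mf_norm; exact: (tc_mf tc (Cf n)).
  move=> t; rewrite (ger0_norm (powR_ge0 _ _)); apply: ge0_ler_powR; rewrite ?nnegrE ?(ltW q0)//.
  exact: le_trans (hM t).
apply: (@I_fatou _ _ _ nu (fun n t => `|fn (n + k0)%N t| `^ q) _ (fun=> (4 * S * A) `^ (q / 2))).
- by move=> n; exact: Lfn.
- by apply: mf_powR; apply: mf_norm; exact: hy2.1.1.
- by move=> n t; exact: powR_ge0.
- by move=> t; exact: powR_ge0.
- apply: (aE_mp fae) => t ct.
  have h1 := cvg_subseq (u := fun n => fn n t) (s := fun n => (n + k0)%N) (fun n => ltnSn _) ct.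
  exact: (cvg_powR q0 (fun n => normr_ge0 _) (cvg_absR h1)).
- move=> n.
  have -> : 4 * S * A = S * (4 * A) by ring.
  apply: hS => //; first by rewrite mulr_gt0.
  have he := emb_isL2 nufin tc (Cf (n + k0)%N).
  have hd := isL2B hy2 he.
  have := hk0 (n + k0)%N (leq_addl _ _); rewrite subr0 => /(le_trans (ler_norm _)).
  rewrite (E2_split hd) => e1.
  have p1 : 0 <= I (fun t => vf (y - emb D (fn (n + k0)%N)) t ^+ 2) by exact: I_sq_ge0.
  have La := L2v_sq hd.2; have Lb := L2v_sq hy2.2.
  apply: (@le_trans _ _ (2 * I (fun t => sq (vv (y - emb D (fn (n + k0)%N)) t)) + 2 * I (fun t => sq (vv y t)))).
    rewrite -(IZ _ La) -(IZ _ Lb) -ID; [|exact: L1Z|exact: L1Z].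
    apply: I_le; [exact: L2v_sq he.2|by apply: L1D; exact: L1Z|].
    move=> t; rewrite !vgE /=; have := sqB (vv y t) (vv y t - D (fn (n + k0)%N) t).
    by rewrite opprB addrCA subrr addr0 [X in _ <= X]addrC.
  by move: e1 p1 yA; lra.
- exact: cvg_cst.
Qed.

Variables (alpha beta : R) (b : T -> R).
Hypothesis alpha0 : 0 < alpha.
Hypothesis mb : measf b.
Hypothesis hb : forall t, alpha <= b t <= beta.

(** The exponents are parameters tied by the relations that the estimates use; [exponents] provides
    their values in R^N. *)
Theorem abstract_existence (B p th m gam rr s q S sg : R) (f : T -> R) :
  0 < B -> 0 <= p -> 0 < th -> th < 1 ->
  1 <= m -> 0 <= gam -> 0 <= rr -> 0 < q -> 1 <= s ->
  2 * rr = 2 - th + gam -> rr * q = s -> gam * m = s * (m - 1) ->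
  (m - 1) / m * (q / 2) < 1 -> 1 <= sg -> sg < 2 -> sg <= s -> (th - gam) * sg <= s * (2 - sg) ->
  0 <= S ->
  (forall (A : R) phi, 0 < A -> C phi -> I (fun t => sq (D phi t)) <= A ->
    I (fun t => `|phi t| `^ q) <= (S * A) `^ (q / 2)) ->
  L1 f -> (forall t, 0 <= f t) -> aE (fun t => 0 < f t) -> L1 (fun t => f t `^ m) ->
  exists (u : T -> R) (Du : T -> 'rV[R]_N),
  [/\ measf u /\ forall i, measf (fun t => Du t ord0 i),
      (forall t, 0 <= u t) /\ aE (fun t => 0 < u t),
      L1 (fun t => u t `^ sg) /\ forall i, L1 (fun t => `|Du t ord0 i| `^ sg),
      (forall i phi, C phi -> I (fun t => u t * D phi t ord0 i) = - I (fun t => Du t ord0 i * phi t)) /\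
      (forall e : R, 0 < e -> exists2 phi, C phi & I (fun t => `|u t - phi t| `^ sg) <= e /\
        forall i, I (fun t => `|Du t ord0 i - D phi t ord0 i| `^ sg) <= e) &
      L1 (fun t => sq (Du t) / u t `^ th) /\
      forall phi, C phi ->
        I (fun t => b t / (1 + u t) `^ p * dotr (Du t) (D phi t)) +
        B * I (fun t => sq (Du t) / u t `^ th * phi t) = I (fun t => f t * phi t)].
Proof.
move=> B0 p0 th0 th1 m1 gam0 rr0 q0 s1 rr_eq s_eq gam_eq e_lt sg1 sg2 sg_s sg_eq S0 sob Lf f0 fp Lfm.
have [K [K_C1 K_0 K_agree]] := truncated_inverses p0.
have sobH := H_sobolev q0 S0 sob.
have S40 : 0 <= 4 * S by rewrite mulr_ge0.
have K_C1' : forall k, C1fun (K k) (Kd p K k) by exact: K_C1.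
have G_0 n : Gn p th K n 0 = 0 by apply: Gn_0.
have G_lip n : exists2 L, 0 <= L & forall s t, `|Gn p th K n s - Gn p th K n t| <= L * `|s - t| by apply: Gn_lip.
have G_bdd n : exists2 M, 0 <= M & forall t, Gn p th K n t <= M by apply: Gn_bdd.
have G_mono n n' t : (n <= n')%N -> Gn p th K n t <= Gn p th K n' t by apply: Gn_mono.
have [x [ix [jx [v [g [hij hsol cv cg]]]]]] := @gradient_sequence _ _ _ nu nufin _ _ _ tc _ _ _ alpha0 mb hb
  B (Gn p th K) B0 (Gn_ge0 p th K) G_0 G_lip G_bdd G_mono f Lf f0.

have vp : aE (fun t => 0 < v t).
  eapply (@v_gt0 d T R nu nufin N C D tc alpha beta b alpha0 mb hb B p th) with (f := f); try eassumption.
have vg : aE (fun t => good K (v t)).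
  eapply (@v_good d T R nu nufin N C D tc alpha beta b alpha0 mb hb B p th) with (f := f) (m := m) (gam := gam) (rr := rr) (s := s) (q := q) (S := 4 * S); try eassumption.
have mu' : measf (ul K v) by eapply mf_ul; try eassumption.
have mDu' i : measf (fun t => Dul p K v g t ord0 i).
  eapply mDul; try eassumption.
have u0 t : 0 <= ul K v t by eapply ul_ge0 with (p := p); try eassumption.
have up : aE (fun t => 0 < ul K v t) by eapply (@ul_gt0 d T R nu nufin N C D tc alpha beta b alpha0 mb hb B p th) with (f := f) (m := m) (gam := gam) (rr := rr) (s := s) (q := q) (S := 4 * S); try eassumption.
have Lus : L1 (fun t => (1 + ul K v t) `^ s) by eapply (@L1_ul d T R nu nufin N C D tc alpha beta b alpha0 mb hb B p th) with (f := f) (m := m) (gam := gam) (rr := rr) (s := s) (q := q) (S := 4 * S); try eassumption.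
have LDu : L1 (fun t => nrm (Dul p K v g t) `^ sg).
  eapply (@L1_Dul d T R nu nufin N C D tc alpha beta b alpha0 mb hb B p th) with (f := f) (m := m) (gam := gam) (rr := rr) (s := s) (q := q) (S := 4 * S) (sg := sg); try eassumption.
have LP : L1 (Phi B p th K v g) by eapply (@L1_Phi d T R nu nufin N C D tc alpha beta b alpha0 mb hb B p th) with (f := f) (m := m) (gam := gam) (rr := rr) (s := s) (q := q) (S := 4 * S); try eassumption.
have PE t : 0 < v t -> good K (v t) -> Phi B p th K v g t = B * (sq (Dul p K v g t) / ul K v t `^ th).
  eapply Phi_ul; try eassumption.
have wg phi i : C phi -> I (fun t => ul K v t * D phi t ord0 i) = - I (fun t => Dul p K v g t ord0 i * phi t).
  eapply (@weak_grad d T R nu nufin N C D tc alpha beta b alpha0 mb hb B p th) with (f := f) (m := m) (gam := gam) (rr := rr) (s := s) (q := q) (S := 4 * S) (sg := sg); try eassumption.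
have ap (e : R) : 0 < e -> exists2 phi, C phi & I (fun t => `|ul K v t - phi t| `^ sg) <= e /\
    forall i, I (fun t => `|Dul p K v g t ord0 i - D phi t ord0 i| `^ sg) <= e.
  eapply (@C_approx d T R nu nufin N C D tc alpha beta b alpha0 mb hb B p th) with (f := f) (m := m) (gam := gam) (rr := rr) (s := s) (q := q) (S := 4 * S) (sg := sg); try eassumption.
have eqn phi : C phi -> I (fun t => b t * dotr (g t) (D phi t)) + I (fun t => Phi B p th K v g t * phi t) = I (fun t => f t * phi t).
  eapply (@equation d T R nu nufin N C D tc alpha beta b alpha0 mb hb B p th) with (f := f) (m := m) (gam := gam) (rr := rr) (s := s) (q := q) (S := 4 * S) (sg := sg); try eassumption.
have sg0 : 0 < sg by lra.
have mr : measf (fun t => sq (Dul p K v g t) / ul K v t `^ th).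
  apply: mfM; first by apply: mf_sum => i; exact: mfM.
  under [X in measf X]eq_fun do rewrite -powRN.
  exact: mf_powR.
have PEa : aE (fun t => Phi B p th K v g t = B * (sq (Dul p K v g t) / ul K v t `^ th)).
  by apply: (aE_mp2 vp vg) => t; exact: PE.
exists (ul K v), (Dul p K v g); split=> //.
- split.
    apply: (L1_dom _ Lus) => [|t]; first exact: mf_powR.
    rewrite ger0_norm ?powR_ge0//; apply: (@le_trans _ _ ((1 + ul K v t) `^ sg)).
      by apply: ge0_ler_powR; rewrite ?nnegrE ?addr_ge0 ?(ltW sg0) ?lerDr.
    by apply: ler_powR; rewrite ?lerDl.
  move=> i; apply: (L1_dom _ LDu) => [|t]; first by apply: mf_powR; exact: mf_norm.
  rewrite ger0_norm ?powR_ge0//; apply: ge0_ler_powR; rewrite ?nnegrE ?(ltW sg0) ?nrm_ge0//.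
  exact: Dul_coord.
- by split=> [i phi|e e0]; [exact: wg|exact: ap].
- split.
    apply: (L1_dom_ae mr (L1Z B^-1 LP)); apply: (aE_mp PEa) => t ->.
    by rewrite mulKf ?gt_eqF// ger0_norm// divr_ge0 ?sq_ge0 ?powR_ge0.
  move=> phi Cphi; rewrite -(eqn _ Cphi); congr (_ + _).
    apply: (I_eq nu) => t; rewrite /Dul dotrZl -mulrA mulKf// gt_eqF// powR_gt0//.
    by rewrite ltr_pwDl.
  have mphi := tc_mf tc Cphi.
  have [Mp hMp] := tc_bdd tc Cphi.
  have L : L1 (fun t => Phi B p th K v g t * phi t).
    by apply: L1_eq (L1_bM mphi hMp LP) => t; exact: mulrC.
  have e : aE (fun t => sq (Dul p K v g t) / ul K v t `^ th * phi t = B^-1 * (Phi B p th K v g t * phi t)).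
    by apply: (aE_mp PEa) => t ->; rewrite -(mulrA B) mulKf ?gt_eqF.
  rewrite (I_eq_ae _ _ e); [|exact: mfM|by apply: mfM; [exact: mf_cst|exact: L1_mf L]].
  by rewrite IZ// mulVKf ?gt_eqF.
Qed.

End existence.

(** * Integration along lines and Gagliardo's inequality *)

Section bounded_support.
Context {d : measure_display} {T : measurableType d} {R : realType}.
Variable m : {measure set T -> \bar R}.
Implicit Types (A : set T) (F G : T -> R).

(** A class preserved by integration in one variable, and on which Fubini's theorem holds without
    further conditions when [A] has finite measure. *)
Definition bca A F := [/\ measf F, exists M, forall x, `|F x| <= M & forall x, F x != 0 -> A x].

Lemma bca_ge0_bound A F : bca A F -> exists M, 0 <= M /\ forall x, `|F x| <= M * \1_A x.
Proof.
move=> [_ [M hM] sF]; exists (Num.max M 0); split; first by rewrite le_max lexx orbT.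
move=> x; have [->|/sF Ax] := eqVneq (F x) 0.
  by rewrite normr0 mulr_ge0// ?le_max ?lexx ?orbT// indicE.
by rewrite indicE mem_set//= mulr1 le_max hM.
Qed.

Lemma L1_ind A : measurable A -> (m A < +oo)%E -> L1 m (\1_A : T -> R).
Proof.
move=> mA fA; apply/integrableP; split; first exact/measurable_EFinP/mf_ind.
under eq_integral do rewrite /= ger0_norm ?indicE ?ler0n//.
rewrite (_ : (fun x => _) = (fun x => (\1_A x)%:E)); last by apply/funext => x; rewrite indicE.
by rewrite integral_indic// setIT.
Qed.

Lemma I_ind A : measurable A -> I m (\1_A : T -> R) = fine (m A).
Proof. by move=> mA; rewrite IE /Rintegral integral_indic// setIT. Qed.

Lemma bca_L1 A F : measurable A -> (m A < +oo)%E -> bca A F -> L1 m F.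
Proof.
move=> mA fA bF; have [M [M0 hM]] := bca_ge0_bound bF.
have L : L1 m (fun x => M * \1_A x).
  by apply: L1Z; exact: L1_ind.
by apply: (L1_dom _ L) => //; case: bF.
Qed.

End bounded_support.

Section fubini_bounded.
Context {d1 d2 : measure_display} {T1 : measurableType d1} {T2 : measurableType d2} {R : realType}.
Variables (m1 : {sigma_finite_measure set T1 -> \bar R}) (m2 : {sigma_finite_measure set T2 -> \bar R}).
Variables (A1 : set T1) (A2 : set T2).
Hypotheses (mA1 : measurable A1) (mA2 : measurable A2) (fA1 : (m1 A1 < +oo)%E) (fA2 : (m2 A2 < +oo)%E).
Variable F : T1 * T2 -> R.
Hypothesis bF : bca (A1 `*` A2) F.

Lemma bca_slice1 x : bca A2 (fun y => F (x, y)).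
Proof.
have [mF [M hM] sF] := bF; split; [|by exists M|by move=> y /sF[]].
exact: measurableT_comp.
Qed.

Lemma bca_slice2 y : bca A1 (fun x => F (x, y)).
Proof.
have [mF [M hM] sF] := bF; split; [|by exists M|by move=> x /sF[]].
exact: measurableT_comp.
Qed.

Lemma prod_L1 : L1 (m1 \x m2)%E F.
Proof.
apply: bca_L1 bF; first exact: measurableX.
rewrite [ltLHS](_ : _ = m1 A1 * m2 A2)%E; last exact: product_measure1E.
by rewrite lte_mul_pinfty// ge0_fin_numE.
Qed.

Lemma bca_int2 : bca A1 (fun x => I m2 (fun y => F (x, y))).
Proof.
have [M [M0 hM]] := bca_ge0_bound bF; split.
- have h := measurable_fubini_F prod_L1.
  have -> : (fun x => I m2 (fun y => F (x, y))) = fine \o (fun x => \int[m2]_y (F (x, y))%:E)%E.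
    by apply/funext => x; rewrite IE.
  exact: measurableT_comp.
- exists (M * fine (m2 A2)) => x.
  have Lx := bca_L1 mA2 fA2 (bca_slice1 x).
  apply: (le_trans (norm_I Lx)).
  have Li : L1 m2 (\1_A2 : T2 -> R) by exact: L1_ind.
  rewrite -I_ind// -IZ//; apply: I_le; [exact: L1_norm|exact: L1Z|].
  move=> y; apply: (le_trans (hM (x, y))); rewrite ler_wpM2l//.
  by rewrite !indicE in_setX/=; case: (x \in A1).
- move=> x; apply: contra_neqP => nA; rewrite -(I_0 m2); apply: I_eq => y.
  have [_ _ sF] := bF.
  by apply/eqP; apply/negP => /negP /sF[].
Qed.

Lemma bca_int1 : bca A2 (fun y => I m1 (fun x => F (x, y))).
Proof.
have [M [M0 hM]] := bca_ge0_bound bF; split.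
- have h := measurable_fubini_G prod_L1.
  have -> : (fun y => I m1 (fun x => F (x, y))) = fine \o (fun y => \int[m1]_x (F (x, y))%:E)%E.
    by apply/funext => x; rewrite IE.
  exact: measurableT_comp.
- exists (M * fine (m1 A1)) => y.
  have Lx := bca_L1 mA1 fA1 (bca_slice2 y).
  apply: (le_trans (norm_I Lx)).
  have Li : L1 m1 (\1_A1 : T1 -> R) by exact: L1_ind.
  rewrite -I_ind// -IZ//; apply: I_le; [exact: L1_norm|exact: L1Z|].
  move=> x; apply: (le_trans (hM (x, y))); rewrite ler_wpM2l//.
  by rewrite !indicE in_setX/= andbC; case: (y \in A2).
- move=> y; apply: contra_neqP => nA; rewrite -(I_0 m1); apply: I_eq => x.
  have [_ _ sF] := bF.
  by apply/eqP; apply/negP => /negP /sF[].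
Qed.

Lemma fubini12 : I m1 (fun x => I m2 (fun y => F (x, y))) = I (m1 \x m2)%E F.
Proof.
rewrite !IE /Rintegral -(integral12_prod_meas1 prod_L1).
congr fine; apply: eq_integral => x _.
by rewrite -(EI (bca_L1 mA2 fA2 (bca_slice1 x))).
Qed.

Lemma fubini21 : I m2 (fun y => I m1 (fun x => F (x, y))) = I (m1 \x m2)%E F.
Proof.
rewrite !IE /Rintegral -(integral21_prod_meas1 prod_L1).
congr fine; apply: eq_integral => x _.
by rewrite -(EI (bca_L1 mA1 fA1 (bca_slice2 x))).
Qed.

End fubini_bounded.

Section tuples.
Context {R : realType}.
Local Notation mR := (measurableTypeR R).
Local Notation leb := (@lebesgue_measure R).
Local Notation tl := (@tuple_lebesgue R).

Definition seg (L : R) : set mR := [set s | `|s| <= L].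
Definition box n (L : R) : set (n.-tuple mR) := [set x | forall i, seg L (tnth x i)].

Lemma segE L : seg L = `[- L, L]%classic.
Proof. by apply/seteqP; split=> s; rewrite /seg/= in_itv/= ler_norml. Qed.

Lemma mseg L : measurable (seg L).
Proof. by rewrite segE; exact: measurable_itv. Qed.

Lemma fseg L : (leb (seg L) < +oo)%E.
Proof. by rewrite segE lebesgue_measure_itv/=; case: ifP => _; rewrite ?ltry// -EFinB ltry. Qed.

Lemma mbox n L : measurable (@box n L).
Proof.
have -> : @box n L = \bigcap_(i in [set: 'I_n]) ((fun t => tnth t i) @^-1` seg L).
  by apply/seteqP; split => t h; [move=> i _; exact: h|move=> i; exact: h].
apply: fin_bigcap_measurable => // i _.
rewrite -[X in measurable X]setTI; apply: measurable_tnth => //; exact: mseg.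
Qed.

Lemma fbox n L : (tl n (@box n L) < +oo)%E.
Proof.
rewrite /box (tuple_lebesgue_box (A := fun=> seg L)) => [|i]; last exact: mseg.
suff : (0 <= \prod_(i < n) leb (seg L))%E /\ (\prod_(i < n) leb (seg L) < +oo)%E by case.
apply: (big_ind (fun x : \bar R => (0 <= x)%E /\ (x < +oo)%E)); first by rewrite ltry lee01.
  by move=> x y [x0 xo] [y0 yo]; rewrite mule_ge0//; split=> //; rewrite lte_mul_pinfty// ge0_fin_numE.
by move=> i _; split; [exact: measure_ge0|exact: fseg].
Qed.

Definition bct n L (F : n.-tuple mR -> R) := bca (@box n L) F.

Lemma bct_L1 n L (F : n.-tuple mR -> R) : bct L F -> L1 (tl n) F.
Proof. by apply: bca_L1; [exact: mbox|exact: fbox]. Qed.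

Lemma bct_cons n L (F : n.+1.-tuple mR -> R) : bct L F ->
  bca (seg L `*` @box n L) (F \o @tuple_cons R n).
Proof.
move=> [mF [M hM] sF]; split.
- by apply: measurableT_comp => //; exact: measurable_tuple_cons.
- by exists M => x; exact: hM.
- move=> [s t] /= /sF h; split => /=; first by have := h ord0.
  by move=> i; have := h (lift ord0 i); rewrite tnthS.
Qed.

Lemma I_cons n L (F : n.+1.-tuple mR -> R) : bct L F ->
  I (tl n.+1) F = I (leb \x tl n)%E (F \o @tuple_cons R n).
Proof.
move=> bF; have mc := @measurable_tuple_cons R n; have [mF _ _] := bF.
rewrite !IE /Rintegral; congr fine.
rewrite /= /cons_measure.
have L1F := prod_L1 (mseg L) (@mbox n L) (fseg L) (@fbox n L) (bct_cons bF).
transitivity (\int[pushforward (@lebesgue_measure R \x (tl n))%E (@tuple_cons R n)]_x (F x)%:E)%E; first by [].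
rewrite (integral_pushforward mc)//; exact/measurable_EFinP.
Qed.

Lemma tuple_fubini12 n L (F : n.+1.-tuple mR -> R) : bct L F ->
  I (tl n.+1) F = I leb (fun s => I (tl n) (fun t => F (tuple_cons (s, t)))).
Proof.
move=> bF; rewrite (I_cons bF); apply/esym.
exact: (fubini12 (mseg L) (@mbox n L) (fseg L) (@fbox n L) (bct_cons bF)).
Qed.

Lemma tuple_fubini21 n L (F : n.+1.-tuple mR -> R) : bct L F ->
  I (tl n.+1) F = I (tl n) (fun t => I leb (fun s => F (tuple_cons (s, t)))).
Proof.
move=> bF; rewrite (I_cons bF); apply/esym.
exact: (fubini21 (mseg L) (@mbox n L) (fseg L) (@fbox n L) (bct_cons bF)).
Qed.

Definition line n (x : n.-tuple mR) (i : 'I_n) (s : R) : n.-tuple mR :=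
  [tuple if j == i then s else tnth x j | j < n].

Lemma line0 n s (t : n.-tuple mR) s' : line (tuple_cons (s, t)) ord0 s' = tuple_cons (s', t).
Proof.
apply: eq_from_tnth => j; rewrite tnth_mktuple.
by case: (unliftP ord0 j) => [k ->|->]; rewrite ?eqxx//= !tnthS.
Qed.

Lemma lineS n s (t : n.-tuple mR) i s' :
  line (tuple_cons (s, t)) (lift ord0 i) s' = tuple_cons (s, line t i s').
Proof.
apply: eq_from_tnth => j; rewrite tnth_mktuple.
case: (unliftP ord0 j) => [k ->|->] //=.
by rewrite !tnthS tnth_mktuple (inj_eq (@lift_inj _ ord0)).
Qed.

Lemma tuple_consE n (x : n.+1.-tuple mR) : x = tuple_cons (thead x, [tuple of behead x]).
Proof. by rewrite {1}(tuple_eta x). Qed.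

(** If the coordinate i is the first one, it is integrated innermost; otherwise the first coordinate
    is split off and the induction applies to the slices. *)
Lemma line_int0 n L (F : n.-tuple mR -> R) i : bct L F ->
  (forall x, I leb (fun s => F (line x i s)) = 0) -> I (tl n) F = 0.
Proof.
elim: n F i => [F [] //|n ih F i bF h]; have bc := bct_cons bF.
case: (unliftP ord0 i) h => [k ->|->] h.
  rewrite (tuple_fubini12 bF) -(I_0 leb); apply: I_eq => s; apply: (ih _ k).
    exact: (bca_slice1 bc).
  by move=> t; rewrite -(h (tuple_cons (s, t))); apply: I_eq => s'; rewrite lineS.
rewrite (tuple_fubini21 bF) -(I_0 (tl n)); apply: I_eq => t.
by rewrite -(h (tuple_cons (0, t))); apply: I_eq => s'; rewrite line0.
Qed.

End tuples.

Section hoelder_I.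
Context {d : measure_display} {T : measurableType d} {R : realType}.
Variable m : {measure set T -> \bar R}.
Implicit Types (A : set T) (f g : T -> R).

Lemma LnormE f (p : R) : L1 m (fun x => `|f x| `^ p) ->
  Lnorm m p%:E (EFin \o f) = (I m (fun x => `|f x| `^ p) `^ p^-1)%:E.
Proof.
by move=> L; rewrite unlock /Lnorm -poweR_EFin -(EI L); congr poweR; apply: eq_integral.
Qed.

Lemma I_hoelder f g (p q : R) : measf f -> measf g -> (forall x, 0 <= f x) -> (forall x, 0 <= g x) ->
  0 < p -> 0 < q -> p^-1 + q^-1 = 1 -> L1 m (fun x => f x `^ p) -> L1 m (fun x => g x `^ q) ->
  L1 m (fun x => f x * g x) ->
  I m (fun x => f x * g x) <= I m (fun x => f x `^ p) `^ p^-1 * I m (fun x => g x `^ q) `^ q^-1.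
Proof.
move=> mf mg f0 g0 p0 q0 pq Lf Lg Lfg.
have ef : (fun x => `|f x| `^ p) = (fun x => f x `^ p) by apply/funext => x; rewrite ger0_norm.
have eg : (fun x => `|g x| `^ q) = (fun x => g x `^ q) by apply/funext => x; rewrite ger0_norm.
have := hoelder m mf mg p0 q0 pq; rewrite Lnorm1 !LnormE ?ef ?eg// -EFinM.
rewrite (_ : (\int[m]_x _)%E = (I m (fun x => f x * g x))%:E) ?lee_fin// -(EI Lfg).
by apply: eq_integral => x _; rewrite /= ger0_norm// mulr_ge0.
Qed.

Lemma bcaM A f g : bca A f -> bca A g -> bca A (fun x => f x * g x).
Proof.
move=> [mf [M hM] sf] [mg [M' hM'] sg]; split; [exact: mfM| |].
  by exists (M * M') => x; rewrite normrM ler_pM.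
by move=> x; rewrite mulf_eq0 negb_or => /andP[/sf].
Qed.

Lemma bca_pow A f (c : R) : 0 < c -> bca A f -> (forall x, 0 <= f x) -> bca A (fun x => f x `^ c).
Proof.
move=> c0 [mf [M hM] sf] f0; split; first exact: mf_powR.
  exists (M `^ c) => x; rewrite ger0_norm ?powR_ge0//; apply: ge0_ler_powR; rewrite ?nnegrE ?(ltW c0)//.
    exact: le_trans (hM x).
  by rewrite -[leLHS]ger0_norm.
by move=> x; rewrite powR_eq0 (gt_eqF c0) andbT => /sf.
Qed.

End hoelder_I.

Section gagliardo.
Context {R : realType}.
Local Notation mR := (measurableTypeR R).
Local Notation leb := (@lebesgue_measure R).
Local Notation tl := (@tuple_lebesgue R).

(** One function [F] serves all directions; in the application it bounds every partial derivative of
    [Psi]. *)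
Definition line_bound n (F Psi : n.-tuple mR -> R) :=
  forall x i, Psi x <= I leb (fun s => F (line x i s)).

Section step.
Variables (n : nat) (L : R) (F Psi : n.+2.-tuple mR -> R).
Hypotheses (bF : bct L F) (bP : bct L Psi).
Hypotheses (F0 : forall x, 0 <= F x) (P0 : forall x, 0 <= Psi x).
Hypothesis hl : line_bound F Psi.

Let Fs s t := F (tuple_cons (s, t)).
Let Ps s t := Psi (tuple_cons (s, t)).
Let Phi t := I leb (fun s => Fs s t).
Let c : R := n.+1%:R^-1.
Let c0 : 0 < c. Proof. by rewrite invr_gt0. Qed.

Let bFs s : bct L (Fs s). Proof. exact: (bca_slice1 (bct_cons bF) s). Qed.
Let bPs s : bct L (Ps s). Proof. exact: (bca_slice1 (bct_cons bP) s). Qed.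
Let bPhi : bct L Phi.
Proof. exact: (bca_int1 (mseg L) (@mbox R n.+1 L) (fseg L) (@fbox R n.+1 L) (bct_cons bF)). Qed.
Let Phi0 t : 0 <= Phi t. Proof. by apply: I_ge0 => s; exact: F0. Qed.
Let IPhi : I (tl n.+1) Phi = I (tl n.+2) F. Proof. by rewrite (tuple_fubini21 bF). Qed.
Let PsPhi s t : Ps s t <= Phi t.
Proof. by have := hl (tuple_cons (s, t)) ord0; under [X in _ <= X]I_eq do rewrite line0. Qed.

Lemma line_bound_slice s : line_bound (Fs s) (Ps s).
Proof.
move=> t i; have := hl (tuple_cons (s, t)) (lift ord0 i).
by under [X in _ <= X]I_eq do rewrite lineS.
Qed.

(** Integration along the first direction gives Psi <= Phi, a function of the other variables only,
    hence Psi^(1 + c) <= Phi^c Psi. The assumption estimates the slices of the latter, and it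
    remains to integrate in the first variable. *)
Lemma gns_step : (forall s, I (tl n.+1) (fun t => Phi t `^ c * Ps s t) <=
    I (tl n.+2) F `^ c * I (tl n.+1) (Fs s)) ->
  I (tl n.+2) (fun x => Psi x `^ (1 + c)) <= I (tl n.+2) F `^ (1 + c).
Proof.
move=> hs; have c1 : 0 < 1 + c by rewrite ltr_pwDl// ltW.
have bP' := bca_pow c1 bP P0.
have X0 : 0 <= I (tl n.+2) F by exact: I_ge0.
rewrite (tuple_fubini12 bP') powRD; last by rewrite gt_eqF.
rewrite powRr1// mulrC.
have bQ := bca_int2 (mseg L) (@mbox R n.+1 L) (fseg L) (@fbox R n.+1 L) (bct_cons bP').
have bG := bca_int2 (mseg L) (@mbox R n.+1 L) (fseg L) (@fbox R n.+1 L) (bct_cons bF).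
have LG := bca_L1 (mseg L) (fseg L) bG.
rewrite {2}(tuple_fubini12 bF) -IZ//; apply: I_le; [exact: (bca_L1 (mseg L) (fseg L) bQ)|exact: L1Z|].
move=> s /=; apply: le_trans (hs s).
have bPc := bca_pow c0 bPhi Phi0.
apply: I_le.
- by apply: bct_L1; exact: (bca_slice1 (bct_cons bP') s).
- by apply: bct_L1; exact: bcaM bPc (bPs s).
move=> t; rewrite powRD; last by rewrite gt_eqF.
rewrite powRr1// mulrC ler_wpM2r//; apply: ge0_ler_powR; rewrite ?nnegrE ?(ltW c0)//.
exact: PsPhi.
Qed.

End step.

Lemma gns1 L (F Psi : 1.-tuple mR -> R) : bct L F -> line_bound F Psi -> forall x, Psi x <= I (tl 1) F.
Proof.
move=> bF hl x; apply: (le_trans (hl x ord0)); rewrite (tuple_fubini12 bF) le_eqVlt; apply/orP; left.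
apply/eqP/I_eq => s; have [mF _ _] := bca_slice1 (bct_cons bF) s.
rewrite IE /Rintegral /= integral_dirac//; last exact/measurable_EFinP.
rewrite diracT mul1e/= [x in line x _ _]tuple_consE line0; congr (F (tuple_cons (s, _))).
by rewrite [LHS]tuple0.
Qed.

(** In dimension N >= 3, Hoelder's inequality on each slice with exponents N - 1 and (N - 1) / (N -
    2) separates Phi from Psi, and the induction hypothesis in dimension N - 1 bounds the second
    factor. In dimension 2 a slice of Psi is bounded outright by the integral of [F] over that
    slice. *)
Theorem gns n L (F Psi : n.+2.-tuple mR -> R) : bct L F -> bct L Psi ->
  (forall x, 0 <= F x) -> (forall x, 0 <= Psi x) -> line_bound F Psi ->
  I (tl n.+2) (fun x => Psi x `^ (1 + n.+1%:R^-1)) <= I (tl n.+2) F `^ (1 + n.+1%:R^-1).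
Proof.
elim: n F Psi => [|n ih] F Psi bF bP F0 P0 hl; apply: (gns_step bF bP) => // s;
  have bFs := bca_slice1 (bct_cons bF) s; have bPs := bca_slice1 (bct_cons bP) s;
  have hls := line_bound_slice hl s;
  have bPhi := bca_int1 (mseg L) (@mbox R _ L) (fseg L) (@fbox R _ L) (bct_cons bF);
  have Phi0 t : 0 <= I leb (fun s => F (tuple_cons (s, t))) by exact: I_ge0.
- rewrite invr1 powRr1 ?I_ge0//.
  rewrite (tuple_fubini21 bF) [leRHS]mulrC -IZ; last exact: bct_L1 bPhi.
  apply: I_le.
  + under [X in L1 _ X]eq_fun do rewrite powRr1//.
    by apply: bct_L1; exact: bcaM bPhi bPs.
  + by apply: L1Z; exact: bct_L1 bPhi.
  move=> t; rewrite powRr1// mulrC ler_wpM2r//.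
  exact: (gns1 bFs hls).
- set p : R := n.+2%:R.
  have p0 : 0 < p by rewrite ltr0n.
  pose q : R := 1 + n.+1%:R^-1.
  have n0 : 0 < n.+1%:R :> R by rewrite ltr0n.
  have pE : p = 1 + n.+1%:R by rewrite /p -natr1 addrC.
  have q0 : 0 < q by rewrite ltr_pwDl// invr_ge0 ltW.
  have pq : p^-1 + q^-1 = 1.
    by rewrite pE /q; field; rewrite !gt_eqF// ?addr_gt0.
  have bPc := bca_pow (c := p^-1) _ bPhi Phi0.
  have IF0 t : 0 <= I leb (fun s => F (tuple_cons (s, t))) `^ p^-1 by exact: powR_ge0.
  have h := @I_hoelder _ _ _ (tl n.+2) (fun t => I leb (fun s => F (tuple_cons (s, t))) `^ p^-1)
    (fun t => Psi (tuple_cons (s, t))) p q.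
  apply: (le_trans (h _ _ _ _ p0 q0 pq _ _ _)) => //.
  + by have [] := bPc (eqbRL (invr_gt0 p) p0).
  + by have [] := bPs.
  + under [X in L1 _ X]eq_fun do rewrite -powRrM mulVf ?gt_eqF// powRr1//.
    exact: bct_L1 bPhi.
  + by apply: bct_L1; apply: (bca_pow q0 bPs) => t; exact: P0.
  + by apply: bct_L1; apply: bcaM bPs; apply: bPc; rewrite invr_gt0.
  rewrite (_ : I _ (fun x => _) = I (tl n.+3) F); last first.
    by rewrite (tuple_fubini21 bF); apply: I_eq => t; rewrite -powRrM mulVf ?gt_eqF// powRr1.
  rewrite ler_wpM2l ?powR_ge0//.
  have I0 : 0 <= I (tl n.+2) (fun t => F (tuple_cons (s, t))) by exact: I_ge0.
  have e (y : R) : 0 <= y -> y = (y `^ q) `^ q^-1 by move=> y0; rewrite -powRrM divff ?gt_eqF// powRr1.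
  rewrite [leRHS](e _ I0).
  apply: ge0_ler_powR; rewrite ?nnegrE ?invr_ge0 ?(ltW q0) ?powR_ge0//.
    by apply: I_ge0 => t; exact: powR_ge0.
  by apply: (ih _ _ bFs bPs) => // t; [exact: F0|exact: P0].
Qed.

End gagliardo.

(** * Borel sets and C^1 functions of N variables *)

Section restriction.
Context {d : measure_display} {T : measurableType d} {R : realType}.
Variables (mu : {measure set T -> \bar R}) (O : set T) (mO : measurable O).
Let nu := mrestr mu mO.

(** [mu] is the sum of its restrictions to [O] and to the complement, each of which vanishes on the
    other set. *)
Lemma ge0_integral_restr (f : T -> \bar R) : measurable_fun setT f -> (forall x, 0 <= f x)%E ->
  (\int[nu]_x f x = \int[mu]_(x in O) f x)%E.
Proof.
move=> mf f0; have mC := measurableC mO.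
have null (O' D : set T) (mO' : measurable O') : measurable D -> O' `&` D = set0 ->
    (\int[mrestr mu mO']_(x in D) f x = 0)%E.
  move=> mD OD; apply: null_set_integral => //; first exact: measurable_funTS.
  by change (mu (D `&` O') = 0%E); rewrite setIC OD measure0.
have -> : (\int[mu]_(x in O) f x = \int[measure_add (mrestr mu mO) (mrestr mu mC)]_(x in O) f x)%E.
  apply: eq_measure_integral => A mA _; apply: (eq_trans _ (esym (measure_addE _ _ A))).
  change (mu A = mu (A `&` O) + mu (A `&` ~` O))%E.
  rewrite -measureU ?setIUr ?setUv ?setIT//; try exact: measurableI.
    by rewrite -setIUr setUv setIT.
  by rewrite setIACA setICr setI0.
rewrite ge0_integral_measure_add//; last exact: measurable_funTS.
rewrite (null _ _ mC)// ?setICl// adde0 -(setUv O) ge0_integral_setU//.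
- by rewrite (null _ (~` O) mO)// ?setICr// adde0.
- by rewrite setUv.
- by apply/disj_set2P; rewrite setICr.
Qed.

Lemma L1_restr f : measf f -> L1 nu f <-> mu.-integrable O (EFin \o f).
Proof.
move=> mf; have h := @ge0_integral_restr (fun x => `|(f x)%:E|)%E.
have e : (\int[nu]_x `|(f x)%:E| = \int[mu]_(x in O) `|(f x)%:E|)%E.
  by apply: h => //; apply/measurable_EFinP; exact: mf_norm.
split=> /integrableP[_ hf]; apply/integrableP; split; rewrite -?e// ?e//.
  by apply: measurable_funTS; exact/measurable_EFinP.
exact/measurable_EFinP.
Qed.

Lemma I_restr f : measf f -> I nu f = \int[mu]_(x in O) f x.
Proof.
move=> mf; rewrite IE /Rintegral; congr fine; have mf' : measurable_fun setT (EFin \o f) by exact/measurable_EFinP.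
rewrite integralE [RHS]integralE; congr (_ - _)%E; apply: ge0_integral_restr => //.
  exact: measurable_funepos.
exact: measurable_funeneg.
Qed.

Lemma ae_restr (P : T -> Prop) : {ae mu, forall x, O x -> P x} <-> aE nu P.
Proof.
split=> [[A [mA A0 hA]]|[A [mA A0 hA]]].
  exists (A `|` ~` O); split; first by apply: measurableU => //; exact: measurableC.
    rewrite /nu /= /mrestr setIUl setICl setU0; apply/eqP; rewrite -measure_le0 -A0.
    by apply: le_measure; rewrite ?inE//; exact: measurableI.
  move=> x nP; have [Ox|nO] := pselect (O x); last by right.
  by left; apply: hA => h; exact: nP (h Ox).
exists (A `&` O); split => //; first exact: measurableI.
by move=> x /not_implyP[Ox nP]; split=> //; exact: hA.
Qed.

End restriction.

Section borel.
Context {R : realType} {N : nat}.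
Local Notation V := 'rV[R]_N.
Local Notation BV := (borel_rV R N).
Local Notation mR := (measurableTypeR R).

Definition cube (c : V) (r : R) : set V := [set x | forall i, `|x ord0 i - c ord0 i| < r].

Lemma measurable_coord i : measurable_fun setT (fun x : BV => (x : V) ord0 i : mR).
Proof.
move=> _ A mA; rewrite setTI; apply: sub_sigma_algebra.
rewrite -bigcup_seq/=; exists i => /=; first by rewrite mem_index_enum.
by exists A => //; rewrite setTI.
Qed.

Lemma measurable_cube c r : measurable (cube c r : set BV).
Proof.
have -> : (cube c r : set BV) = \bigcap_(i in [set: 'I_N]) ((fun x : BV => (x : V) ord0 i : mR) @^-1` `](c ord0 i - r), (c ord0 i + r)[%classic).
  apply/seteqP; split => t h; [move=> i _|move=> i]; have := h i; rewrite /= in_itv/= ltr_distl//.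
  by apply.
apply: fin_bigcap_measurable => // i _; rewrite -[X in measurable X]setTI.
by apply: measurable_coord => //; exact: measurable_itv.
Qed.

Lemma cube_ball c r : 0 < r -> cube c r = ball c r.
Proof.
move=> r0; apply/seteqP; split=> x h.
  split=> // i j; rewrite (ord1 i); have := h j; rewrite distrC; exact.
by move=> i; have := h.2 ord0 i; rewrite /ball /= distrC.
Qed.

Lemma open_cubes (U : set V) : open U -> exists (P : set nat) (c : nat -> V) (r : nat -> R),
  (forall n, P n -> 0 < r n /\ forall x : V, (forall i, `|x ord0 i - c n ord0 i| <= r n) -> U x) /\
  U = \bigcup_(n in P) cube (c n) (r n).
Proof.
move=> oU; pose K := ('rV[rat]_N * nat)%type.
pose ck (k : K) : V := map_mx ratr k.1; pose rk (k : K) : R := k.2.+1%:R^-1.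
pose Q (k : K) := forall x : V, (forall i, `|x ord0 i - ck k ord0 i| <= rk k) -> U x.
pose k0 : K := (0, 0%N).
pose kn n : K := odflt k0 (unpickle n).
exists [set n | Q (kn n)], (fun n => ck (kn n)), (fun n => rk (kn n)); split.
  by move=> n Qn; split=> //; rewrite invr_gt0 ltr0n.
apply/seteqP; split=> x; last first.
  by move=> [n Qn hx]; apply: Qn => i; exact: ltW.
move=> Ux; have /nbhs_ballP[e /= e0 he] := open_nbhs_nbhs (conj oU Ux).
have [n hn] : exists n : nat, n.+1%:R^-1 < e / 2.
  have [n _ /(_ n (leqnn n))] := near_infty_natSinv_lt (PosNum (divr_gt0 e0 (ltr0Sn R 1))).
  by exists n.
have rn0 : 0 < n.+1%:R^-1 :> R by rewrite invr_gt0 ltr0n.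
have hq i : exists q : rat, `|x ord0 i - ratr q| < n.+1%:R^-1.
  have lt : x ord0 i - n.+1%:R^-1 < x ord0 i + n.+1%:R^-1 by rewrite ltrBlDr -addrA ltrDl addr_gt0.
  have [q] := rat_in_itvoo lt.
  by move=> /itvP h; exists q; rewrite distrC ltr_distl !h.
pose q : 'rV[rat]_N := \row_i projT1 (cid (hq i)).
have hqE i : `|x ord0 i - ratr (q ord0 i)| < n.+1%:R^-1 by rewrite mxE; case: cid.
exists (pickle ((q, n) : K)).
  rewrite /= /Q /kn pickleK/= => y hy; apply: he; rewrite -cube_ball//= => i.
  have := hy i; rewrite /ck /rk/= mxE => h2; have h1 := hqE i.
  have -> : y ord0 i - x ord0 i = (y ord0 i - ratr (q ord0 i)) - (x ord0 i - ratr (q ord0 i)) by ring.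
  apply: (le_lt_trans (ler_normB _ _)).
  by move: h1 h2 hn; set r := n.+1%:R^-1; move=> h1 h2 hn; lra.
by move=> i; rewrite /kn pickleK/= /ck /rk/= mxE.
Qed.

Lemma open_borel (U : set V) : open U -> measurable (U : set BV).
Proof.
by move=> /open_cubes[P [c [r [_ ->]]]]; apply: bigcup_measurable => n _; exact: measurable_cube.
Qed.

Lemma continuous_borel (f : V -> R) : continuous f -> measurable_fun setT (f : BV -> R).
Proof.
move=> /continuousP cf; apply: (measurability _ (RGenOInfty.measurableE R)).
move=> _ [_ [a ->] <-]; rewrite setTI; apply: open_borel; apply: cf.
by rewrite set_itvE; exact: open_gt.
Qed.

Lemma borel_id : measurable_fun setT (idfun : lebesgue_rV R N -> BV).
Proof.
move=> _ A mA; rewrite setTI preimage_id; apply: sub_caratheodory.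
exact: sub_sigma_algebra.
Qed.

Lemma borel_measf (f : V -> R) : measurable_fun setT (f : BV -> R) -> measf (f : lebesgue_rV R N -> R).
Proof. by move=> mf; exact: (measurableT_comp mf borel_id). Qed.

Lemma lebesgueN_borel (A : set BV) : measurable A -> @lebesgueN R N A = borel_lebesgue A.
Proof. by move=> mA; exact: measurable_mu_extE. Qed.

(** Iterated integration is reached through Borel functions: the map from tuples to rows is shown to
    be measurable for the Borel sigma-algebra, not for its completion. *)
Lemma ge0_integral_lebesgueN (h : BV -> \bar R) : measurable_fun setT h -> (forall x, 0 <= h x)%E ->
  (\int[@lebesgueN R N]_x (h (x : V)) = \int[tuple_lebesgue N]_t h (row_of_tuple t))%E.
Proof.
move=> mh h0.
transitivity (\int[pushforward (@lebesgueN R N) (idfun : lebesgue_rV R N -> BV)]_x h x)%E.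
  by rewrite (ge0_integral_pushforward borel_id).
transitivity (\int[borel_lebesgue]_x h x)%E.
  have mi := borel_id.
  by apply: eq_measure_integral => A mA _; exact: lebesgueN_borel.
by rewrite (ge0_integral_pushforward (@measurable_row_of_tuple R N)).
Qed.

Lemma I_lebesgueN (h : V -> R) : measurable_fun setT (h : BV -> R) ->
  I (@lebesgueN R N) h = I (tuple_lebesgue N) (fun t => h (row_of_tuple t)).
Proof.
move=> mh; rewrite !IE /Rintegral; congr fine; rewrite integralE [RHS]integralE.
have mh' : measurable_fun setT (EFin \o (h : BV -> R)) by exact/measurable_EFinP.
congr (_ - _)%E.
  by apply: (etrans (ge0_integral_lebesgueN (measurable_funepos mh') (fun x => funepos_ge0 _ x))); apply: eq_integral => t _; rewrite ?funeposE ?funenegE.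
by apply: (etrans (ge0_integral_lebesgueN (measurable_funeneg mh') (fun x => funeneg_ge0 _ x))); apply: eq_integral => t _; rewrite ?funeposE ?funenegE.
Qed.

Lemma bounded_coord (O : set V) : bounded_set O -> exists L : R, forall x, O x -> forall i, `|x ord0 i| <= L.
Proof.
move=> [M [Mr hM]]; exists (`|M| + 1) => x Ox i.
have := hM (`|M| + 1) _ x Ox; rewrite (le_lt_trans (ler_norm M)) ?ltrDl// => /(_ isT) /=.
rewrite [X in X <= _ -> _]/Num.Def.normr /= mx_normrE; apply: le_trans.
exact: (le_bigmax _ _ (ord0, i)).
Qed.

Lemma lebesgueN_bounded (O : set V) : bounded_set O -> measurable (O : set (lebesgue_rV R N)) ->
  (@lebesgueN R N O < +oo)%E.
Proof.
move=> bO mO; have [M [Mr hM]] := bO.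
have [L hL] := bounded_coord bO.
have mB : measurable ([set x : V | forall i, seg L (x ord0 i)] : set BV).
  have -> : ([set x : V | forall i, seg L (x ord0 i)] : set BV) =
      \bigcap_(i in [set: 'I_N]) ((fun x : BV => (x : V) ord0 i : mR) @^-1` seg L).
    by apply/seteqP; split => t h; [move=> i _; exact: h|move=> i; exact: h].
  apply: fin_bigcap_measurable => // i _; rewrite -[X in measurable X]setTI.
  by apply: measurable_coord => //; exact: mseg.
have : (@lebesgueN R N [set x : V | forall i, seg L (x ord0 i)] < +oo)%E.
  rewrite (lebesgueN_box (A := fun=> seg L)); last by move=> i; exact: mseg.
  have := fbox N L; rewrite /box (tuple_lebesgue_box (A := fun=> seg L))// => i; exact: mseg.
apply: le_lt_trans; apply: le_measure; rewrite ?inE//.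
by have := borel_id measurableT mB; rewrite setTI.
Qed.

End borel.

Section C1v.
Context {R : realType} {N : nat}.
Local Notation V := 'rV[R]_N.
Implicit Types (f g : V -> R) (O : set V).

Definition C1v f := (forall x, differentiable f x) /\ forall i, continuous (partial i f).

Lemma C1v_cont f : C1v f -> continuous f.
Proof. by move=> [df _] x; exact: differentiable_continuous. Qed.

Lemma partial_lin (a : R) f g i x : C1v f -> C1v g ->
  partial i (fun t => a * f t + g t) x = a * partial i f x + partial i g x.
Proof.
move=> [df _] [dg _]; have dif : derivable f x (delta_mx ord0 i) by exact: diff_derivable.
have dig : derivable g x (delta_mx ord0 i) by exact: diff_derivable.
have := is_deriveD (is_deriveZ a (derivableP dif)) (derivableP dig).
by move=> h; rewrite /partial; have [_ e] := h; exact: e.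
Qed.

Lemma partial_mul f g i x : C1v f -> C1v g ->
  partial i (fun t => f t * g t) x = g x * partial i f x + f x * partial i g x.
Proof.
move=> [df _] [dg _]; have dif : derivable f x (delta_mx ord0 i) by exact: diff_derivable.
have dig : derivable g x (delta_mx ord0 i) by exact: diff_derivable.
have h := is_deriveM (derivableP dif) (derivableP dig).
by rewrite /partial; have [_ e] := h; rewrite addrC; exact: e.
Qed.

Lemma C1_diff (r r' : R -> R) y : C1fun r r' -> differentiable r y.
Proof. by move=> [h _]; apply/derivable1_diffP; have [] := h y. Qed.

Lemma partial_comp (r r' : R -> R) f i x : C1fun r r' -> C1v f ->
  partial i (fun t => r (f t)) x = r' (f x) * partial i f x.
Proof.
move=> hr [df _]; have dr := C1_diff (f x) hr.
rewrite /partial deriveE; last exact: (differentiable_comp (df x) dr).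
rewrite (diff_comp (df x) dr) /= diff1E// derive1E.
have [_ ->] := hr.1 (f x).
by rewrite -deriveE// mulrC.
Qed.

Lemma C1v_lin a f g : C1v f -> C1v g -> C1v (fun t => a * f t + g t).
Proof.
move=> hf hg; split=> [x|i].
  by apply: differentiableD; [apply: differentiableZ; exact: hf.1|exact: hg.1].
rewrite (_ : partial i _ = fun x => a * partial i f x + partial i g x); last first.
  by apply/funext => x; exact: partial_lin.
move=> x; apply: (@continuousD _ _ _ (fun x => a * partial i f x) (partial i g) x); last exact: hg.2.
by apply: continuousM; [exact: cst_continuous|exact: hf.2].
Qed.

Lemma C1v_mul f g : C1v f -> C1v g -> C1v (fun t => f t * g t).
Proof.
move=> hf hg; split=> [x|i].
  by apply: differentiableM; [exact: hf.1|exact: hg.1].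
rewrite (_ : partial i _ = fun x => g x * partial i f x + f x * partial i g x); last first.
  by apply/funext => x; exact: partial_mul.
move=> x; apply: (@continuousD _ _ _ (fun x => g x * partial i f x) (fun x => f x * partial i g x) x);
  apply: continuousM; [exact: (C1v_cont hg)|exact: hf.2|exact: (C1v_cont hf)|exact: hg.2].
Qed.

Lemma C1v_comp (r r' : R -> R) f : C1fun r r' -> C1v f -> C1v (fun t => r (f t)).
Proof.
move=> hr hf; split=> [x|i].
  exact: (differentiable_comp (hf.1 x) (C1_diff (f x) hr)).
rewrite (_ : partial i _ = fun x => r' (f x) * partial i f x); last first.
  by apply/funext => x; exact: (partial_comp i x hr hf).
move=> x; apply: continuousM; last exact: hf.2.
by apply: (@continuous_comp _ _ _ f r'); [exact: (C1v_cont hf)|exact: hr.2].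
Qed.

Lemma C1v_cst (c : R) : C1v (fun=> c).
Proof.
split=> [x|i]; first exact: differentiable_cst.
rewrite (_ : partial i _ = fun=> 0); first exact: cst_continuous.
by apply/funext => x; rewrite /partial derive_cst.
Qed.

Lemma partial_coord i j (x : V) : partial i (fun t : V => t ord0 j) x = (i == j)%:R.
Proof.
rewrite /partial deriveE; last exact: differentiable_coord.
have h : linear (fun t : V => t ord0 j : R) by move=> k u v; rewrite !mxE.
pose m := GRing.isLinear.Build _ _ _ _ _ h.
pose l : {linear V -> R} := HB.pack (fun t : V => t ord0 j : R) m.
rewrite (_ : (fun t : V => _) = l)// diff_lin/=; last exact: coord_continuous.
by rewrite mxE eqxx/= eq_sym.
Qed.

Lemma C1v_coord j : C1v (fun t : V => t ord0 j).
Proof.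
split=> [x|i]; first exact: differentiable_coord.
rewrite (_ : partial i _ = fun=> (i == j)%:R); first exact: cst_continuous.
by apply/funext => x; exact: partial_coord.
Qed.

Lemma C1v_prod (J : Type) (s : seq J) (F : J -> V -> R) :
  (forall j, C1v (F j)) -> C1v (fun x => \prod_(j <- s) F j x).
Proof.
move=> h; elim: s => [|j s ih].
  rewrite (_ : (fun _ => _) = fun=> 1); first exact: C1v_cst.
  by apply/funext => x; rewrite big_nil.
rewrite (_ : (fun _ => _) = fun x => F j x * \prod_(j <- s) F j x); first exact: C1v_mul.
by apply/funext => x; rewrite big_cons.
Qed.

Lemma C1_along f (a : V) i : C1v f ->
  C1fun (fun s : R => f (a + s *: delta_mx ord0 i)) (fun s => partial i f (a + s *: delta_mx ord0 i)).
Proof.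
move=> [df cf]; set v := delta_mx ord0 i : V.
have ca : continuous (fun s : R => a + s *: v).
  by move=> s; apply: cvgD; [exact: cvg_cst|apply: cvgZr_tmp; exact: cvg_id].
split=> s; last exact: (continuous_comp (ca s) (cf i _)).
have E : (fun h : R => h^-1 *: (((fun s : R => f (a + s *: v)) \o shift s) (h *: 1) - f (a + s *: v))) =
  (fun h : R => h^-1 *: ((f \o shift (a + s *: v)) (h *: v) - f (a + s *: v))).
  by apply/funext => h /=; rewrite /shift/= -[h *: 1]/(h * 1) mulr1 scalerDl addrCA.
apply: DeriveDef; first by rewrite /derivable E; exact: diff_derivable (df _).
by rewrite /derive E.
Qed.

End C1v.

Section C1c.
Context {R : realType} {N : nat} (O : set 'rV[R]_N).
Local Notation V := 'rV[R]_N.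
Implicit Types (f g : V -> R).

Lemma C1c_C1v f : C1c O f -> C1v f. Proof. by case. Qed.

Lemma C1c_sub f g : C1v g -> (forall x, f x = 0 -> g x = 0) -> C1c O f -> C1c O g.
Proof.
move=> [dg cg] fg [_ _ cs so].
have sub : closure [set x | g x != 0] `<=` closure [set x | f x != 0].
  by apply: closureS => x /=; apply: contra_neq; exact: fg.
split=> //; last exact: subset_trans so.
exact: (subclosed_compact (@closed_closure _ _) cs sub).
Qed.

Lemma C1c_lin a f g : C1c O f -> C1c O g -> C1c O (fun t => a * f t + g t).
Proof.
move=> hf hg; have [dh ch] := C1v_lin a (C1c_C1v hf) (C1c_C1v hg).
have [_ _ cf sf] := hf; have [_ _ cg sg] := hg.
have sub : closure [set x | a * f x + g x != 0] `<=` closure [set x | f x != 0] `|` closure [set x | g x != 0].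
  rewrite -closureU; apply: closureS => x /=; apply: contra_neqP => /not_orP[/negP/negPn/eqP-> /negP/negPn/eqP->].
  by rewrite mulr0 addr0.
split=> //.
  by apply: (subclosed_compact (@closed_closure _ _) (compactU cf cg) sub).
by move=> x /sub[/sf|/sg].
Qed.

Lemma C1c_comp (r r' : R -> R) f : C1fun r r' -> r 0 = 0 -> C1c O f -> C1c O (fun t => r (f t)).
Proof. by move=> hr r0 hf; apply: (C1c_sub (C1v_comp hr (C1c_C1v hf)) _ hf) => x ->. Qed.

Lemma C1c_mulr f g : C1v g -> C1c O f -> C1c O (fun t => g t * f t).
Proof.
by move=> hg hf; apply: (C1c_sub (C1v_mul hg (C1c_C1v hf)) _ hf) => x ->; rewrite mulr0.
Qed.

Lemma C1c_0 : C1c O (fun=> 0).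
Proof.
have [dc cc] := @C1v_cst R N 0.
have e : closure [set x : V | (0 : R) != 0] = set0.
  by rewrite (_ : [set x | _] = set0) ?closure0//; apply/seteqP; split=> x //=; rewrite eqxx.
by split=> //; rewrite e; [exact: compact0|].
Qed.

Lemma partial_supp f i x : partial i f x != 0 -> closure [set x | f x != 0] x.
Proof.
move=> px; apply: contrapT => nc; move/eqP: px; apply.
have ox : open (~` closure [set x | f x != 0]) by apply: closed_openC; exact: closed_closure.
rewrite /partial (@near_eq_derive _ _ _ f (cst 0)) ?derive_cst//.
have := open_nbhs_nbhs (conj ox nc); apply: filterS => y ny /=.
by apply/eqP; apply: contrapT => /negP yn; apply: ny; exact: subset_closure.
Qed.

Lemma C1c_supp f : C1c O f -> exists L : R, forall x,
  (f x != 0 \/ exists i, partial i f x != 0) -> O x /\ forall i, `|x ord0 i| <= L.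
Proof.
move=> [df cf cs so]; have [L hL] := bounded_coord (compact_bounded cs).
exists L => x h; suff xs : closure [set x | f x != 0] x by split; [exact: so|exact: hL].
by case: h => [fx|[i]]; [exact: subset_closure|exact: partial_supp].
Qed.

Lemma compact_supp_bdd (h : V -> R) (K : set V) : continuous h -> compact K ->
  (forall x, h x != 0 -> K x) -> exists M, forall x, `|h x| <= M.
Proof.
move=> ch cK hK.
have [M [Mr hM]] := compact_bounded (continuous_compact (continuous_subspaceT ch) cK).
exists (`|M| + 1) => x; have [->|/hK Kx] := eqVneq (h x) 0; first by rewrite normr0 addr_ge0.
apply: (hM (`|M| + 1)); last by exists x.
by rewrite (le_lt_trans (ler_norm M))// ltrDl.
Qed.

Lemma C1c_bdd f : C1c O f -> exists M, forall x, `|f x| <= M.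
Proof.
move=> hf; have [_ _ cs _] := hf.
apply: (compact_supp_bdd (C1v_cont (C1c_C1v hf)) cs) => x fx; exact: (subset_closure (A := [set x | f x != 0])).
Qed.

Lemma C1c_bddD f : C1c O f -> exists M, forall x i, `|partial i f x| <= M.
Proof.
move=> hf; have [_ cf cs _] := hf.
have h i : exists M, forall x, `|partial i f x| <= M.
  by apply: (compact_supp_bdd (cf i) cs) => x; exact: partial_supp.
exists (\sum_i `|projT1 (cid (h i))|) => x i.
apply: (le_trans (projT2 (cid (h i)) x)); apply: (le_trans (ler_norm _)).
by rewrite (bigD1 i)//= lerDl sumr_ge0.
Qed.

End C1c.

(** * The fundamental theorem of calculus along lines *)

Section ftc_line.
Context {R : realType}.
Local Notation leb := (@lebesgue_measure R).
Local Notation mR := (measurableTypeR R).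

Lemma I_ftc (g g' : R -> R) (a b : R) : C1fun g g' -> a < b ->
  I leb (fun s : mR => g' s * \1_(`[a, b]%classic : set mR) s) = g b - g a.
Proof.
move=> hg ab.
have F := @continuous_FTC2 R g' g a b ab.
have {}F : (\int[leb]_(x in `[a, b]) (g' x)%:E = (g b)%:E - (g a)%:E)%E.
  apply: F; first exact: (continuous_subspaceT hg.2).
    split=> [x _||]; first by have [] := hg.1 x.
      by apply: cvg_at_right_filter; exact: (C1_cont hg).
    by apply: cvg_at_left_filter; exact: (C1_cont hg).
  by move=> x _; rewrite derive1E; have [] := hg.1 x.
rewrite IE /Rintegral (_ : (\int[leb]_x _)%E = (g b - g a)%:E)// -[RHS]/((g b)%:E - (g a)%:E)%E -F.
rewrite [RHS]integral_mkcond; apply: eq_integral => x _.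
by rewrite patchE indicE; case: (x \in _); rewrite ?mulr1 ?mulr0.
Qed.

Variables (g g' : R -> R) (L : R).
Hypothesis hg : C1fun g g'.
Hypothesis gL : forall s, g s != 0 -> `|s| <= L.
Hypothesis g'L : forall s, g' s != 0 -> `|s| <= L.

Let mg' : measf (g' : mR -> R). Proof. exact: continuous_measurable_fun hg.2. Qed.

Lemma L1_line : L1 leb (g' : mR -> R).
Proof.
apply: (bca_L1 (mseg L) (fseg L)); split=> //.
have aL : - (`|L| + 1) <= `|L| + 1 by rewrite (@le_trans _ _ 0) ?oppr_le0 ?addr_ge0.
have z (s : R) : `|L| + 1 <= `|s| -> g s = 0 /\ g' s = 0.
  move=> h; split; apply: contraTeq h; rewrite -ltNge; [move=> /gL h|move=> /g'L h];
  by rewrite (le_lt_trans h)// (le_lt_trans (ler_norm L))// ltrDl.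
have [|t h|M _ hM] := C1_bounded hg aL.
- by move=> t h; apply: z; rewrite -(normrN t); apply: (le_trans _ (ler_norm (- t))); rewrite lerNr.
- by apply: z; exact: le_trans h (ler_norm _).
- by exists M => t; have [] := hM t.
Qed.

Lemma line_int_zero : I leb (g' : mR -> R) = 0.
Proof.
pose M := `|L| + 1.
have M0 : 0 < M by rewrite ltr_wpDl.
have LM : L < M by rewrite (le_lt_trans (ler_norm L))// ltrDl.
have z (s : R) : M <= `|s| -> g s = 0.
  by move=> h; apply: contraTeq h => /gL h; rewrite -ltNge; exact: le_lt_trans LM.
have e (s : mR) : g' s = g' s * \1_(`[- M, M]%classic : set mR) s.
  have [->|/g'L h] := eqVneq (g' s) 0; first by rewrite mul0r.
  rewrite indicE mem_set ?mulr1//= in_itv/= -ler_norml.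
  exact: le_trans (ltW LM).
rewrite (I_eq leb e) (I_ftc hg)//; last by rewrite gtrN.
by rewrite !z ?subrr// ?normrN gtr0_norm.
Qed.

Lemma line_int_bound x : g x <= I leb (fun s : mR => `|g' s|).
Proof.
pose M := `|L| + `|x| + 1.
have M0 : 0 < M by rewrite ltr_wpDl// addr_ge0.
have LM : L < M by rewrite (le_lt_trans (ler_norm L))// /M -addrA ltrDl ltr_wpDl.
have Mx : - M < x.
  by rewrite ltrNl (le_lt_trans (ler_norm _))// normrN /M -addrA addrCA ltrDl ltr_wpDl.
have z : g (- M) = 0.
  apply/eqP; apply: contraT => /gL; rewrite normrN gtr0_norm// => h.
  by have := le_lt_trans h LM; rewrite ltxx.
rewrite -[leLHS]subr0 -z -(I_ftc hg Mx).
have L1i : L1 leb (fun s : mR => g' s * \1_(`[- M, x]%classic : set mR) s).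
  apply: (L1_dom _ (L1_norm L1_line)); first by apply: mfM => //; apply: mf_ind; exact: measurable_itv.
  by move=> s; rewrite normrM ler_piMr// indicE; case: (s \in _); rewrite ?normr1 ?normr0.
apply: I_le => //; first exact: L1_norm L1_line.
move=> s; apply: (le_trans (ler_norm _)).
by rewrite normrM ler_piMr// indicE; case: (s \in _); rewrite ?normr1 ?normr0.
Qed.

End ftc_line.

Lemma continuous_abs_powR {R : realType} (c : R) : 0 < c -> continuous (fun t : R => `|t| `^ c).
Proof.
move=> c0 t; have [->|t0] := eqVneq t 0; last first.
  apply: (@continuous_comp _ _ _ (fun t : R => `|t|) (fun s => s `^ c)); first exact: norm_continuous.
  by apply: powR_cont; rewrite normr_gt0.
apply/cvgrPdist_le => e e0; rewrite normr0 powR0 ?gt_eqF//.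
exists (e `^ c^-1) => /=; first exact: powR_gt0.
move=> s /=; rewrite !sub0r !normrN => /ltW es; rewrite ger0_norm ?powR_ge0//.
apply: (@le_trans _ _ ((e `^ c^-1) `^ c)); last by rewrite -powRrM mulVf ?gt_eqF// powRr1// ltW.
by apply: ge0_ler_powR; rewrite ?nnegrE ?(ltW c0) ?powR_ge0.
Qed.

Section row_lines.
Context {R : realType} {N : nat}.
Local Notation mR := (measurableTypeR R).
Local Notation V := 'rV[R]_N.

Lemma row_line (t : N.-tuple mR) i s :
  row_of_tuple (line t i s) = (row_of_tuple (line t i 0) + s *: delta_mx ord0 i :> V).
Proof.
apply/rowP => j; rewrite /row_of_tuple !mxE !tnth_mktuple eqxx/=.
by case: eqP => _; rewrite ?mulr1 ?mulr0 ?add0r ?addr0.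
Qed.

Lemma line_self (t : N.-tuple mR) i : line t i (tnth t i) = t.
Proof. by apply: eq_from_tnth => j; rewrite tnth_mktuple; case: eqP => [->|]. Qed.

Lemma measurable_line (t : N.-tuple mR) i : measurable_fun setT (fun s : mR => line t i s).
Proof.
apply/measurable_fun_tnthP => j.
rewrite (_ : _ \o _ = if j == i then id else fun=> tnth t j); last first.
  by apply/funext => s /=; rewrite tnth_mktuple; case: (j == i).
by case: (j == i).
Qed.

Lemma bct_row (h : V -> R) L M : measurable_fun setT (h : borel_rV R N -> R) ->
  (forall x, `|h x| <= M) -> (forall x, h x != 0 -> forall i, `|x ord0 i| <= L) ->
  bct L (h \o @row_of_tuple R N).
Proof.
move=> mh hM hL; split; first exact: (measurableT_comp mh (@measurable_row_of_tuple R N)).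
  by exists M => t; exact: hM.
by move=> t /hL ht i; have := ht i; rewrite /row_of_tuple mxE.
Qed.

End row_lines.

Section concrete.
Context {R : realType} {N : nat}.
Local Notation V := 'rV[R]_N.
Local Notation BV := (borel_rV R N).
Local Notation mR := (measurableTypeR R).
Local Notation leb := (@lebesgue_measure R).
Local Notation tl := (tuple_lebesgue N).
Variables (O : set V) (mO : measurable (O : set (lebesgue_rV R N))).
Notation nu := (mrestr (@lebesgueN R N) mO).
Lemma I_nu_tuple (h : V -> R) : measurable_fun setT (h : BV -> R) -> (forall x, h x != 0 -> O x) ->
  I nu h = I tl (h \o @row_of_tuple R N).
Proof.
move=> mh hO; have mh' := borel_measf mh.
rewrite I_restr// -I_lebesgueN// IE /Rintegral; congr fine.
rewrite integral_mkcond; apply: eq_integral => x _; rewrite patchE; case: ifPn => //= xO.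
have [->//|/hO Ox] := eqVneq (h x) 0.
by move: xO; rewrite mem_set.
Qed.

Notation I := (I nu).
Notation L1 := (L1 nu).

Lemma restr_fin : (@lebesgueN R N O < +oo)%E -> (nu [set: lebesgue_rV R N] < +oo)%E.
Proof. by move=> h; change (@lebesgueN R N ([set: lebesgue_rV R N] `&` O) < +oo)%E; rewrite setTI. Qed.

Lemma C1v_borel (f : V -> R) : C1v f -> measurable_fun setT (f : BV -> R).
Proof. by move=> h; apply: continuous_borel; exact: C1v_cont. Qed.

Lemma partial_borel (f : V -> R) i : C1v f -> measurable_fun setT (partial i f : BV -> R).
Proof. by move=> h; apply: continuous_borel; exact: h.2. Qed.

Lemma C1c_line f (t : N.-tuple mR) i : C1c O f ->
  C1fun (fun s => f (row_of_tuple (line t i s))) (fun s => partial i f (row_of_tuple (line t i s))) /\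
   exists L, (forall s, f (row_of_tuple (line t i s)) != 0 -> `|s| <= L) /\
     forall s, partial i f (row_of_tuple (line t i s)) != 0 -> `|s| <= L.
Proof.
move=> hf; split.
  apply: (C1_eq _ _ (C1_along (row_of_tuple (line t i 0) : V) i (C1c_C1v hf))) => s; first by rewrite [in RHS]row_line.
  by rewrite [in RHS]row_line.
have [L hL] := C1c_supp hf.
have e s : (row_of_tuple (line t i s) : V) ord0 i = s by rewrite /row_of_tuple mxE tnth_mktuple eqxx.
exists L; split=> s h; rewrite -(e s); apply: (hL _ _).2; first by left.
by right; exists i.
Qed.

Lemma C1c_ibp f i : C1c O f -> I (partial i f) = 0.
Proof.
move=> hf; have [L hL] := C1c_supp hf; have [M hM] := C1c_bddD hf.
have pb := partial_borel i (C1c_C1v hf).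
rewrite I_nu_tuple//; last by move=> x px; apply: (hL x _).1; right; exists i.
apply: (@line_int0 R N L _ i).
  by apply: bct_row => // x px; apply: (hL x _).2; right; exists i.
move=> t; have [h [L' [h1 h2]]] := C1c_line t i hf.
exact: (line_int_zero h h1 h2).
Qed.

(** The integral of the i-th derivative of x_i f^2 vanishes, so that of f^2 equals that of - 2 x_i f
    d_i f, where |x_i| <= L. Young's inequality absorbs half of it and leaves 4 L^2. *)
Lemma C1c_poincare (i : 'I_N) : bounded_set O -> exists2 K, 0 <= K & forall f, C1c O f ->
  I (fun t => f t ^+ 2) <= K * I (fun t => sq (grad f t)).
Proof.
move=> bO; have fO := lebesgueN_bounded bO mO; have [L hL] := bounded_coord bO.
have nufin := restr_fin fO.
exists (4 * L ^+ 2) => [|f hf]; first by rewrite mulr_ge0// sqr_ge0.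
have Cf := C1c_C1v hf; have [M hM] := C1c_bdd hf; have [M' hM'] := C1c_bddD hf.
have [L' hL'] := C1c_supp hf.
have hff : C1c O (fun t => f t * f t) by exact: C1c_mulr.
have hx := C1c_mulr (C1v_coord i) hff.
have := C1c_ibp i hx.
have mf := borel_measf (C1v_borel Cf); have md := borel_measf (partial_borel i Cf).
have mc := borel_measf (C1v_borel (C1v_coord i)).
have e t : partial i (fun t => t ord0 i * (f t * f t)) t = f t ^+ 2 + 2 * t ord0 i * f t * partial i f t.
  rewrite partial_mul; [|exact: C1v_coord|exact: C1c_C1v hff].
  rewrite partial_mul// partial_coord eqxx.
  have -> : (true : bool)%:R = 1 :> R by [].
  by ring.
rewrite (I_eq nu e).
have L1f : L1 (fun t => f t ^+ 2).
  apply: (L1_bdd nufin (M := M ^+ 2)); first exact: mfX.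
  by move=> t; rewrite normrX ler_pXn2r// ?nnegrE// (le_trans _ (hM t)).
have L1d : L1 (fun t => partial i f t ^+ 2).
  apply: (L1_bdd nufin (M := M' ^+ 2)); first exact: mfX.
  by move=> t; rewrite normrX ler_pXn2r// ?nnegrE// (le_trans _ (hM' t i)).
have pw (t : V) : `|2 * t ord0 i * f t * partial i f t| <= 2^-1 * f t ^+ 2 + 2 * L ^+ 2 * partial i f t ^+ 2.
  have [->|f0] := eqVneq (f t) 0.
    rewrite mulr0 mul0r normr0 expr0n/= mulr0 add0r -mulrA; apply: mulr_ge0 => //.
    by apply: mulr_ge0; exact: sqr_ge0.
  have xL : t ord0 i ^+ 2 <= L ^+ 2.
    have h := hL t (hL' t (or_introl f0)).1 i.
    by rewrite -[leLHS]real_normK ?num_real// ler_pXn2r ?nnegrE// (le_trans _ h).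
  have h := sqr_ge0 (2^-1 * f t - t ord0 i * partial i f t).
  have h' := sqr_ge0 (2^-1 * f t + t ord0 i * partial i f t).
  have h'' := ler_wpM2r (sqr_ge0 (partial i f t)) xL.
  by rewrite ler_norml; apply/andP; split; nra.
have mm : measf (fun t : lebesgue_rV R N => 2 * (t : V) ord0 i * f t * partial i f t).
  by apply: mfM => //; apply: mfM => //; apply: mfM => //; exact: mf_cst.
have Lr : L1 (fun t => 2^-1 * f t ^+ 2 + 2 * L ^+ 2 * partial i f t ^+ 2) by apply: L1D; exact: L1Z.
have Lm : L1 (fun t : V => 2 * t ord0 i * f t * partial i f t) by apply: (L1_dom mm Lr) => t; exact: pw.
rewrite ID// => e0.
have pwN (t : V) : - (2 * t ord0 i * f t * partial i f t) <= 2^-1 * f t ^+ 2 + 2 * L ^+ 2 * partial i f t ^+ 2.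
  by apply: le_trans (pw t); rewrite -normrN ler_norm.
have := I_le (L1N Lm) Lr pwN.
rewrite IN// ID; [|exact: L1Z|exact: L1Z]; rewrite !IZ//.
have : I (fun t => partial i f t ^+ 2) <= I (fun t => sq (grad f t)).
  apply: I_le => // [|t].
    apply: L1_sum => j; apply: (L1_bdd nufin (M := M' ^+ 2)).
      by apply: mfM; under [X in measf X]eq_fun do rewrite mxE; exact: borel_measf (partial_borel j Cf).
    by move=> t; rewrite mxE -expr2 normrX ler_pXn2r// ?nnegrE// (le_trans _ (hM' t j)).
  by have := sq_coord (grad f t) i; rewrite mxE.
move=> h1 h2; have h3 := ler_wpM2l (sqr_ge0 L) h1.
by move: e0 h2 h3; nra.
Qed.

End concrete.

(** * Sobolev inequality and fundamental lemma *)

Lemma coord_nrm {R : realType} {N : nat} (a : 'rV[R]_N) i : `|a ord0 i| <= nrm a.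
Proof.
rewrite -(@ler_pXn2r _ 2)// ?nnegrE ?nrm_ge0// real_normK ?num_real// nrm_sq.
exact: sq_coord.
Qed.

(** [r] is (t^+)^tau. The lower bound up to the factor 2^-tau, obtained from the increment between t
    / 2 and t, is enough for an inequality with unspecified constant. *)
Lemma power_primitive {R : realType} (tau : R) : 1 < tau ->
  exists r r' : R -> R, [/\ C1fun r r', r 0 = 0, forall t, r' t = tau * `|Num.max t 0| `^ (tau - 1),
    forall t, t <= 0 -> r t = 0 & forall t, 0 <= t -> 2 `^ (- tau) * t `^ tau <= r t].
Proof.
move=> tau1; have t0 : 0 < tau - 1 by rewrite subr_gt0.
have tau0 : 0 < tau by exact: lt_trans tau1.
have cw : continuous (fun t : R => tau * `|t| `^ (tau - 1)).
  by move=> t; apply: cvgM; [exact: cvg_cst|exact: continuous_abs_powR].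
have [r [r0 hr]] := C1_primitive cw.
exists r, (fun t => tau * `|Num.max t 0| `^ (tau - 1)).
have r'0 (t : R) : 0 <= tau * `|Num.max t 0| `^ (tau - 1) by rewrite mulr_ge0 ?powR_ge0 ?ltW.
split=> // t h.
  have [c [_ hc]] := C1_mvt hr h; rewrite r0 sub0r max_r// normr0 powR0 ?gt_eqF// mulr0 mul0r.
  by move/eqP; rewrite oppr_eq0 => /eqP.
have h2 : t / 2 <= t by rewrite ler_pdivrMr// ler_peMr// ler1n.
have [c [c1 c2 e]] := C1_mvt hr h2.
have t20 : 0 <= t / 2 by rewrite divr_ge0.
have rt2 : 0 <= r (t / 2) by rewrite -r0; apply: (C1_nd hr).
have c0 : 0 <= c by exact: le_trans c1.
suff h3 : 2 `^ (- tau) * t `^ tau <= r t - r (t / 2) by move: h3 rt2; lra.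
rewrite e max_l// (ger0_norm c0) (_ : t - t / 2 = t / 2); last by field.
have -> : 2 `^ (- tau) * t `^ tau = (t / 2) `^ (tau - 1) * (t / 2).
  have -> : (t / 2) `^ (tau - 1) * (t / 2) = (t / 2) `^ tau.
    have [t2z|t2n] := eqVneq (t / 2) 0; first by rewrite t2z mulr0 powR0 ?gt_eqF.
    by rewrite -[X in _ * X]powRr1// -powRD ?subrK//; apply/implyP.
  by rewrite powRM// ?invr_ge0// -powR_inv1// -powRrM mulN1r mulrC.
apply: ler_wpM2r => //; apply: (@le_trans _ _ (c `^ (tau - 1))).
  by apply: ge0_ler_powR; rewrite ?nnegrE ?(ltW t0).
by rewrite ler_peMl ?powR_ge0// ltW.
Qed.

Section sobolev.
Context {R : realType} {n : nat}.
Local Notation N := n.+3.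
Local Notation V := 'rV[R]_N.
Local Notation BV := (borel_rV R N).
Local Notation mR := (measurableTypeR R).
Local Notation leb := (@lebesgue_measure R).
Variables (O : set V) (mO : measurable (O : set (lebesgue_rV R N))).
Hypothesis bO : bounded_set O.
Notation nu := (mrestr (@lebesgueN R N) mO).
Notation I := (I nu).
Notation L1 := (L1 nu).

Let nufin : (nu [set: lebesgue_rV R N] < +oo)%E.
Proof. by apply: restr_fin; exact: lebesgueN_bounded. Qed.

Lemma grad_nrm_bdd f : C1c O f -> exists M, forall x, nrm (grad f x) <= M.
Proof.
move=> hf; have [M hM] := C1c_bddD hf.
exists (1 + \sum_(i < N) M ^+ 2) => x.
have s0 : 0 <= sq (grad f x) by exact: sq_ge0.
apply: (@le_trans _ _ (1 + sq (grad f x))).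
  rewrite -nrm_sq; have := sqr_ge0 (nrm (grad f x) - 1); have := sqr_ge0 (nrm (grad f x)); lra.
rewrite lerD2l; apply: ler_sum => i _; rewrite mxE -expr2 -real_normK ?num_real//.
by rewrite ler_pXn2r ?nnegrE// (le_trans _ (hM x i)).
Qed.

Lemma grad_borel f : C1c O f -> measurable_fun setT (fun x : BV => nrm (grad f x)).
Proof.
move=> hf; apply: mf_nrm => i; under eq_fun do rewrite mxE.
exact: partial_borel (C1c_C1v hf).
Qed.

(** Gagliardo's inequality for |phi|^tau, with tau such that tau N / (N - 1) = 2 (tau - 1) = q. With
    Hoelder's inequality for the exponent 2 it gives Y <= c Y^(kap / 2) for the integral Y of
    |phi|^q. Here kap / 2 < 1 because N >= 3, and Y is finite since phi is bounded. *)
Theorem C1c_sobolev : let q : R := 2 * N%:R / (N%:R - 2) in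
  exists2 S : R, 0 <= S & forall A phi, 0 < A -> C1c O phi -> I (fun t => sq (grad phi t)) <= A ->
    I (fun t => `|phi t| `^ q) <= (S * A) `^ (q / 2).
Proof.
move=> q; have N3 : 3 <= N%:R :> R by rewrite ler_nat.
pose tau : R := 2 * (N%:R - 1) / (N%:R - 2).
have d0 : 0 < N%:R - 2 :> R by move: N3; lra.
have d1 : 0 < N%:R - 1 :> R by move: N3; lra.
have tau1 : 1 < tau by rewrite ltr_pdivlMr//; move: N3; lra.
have tau0 : 0 < tau by exact: lt_trans tau1.
have q0 : 0 < q by rewrite divr_gt0// mulr_gt0// ltr0n.
pose kap : R := 1 + n.+2%:R^-1.
have n2 : n.+2%:R = N%:R - 1 :> R by rewrite -[in RHS]natr1 addrK.
have kapE : kap = N%:R / (N%:R - 1) by rewrite /kap n2; field; rewrite gt_eqF.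
have k2 : kap / 2 < 1.
  by rewrite ltr_pdivrMr// mul1r kapE ltr_pdivrMr//; move: N3; lra.
have kap0 : 0 < kap by rewrite kapE divr_gt0// ltr0n.
have kq : kap * tau = q by rewrite kapE /tau /q; field; rewrite !gt_eqF.
have tq : (tau - 1) * 2 = q by rewrite /tau /q; field; rewrite gt_eqF.
have ek : (1 - kap / 2)^-1 = tau.
  have -> : 1 - kap / 2 = (N%:R - 2) / (2 * (N%:R - 1)) by rewrite kapE; field; rewrite gt_eqF.
  by rewrite invf_div.
have [r [r' [hr r0 r'E rneg rpos]]] := power_primitive tau1.
exists ((2 `^ tau * tau) ^+ 2) => [|A phi A0 hphi hA]; first exact: sqr_ge0.
have [L hL] := C1c_supp hphi; have [M hM] := C1c_bdd hphi; have [M' hM'] := grad_nrm_bdd hphi.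
have Cphi := C1c_C1v hphi.
have hrn : C1fun (fun t => r (- t)) (fun t => - r' (- t)).
  by apply: C1_eq (C1_comp hr (C1N C1_id)) => // t; rewrite mulrN1.
(* A C^1 replacement for |t|^tau. *)
pose rr (t : R) := r t + r (- t); pose rr' (t : R) := r' t + - r' (- t).
have hrr : C1fun rr rr' by exact: C1D.
have rr0 : rr 0 = 0 by rewrite /rr oppr0 r0 addr0.
have rr_lb (t : R) : 2 `^ (- tau) * `|t| `^ tau <= rr t.
  rewrite /rr; have [t0|t0] := leP 0 t.
    by rewrite (rneg (- t)) ?oppr_le0// addr0 ger0_norm//; exact: rpos.
  by rewrite (rneg t (ltW t0)) add0r ltr0_norm//; apply: rpos; rewrite oppr_ge0 ltW.
have rr'_ub (t : R) : `|rr' t| <= tau * `|t| `^ (tau - 1).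
  have t0 : 0 < tau - 1 by rewrite subr_gt0.
  rewrite /rr' !r'E; have [h|h] := leP 0 t.
    rewrite (@max_r _ _ (- t)) ?oppr_le0// (ger0_norm h) normr0 powR0 ?gt_eqF// mulr0 subr0.
    by rewrite ger0_norm// mulr_ge0 ?powR_ge0 ?(ltW tau0).
  rewrite (@max_l _ _ (- t)) ?oppr_ge0 ?(ltW h)// normr0 powR0 ?gt_eqF// mulr0 sub0r normrN.
  by rewrite normrN ger0_norm// mulr_ge0 ?powR_ge0 ?(ltW tau0).
pose Psi (x : V) := rr (phi x).
have hPsi : C1c O Psi by exact: C1c_comp hrr rr0 hphi.
have Psi0 x : 0 <= Psi x by apply: le_trans (rr_lb _); rewrite mulr_ge0 ?powR_ge0.
have mphi := C1v_borel Cphi.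
pose F (x : V) := tau * (`|phi x| `^ (tau - 1) * nrm (grad phi x)).
have F0 x : 0 <= F x by apply: mulr_ge0; [exact: ltW|apply: mulr_ge0; [exact: powR_ge0|exact: nrm_ge0]].
have mP : measurable_fun setT (fun x : BV => `|phi x| `^ (tau - 1)).
  by apply: mf_powR; exact: mf_norm.
have mF : measurable_fun setT (F : BV -> R).
  by apply: mfM; [exact: mf_cst|apply: mfM => //; exact: grad_borel].
have bP x : `| `|phi x| `^ (tau - 1)| <= M `^ (tau - 1).
  rewrite ger0_norm ?powR_ge0//; apply: ge0_ler_powR; rewrite ?nnegrE ?subr_ge0 ?(ltW tau1)//.
  exact: le_trans (hM x).
have bF x : `|F x| <= tau * (M `^ (tau - 1) * M').
  rewrite ger0_norm// ler_wpM2l ?(ltW tau0)// ler_pM ?powR_ge0 ?nrm_ge0//.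
  by have := bP x; rewrite ger0_norm ?powR_ge0.
have sF x : F x != 0 -> O x /\ forall i, `|x ord0 i| <= L.
  rewrite /F !mulf_eq0 !negb_or powR_eq0 negb_and normr_eq0 => /and3P[_ h _].
  by apply: hL; left; case/orP: h => //; rewrite subr_eq0 gt_eqF.
have [LP hLP] := C1c_supp hPsi; have [MP hMP] := C1c_bdd hPsi.
pose L' := Num.max L LP.
have bctF : bct L' (F \o @row_of_tuple R N).
  by apply: bct_row mF bF _ => x /sF[_ h] i; rewrite le_max h.
have bctP : bct L' (Psi \o @row_of_tuple R N).
  apply: bct_row (C1v_borel (C1c_C1v hPsi)) hMP _ => x h i.
  by rewrite le_max (hLP x (or_introl h)).2 orbT.
have lb : line_bound (F \o @row_of_tuple R N) (Psi \o @row_of_tuple R N).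
  move=> t i; have [h [L0 [h1 h2]]] := C1c_line t i hPsi.
  have e : row_of_tuple t = row_of_tuple (line t i (tnth t i)) by rewrite line_self.
  rewrite /= e; apply: (le_trans (line_int_bound h h1 h2 _)).
  apply: I_le; first exact: L1_norm (L1_line h h1 h2).
    apply: (bca_L1 (mseg L') (fseg L')); have [mf [MF bF'] sf] := bctF; split.
    - exact: (measurableT_comp mf (measurable_line t i)).
    - by exists MF => s; exact: bF'.
    - by move=> s /sf /(_ i); rewrite tnth_mktuple eqxx.
  move=> s; set x := row_of_tuple _; rewrite /Psi (partial_comp i _ hrr Cphi) normrM /F mulrA.
  apply: ler_pM => //; apply: le_trans (coord_nrm _ i); by rewrite mxE.
have := gns bctF bctP (fun x => F0 _) (fun x => Psi0 _) lb; rewrite -/kap.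
set Y := I (fun t => `|phi t| `^ q) => hg.
have mphi' := borel_measf mphi.
have mY : measf (fun t : lebesgue_rV R N => `|phi t| `^ q) by apply: mf_powR; exact: mf_norm.
have LY : L1 (fun t => `|phi t| `^ q).
  apply: (L1_bdd nufin (M := M `^ q)) => // t; rewrite ger0_norm ?powR_ge0//.
  by apply: ge0_ler_powR; rewrite ?nnegrE ?(ltW q0)// (le_trans _ (hM t)).
have mPk : measurable_fun setT (fun x : BV => Psi x `^ kap).
  by apply: mf_powR; exact: C1v_borel (C1c_C1v hPsi).
have LPk : L1 (fun t => Psi t `^ kap).
  apply: (L1_bdd nufin (M := MP `^ kap)); first exact: borel_measf mPk.
  move=> t; rewrite ger0_norm ?powR_ge0//.
  by apply: ge0_ler_powR; rewrite ?nnegrE ?(ltW kap0)//; have := hMP t; rewrite ger0_norm// => /(le_trans (Psi0 t)).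
have h1 : Y <= 2 `^ q * I (fun t => Psi t `^ kap).
  rewrite -IZ//; apply: I_le; [exact: LY|exact: L1Z|] => t.
  have := @ge0_ler_powR _ kap (ltW kap0) _ _ _ _ (rr_lb (phi t)).
  rewrite !nnegrE => /(_ (mulr_ge0 (powR_ge0 _ _) (powR_ge0 _ _)) (Psi0 t)).
  rewrite powRM ?powR_ge0// -!powRrM mulNr mulrC (mulrC tau) kq powRN ler_pdivrMr ?powR_gt0//.
  by rewrite mulrC.
have mn := borel_measf (grad_borel hphi).
have mA := borel_measf mP.
have sqn t : nrm (grad phi t) `^ 2 = sq (grad phi t) by rewrite powR_mulrn ?nrm_ge0// nrm_sq.
have Lsq : L1 (fun t => nrm (grad phi t) `^ 2).
  apply: (L1_bdd nufin (M := M' ^+ 2)); first exact: mf_powR.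
  move=> t; rewrite ger0_norm ?powR_ge0// powR_mulrn ?nrm_ge0//.
  by rewrite ler_pXn2r ?nnegrE ?nrm_ge0// (le_trans _ (hM' t)) ?nrm_ge0.
have Lpn : L1 (fun t => `|phi t| `^ (tau - 1) * nrm (grad phi t)).
  by apply: (L1_bM mA bP); apply: (L1_bdd nufin (M := M')) => // t; rewrite ger0_norm ?nrm_ge0.
have h2 : I F <= tau * (Y `^ 2^-1 * A `^ 2^-1).
  rewrite IZ// ler_wpM2l ?(ltW tau0)//.
  apply: (le_trans (I_hoelder (p := 2) (q := 2) mA mn _ _ _ _ _ _ Lsq Lpn)) => //.
  + by move=> t; exact: nrm_ge0.
  + by field.
  + by apply: L1_eq LY => t; rewrite -powRrM tq.
  rewrite (I_eq nu (g := fun t => `|phi t| `^ q)); last by move=> t; rewrite -powRrM tq.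
  rewrite ler_wpM2l ?powR_ge0//; apply: ge0_ler_powR; rewrite ?nnegrE ?invr_ge0 ?(ltW A0)//.
    by apply: I_ge0 => t; exact: powR_ge0.
  by rewrite (I_eq nu sqn).
have Y0 : 0 <= Y by apply: I_ge0 => t; exact: powR_ge0.
have hg' : I (fun t => Psi t `^ kap) <= I F `^ kap.
  rewrite (I_nu_tuple mO mPk) ?(I_nu_tuple mO mF)//.
    by move=> x /sF[].
  by move=> x; rewrite powR_eq0 negb_and => /orP[h|]; [exact: (hLP x (or_introl h)).1|rewrite gt_eqF].
have [->|Yn] := eqVneq Y 0; first exact: powR_ge0.
have Yp : 0 < Y by rewrite lt_def Yn.
pose c := (2 `^ tau * (tau * A `^ 2^-1)) `^ kap.
have hY : Y <= c * Y `^ (kap / 2).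
  apply: (le_trans h1); apply: (@le_trans _ _ (2 `^ q * (tau * (Y `^ 2^-1 * A `^ 2^-1)) `^ kap)).
    rewrite ler_wpM2l ?powR_ge0//; apply: (le_trans hg'); apply: ge0_ler_powR h2; rewrite ?nnegrE ?(ltW kap0)//.
      exact: I_ge0.
    by rewrite mulr_ge0 ?(ltW tau0)// mulr_ge0 ?powR_ge0.
  have e1 : 2 `^ q = (2 `^ tau) `^ kap :> R by rewrite -powRrM -kq mulrC.
  have e2 : Y `^ (kap / 2) = (Y `^ 2^-1) `^ kap by rewrite -powRrM mulrC.
  rewrite /c e1 e2; move: (powR_ge0 2 tau) (powR_ge0 Y 2^-1) (powR_ge0 A 2^-1).
  set w := 2 `^ tau; set y := Y `^ 2^-1; set a := A `^ 2^-1 => w0 y0 a0; have t0 := ltW tau0.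
  rewrite -[leLHS]powRM ?mulr_ge0// -[leRHS]powRM ?mulr_ge0//.
  by rewrite le_eqVlt; apply/orP; left; apply/eqP; congr (_ `^ _); ring.
apply: (le_trans (powR_absorb Yp k2 hY)); rewrite ek.
have T0 : 0 <= 2 `^ tau * (tau * A `^ 2^-1).
  by rewrite mulr_ge0 ?powR_ge0// mulr_ge0 ?powR_ge0 ?(ltW tau0).
rewrite /c -powRrM kq le_eqVlt; apply/orP; left; apply/eqP.
have -> : (2 `^ tau * tau) ^+ 2 * A = (2 `^ tau * (tau * A `^ 2^-1)) `^ 2.
  have eA : A = (A `^ 2^-1) ^+ 2 by rewrite -powR_mulrn ?powR_ge0// -powRrM mulVf// powRr1// ltW.
  rewrite powR_mulrn// [in LHS]eA; move: (A `^ 2^-1) (2 `^ tau) => a w; ring.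
by rewrite -powRrM; congr (_ `^ _); field.
Qed.

End sobolev.

(** * Borel hulls and the fundamental lemma of the calculus of variations *)

Section borel_hull.
Context {R : realType} {N : nat}.
Local Notation V := 'rV[R]_N.
Local Notation BV := (borel_rV R N).
Local Notation mu := (@lebesgueN R N).

(** Lebesgue measure is an infimum over Borel covers, so the intersection of covers with excess 1 /
    (k + 1) is a Borel set with the measure of [E]. *)
Lemma borel_hull (E : set V) : measurable (E : set (lebesgue_rV R N)) -> (mu E < +oo)%E ->
  exists F : set BV, [/\ measurable F, E `<=` F & mu ((F : set V) `\` E) = 0%E].
Proof.
move=> mE fE; have inv0 k : 0 < k.+1%:R^-1 :> R by rewrite invr_gt0.
have cov k : exists A : (set BV)^nat, measurable_cover (E : set BV) A /\
    (\sum_(0 <= j <oo) borel_lebesgue (A j) < mu E + (k.+1%:R^-1)%:E)%E.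
  have : mu E \is a fin_num by rewrite ge0_fin_numE.
  move/lb_ereal_inf_adherent => /(_ _ (inv0 k))[_/= [A EA] <-] h.
  by exists A.
pose A k := projT1 (cid (cov k)).
have hA k := projT2 (cid (cov k)).
pose F k : set BV := \bigcup_j A k j.
have mF k : measurable (F k).
  by apply: bigcupT_measurable => j; have [[+ _] _] := hA k; exact.
have EF k : E `<=` F k by have [[_ +] _] := hA k.
pose G : set BV := \bigcap_k F k.
have mG : measurable G by exact: bigcapT_measurable.
have lm (B : set BV) : measurable B -> measurable (B : set (lebesgue_rV R N)).
  by move=> mB; have := borel_id measurableT mB; rewrite setTI.
exists G; split=> //; first by move=> x Ex k _; exact: EF.
have muF k : (mu (F k) <= mu E + (k.+1%:R^-1)%:E)%E.
  rewrite lebesgueN_borel//; apply: ltW; apply: le_lt_trans (hA k).2.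
  apply: measure_sigma_subadditive => //.
  by move=> j; have [[+ _] _] := hA k; exact.
have muG : (mu G <= mu E)%E.
  apply/lee_addgt0Pr => e e0.
  have [k hk] : exists k : nat, k.+1%:R^-1 < e.
    have [n _ /(_ n (leqnn n))] := near_infty_natSinv_lt (PosNum e0).
    by exists n.
  apply: (@le_trans _ _ (mu (F k))).
    by apply: le_measure; rewrite ?inE; [exact: lm|exact: lm|exact: bigcap_inf].
  by apply: (le_trans (muF k)); rewrite leeD2l// lee_fin ltW.
have e : mu ((G : set V) `\` E) = (mu G - mu (G `&` E))%E.
  by apply: (measureD (lm _ mG) mE); exact: le_lt_trans fE.
have EG : E `<=` G by move=> x Ex k _; exact: EF.
have eG : mu G = mu E.
  by apply/eqP; rewrite eq_le muG/=; apply: le_measure; rewrite ?inE//; exact: lm.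
by apply: (eq_trans e); rewrite (setIidr EG) eG subee// ge0_fin_numE.
Qed.

End borel_hull.

Lemma borel_open {R : realType} {N : nat} : @measurable _ (borel_rV R N) = <<s @open 'rV[R]_N >>.
Proof.
apply/seteqP; split; last first.
  by apply: smallest_sub; [exact: sigma_algebra_measurable|exact: open_borel].
apply: smallest_sub; first exact: smallest_sigma_algebra.
rewrite -bigcup_seq => A [i _ [B mB <-]].
have m : measurable_fun setT (fun x : g_sigma_algebraType (@open 'rV[R]_N) => (x : 'rV[R]_N) ord0 i).
  apply: (measurability _ (RGenOInfty.measurableE R)) => _ [_ [a ->] <-]; rewrite setTI.
  apply: sub_sigma_algebra; have /continuousP co := @coord_continuous R 1 N ord0 i; apply: co.
  by rewrite set_itvE; exact: open_gt.
exact: (m measurableT B mB).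
Qed.

Section fundamental_lemma.
Context {R : realType} {N : nat}.
Local Notation V := 'rV[R]_N.
Local Notation BV := (borel_rV R N).
Variables (O : set V) (mO : measurable (O : set (lebesgue_rV R N))).
Hypotheses (oO : open O) (bO : bounded_set O).
Notation nu := (mrestr (@lebesgueN R N) mO).
Notation I := (I nu).
Notation L1 := (L1 nu).

Let fO : (@lebesgueN R N O < +oo)%E. Proof. exact: lebesgueN_bounded. Qed.
Let nufin : (nu [set: lebesgue_rV R N] < +oo)%E. Proof. exact: restr_fin. Qed.

Lemma ae_O : aE nu (fun x => O x).
Proof.
exists (~` O : set (lebesgue_rV R N)); split=> //; first exact: measurableC.
by change (@lebesgueN R N ((~` O : set (lebesgue_rV R N)) `&` O) = 0%E); rewrite setICl measure0.
Qed.

(** A C^1 function that is nonzero exactly on the open cube; working with cubes makes it a product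
    of functions of one variable. *)
Definition bump (c : V) (r : R) (x : V) : R := \prod_i pos2 (r ^+ 2 - (x ord0 i - c ord0 i) ^+ 2).

Lemma bump_ge0 c r x : 0 <= bump c r x.
Proof. by apply: prodr_ge0 => i _; exact: pos2_ge0. Qed.

Lemma bump_neq0 c r x : 0 < r -> (bump c r x != 0) <-> cube c r x.
Proof.
move=> r0; have e (y : R) : (pos2 (r ^+ 2 - y ^+ 2) != 0) = (`|y| < r).
  rewrite -[y ^+ 2]real_normK ?num_real//; apply/idP/idP => [h|h].
    rewrite -(@ltr_pXn2r _ 2)// ?nnegrE ?(ltW r0)//; rewrite ltNge; apply: contra h => h.
    by rewrite pos2_neg// subr_le0.
  have h2 : `|y| ^+ 2 < r ^+ 2 by rewrite ltr_pXn2r ?nnegrE ?(ltW r0).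
  by rewrite pos2_pos ?subr_ge0 ?(ltW h2)// expf_neq0// subr_eq0 gt_eqF.
split=> [/prodf_neq0 h i|h]; first by rewrite -e; exact: h.
by apply/prodf_neq0 => i _; rewrite e.
Qed.

Lemma C1c_bump (c : V) r : 0 < r -> (forall x : V, (forall i, `|x ord0 i - c ord0 i| <= r) -> O x) ->
  C1c O (bump c r).
Proof.
move=> r0 hO.
have hC : C1v (bump c r).
  apply: C1v_prod => i; apply: (C1v_comp (r := fun s => pos2 (r ^+ 2 - (s - c ord0 i) ^+ 2)) _ (C1v_coord i)).
  have h1 := C1D (@C1_id R) (C1_cst (- c ord0 i)).
  have h2 := C1_comp (@C1_pos2 R) (C1D (C1_cst (r ^+ 2)) (C1N (C1M h1 h1))).
  by apply: C1_eq h2 => // t; rewrite expr2.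
pose Q : set V := [set x | forall i, x ord0 i \in `[c ord0 i - r, c ord0 i + r]].
have QE x : Q x <-> forall i, `|x ord0 i - c ord0 i| <= r.
  by split=> h i; have := h i; rewrite in_itv/= ler_distl.
have cQ : compact Q.
  apply: (@rV_compact _ _ (fun i => `[c ord0 i - r, c ord0 i + r]%classic)) => i.
  exact: segment_compact.
have sub : closure [set x | bump c r x != 0] `<=` Q.
  rewrite closureE; apply: smallest_sub.
    by apply: compact_closed => //; exact: norm_hausdorff.
  by move=> x /= /(bump_neq0 _ _ r0) h; apply/QE => i; exact/ltW/h.
split=> //; [exact: hC.1|exact: hC.2| |by move=> x /sub /QE; exact: hO].
exact: (subclosed_compact (@closed_closure _ _) cQ sub).
Qed.

(** At each point of [U] the partial sums of the bumps attached to a countable cover by cubes are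
    positive from some index on, and [pind] with parameter tending to 0 carries positive values to
    1. *)
Lemma open_exhaustion (U : set V) : open U -> U `<=` O -> exists p : nat -> V -> R,
  [/\ forall n, C1c O (p n), forall n x, 0 <= p n x <= 1 &
    forall x, p n x @[n --> \oo] --> (\1_U x : R)].
Proof.
move=> oU UO; have [P [c [r [hP hU]]]] := open_cubes oU.
pose be (k : nat) : V -> R := if k \in P then bump (c k) (r k) else fun=> 0.
have Cbe k : C1c O (be k).
  rewrite /be; case: ifPn => [|_]; last exact: C1c_0.
  by rewrite inE => /hP[r0 hr]; apply: C1c_bump => // x /hr /UO.
have be0 k x : 0 <= be k x by rewrite /be; case: ifP => // _; exact: bump_ge0.
pose xi n x : R := \sum_(k < n) be k x.
have Cxi n : C1c O (xi n).
  elim: n => [|n ih]; first by rewrite (_ : xi 0%N = fun=> 0); [exact: C1c_0|apply/funext => x; rewrite /xi big_ord0].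
  rewrite (_ : xi n.+1 = fun x => 1 * be n x + xi n x); first exact: C1c_lin.
  by apply/funext => x; rewrite /xi big_ord_recr/= mul1r addrC.
have xi0 n x : 0 <= xi n x by exact: sumr_ge0.
exists (fun n x => pind (dlt n) (xi n x)); split=> [n|n x|x].
- by apply: (C1c_comp (C1_pind _)) => //; exact: pind0.
- by rewrite pind_ge0 ?pind_le1// dlt_gt0.
have [Ux|nU] := pselect (U x); last first.
  rewrite indicE memNset//= (_ : (fun n => _) = fun=> 0); first exact: cvg_cst.
  apply/funext => n; rewrite (_ : xi n x = 0) ?pind0//; apply: big1 => k _.
  rewrite /be; case: ifPn => //; rewrite inE => Pk; apply/eqP; apply: contraT => /(bump_neq0 _ _ (hP k Pk).1) h.
  by exfalso; apply: nU; rewrite hU; exists k.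
rewrite indicE mem_set//=.
have [k Pk hx] : (\bigcup_(n in P) cube (c n) (r n)) x by rewrite -hU.
have bk : 0 < be k x.
  by rewrite lt_def be0 andbT /be mem_set//; apply/(bump_neq0 _ _ (hP k Pk).1).
have := @pind_cvg R (be k x); rewrite bk => /cvg_epsP h; apply/cvg_epsP => e e0.
have [n0 hn0] := h e e0; exists (maxn n0 k.+1) => n; rewrite geq_max => /andP[n0n kn].
have := hn0 n n0n.
have p1 := pind_le1 (xi n x) (dlt_gt0 n : 0 < dlt n :> R).
have p2 : pind (dlt n) (be k x) <= pind (dlt n) (xi n x).
  apply: (C1_nd (C1_pind _)); first by move=> t; exact: pind'_ge0 (dlt_gt0 n).
  by rewrite /xi (bigD1 (Ordinal kn))//= lerDl sumr_ge0.
have p3 := pind_le1 (be k x) (dlt_gt0 n : 0 < dlt n :> R).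
rewrite (_ : true%:R = 1 :> R)// ler0_norm ?subr_le0// ler0_norm ?subr_le0//.
by move: p2; lra.
Qed.

(** Test functions reach the open subsets of [O], intersection with [O] all open sets, and Dynkin's
    theorem the Borel sets, since open sets are stable under intersection. *)
Lemma I_borel (h : V -> R) : L1 h -> (forall phi, C1c O phi -> I (fun x => h x * phi x) = 0) ->
  forall B : set BV, measurable B -> I (fun x => h x * \1_B x) = 0.
Proof.
move=> Lh h0; have mh := L1_mf Lh.
have mi (B : set BV) : measurable B -> measf (\1_B : lebesgue_rV R N -> R).
  by move=> mB; apply: mf_ind; have := borel_id measurableT mB; rewrite setTI.
have LB (B : set BV) : measurable B -> L1 (fun x => h x * \1_B x).
  move=> mB; apply: (L1_dom _ (L1_norm Lh)); first by apply: mfM => //; exact: mi.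
  by move=> x; rewrite normrM ler_piMr// indicE; case: (_ \in _); rewrite ?normr1 ?normr0.
have hO (U : set V) : open U -> U `<=` O -> I (fun x => h x * \1_U x) = 0.
  move=> oU UO; have [p [Cp p01 cp]] := open_exhaustion oU UO.
  have := @I_dct _ _ _ nu (fun n x => h x * p n x) (fun x => h x * \1_U x) (fun x => `|h x|).
  move=> /(_ _ _ (L1_norm Lh)) [||||_ c].
  - by move=> n; apply: mfM => //; exact: borel_measf (C1v_borel (C1c_C1v (Cp n))).
  - by apply: mfM => //; apply: mi; exact: open_borel.
  - by apply: aE_all => x; apply: cvgM; [exact: cvg_cst|exact: cp].
  - move=> n; apply: aE_all => x; rewrite normrM ler_piMr//.
    by have /andP[p0 p1] := p01 n x; rewrite ger0_norm.
  have c0 : (fun n => I (fun x => h x * p n x)) = fun=> 0 by apply/funext => n; exact: h0.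
  by rewrite c0 in c; apply: (cvg_unique _ c) => //; exact: cvg_cst.
have OE := ae_O.
have mO' := open_borel oO.
have hU (U : set V) : open U -> I (fun x => h x * \1_U x) = 0.
  move=> oU; rewrite -(hO (U `&` O)); [|exact: openI|by move=> x []].
  apply: I_eq_ae; [exact: L1_mf (LB _ (open_borel oU))| |].
    by apply: L1_mf; apply: LB; exact: open_borel (openI oU oO).
  apply: (aE_mp OE) => x Ox; congr (_ * _); rewrite !indicE in_setI.
  by rewrite (mem_set Ox) andbT.
have hT : I h = 0.
  by rewrite -(hU setT openT); apply: I_eq => x; rewrite indicT mulr1.
move=> B; rewrite borel_open; move: B.
apply: (@dynkin_induction _ BV (@open V) (fun B => I (fun x => h x * \1_B x) = 0)).
- exact: borel_open.
- exact: openI.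
- by rewrite -(hU setT openT).
- by move=> U; exact: hU.
- move=> B mB hB; rewrite -[RHS](subr0) -[X in _ = _ - X]hB -hT -IB//; last exact: LB.
  by apply: I_eq => x; rewrite !indicE in_setC; case: (x \in B); rewrite ?mulr1 ?mulr0 ?subrr ?subr0.
- move=> F mF tF hF; pose s n x : R := \sum_(k < n) \1_(F k) x.
  have sE k x n : F k x -> s n x = (k < n)%N%:R.
    move=> Fx; have e j : \1_(F j) x = (j == k)%:R :> R.
      have [->|jk] := eqVneq j k; first by rewrite indicE mem_set.
      rewrite indicE memNset// => Fj.
      have /trivIsetP/(_ j k Logic.I Logic.I jk) e0 := tF.
      by suff : (F j `&` F k) x by rewrite e0.
    rewrite /s (eq_bigr _ (fun (j : 'I_n) _ => e j)); case: ltnP => kn.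
      by rewrite (bigD1 (Ordinal kn))//= eqxx big1 ?addr0// => j; rewrite -val_eqE/= => /negbTE ->.
    by apply: big1 => j _; rewrite ltn_eqF// (leq_trans (ltn_ord j)).
  have s0 x n : ~ (\bigcup_k F k) x -> s n x = 0.
    by move=> nx; apply: big1 => k _; rewrite indicE memNset// => Fx; apply: nx; exists k.
  have := @I_dct _ _ _ nu (fun n x => h x * s n x) (fun x => h x * \1_(\bigcup_k F k) x) (fun x => `|h x|).
  move=> /(_ _ _ (L1_norm Lh)) [||||_ c].
  + by move=> n; apply: mfM => //; apply: mf_sum => k; exact: mi.
  + by apply: mfM => //; apply: mi; exact: bigcupT_measurable.
  + apply: aE_all => x; apply: cvgM; first exact: cvg_cst.
    have [Ux|nU] := pselect ((\bigcup_k F k) x); last first.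
      rewrite indicE memNset// (_ : (fun n => _) = fun=> 0); first exact: cvg_cst.
      by apply/funext => n; exact: s0.
    rewrite indicE mem_set//; case: Ux => k _ Fk; apply/cvg_epsP => e e0; exists k.+1 => n kn.
    by rewrite (sE k)// kn subrr normr0 ltW.
  + move=> n; apply: aE_all => x; rewrite normrM ler_piMr//.
    have [[k _ Fk]|nU] := pselect ((\bigcup_k F k) x).
      by rewrite (sE k)// normr_nat; case: (_ < _)%N.
    by rewrite s0// normr0.
  have c0 : (fun n => I (fun x => h x * s n x)) = fun=> 0.
    apply/funext => n; transitivity (\sum_(k < n) I (fun x => h x * \1_(F k) x)); last by apply: big1.
    rewrite -I_sum => [|k]; last exact: LB.
    by apply: I_eq => x; rewrite /s mulr_sumr.
  by rewrite c0 in c; apply: (cvg_unique _ c) => //; exact: cvg_cst.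
Qed.

(** It suffices to show h <= 0 and to apply this to - h. The set {h > 0} is only Lebesgue
    measurable; a Borel hull with the same measure makes [I_borel] applicable. *)
Lemma C1c_fundamental (h : V -> R) : L1 h -> (forall phi, C1c O phi -> I (fun x => h x * phi x) = 0) ->
  aE nu (fun x => h x = 0).
Proof.
have key (k : V -> R) : L1 k -> (forall phi, C1c O phi -> I (fun x => k x * phi x) = 0) ->
    aE nu (fun x => k x <= 0).
  move=> Lk k0; have mk := L1_mf Lk.
  pose E : set V := [set x | 0 < k x] `&` O.
  have mE0 : measurable ([set x | 0 < k x] : set (lebesgue_rV R N)).
    have := mk measurableT _ (measurable_itv `]0, +oo[); rewrite setTI.
    rewrite (_ : k @^-1` _ = [set x | 0 < k x])//.
    by apply/seteqP; split=> x; rewrite /= in_itv/= andbT.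
  have mE : measurable (E : set (lebesgue_rV R N)) by exact: measurableI.
  have fE : (@lebesgueN R N E < +oo)%E.
    by apply: le_lt_trans fO; apply: le_measure; rewrite ?inE//; exact: subIsetr.
  have [F [mF EF F0]] := borel_hull mE fE.
  have mF' : measurable (F : set (lebesgue_rV R N)).
    by have := borel_id measurableT mF; rewrite setTI.
  have e : aE nu (fun x => k x * \1_F x = k x * \1_E x).
    apply: (@ae_restr _ _ _ (@lebesgueN R N) O mO _).1; exists ((F : set V) `\` E); split=> //; first exact: measurableD.
    move=> x /not_implyP[Ox ne]; split; first by apply: contrapT => nF; apply: ne; rewrite !indicE !memNset// => /EF.
    by move=> Ex; apply: ne; rewrite !indicE !mem_set//; exact: EF.
  have mi (B : set V) : measurable (B : set (lebesgue_rV R N)) -> measf (\1_B : lebesgue_rV R N -> R).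
    exact: mf_ind.
  have LE : L1 (fun x => k x * \1_E x).
    apply: (L1_dom _ (L1_norm Lk)); first by apply: mfM => //; exact: mi.
    by move=> x; rewrite normrM ler_piMr// indicE; case: (_ \in _); rewrite ?normr1 ?normr0.
  have I0 : I (fun x => k x * \1_E x) = 0.
    rewrite -(I_borel Lk k0 mF); apply/esym; apply: I_eq_ae e; last exact: L1_mf LE.
    by apply: mfM => //; exact: mi.
  have OE := ae_O.
  have E0 : aE nu (fun x => k x * \1_E x = 0).
    apply: (I_eq0 LE) => [x|]; last by rewrite I0.
    by rewrite indicE; case: (boolP (x \in E)); rewrite ?mulr0// inE => -[/= /ltW kx _]; rewrite mulr1.
  apply: (aE_mp2 E0 OE).
  move=> x kx Ox; rewrite leNgt; apply/negP => kp; move: kx.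
  by rewrite indicE mem_set//= mulr1 => k00; rewrite k00 ltxx in kp.
move=> Lh h0; have h1 := key h Lh h0.
have h2 := key (fun x => - h x) (L1N Lh).
apply: (aE_mp2 h1 (h2 _)) => [phi Cphi|x a c].
  rewrite -[RHS]oppr0 -(h0 _ Cphi) -IN; first by apply: I_eq => x; rewrite mulNr.
  have [M hM] := C1c_bdd Cphi.
  by apply: L1_eq (L1_bM (borel_measf (C1v_borel (C1c_C1v Cphi))) hM Lh) => x; exact: mulrC.
by apply/eqP; rewrite eq_le a -oppr_le0.
Qed.

End fundamental_lemma.

(** * Existence *)

(** [q] is the Sobolev exponent, and [gam] is determined by two demands: Sobolev's inequality must
    control the power s = q (2 - theta + gam) / 2, and Hoelder's inequality with f in L^m must turn
    (1 + u)^gam into (1 + u)^s. The lower bound on m gives sg >= 1, the upper one sg < 2; [sg] is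
    the exponent for which the last relation is an equality. *)
Lemma exponents {R : realType} (N th m : R) : 3 <= N -> 0 < th -> th < 1 -> 1 <= m ->
  N / (2 * N - th * (N - 1)) < m -> m < 2 * N / (2 * N - th * (N - 2)) ->
  let sg := m * N * (2 - th) / (N - th * m) in
  let gam := N * (2 - th) * (m - 1) / (N - 2 * m) in
  let s := N * (2 - th) * m / (N - 2 * m) in
  let q := 2 * N / (N - 2) in
  let rr := (2 - th + gam) / 2 in
  [/\ [/\ 0 <= gam, 0 <= rr, 0 < q & 1 <= s], [/\ 2 * rr = 2 - th + gam, rr * q = s, gam * m = s * (m - 1) &
    (m - 1) / m * (q / 2) < 1] & [/\ 1 <= sg, sg < 2, sg <= s & (th - gam) * sg <= s * (2 - sg)]].
Proof.
move=> N3 t0 t1 m1 hm1 hm2 sg gam s q rr.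
have d1 : 0 < 2 * N - th * (N - 1) by nra.
have d2 : 0 < 2 * N - th * (N - 2) by nra.
rewrite ltr_pdivrMr// in hm1; rewrite ltr_pdivlMr// in hm2.
have mN : 2 * m < N by nra.
have e1 : 0 < N - 2 * m by rewrite subr_gt0.
have e2 : 0 < N - th * m by nra.
have n2 : 0 < N - 2 by lra.
have m0 : 0 < m by lra.
have N0 : 0 < N by lra.
have th2 : 0 < 2 - th by lra.
have gam0 : 0 <= gam by rewrite divr_ge0 ?(ltW e1)// mulr_ge0 ?subr_ge0// mulr_ge0 ?(ltW th2) ?(ltW N0).
have sg1 : 1 <= sg by rewrite ler_pdivlMr//; nra.
have sgs : sg <= s.
  rewrite /sg /s (_ : m * N * (2 - th) = N * (2 - th) * m); last by ring.
  rewrite ler_wpM2l ?mulr_ge0 ?(ltW N0) ?(ltW th2) ?(ltW m0)// lef_pV2 ?posrE//.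
  by rewrite lerB// ler_wpM2r ?(ltW m0)//; lra.
split; split=> //.
- by rewrite divr_ge0// addr_ge0// ltW.
- by rewrite divr_gt0// mulr_gt0.
- exact: le_trans sgs.
- by rewrite /rr; field.
- by rewrite /rr /gam /q /s; field; rewrite !gt_eqF.
- by rewrite /gam /s; field; rewrite gt_eqF.
- rewrite /q (_ : _ * _ = (m - 1) * N / (m * (N - 2))); last by field; rewrite !gt_eqF.
  by rewrite ltr_pdivrMr ?mulr_gt0//; nra.
- by rewrite ltr_pdivrMr//; nra.
- rewrite le_eqVlt; apply/orP; left; apply/eqP.
  by rewrite /gam /s /sg; field; rewrite !gt_eqF.
Qed.

(** * Verification of the abstract hypotheses in R^N *)

Section instance.
Context {R : realType} {n : nat}.
Local Notation N := n.+3.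
Local Notation V := 'rV[R]_N.
Variables (O : set V) (mO : measurable (O : set (lebesgue_rV R N))).
Hypotheses (oO : open O) (bO : bounded_set O).
Notation nu := (mrestr (@lebesgueN R N) mO).

Lemma C1c_test_class : @test_class _ (lebesgue_rV R N) R nu N (C1c O) (fun f => grad f).
Proof.
have fO := lebesgueN_bounded bO mO.
split.
- by move=> f hf; exact: borel_measf (C1v_borel (C1c_C1v hf)).
- by move=> f i hf; under [X in measf X]eq_fun do rewrite mxE; exact: borel_measf (partial_borel i (C1c_C1v hf)).
- by move=> f /C1c_bdd.
- by move=> f /C1c_bddD[M hM]; exists M => t i; rewrite mxE.
- exact: C1c_0.
- by move=> a f g; exact: C1c_lin.
- move=> a f g hf hg; apply/funext => t; apply/rowP => i; rewrite !mxE.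
  exact: partial_lin (C1c_C1v hf) (C1c_C1v hg).
- by move=> f g hf hg; exact: C1c_mulr (C1c_C1v hf) hg.
- move=> f g hf hg; apply/funext => t; apply/rowP => i; rewrite !mxE.
  exact: partial_mul (C1c_C1v hf) (C1c_C1v hg).
- by move=> r r' f; exact: C1c_comp.
- move=> r r' f hr r0 hf; apply/funext => t; apply/rowP => i; rewrite !mxE.
  exact: (partial_comp i t hr (C1c_C1v hf)).
- move=> f i hf; rewrite -(C1c_ibp mO i hf); apply: I_eq => t; by rewrite mxE.
- by move=> h; exact: C1c_fundamental.
- exact: (C1c_poincare mO ord0 bO).
Qed.

(** Norms on Omega are defined by extension by zero, integrals below are taken against the
    restricted measure; this identifies the two. *)
Lemma Lp_patch (h : V -> R) (p : R) : 0 < p -> measf (h : lebesgue_rV R N -> R) ->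
  L1 nu (fun x => `|h x| `^ p) ->
  in_Lp O p h /\ Lp_norm O p h = (I nu (fun x => `|h x| `^ p) `^ p^-1)%:E.
Proof.
move=> p0 mh Lh.
have e : (fun x => `|(h \_ O) x| `^ p) = (fun x => `|h x| `^ p) \_ O.
  apply/funext => x; rewrite /= !patchE; case: ifP => // _.
  by rewrite normr0 powR0// gt_eqF.
have mhp : measf (fun x : lebesgue_rV R N => `|h x| `^ p) by apply: mf_powR; exact: mf_norm.
have E : EFin \o ((fun x => `|h x| `^ p) \_ O) = (EFin \o (fun x => `|h x| `^ p)) \_ O.
  by apply/funext => x; rewrite /= !patchE; case: ifP.
have Lm : L1 (@lebesgueN R N) (fun x => `|(h \_ O) x| `^ p).
  rewrite e /L1 E; have [h1 _] := @integrable_mkcond _ _ _ (@lebesgueN R N) O (EFin \o (fun x => `|h x| `^ p)) mO.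
  by apply: h1; have [h2 _] := @L1_restr _ _ _ (@lebesgueN R N) O mO _ mhp; exact: h2.
have eI : I (@lebesgueN R N) (fun x => `|(h \_ O) x| `^ p) = I nu (fun x => `|h x| `^ p).
  rewrite (I_restr (@lebesgueN R N) mO mhp) IE e /Rintegral; apply: f_equal; rewrite [RHS]integral_mkcond.
  by apply: eq_integral => x _; rewrite -E.
have nE : Lp_norm O p h = (I nu (fun x => `|h x| `^ p) `^ p^-1)%:E.
  by rewrite /Lp_norm (LnormE Lm) eI.
split=> //; rewrite /in_Lp inE; apply/andP; split.
  rewrite inE /=; have [h1 _] := measurable_restrictT (h : lebesgue_rV R N -> R) mO.
  by apply: h1; exact: measurable_funTS.
by rewrite inE /= /finite_norm -/(Lp_norm O p h) nE ltry.
Qed.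

End instance.

Theorem theorem1p2 (R : realType) (N : nat) (Omega : set 'rV[R]_N)
    (B p alpha beta theta m : R) (b f : 'rV[R]_N -> R) :
  (3 <= N)%N ->
  open Omega -> bounded_set Omega ->
  0 < B -> 0 < p ->
  measurable_on Omega b -> 0 < alpha -> 0 < beta ->
  {ae @lebesgueN R N, forall x, Omega x -> alpha <= b x <= beta} ->
  0 < theta < 1 ->
  1 <= m ->
  N%:R / (2 * N%:R - theta * (N%:R - 1)) < m ->
  m < 2 * N%:R / (2 * N%:R - theta * (N%:R - 2)) ->
  in_Lp Omega m f ->
  {ae @lebesgueN R N, forall x, Omega x -> 0 < f x} ->
  let sigma := m * N%:R * (2 - theta) / (N%:R - theta * m) in
  exists u : 'rV[R]_N -> R, exists Du : 'rV[R]_N -> 'rV[R]_N,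
    [/\ W1p0 Omega sigma u Du,
        {ae @lebesgueN R N, forall x, Omega x -> 0 < u x},
        (@lebesgueN R N).-integrable Omega
          (fun x => (dotr (Du x) (Du x) / u x `^ theta)%:E) &
        forall phi : 'rV[R]_N -> R, C1c Omega phi ->
          \int[@lebesgueN R N]_(x in Omega)
             (b x / (1 + u x) `^ p * dotr (Du x) (grad phi x)) +
          B * \int[@lebesgueN R N]_(x in Omega)
             (dotr (Du x) (Du x) / u x `^ theta * phi x) =
          \int[@lebesgueN R N]_(x in Omega) (f x * phi x)].
Proof.
case: N Omega b f => [|[|[|n]]] Omega b f // _.
move=> oO bO B0 p0 mb al0 be0 hb /andP[th0 th1] m1 hm1 hm2 Lf fp sigma.
set N := n.+3; set mu := @lebesgueN R N.
have N3 : 3 <= N%:R :> R by rewrite ler_nat.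
have [[gam0 rr0 q0 s1] [rrE sE gamE e_lt] [sg1 sg2 sgs sgE]] := exponents N3 th0 th1 m1 hm1 hm2.
have mO : measurable (Omega : set (lebesgue_rV R N)).
  by have := borel_id measurableT (open_borel oO); rewrite setTI.
pose nu : {measure set (lebesgue_rV R N) -> \bar R} := mrestr mu mO.
have nufin : (nu setT < +oo)%E by apply: restr_fin; exact: lebesgueN_bounded.
have tc : test_class nu (C1c Omega) (fun f => grad f) by exact: C1c_test_class.
have sg0 : 0 < sigma by exact: lt_le_trans sg1.
have m0 : 0 < m by exact: lt_le_trans m1.
have aeR (P : lebesgue_rV R N -> Prop) : {ae mu, forall x, Omega x -> P x} <-> aE nu P by exact: ae_restr.
have IR (h : lebesgue_rV R N -> R) : measf h -> I nu h = \int[mu]_(x in Omega) h x by exact: I_restr.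
have OE : aE nu (fun x => Omega x) by exact: ae_O.
pose bO' : lebesgue_rV R N -> R := b \_ Omega.
have mbO : measf bO'.
  by have [h _] := measurable_restrictT (b : lebesgue_rV R N -> R) mO; exact: h.
(* [b] obeys its bounds only almost everywhere on Omega and is clamped so that they hold at every
   point. The upper bound is max(alpha, beta), since alpha <= beta does not follow when Omega is
   empty. *)
pose b' x := Num.max alpha (Num.min (Num.max alpha beta) (bO' x)).
have mb' : measf b' by apply: mf_max; [exact: mf_cst|apply: mf_min => //; exact: mf_cst].
have hb' x : alpha <= b' x <= Num.max alpha beta.
  apply/andP; split; first by rewrite le_max lexx.
  by rewrite ge_max (@le_max _ _ alpha) lexx/= ge_min lexx.
have bE : aE nu (fun x => b' x = bO' x).
  apply: (aE_mp2 ((aeR _).1 hb) OE) => x /andP[h1 h2] Ox.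
  rewrite /b' /bO' patchE mem_set// min_r; first by rewrite max_r.
  by rewrite le_max h2 orbT.
pose fO : lebesgue_rV R N -> R := f \_ Omega.
have [mfO LfO] : measf fO /\ L1 mu (fun x => `|fO x| `^ m).
  split; last exact: Lfun_integrable m1 Lf.
  by move: Lf; rewrite /in_Lp inE => /andP[]; rewrite inE.
(* Likewise the datum is made nonnegative at every point, without change almost everywhere on
   Omega. *)
pose f' x := Num.max (fO x) 0.
have mf' : measf f' by apply: mf_max => //; exact: mf_cst.
have f'0 x : 0 <= f' x by rewrite le_max lexx orbT.
have fE : aE nu (fun x => f' x = fO x).
  by apply: (aE_mp2 ((aeR _).1 fp) OE) => x h Ox; rewrite /f' /fO patchE mem_set// max_l// ltW.
have f'p : aE nu (fun x => 0 < f' x).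
  by apply: (aE_mp2 ((aeR _).1 fp) OE) => x h Ox; rewrite /f' /fO patchE mem_set// lt_max h.
have mfm : measf (fun x => f' x `^ m) by apply: mf_powR.
have Lfm : L1 nu (fun x => f' x `^ m).
  have [_ h] := L1_restr mu mO mfm; apply: h.
  have : mu.-integrable Omega (EFin \o (fun x => `|fO x| `^ m)).
    exact: (integrableS measurableT mO (@subsetT _ Omega) LfO).
  apply: le_integrable => //; first exact/measurable_EFinP/measurable_funTS.
  move=> x _ /=; rewrite lee_fin (ger0_norm (powR_ge0 (f' x) m)) (ger0_norm (powR_ge0 `|fO x| m)); apply: ge0_ler_powR; rewrite ?nnegrE ?(ltW m0)//.
  by rewrite /f' ge_max normr_ge0 ler_norm.
have Lf' : L1 nu f'.
  apply: (L1_dom mf' (L1D (L1_cst nufin 1) Lfm)) => x.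
  by have := powR_abs_le (f' x) m1; rewrite (ger0_norm (f'0 x)).
have [S S0 hS] := @C1c_sobolev R n Omega mO bO.
have [u [Du [[mu' mDu] [u0 up] [Lu LDu] [wg ap] [LP eqn]]]] :=
  abstract_existence nufin tc al0 mb' hb' B0 (ltW p0) th0 th1 m1 gam0 rr0 q0 s1 rrE sE gamE e_lt
    sg1 sg2 sgs sgE S0 hS Lf' f'0 f'p Lfm.
have LpE (h : lebesgue_rV R N -> R) : measf h -> L1 nu (fun x => `|h x| `^ sigma) ->
    in_Lp Omega sigma h /\ Lp_norm Omega sigma h = (I nu (fun x => `|h x| `^ sigma) `^ sigma^-1)%:E.
  by move=> mh Lh; exact: (Lp_patch sg0 mh Lh).
have Lu' : L1 nu (fun x => `|u x| `^ sigma) by apply: L1_eq Lu => x; rewrite ger0_norm.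
have mr : measf (fun x => dotr (Du x) (Du x) / u x `^ theta) by exact: L1_mf LP.
exists u, Du; split.
- split.
    split; [exact: (LpE u mu' Lu').1|by move=> i; exact: (LpE _ (mDu i) (LDu i)).1|].
    move=> phi Cphi i; have Cv := C1c_C1v Cphi.
    have mphi := borel_measf (C1v_borel Cv); have md := borel_measf (partial_borel i Cv).
    rewrite -!IR; [|exact: mfM|exact: mfM].
    by rewrite -(wg i phi Cphi); apply: I_eq => x; rewrite mxE.
  (* There are N + 1 norms to add, each at most [dl], and the sum must be strictly less than e. *)
  move=> e e0; pose dl := e / (N%:R + 2).
  have dl0 : 0 < dl by rewrite divr_gt0// addr_gt0// ltr0n.
  have [phi Cphi [hu hDu]] := ap (dl `^ sigma) (powR_gt0 _ dl0).
  exists phi => //; have Cv := C1c_C1v Cphi; have [M hM] := C1c_bdd Cphi; have [M' hM'] := C1c_bddD Cphi.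
  have mphi := borel_measf (C1v_borel Cv).
  have key (h k : lebesgue_rV R N -> R) (K : R) : measf h -> measf k -> (forall x, `|k x| <= K) ->
      L1 nu (fun x => `|h x| `^ sigma) -> I nu (fun x => `|h x - k x| `^ sigma) <= dl `^ sigma ->
      (Lp_norm Omega sigma (fun x => h x - k x)%R <= dl%:E)%E.
    move=> mh mk hK Lh hI; have mhk : measf (fun x => h x - k x) by exact: mfB.
    have Lk : L1 nu (fun x => `|k x| `^ sigma).
      apply: (L1_bdd nufin (M := K `^ sigma)); first by apply: mf_powR; exact: mf_norm.
      by move=> x; rewrite ger0_norm ?powR_ge0//; apply: ge0_ler_powR; rewrite ?nnegrE ?(ltW sg0)// (le_trans _ (hK x)).
    have L : L1 nu (fun x => `|h x - k x| `^ sigma).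
      apply: (L1_dom _ (L1Z (2 `^ sigma) (L1D Lh Lk))); first by apply: mf_powR; exact: mf_norm.
      by move=> x; rewrite ger0_norm ?powR_ge0// -(normrN (k x)); apply: powR_absD; exact: ltW.
    have [_ ->] := LpE _ mhk L; rewrite lee_fin.
    have -> : dl = (dl `^ sigma) `^ sigma^-1 by rewrite -powRrM divff ?gt_eqF// powRr1// ltW.
    by apply: ge0_ler_powR; rewrite ?nnegrE ?invr_ge0 ?(ltW sg0) ?powR_ge0//; apply: I_ge0 => x; exact: powR_ge0.
  have k1 := key u phi M mu' mphi hM Lu' hu.
  have k2 i : (Lp_norm Omega sigma (fun x => (Du x - grad phi x) ord0 i)%R <= dl%:E)%E.
    have -> : (fun x => (Du x - grad phi x) ord0 i) = (fun x => Du x ord0 i - partial i phi x).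
      by apply/funext => x; rewrite !mxE.
    apply: (key _ _ M' (mDu i) (borel_measf (partial_borel i Cv)) (fun x => hM' x i) (LDu i)).
    by apply: le_trans (hDu i); rewrite le_eqVlt; apply/orP; left; apply/eqP/I_eq => x; rewrite mxE.
  rewrite /W1p_norm; apply: (@le_lt_trans _ _ (dl%:E + \sum_(i < N) dl%:E)%E).
    by apply: leeD => //; exact: lee_sum.
  rewrite sumEFin -EFinD lte_fin sumr_const card_ord -mulr_natl /dl.
  have n0 : 0 < N%:R + 2 :> R by rewrite addr_gt0// ltr0n.
  rewrite -[X in X + _]mul1r -mulrDl mulrA ltr_pdivrMr//; move: e0; set z : R := N%:R; lra.
- exact: (aeR _).2.
- by have [h _] := L1_restr mu mO mr; exact: h LP.
move=> phi Cphi; have Cv := C1c_C1v Cphi; have mphi := borel_measf (C1v_borel Cv).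
have mdot : measf (fun x => dotr (Du x) (grad phi x)).
  apply: mf_sum => i; apply: mfM => //; under [X in measf X]eq_fun do rewrite mxE.
  exact: borel_measf (partial_borel i Cv).
have mw : measf (fun x => ((1 + u x) `^ p)^-1).
  under [X in measf X]eq_fun do rewrite -powRN.
  by apply: mf_powR; apply: mfD => //; exact: mf_cst.
have := eqn phi Cphi; rewrite (IR _ (mfM mr mphi)).
rewrite (I_eq_ae (g := fun x => bO' x / (1 + u x) `^ p * dotr (Du x) (grad phi x))); last first.
- by apply: (aE_mp bE) => x ->.
- by apply: mfM => //; exact: mfM.
- by apply: mfM => //; exact: mfM.
rewrite (I_eq_ae (f := fun x => f' x * phi x) (g := fun x => fO x * phi x)); last first.
- by apply: (aE_mp fE) => x ->.
- exact: mfM.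
- exact: mfM.
rewrite IR; last by apply: mfM => //; exact: mfM.
rewrite IR; last exact: mfM.
have pE (k : 'rV[R]_N -> R) (h : lebesgue_rV R N -> R) :
    \int[mu]_(x in Omega) ((k \_ Omega) x * h x) = \int[mu]_(x in Omega) (k x * h x).
  by rewrite /Rintegral; apply: f_equal; apply: eq_integral => x xO; rewrite patchE xO.
rewrite pE => <-; congr (_ + _).
rewrite /Rintegral; apply: f_equal; apply: eq_integral => x xO.
by rewrite /bO' patchE xO.
Qed.
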